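(* Let $b_1,b_2,\gamma$ be half-integers (elements of $\frac12\mathbb{Z}$) such that $b_1\ge0$, $\gamma\ge1$, $\frac{1-\gamma}2\le b_2\le\frac12+b_1$. The unitary operator $$S_{b_1,b_2,\gamma}:f(x)\mapsto\frac1\gamma\int_0^\infty G^{20}_{04}\bigl((xy)^{\frac1\gamma}\bigm|b_1,b_2,1-\gamma-b_1,1-\gamma-b_2\bigr)f(y)\,dy$$ on $L^2(\mathbb{R}_+)$ is of order two, that is, $(S_{b_1,b_2,\gamma})^{-1}=S_{b_1,b_2,\gamma}$.
   Context: $L^2(\mathbb{R}_+)$ is with respect to Lebesgue measure. $G^{20}_{04}$ is Meijer's $G$-function: for $x>0$, $G^{20}_{04}(x\mid b_1,b_2,b_3,b_4)=\frac1{2\pi i}\int_L\frac{\Gamma(b_1-\lambda)\Gamma(b_2-\lambda)}{\Gamma(1-b_3+\lambda)\Gamma(1-b_4+\lambda)}x^\lambda d\lambda$, where $L$ goes from $\gamma'-i\infty$ to $\gamma'+i\infty$ leaving all the points $b_1+\mathbb{N}$, $b_2+\mathbb{N}$ to the right, and $\gamma'>\frac14(\operatorname{Re}(b_1+b_2+b_3+b_4)-1)$. The integral transform is defined on a dense subspace such as $C_0^\infty(\mathbb{R}_+)$ and extended by continuity to $L^2(\mathbb{R}_+)$. *)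

(* Defs.v *)
From HB Require Import structures.
From mathcomp Require Import all_boot all_order all_algebra.
From mathcomp Require Import all_classical all_reals all_analysis.
From mathcomp Require Import complex.

Set Implicit Arguments.
Unset Strict Implicit.
Unset Printing Implicit Defensive.

Import Order.TTheory GRing.Theory Num.Theory.
Import numFieldNormedType.Exports.

Local Open Scope classical_set_scope.
Local Open Scope ring_scope.
Local Open Scope complex_scope.

(* Num.Theory shadows the R-valued projections. *)
Local Notation Re := complex.Re.
Local Notation Im := complex.Im.

Definition half_integer (R : realType) (x : R) : Prop :=
  exists m : int, x = m%:~R / 2%:R.

Definition Rplus (R : realType) : set R := [set x | 0 < x].
Arguments Rplus R : clear implicits.

Definition cexp (R : realType) (z : R[i]) : R[i] :=
  (expR (Re z))%:C * (cos (Im z) +i* sin (Im z)).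

(* x ^ z = exp (z ln x), meaningful for x > 0. *)
Definition cpow (R : realType) (x : R) (z : R[i]) : R[i] :=
  cexp (z * (ln x)%:C).

Definition cintegral (R : realType) (D : set R) (f : R -> R[i]) : R[i] :=
  (Rintegral lebesgue_measure D (fun x => Re (f x))) +i*
  (Rintegral lebesgue_measure D (fun x => Im (f x))).

Definition euler_integral (R : realType) (z : R[i]) : R[i] :=
  cintegral (Rplus R) (fun t => cpow t (z - 1) * (expR (- t))%:C).

(* Least n such that 0 < Re (z + n). *)
Definition gamma_shift (R : realType) (z : R[i]) : nat :=
  if 0 < Re z then 0%N else (Num.truncn (- Re z)).+1.

(* Euler's integral, continued to Re z <= 0 by Gamma (z + 1) = z Gamma z.
   At the poles 0, -1, -2, ... the denominator vanishes, so that cgamma is 0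
   there; hence (cgamma z)^-1 is the entire function 1 / Gamma everywhere. *)
Definition cgamma (R : realType) (z : R[i]) : R[i] :=
  let n := gamma_shift z in
  euler_integral (z + n%:R) / \prod_(k < n) (z + k%:R).

Definition meijerG2004_integrand (R : realType) (b1 b2 b3 b4 : R[i]) (x : R)
    (lambda : R[i]) : R[i] :=
  cgamma (b1 - lambda) * cgamma (b2 - lambda)
    / (cgamma (1 - b3 + lambda) * cgamma (1 - b4 + lambda))
    * cpow x lambda.

(* The contour L is t |-> sigma t + i t.  It runs from gamma' - i oo to
   gamma' + i oo, so sigma is required to equal gamma' outside a compact set;
   since it is a graph over the imaginary axis, a point b lies to its right
   iff sigma (Im b) < Re b. *)
Definition meijerG2004_contour (R : realType) (b1 b2 b3 b4 : R[i])
    (sigma : R -> R) : Prop :=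
  [/\ forall t, derivable sigma t 1,
      continuous (derive1 sigma),
      exists gamma' T : R,
        (Re (b1 + b2 + b3 + b4) - 1) / 4%:R < gamma' /\
        (forall t, T < `|t| -> sigma t = gamma'),
      forall k : nat, sigma (Im b1) < Re b1 + k%:R
    & forall k : nat, sigma (Im b2) < Re b2 + k%:R].

Definition meijerG2004 (R : realType) (sigma : R -> R) (b1 b2 b3 b4 : R[i])
    (x : R) : R[i] :=
  (0 +i* (2%:R * pi))^-1 *
  cintegral setT (fun t =>
    meijerG2004_integrand b1 b2 b3 b4 x (sigma t +i* t)
      * (derive1 sigma t +i* 1)).

(* Elements of L^2(R_+; C) are represented by functions on R, of which only
   the restriction to R_+, up to null sets, matters. *)
Definition inL2 (R : realType) (f : R -> R[i]) : Prop :=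
  [/\ measurable_fun (Rplus R) (fun x => Re (f x)),
      measurable_fun (Rplus R) (fun x => Im (f x))
    & (\int[lebesgue_measure]_(x in Rplus R)
         ((Normc.normc (f x)) ^+ 2)%:E < +oo)%E].

Definition eqL2 (R : realType) (f g : R -> R[i]) : Prop :=
  ae_eq lebesgue_measure (Rplus R) f g.

Definition innerL2 (R : realType) (f g : R -> R[i]) : R[i] :=
  cintegral (Rplus R) (fun x => f x * conjc (g x)).

Definition normL2 (R : realType) (f : R -> R[i]) : R :=
  Num.sqrt (Rintegral lebesgue_measure (Rplus R)
              (fun x => (Normc.normc (f x)) ^+ 2)).

Definition linearL2 (R : realType) (S : (R -> R[i]) -> (R -> R[i])) : Prop :=
  [/\ forall f, inL2 f -> inL2 (S f),
      forall f g, inL2 f -> inL2 g -> eqL2 f g -> eqL2 (S f) (S g)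
    & forall (a : R[i]) f g, inL2 f -> inL2 g ->
        eqL2 (S (fun x => a * f x + g x)) (fun x => a * S f x + S g x)].

Definition boundedL2 (R : realType) (S : (R -> R[i]) -> (R -> R[i])) : Prop :=
  exists M : R, forall f, inL2 f -> normL2 (S f) <= M * normL2 f.

Definition unitaryL2 (R : realType) (S : (R -> R[i]) -> (R -> R[i])) : Prop :=
  [/\ linearL2 S,
      forall f g, inL2 f -> inL2 g -> innerL2 (S f) (S g) = innerL2 f g
    & forall g, inL2 g -> exists2 f, inL2 f & eqL2 (S f) g].

(* C_0^oo(R_+): smooth, with compact support in ]0, +oo[ (extended by 0). *)
Definition test_function (R : realType) (f : R -> R[i]) : Prop :=
  [/\ forall (n : nat) (x : R),
        derivable (derive1n n (fun y : R => Re (f y))) x 1,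
      forall (n : nat) (x : R),
        derivable (derive1n n (fun y : R => Im (f y))) x 1
    & exists a b : R, 0 < a /\ forall x, f x != 0 -> a <= x <= b].

Definition continuous_extensionL2 (R : realType)
    (T S : (R -> R[i]) -> (R -> R[i])) : Prop :=
  [/\ linearL2 S, boundedL2 S
    & forall f, test_function f -> eqL2 (S f) (T f)].

Definition meijer_transform (R : realType) (sigma : R -> R) (b1 b2 gamma : R)
    (f : R -> R[i]) (x : R) : R[i] :=
  (gamma^-1)%:C *
  cintegral (Rplus R) (fun y =>
    meijerG2004 sigma b1%:C b2%:C (1 - gamma - b1)%:C (1 - gamma - b2)%:C
      ((x * y) `^ (gamma^-1)) * f y).

(* Main.v *)
(* With b3 = 1 - gamma - b1 and b4 = 1 - gamma - b2, the kernel of the transform is the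
   product of the quotients Gamma (b_j - l) / Gamma (gamma + b_j + l), j = 1, 2.  On the
   critical line l = - gamma / 2 + i t these are
   Gamma (a_j - i t) / Gamma (a_j + i t), a_j = b_j + gamma / 2 > 0, so that their product
   m t is unimodular and satisfies conj (m t) = m (- t).  After integration against a test
   function the contour can be moved to that line, and the substitution x = e^(gamma u)
   turns the transform into f |-> F (m . F f), F being the Fourier transform.
   By Plancherel it is isometric; the kernel being symmetric and real, it is also
   symmetric for the inner product.  An isometry S with <S f, g> = <f, S g> satisfies
   |S S f - f|^2 = |S S f|^2 + |f|^2 - 2 |S f|^2 = 0.  The decay of the Gamma quotients
   along the contour comes from the products of Gauss,
   Gamma z / Gamma w = lim n^(z - w) prod_(k < n) (w + k) / (z + k),
   which are also the holomorphic functions to which contour deformation is applied. *)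

(* Since b1 + b2 + b3 + b4 = 2 - 2 gamma, the condition on the contour reads gamma + 2 gamma' > 1/2.
   It is what makes the kernel an absolutely convergent integral, the integrand being O((1 +
   t^2)^-(gamma + 2 gamma')). On the critical line this exponent is 0 and the integrand is not
   integrable, so the kernel itself cannot be written there: pairing with a test function has to
   come first, and the Laplace transform of the test function, which decays like t^-2, supplies the
   convergence. Surjectivity is a consequence of S S f = f, so no Fourier inversion enters:
   Plancherel serves only as an equality of norms, for functions that are continuous, bounded and
   integrable. The extension to L^2 is read off the closure of the graph of the transform in L^2 x
   L^2. Linear combinations, norms and inner products pass to the limit along that closure, and
   single-valuedness, uniqueness and the involution are statements about pairs in it. *)
Require Import Defs.
From HB Require Import structures.
From mathcomp Require Import all_boot all_order all_algebra.
From mathcomp Require Import all_classical all_reals all_analysis.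
From mathcomp Require Import measurable_realfun complex.
From mathcomp Require Import ring lra.

Set Implicit Arguments.
Unset Strict Implicit.
Unset Printing Implicit Defensive.

Import Order.TTheory GRing.Theory Num.Theory.
Import numFieldNormedType.Exports.

Local Open Scope classical_set_scope.
Local Open Scope ring_scope.
Local Open Scope complex_scope.

Local Notation Re := complex.Re.
Local Notation Im := complex.Im.
Local Notation normc := Normc.normc.

(** * Complex-valued functions and integrals *)

Section Complex_basics.
Variable R : realType.
Implicit Types (x y z w : R[i]) (a b : R).

Lemma ReM z w : Re (z * w) = Re z * Re w - Im z * Im w.
Proof. by case: z => ? ?; case: w. Qed.

Lemma ImM z w : Im (z * w) = Re z * Im w + Im z * Re w.
Proof. by case: z => ? ?; case: w. Qed.

Lemma ReD z w : Re (z + w) = Re z + Re w.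
Proof. by case: z => ? ?; case: w. Qed.

Lemma ImD z w : Im (z + w) = Im z + Im w.
Proof. by case: z => ? ?; case: w. Qed.

Lemma ReN z : Re (- z) = - Re z.
Proof. by case: z. Qed.

Lemma ImN z : Im (- z) = - Im z.
Proof. by case: z. Qed.

Lemma ReV z : Re z^-1 = Re z / (Re z ^+ 2 + Im z ^+ 2).
Proof. by case: z. Qed.

Lemma ImV z : Im z^-1 = - (Im z / (Re z ^+ 2 + Im z ^+ 2)).
Proof. by case: z. Qed.

Lemma ReC a : Re (a%:C) = a. Proof. by []. Qed.

Lemma ImC a : Im (a%:C) = 0. Proof. by []. Qed.

Lemma Re_nat n : Re (n%:R : R[i]) = n%:R.
Proof. by rewrite -(rmorph_nat (real_complex R)). Qed.

Lemma Im_nat n : Im (n%:R : R[i]) = 0.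
Proof. by rewrite -(rmorph_nat (real_complex R)). Qed.

Lemma Re_conj z : Re (conjc z) = Re z. Proof. by case: z. Qed.

Lemma Im_conj z : Im (conjc z) = - Im z. Proof. by case: z. Qed.

Lemma complexP z w : Re z = Re w -> Im z = Im w -> z = w.
Proof. by case: z => ? ?; case: w => ? ? /= -> ->. Qed.

Lemma normc_ge0 z : 0 <= normc z.
Proof. by case: z => a b; exact: sqrtr_ge0. Qed.

Lemma sqr_normc z : normc z ^+ 2 = Re z ^+ 2 + Im z ^+ 2.
Proof. by case: z => a b /=; rewrite sqr_sqrtr// addr_ge0// sqr_ge0. Qed.

Lemma ler_sqr_ge0 a b : 0 <= b -> a ^+ 2 <= b ^+ 2 -> a <= b.
Proof.
move=> b0 ab; have [/ltW a0|a0] := ltP a 0; first exact: le_trans b0.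
by rewrite -(ler_pXn2r (n := 2))// nnegrE.
Qed.

Lemma normr_Re z : `|Re z| <= normc z.
Proof.
by apply: ler_sqr_ge0; rewrite ?normc_ge0// real_normK ?num_real// sqr_normc lerDl sqr_ge0.
Qed.

Lemma normr_Im z : `|Im z| <= normc z.
Proof.
by apply: ler_sqr_ge0; rewrite ?normc_ge0// real_normK ?num_real// sqr_normc lerDr sqr_ge0.
Qed.

Lemma normc_le_ReIm z : normc z <= `|Re z| + `|Im z|.
Proof.
apply: ler_sqr_ge0; first by rewrite addr_ge0.
rewrite sqr_normc sqrrD !real_normK ?num_real//.
by rewrite lerD2r lerDl mulrn_wge0// mulr_ge0.
Qed.

Lemma normcD z w : normc (z + w) <= normc z + normc w.
Proof. exact: (@le_normcD R z w). Qed.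

Lemma normc_N z : normc (- z) = normc z.
Proof. exact: (@normcN R z). Qed.

Lemma normcM z w : normc (z * w) = normc z * normc w.
Proof. exact: Normc.normcM. Qed.

Lemma normcV z : normc z^-1 = (normc z)^-1.
Proof. exact: Normc.normcV. Qed.

Lemma normcC a : normc (a%:C) = `|a|.
Proof. by rewrite /= expr0n/= addr0 sqrtr_sqr. Qed.

Lemma normc_conj z : normc (conjc z) = normc z.
Proof. by case: z => a b /=; rewrite sqrrN. Qed.

Lemma normc_eq0 z : (normc z == 0) = (z == 0).
Proof.
apply/eqP/eqP => [/Normc.eq0_normc//|->]; exact: Normc.normc0.
Qed.

Lemma normc_gt0 z : (0 < normc z) = (z != 0).
Proof. by rewrite lt_neqAle normc_ge0 andbT eq_sym normc_eq0. Qed.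

Lemma normc_prod (I : Type) (r : seq I) (P : pred I) (F : I -> R[i]) :
  normc (\prod_(i <- r | P i) F i) = \prod_(i <- r | P i) normc (F i).
Proof.
by elim/big_rec2 : _ => [|i y z _ <-]; rewrite ?Normc.normc1// normcM.
Qed.

Lemma Re_cexp z : Re (cexp z) = expR (Re z) * cos (Im z).
Proof. by rewrite /cexp ReM /= mul0r subr0. Qed.

Lemma Im_cexp z : Im (cexp z) = expR (Re z) * sin (Im z).
Proof. by rewrite /cexp ImM /= mul0r addr0. Qed.

Lemma normc_cexp z : normc (cexp z) = expR (Re z).
Proof.
apply/eqP; rewrite -(eqrXn2 (n := 2)) ?normc_ge0 ?expR_ge0// sqr_normc Re_cexp Im_cexp.
by rewrite !exprMn -mulrDr cos2Dsin2 mulr1.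
Qed.

Lemma cexpD z w : cexp (z + w) = cexp z * cexp w.
Proof.
apply: complexP; rewrite !(ReM, ImM, Re_cexp, Im_cexp) ReD ImD expRD.
  by rewrite cosD; ring.
by rewrite sinD; ring.
Qed.

Lemma cexp0 : cexp (0 : R[i]) = 1.
Proof. by apply: complexP; rewrite ?Re_cexp ?Im_cexp /= ?expR0 ?cos0 ?sin0 ?mulr1 ?mulr0. Qed.

Lemma cexp_neq0 z : cexp z != 0.
Proof. by rewrite -normc_gt0 normc_cexp expR_gt0. Qed.

Lemma cexpN z : cexp (- z) = (cexp z)^-1.
Proof.
apply: (mulIf (cexp_neq0 z)); rewrite mulVf ?cexp_neq0//.
by rewrite -cexpD addNr cexp0.
Qed.

Lemma conj_cexp z : conjc (cexp z) = cexp (conjc z).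
Proof.
by apply: complexP; rewrite ?(Re_conj, Im_conj, Re_cexp, Im_cexp) ?cosN ?sinN// mulrN.
Qed.

Lemma cexpC a : cexp (a%:C) = (expR a)%:C.
Proof. by apply: complexP; rewrite ?Re_cexp ?Im_cexp /= ?cos0 ?sin0 ?mulr1 ?mulr0. Qed.

End Complex_basics.

(** * Measurability of complex-valued functions *)

Section Complex_measurable.
Context {R : realType} d (T : measurableType d).
Implicit Types (D : set T) (f g : T -> R[i]).

Definition cmeasurable D f :=
  measurable_fun D (fun x => Re (f x)) /\ measurable_fun D (fun x => Im (f x)).

Lemma cmeasurable_cst D (c : R[i]) : cmeasurable D (fun=> c).
Proof. by split; exact: measurable_cst. Qed.

Lemma cmeasurableD D f g : cmeasurable D f -> cmeasurable D g ->
  cmeasurable D (fun x => f x + g x).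
Proof.
move=> [f1 f2] [g1 g2]; split.
  by under eq_fun do rewrite ReD; exact: measurable_funD.
by under eq_fun do rewrite ImD; exact: measurable_funD.
Qed.

Lemma cmeasurableN D f : cmeasurable D f -> cmeasurable D (fun x => - f x).
Proof.
move=> [f1 f2]; split.
  by under eq_fun do rewrite ReN; exact: measurableT_comp.
by under eq_fun do rewrite ImN; exact: measurableT_comp.
Qed.

Lemma cmeasurableB D f g : cmeasurable D f -> cmeasurable D g ->
  cmeasurable D (fun x => f x - g x).
Proof. by move=> cf cg; apply: cmeasurableD => //; exact: cmeasurableN. Qed.

Lemma cmeasurableM D f g : cmeasurable D f -> cmeasurable D g ->
  cmeasurable D (fun x => f x * g x).
Proof.
move=> [f1 f2] [g1 g2]; split.
  by under eq_fun do rewrite ReM; apply: measurable_funB; exact: measurable_funM.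
by under eq_fun do rewrite ImM; apply: measurable_funD; exact: measurable_funM.
Qed.

Lemma measurable_fun_inv D (f : T -> R) : measurable_fun D f ->
  (forall x, 0 <= f x) -> measurable_fun D (fun x => (f x)^-1).
Proof.
move=> mf f0.
(* On nonnegative reals inversion coincides with the power -1, at 0 as well since both sides are 0
   there; measurability is then that of [powR]. *)
have -> : (fun x => (f x)^-1) = (fun x => powR (f x) (-1)).
  apply/funext => x; have [->|fx] := eqVneq (f x) 0.
    by rewrite invr0 powR0// oppr_eq0 oner_eq0.
  by rewrite powR_inv1.
exact: (measurableT_comp (measurable_powR _) mf).
Qed.

Lemma cmeasurableV D f : cmeasurable D f -> cmeasurable D (fun x => (f x)^-1).
Proof.
move=> [f1 f2].
have h : measurable_fun D (fun x => (Re (f x) ^+ 2 + Im (f x) ^+ 2)^-1).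
  apply: measurable_fun_inv.
    by apply: measurable_funD; exact: measurable_funX.
  by move=> x; rewrite addr_ge0// sqr_ge0.
split.
  by under eq_fun do rewrite ReV; exact: measurable_funM.
by under eq_fun do rewrite ImV; apply: measurableT_comp => //; exact: measurable_funM.
Qed.

Lemma cmeasurable_real D (f : T -> R) : measurable_fun D f ->
  cmeasurable D (fun x => (f x)%:C).
Proof. by move=> mf; split => //=; exact: measurable_cst. Qed.

Lemma cmeasurable_Complex D (f g : T -> R) : measurable_fun D f ->
  measurable_fun D g -> cmeasurable D (fun x => f x +i* g x).
Proof. by []. Qed.

Lemma cmeasurable_cexp D f : cmeasurable D f -> cmeasurable D (fun x => cexp (f x)).
Proof.
move=> [f1 f2]; split.
  under eq_fun do rewrite Re_cexp; apply: measurable_funM.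
    exact: measurableT_comp.
  by apply: measurableT_comp => //; apply: continuous_measurable_fun; exact: continuous_cos.
under eq_fun do rewrite Im_cexp; apply: measurable_funM.
  exact: measurableT_comp.
by apply: measurableT_comp => //; apply: continuous_measurable_fun; exact: continuous_sin.
Qed.

Lemma cmeasurable_prod D n (F : nat -> T -> R[i]) :
  (forall k, cmeasurable D (F k)) -> cmeasurable D (fun x => \prod_(k < n) F k x).
Proof.
move=> mF; elim: n => [|n IH].
  by under eq_fun do rewrite big_ord0; exact: cmeasurable_cst.
by under eq_fun do rewrite big_ord_recr/=; exact: cmeasurableM.
Qed.

Lemma cmeasurable_normc D f : cmeasurable D f -> measurable_fun D (fun x => normc (f x)).
Proof.
move=> [f1 f2].
have -> : (fun x => normc (f x)) = (fun x => Num.sqrt (Re (f x) ^+ 2 + Im (f x) ^+ 2)).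
  by apply/funext => x; case: (f x).
apply: measurableT_comp; first by apply: continuous_measurable_fun; exact: sqrt_continuous.
by apply: measurable_funD; exact: measurable_funX.
Qed.

Lemma cmeasurableS D E f : measurable E -> D `<=` E -> cmeasurable E f -> cmeasurable D f.
Proof. by move=> mE DE [f1 f2]; split; exact: (measurable_funS mE DE). Qed.

End Complex_measurable.

(** * Integrals of real functions and dominated convergence *)

Section Real_integrals.
Variable R : realType.
Local Notation mu := (@lebesgue_measure R).
Local Notation intg D f := (mu.-integrable D (EFin \o f)).
Implicit Types (D E : set R) (f g : R -> R).

Lemma intg_measurable D f : intg D f -> measurable_fun D f.
Proof. by move=> /integrableP[/measurable_EFinP]. Qed.

Lemma intg_le D f g : measurable D -> measurable_fun D f -> intg D g ->
  (forall x, D x -> `|f x| <= g x) -> intg D f.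
Proof.
move=> mD mf ig fg; apply: (@le_integrable _ _ _ mu D mD (EFin \o f) (EFin \o g)) => //.
  exact/measurable_EFinP.
move=> x Dx /=; rewrite !lee_fin.
by rewrite (le_trans (fg _ Dx))// ler_norm.
Qed.

Lemma eq_intg D f g : measurable D -> (forall x, D x -> f x = g x) -> intg D f -> intg D g.
Proof. by move=> mD fg; apply: (@eq_integrable _ _ _ mu D mD) => // x /set_mem Dx /=; rewrite fg. Qed.

Lemma eq_Rint D f g : (forall x, D x -> f x = g x) ->
  \int[mu]_(x in D) f x = \int[mu]_(x in D) g x.
Proof. by move=> fg; apply: eq_Rintegral => x /set_mem; exact: fg. Qed.

Lemma intgD D f g : measurable D -> intg D f -> intg D g -> intg D (fun x => f x + g x).
Proof. by move=> mD fi gi; exact: (@integrableD _ _ _ mu D mD _ _ fi gi). Qed.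

Lemma intgB D f g : measurable D -> intg D f -> intg D g -> intg D (fun x => f x - g x).
Proof. by move=> mD fi gi; exact: (@integrableB _ _ _ mu D mD _ _ fi gi). Qed.

Lemma intgZ D (k : R) f : measurable D -> intg D f -> intg D (fun x => k * f x).
Proof. by move=> mD fi; exact: (@integrableZl _ _ _ mu D mD k _ fi). Qed.

Lemma intg_norm D f : intg D f -> intg D (fun x => `|f x|).
Proof. exact: integrable_norm. Qed.

Lemma intgS D E f : measurable E -> measurable D -> D `<=` E -> intg E f -> intg D f.
Proof. by move=> mE mD DE; exact: integrableS. Qed.

Lemma ler_norm_Rint D f : measurable D -> intg D f ->
  `|\int[mu]_(x in D) f x| <= \int[mu]_(x in D) `|f x|.
Proof. by move=> mD fi; exact: (@le_normr_Rintegral _ _ _ mu D f mD fi). Qed.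

Lemma ler_Rint D f g : measurable D -> intg D f -> intg D g ->
  (forall x, D x -> f x <= g x) -> \int[mu]_(x in D) f x <= \int[mu]_(x in D) g x.
Proof. by move=> mD fi gi fg; exact: (@le_Rintegral _ _ _ mu D f g mD fi gi fg). Qed.

Lemma Rint_EFin D f : measurable D -> intg D f ->
  (\int[mu]_(x in D) (f x)%:E = (\int[mu]_(x in D) f x)%:E)%E.
Proof.
move=> mD fi; rewrite /Rintegral fineK//.
exact: (@integrable_fin_num _ _ _ mu D mD _ fi).
Qed.

Lemma intg_fin_lty D f : measurable D -> measurable_fun D f ->
  (\int[mu]_(x in D) (`|f x|)%:E < +oo)%E -> intg D f.
Proof. by move=> mD mf h; apply/integrableP; split => //; exact/measurable_EFinP. Qed.

Lemma Rdominated_cvg D (f_ : nat -> R -> R) f g : measurable D ->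
  (forall n, measurable_fun D (f_ n)) ->
  (forall x, D x -> f_ n x @[n --> \oo] --> f x) ->
  intg D g -> (forall n x, D x -> `|f_ n x| <= g x) ->
  intg D f /\
  (\int[mu]_(x in D) f_ n x) @[n --> \oo] --> (\int[mu]_(x in D) f x).
Proof.
move=> mD mf cf ig fg.
have mlim : measurable_fun D f by exact: (measurable_fun_cvg mf).
have [] := @dominated_convergence _ _ _ mu D mD (fun n => EFin \o f_ n) (EFin \o f) (EFin \o g).
- by move=> n; apply/measurable_EFinP; exact: mf.
- by apply/measurable_EFinP.
- by apply: aeW => x Dx; apply: cvg_EFin; [exact: nearW|exact: cf].
- by [].
- by apply: aeW => x n Dx; rewrite /= lee_fin fg.
move=> fi _ h; split => //.
have fin n : intg D (f_ n) by apply: intg_le ig _ => // x; exact: fg.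
move: h; rewrite /= Rint_EFin//.
under eq_fun do rewrite Rint_EFin//.
by move=> /fine_cvgP[].
Qed.

End Real_integrals.

(** * Fubini's theorem under domination by a product *)

Section Fubini_product_bound.
Variable R : realType.
Local Notation mu := (@lebesgue_measure R).
Local Notation intg D f := (mu.-integrable D (EFin \o f)).

Lemma intg_restrict (D : set R) (f : R -> R) : measurable D ->
  intg D f <-> intg setT (fun x => f x * \1_D x).
Proof.
move=> mD.
have -> : EFin \o (fun x => f x * \1_D x) = ((EFin \o f) \_ D)%E.
  apply/funext => x /=; rewrite patchE indicE.
  by case: (x \in D); rewrite ?mulr1 ?mulr0.
by split => h; [apply/(@integrable_mkcond _ _ _ mu D _ mD).1|apply/(@integrable_mkcond _ _ _ mu D _ mD).2].
Qed.

Lemma Rint_restrict (D : set R) (f : R -> R) :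
  \int[mu]_(x in D) f x = \int[mu]_(x in setT) (f x * \1_D x).
Proof.
rewrite Rintegral_mkcond; apply: eq_Rint => x _; rewrite patchE indicE.
by case: (x \in D); rewrite ?mulr1 ?mulr0.
Qed.

(** Tonelli applied to the product bound gives absolute integrability on the plane, and Fubini then
    exchanges the integrals. Every exchange of integrals below goes through a bound of this
    shape. *)
Lemma Rfubini (D1 D2 : set R) (f : R -> R -> R) (g1 g2 : R -> R) :
  measurable D1 -> measurable D2 ->
  measurable_fun setT (fun p : R * R => f p.1 p.2) ->
  intg D1 g1 -> intg D2 g2 ->
  (forall x, D1 x -> 0 <= g1 x) ->
  (forall x y, D1 x -> D2 y -> `|f x y| <= g1 x * g2 y) ->
  intg D1 (fun x => \int[mu]_(y in D2) f x y) /\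
    \int[mu]_(x in D1) \int[mu]_(y in D2) f x y =
    \int[mu]_(y in D2) \int[mu]_(x in D1) f x y.
Proof.
move=> mD1 mD2 mf i1 i2 g10 fg.
(* The domains are turned into indicator factors, so that a single integral over the whole plane is
   studied. *)
pose F (p : R * R) := (f p.1 p.2 * \1_D1 p.1 * \1_D2 p.2)%:E.
have mF : measurable_fun setT F.
  apply/measurable_EFinP; apply: measurable_funM; first apply: measurable_funM => //.
    exact: (measurableT_comp (f := (\1_D1 : R -> R)) (measurable_indic mD1) measurable_fst).
  exact: (measurableT_comp (f := (\1_D2 : R -> R)) (measurable_indic mD2) measurable_snd).
have mfx x : measurable_fun setT (f x).
  have := measurableT_comp mf (measurable_fun_pair (measurable_cst x) (@measurable_id _ R setT)).
  by [].
have mfy y : measurable_fun setT (f ^~ y).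
  have := measurableT_comp mf (measurable_fun_pair (@measurable_id _ R setT) (measurable_cst y)).
  by [].
have ifx x : D1 x -> intg D2 (f x).
  move=> Dx; apply: (intg_le mD2 _ (intgZ (g1 x) mD2 i2)).
    exact: measurable_funTS.
  by move=> y Dy; rewrite fg.
have ify y : D2 y -> intg D1 (f ^~ y).
  move=> Dy; apply: (intg_le mD1 _ (intgZ (g2 y) mD1 i1)).
    exact: measurable_funTS.
  by move=> x Dx; rewrite mulrC fg.
have iF : (mu \x mu)%E.-integrable setT F.
  apply/(@integrable12ltyP _ _ _ _ _ mu mu _ mF).
  apply: (@le_lt_trans _ _ (\int[mu]_x ((g1 x * \1_D1 x) * (\int[mu]_(y in D2) `|g2 y|))%:E)%E).
    apply: ge0_le_integral => //.
    - by move=> x _; exact: integral_ge0.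
    - apply: (@measurable_fun_fubini_tonelli_F _ _ (measurableTypeR R) (measurableTypeR R) R mu (abse \o F)).
        by apply: measurableT_comp.
      by move=> x; exact: abse_ge0.
    - apply/measurable_EFinP; apply: measurable_funM => //.
      exact: (intg_measurable ((intg_restrict g1 mD1).1 i1)).
    move=> x _.
    have [Dx|Dx] := boolP (x \in D1); last first.
      rewrite indicE (negbTE Dx) mulr0 mul0r.
      rewrite integral0_eq// => y _; rewrite /F/= indicE (negbTE Dx).
      by rewrite mulr0 mul0r normr0.
    rewrite indicE Dx mulr1.
    rewrite Rint_restrict.
    have Dx' := set_mem Dx.
    have i2' : intg setT (fun y => g1 x * (`|g2 y| * \1_D2 y)).
      by apply: intgZ => //; apply/(intg_restrict _ mD2); exact: intg_norm.
    rewrite -RintegralZl//; last by apply/(intg_restrict _ mD2); exact: intg_norm.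
    rewrite -Rint_EFin//.
    apply: ge0_le_integral => //.
    - by apply: measurableT_comp => //; exact: (measurableT_comp mF (measurable_fun_pair (measurable_cst x) (@measurable_id _ R setT))).
    - by apply/measurable_EFinP; exact: intg_measurable i2'.
    move=> y _; rewrite /F/= lee_fin indicE Dx mulr1 indicE.
    have [Dy|Dy] := boolP (y \in D2); last by rewrite !mulr0 normr0.
    rewrite !mulr1 (le_trans (fg _ _ Dx' (set_mem Dy)))//.
    by rewrite ler_wpM2l ?g10// ler_norm.
  have i1' : intg setT (fun x => (\int[mu]_(y in D2) `|g2 y|) * (g1 x * \1_D1 x)).
    by apply: intgZ => //; apply/(intg_restrict _ mD1).
  under eq_integral do rewrite mulrC.
  by rewrite (Rint_EFin _ i1')// ltry.
have E1 x : (\int[mu]_y F (x, y))%E = ((\int[mu]_(y in D2) f x y) * \1_D1 x)%:E.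
  have [Dx|Dx] := boolP (x \in D1); last first.
    rewrite indicE (negbTE Dx) mulr0.
    by rewrite integral0_eq// => y _; rewrite /F/= indicE (negbTE Dx) mulr0 mul0r.
  rewrite indicE Dx mulr1 Rint_restrict -Rint_EFin//; last first.
    by apply/(intg_restrict _ mD2); apply: ifx; exact: set_mem.
  by apply: eq_integral => y _; rewrite /F/= indicE Dx mulr1.
have E2 y : (\int[mu]_x F (x, y))%E = ((\int[mu]_(x in D1) f x y) * \1_D2 y)%:E.
  have [Dx|Dx] := boolP (y \in D2); last first.
    rewrite indicE (negbTE Dx) mulr0.
    by rewrite integral0_eq// => x _; rewrite /F/= [\1_D2 _]indicE (negbTE Dx) mulr0.
  rewrite [\1_D2 _]indicE Dx mulr1 Rint_restrict -Rint_EFin//; last first.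
    by apply/(intg_restrict _ mD1); apply: ify; exact: set_mem.
  by apply: eq_integral => x _; rewrite /F/= [\1_D2 _]indicE Dx mulr1.
have := Fubini iF.
have I1 : intg D1 (fun x => \int[mu]_(y in D2) f x y).
  apply/(intg_restrict _ mD1).
  have := integrable_fubini_F iF; apply: eq_integrable => // x _.
  by rewrite /fubini_F E1.
under eq_integral do rewrite E1.
under [in RHS]eq_integral do rewrite E2.
move=> FE; split; first exact: I1.
by rewrite Rint_restrict [RHS]Rint_restrict /Rintegral; congr fine.
Qed.

End Fubini_product_bound.

(** * Complex-valued integrals and limits *)

Section Complex_integrals.
Variable R : realType.
Local Notation mu := (@lebesgue_measure R).
Local Notation intg D f := (mu.-integrable D (EFin \o f)).
Implicit Types (D E : set R) (f g : R -> R[i]).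

Definition cintegrable D f :=
  intg D (fun x => Re (f x)) /\ intg D (fun x => Im (f x)).

Lemma Re_cintegral D f : Re (cintegral D f) = \int[mu]_(x in D) Re (f x).
Proof. by []. Qed.

Lemma Im_cintegral D f : Im (cintegral D f) = \int[mu]_(x in D) Im (f x).
Proof. by []. Qed.

Lemma cintegrable_cmeasurable D f : cintegrable D f -> cmeasurable D f.
Proof. by move=> [/intg_measurable f1 /intg_measurable f2]. Qed.

Lemma cintegrable_le D f (g : R -> R) : measurable D -> cmeasurable D f ->
  intg D g -> (forall x, D x -> normc (f x) <= g x) -> cintegrable D f.
Proof.
move=> mD [f1 f2] ig fg; split; apply: (intg_le mD _ ig) => // x Dx.
  exact: le_trans (normr_Re _) (fg _ Dx).
exact: le_trans (normr_Im _) (fg _ Dx).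
Qed.

Lemma intg_normc D f : measurable D -> cintegrable D f -> intg D (fun x => normc (f x)).
Proof.
move=> mD fi; have [f1 f2] := fi.
apply: (intg_le mD _ (intgD mD (intg_norm f1) (intg_norm f2))).
  exact/cmeasurable_normc/cintegrable_cmeasurable.
by move=> x _; rewrite ger0_norm ?normc_ge0// normc_le_ReIm.
Qed.

Lemma eq_cintegral D f g : (forall x, D x -> f x = g x) -> cintegral D f = cintegral D g.
Proof.
by move=> fg; apply: complexP; rewrite ?Re_cintegral ?Im_cintegral; apply: eq_Rint => x /fg ->.
Qed.

Lemma eq_cintegrable D f g : measurable D -> (forall x, D x -> f x = g x) ->
  cintegrable D f -> cintegrable D g.
Proof. by move=> mD fg [f1 f2]; split; [apply: eq_intg f1|apply: eq_intg f2] => // x /fg ->. Qed.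

Lemma cintegrableD D f g : measurable D -> cintegrable D f -> cintegrable D g ->
  cintegrable D (fun x => f x + g x).
Proof.
move=> mD [f1 f2] [g1 g2]; split.
  by under eq_fun do rewrite ReD; exact: intgD.
by under eq_fun do rewrite ImD; exact: intgD.
Qed.

Lemma cintegralD D f g : measurable D -> cintegrable D f -> cintegrable D g ->
  cintegral D (fun x => f x + g x) = cintegral D f + cintegral D g.
Proof.
move=> mD [f1 f2] [g1 g2]; apply: complexP; rewrite ?(ReD, ImD) ?Re_cintegral ?Im_cintegral.
  by under eq_Rint do rewrite ReD; rewrite RintegralD.
by under eq_Rint do rewrite ImD; rewrite RintegralD.
Qed.

Lemma cintegrableZl D (c : R[i]) f : measurable D -> cintegrable D f ->
  cintegrable D (fun x => c * f x).
Proof.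
move=> mD [f1 f2]; split.
  by under eq_fun do rewrite ReM; apply: intgB => //; exact: intgZ.
by under eq_fun do rewrite ImM; apply: intgD => //; exact: intgZ.
Qed.

Lemma cintegralZl D (c : R[i]) f : measurable D -> cintegrable D f ->
  cintegral D (fun x => c * f x) = c * cintegral D f.
Proof.
move=> mD [f1 f2]; apply: complexP; rewrite ?(ReM, ImM) ?Re_cintegral ?Im_cintegral.
  under eq_Rint do rewrite ReM.
  by rewrite RintegralB ?RintegralZl//; exact: intgZ.
under eq_Rint do rewrite ImM.
by rewrite RintegralD ?RintegralZl//; exact: intgZ.
Qed.

Lemma cintegrableN D f : measurable D -> cintegrable D f -> cintegrable D (fun x => - f x).
Proof.
move=> mD /(cintegrableZl (-1) mD); apply: eq_cintegrable => // x _.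
by rewrite mulN1r.
Qed.

Lemma cintegralN D f : measurable D -> cintegrable D f ->
  cintegral D (fun x => - f x) = - cintegral D f.
Proof.
move=> mD fi; rewrite -mulN1r -cintegralZl//; apply: eq_cintegral => x _.
by rewrite mulN1r.
Qed.

Lemma cintegralB D f g : measurable D -> cintegrable D f -> cintegrable D g ->
  cintegral D (fun x => f x - g x) = cintegral D f - cintegral D g.
Proof.
move=> mD fi gi; rewrite cintegralD// ?cintegralN//; exact: cintegrableN.
Qed.

(** The factor 2 comes from bounding the real and imaginary parts separately; all uses are estimates
    up to a constant. *)
Lemma normc_cintegral D f : measurable D -> cintegrable D f ->
  normc (cintegral D f) <= 2 * \int[mu]_(x in D) normc (f x).
Proof.
move=> mD fi; have [f1 f2] := fi; have fn := intg_normc mD fi.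
rewrite (le_trans (normc_le_ReIm _))// mulr_natl mulr2n lerD//.
  rewrite (le_trans (ler_norm_Rint mD f1))//; apply: ler_Rint => //.
    exact: intg_norm.
  by move=> x _; exact: normr_Re.
rewrite (le_trans (ler_norm_Rint mD f2))//; apply: ler_Rint => //.
  exact: intg_norm.
by move=> x _; exact: normr_Im.
Qed.

Lemma conj_cintegral D f : measurable D -> cintegrable D f ->
  conjc (cintegral D f) = cintegral D (fun x => conjc (f x)).
Proof.
move=> mD [f1 f2]; apply: complexP; rewrite ?(Re_conj, Im_conj) ?Re_cintegral ?Im_cintegral.
  by apply: eq_Rint => x _; rewrite Re_conj.
rewrite -mulN1r -RintegralZl//; apply: eq_Rint => x _.
by rewrite Im_conj mulN1r.
Qed.

Lemma cintegrableS D E f : measurable E -> measurable D -> D `<=` E ->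
  cintegrable E f -> cintegrable D f.
Proof. by move=> mE mD DE [f1 f2]; split; exact: (intgS mE mD DE). Qed.

Definition ccvg (u : nat -> R[i]) (l : R[i]) :=
  (Re (u n) @[n --> \oo] --> Re l) /\ (Im (u n) @[n --> \oo] --> Im l).

Lemma cdominated_cvg D (f_ : nat -> R -> R[i]) f (g : R -> R) : measurable D ->
  (forall n, cmeasurable D (f_ n)) ->
  (forall x, D x -> ccvg (f_ ^~ x) (f x)) ->
  intg D g -> (forall n x, D x -> normc (f_ n x) <= g x) ->
  cintegrable D f /\ ccvg (fun n => cintegral D (f_ n)) (cintegral D f).
Proof.
move=> mD mf cf ig fg.
have [i1 c1] := @Rdominated_cvg R D (fun n x => Re (f_ n x)) (fun x => Re (f x)) g
  mD (fun n => (mf n).1) (fun x Dx => (cf x Dx).1) ig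
  (fun n x Dx => le_trans (normr_Re _) (fg n x Dx)).
have [i2 c2] := @Rdominated_cvg R D (fun n x => Im (f_ n x)) (fun x => Im (f x)) g
  mD (fun n => (mf n).2) (fun x Dx => (cf x Dx).2) ig
  (fun n x Dx => le_trans (normr_Im _) (fg n x Dx)).
by [].
Qed.

Lemma cfubini (D1 D2 : set R) (f : R -> R -> R[i]) (g1 g2 : R -> R) :
  measurable D1 -> measurable D2 ->
  cmeasurable setT (fun p : R * R => f p.1 p.2) ->
  intg D1 g1 -> intg D2 g2 ->
  (forall x, D1 x -> 0 <= g1 x) ->
  (forall x y, D1 x -> D2 y -> normc (f x y) <= g1 x * g2 y) ->
  cintegrable D1 (fun x => cintegral D2 (f x)) /\
    cintegral D1 (fun x => cintegral D2 (f x)) =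
    cintegral D2 (fun y => cintegral D1 (f ^~ y)).
Proof.
move=> mD1 mD2 [mf1 mf2] i1 i2 g10 fg.
have [j1 e1] := @Rfubini R D1 D2 (fun x y => Re (f x y)) g1 g2 mD1 mD2 mf1 i1 i2 g10
  (fun x y D1x D2y => le_trans (normr_Re _) (fg x y D1x D2y)).
have [j2 e2] := @Rfubini R D1 D2 (fun x y => Im (f x y)) g1 g2 mD1 mD2 mf2 i1 i2 g10
  (fun x y D1x D2y => le_trans (normr_Im _) (fg x y D1x D2y)).
by split; [split; [exact: j1|exact: j2]|apply: complexP; [exact: e1|exact: e2]].
Qed.

Lemma ccvg_cst (c : R[i]) : ccvg (fun=> c) c.
Proof. by split; exact: cvg_cst. Qed.

Lemma ccvgD (u v : nat -> R[i]) a b : ccvg u a -> ccvg v b ->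
  ccvg (fun n => u n + v n) (a + b).
Proof.
move=> [u1 u2] [v1 v2]; split.
  by under eq_fun do rewrite ReD; rewrite ReD; exact: cvgD.
by under eq_fun do rewrite ImD; rewrite ImD; exact: cvgD.
Qed.

Lemma ccvgM (u v : nat -> R[i]) a b : ccvg u a -> ccvg v b ->
  ccvg (fun n => u n * v n) (a * b).
Proof.
move=> [u1 u2] [v1 v2]; split.
  by under eq_fun do rewrite ReM; rewrite ReM; apply: cvgB; exact: cvgM.
by under eq_fun do rewrite ImM; rewrite ImM; apply: cvgD; exact: cvgM.
Qed.

Lemma ccvgN (u : nat -> R[i]) a : ccvg u a -> ccvg (fun n => - u n) (- a).
Proof.
move=> [u1 u2]; split.
  by under eq_fun do rewrite ReN; rewrite ReN; exact: cvgN.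
by under eq_fun do rewrite ImN; rewrite ImN; exact: cvgN.
Qed.

Lemma ccvgV (u : nat -> R[i]) a : a != 0 -> ccvg u a -> ccvg (fun n => (u n)^-1) a^-1.
Proof.
move=> a0 [u1 u2].
have q0 : Re a ^+ 2 + Im a ^+ 2 != 0.
  by rewrite -sqr_normc expf_neq0// normc_eq0.
have h : (Re (u n) ^+ 2 + Im (u n) ^+ 2) @[n --> \oo] --> Re a ^+ 2 + Im a ^+ 2.
  by under eq_fun do rewrite !expr2; rewrite !expr2; apply: cvgD; apply: cvgM.
split.
  by under eq_fun do rewrite ReV; rewrite ReV; apply: cvgM => //; apply: cvgV.
by under eq_fun do rewrite ImV; rewrite ImV; apply: cvgN; apply: cvgM => //; apply: cvgV.
Qed.

Lemma ccvg_normc (u : nat -> R[i]) a : ccvg u a -> normc (u n) @[n --> \oo] --> normc a.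
Proof.
move=> [u1 u2].
have E (z : R[i]) : normc z = Num.sqrt (Re z ^+ 2 + Im z ^+ 2) by case: z.
under eq_fun do rewrite E; rewrite E.
have h : Re (u n) ^+ 2 + Im (u n) ^+ 2 @[n --> \oo] --> Re a ^+ 2 + Im a ^+ 2.
  by under eq_fun do rewrite !expr2; rewrite !expr2; apply: cvgD; apply: cvgM.
exact: (cvg_comp _ _ h (@sqrt_continuous R _)).
Qed.

Lemma ccvg0P (u : nat -> R[i]) : normc (u n) @[n --> \oo] --> (0 : R) -> ccvg u 0.
Proof.
move=> u0; split.
  apply/norm_cvg0P; apply: (squeeze_cvgr _ (cvg_cst 0) u0).
  by apply: nearW => n; rewrite normr_ge0 normr_Re.
apply/norm_cvg0P; apply: (squeeze_cvgr _ (cvg_cst 0) u0).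
by apply: nearW => n; rewrite normr_ge0 normr_Im.
Qed.

Lemma ccvg_unique (u : nat -> R[i]) a b : ccvg u a -> ccvg u b -> a = b.
Proof.
move=> [u1 u2] [v1 v2]; apply: complexP.
  by rewrite -(cvg_lim _ u1)// -(cvg_lim _ v1).
by rewrite -(cvg_lim _ u2)// -(cvg_lim _ v2).
Qed.

Lemma ccvg_near (u v : nat -> R[i]) a : (\forall n \near \oo, u n = v n) ->
  ccvg u a -> ccvg v a.
Proof.
move=> uv [u1 u2]; split.
  by apply: cvg_trans u1; apply: near_eq_cvg; apply: filterS uv => n ->.
by apply: cvg_trans u2; apply: near_eq_cvg; apply: filterS uv => n ->.
Qed.

End Complex_integrals.

(** * Calculus of complex functions of a real variable *)

Section Complex_calculus.
Variable R : realType.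
Local Notation mu := (@lebesgue_measure R).
Local Notation intg D f := (mu.-integrable D (EFin \o f)).
Implicit Types (a b t : R).

Lemma within_continuous_itv (f : R -> R) a b :
  (forall x, a <= x <= b -> {for x, continuous f}) -> {within `[a, b], continuous f}.
Proof.
move=> cf; apply: continuous_in_subspaceT => x; rewrite inE/= in_itv/=.
exact: cf.
Qed.

Lemma intg_itv_continuous (f : R -> R) a b :
  (forall x, a <= x <= b -> {for x, continuous f}) -> intg `[a, b] f.
Proof.
move=> cf; apply: continuous_compact_integrable; first exact: segment_compact.
exact: within_continuous_itv.
Qed.

Lemma is_derive_continuous (f : R -> R) (x d : R) : is_derive x 1 f d -> {for x, continuous f}.
Proof.
by move=> df; apply: differentiable_continuous; apply/derivable1_diffP.
Qed.

Lemma Rint_FTC (F f : R -> R) (a b : R) : a <= b ->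
  (forall x : R, a <= x <= b -> is_derive x 1 F (f x)) ->
  (forall x, a <= x <= b -> {for x, continuous f}) ->
  \int[mu]_(x in `[a, b]) f x = F b - F a.
Proof.
rewrite le_eqVlt => /predU1P[<-|ab] dF cf.
  by rewrite set_itv1 Rintegral_set1 subrr.
rewrite /Rintegral (@continuous_FTC2 _ f F)//.
- exact: within_continuous_itv.
- have cF x : a <= x <= b -> {for x, continuous F} by move=> /dF /is_derive_continuous.
  split.
  + move=> x; rewrite in_itv/= => /andP[ax xb].
    by have [] := dF x (ltac:(by rewrite !ltW)).
  + by apply: cvg_at_right_filter; apply: cF; rewrite lexx ltW.
  + by apply: cvg_at_left_filter; apply: cF; rewrite lexx ltW.
- move=> x; rewrite in_itv/= => /andP[ax xb].
  have [_] := dF x (ltac:(by rewrite !ltW)).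
  by rewrite derive1E.
Qed.

Lemma bounded_itv_continuous (f : R -> R) a b :
  (forall x, a <= x <= b -> {for x, continuous f}) ->
  exists2 M : R, 0 <= M & forall x : R, a <= x <= b -> `|f x| <= M.
Proof.
move=> cf; have [ab|ba] := leP a b; last first.
  by exists 0 => // x /andP[/le_trans h /h]; rewrite leNgt ba.
have cn : {within `[a, b], continuous (fun x => `|f x|)}.
  apply: within_continuous_itv => x xab.
  by apply: (cvg_comp _ _ (cf _ xab)); exact: norm_continuous.
have [c cab Mc] := EVT_max ab cn.
by exists `|f c| => // x xab; apply: Mc; rewrite in_itv.
Qed.

Definition ccont (T : topologicalType) (f : T -> R[i]) (p : T) :=
  {for p, continuous (fun x : T => Re (f x))} /\ {for p, continuous (fun x : T => Im (f x))}.

Definition cderive (f : R -> R[i]) (t : R) (d : R[i]) :=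
  is_derive t 1 (fun x => Re (f x)) (Re d) /\ is_derive t 1 (fun x => Im (f x)) (Im d).

Lemma cderive_ccont (f : R -> R[i]) t d : cderive f t d -> ccont f t.
Proof. by move=> [/is_derive_continuous ? /is_derive_continuous ?]. Qed.

Lemma cderive_eq f t d e : cderive f t d -> d = e -> cderive f t e.
Proof. by move=> + <-. Qed.

Lemma cderive_cst (c : R[i]) t : cderive (fun=> c) t 0.
Proof. by split; exact: is_derive_cst. Qed.

Lemma cderive_real (f : R -> R) (t d : R) : is_derive t 1 f d ->
  cderive (fun x => (f x)%:C) t d%:C.
Proof. by move=> h; split => //=; exact: is_derive_cst. Qed.

Lemma cderiveD f g t d e : cderive f t d -> cderive g t e ->
  cderive (fun x => f x + g x) t (d + e).
Proof.
move=> [f1 f2] [g1 g2]; split.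
  by under eq_fun do rewrite ReD; rewrite ReD; exact: is_deriveD.
by under eq_fun do rewrite ImD; rewrite ImD; exact: is_deriveD.
Qed.

Lemma cderiveN f t d : cderive f t d -> cderive (fun x => - f x) t (- d).
Proof.
move=> [f1 f2]; split.
  by under eq_fun do rewrite ReN; rewrite ReN; exact: is_deriveN.
by under eq_fun do rewrite ImN; rewrite ImN; exact: is_deriveN.
Qed.

Lemma is_deriveMr (f g : R -> R) (t d e : R) : is_derive t 1 f d -> is_derive t 1 g e ->
  is_derive t 1 (fun x => f x * g x) (f t * e + g t * d).
Proof. by move=> df dg; exact: (is_deriveM df dg). Qed.

Lemma is_deriveDr (f g : R -> R) (t d e : R) : is_derive t 1 f d -> is_derive t 1 g e ->
  is_derive t 1 (fun x => f x + g x) (d + e).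
Proof. by move=> df dg; exact: (is_deriveD df dg). Qed.

Lemma cderiveM f g t d e : cderive f t d -> cderive g t e ->
  cderive (fun x => f x * g x) t (d * g t + f t * e).
Proof.
move=> [f1 f2] [g1 g2]; split.
  under eq_fun do rewrite ReM.
  apply: (is_derive_eq (is_deriveB (is_deriveMr f1 g1) (is_deriveMr f2 g2))).
  by rewrite ReD !ReM; ring.
under eq_fun do rewrite ImM.
apply: (is_derive_eq (is_deriveD (is_deriveMr f1 g2) (is_deriveMr f2 g1))).
by rewrite ImD !ImM; ring.
Qed.

Lemma cderiveV f t d : f t != 0 -> cderive f t d ->
  cderive (fun x => (f x)^-1) t (- d * (f t)^-1 ^+ 2).
Proof.
move=> ft [f1 f2].
have q0 : Re (f t) ^+ 2 + Im (f t) ^+ 2 != 0.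
  by rewrite -sqr_normc expf_neq0// normc_eq0.
have q0' : Re (f t) * Re (f t) + Im (f t) * Im (f t) != 0 by rewrite -!expr2.
have dq := is_deriveDr (is_deriveMr f1 f1) (is_deriveMr f2 f2).
have dv := @is_deriveV _ (fun x : R => Re (f x) * Re (f x) + Im (f x) * Im (f x)) t _ _ q0' dq.
split.
  under eq_fun do rewrite ReV !expr2.
  apply: (is_derive_eq (is_deriveMr f1 dv)).
  by rewrite !expr2 !(ReM, ReN, ReV, ImM, ImN, ImV) /GRing.scale/=; field.
under eq_fun do rewrite ImV !expr2.
apply: (is_derive_eq (is_deriveN (is_deriveMr f2 dv))).
by rewrite !expr2 !(ReM, ReN, ReV, ImM, ImN, ImV) /GRing.scale/=; field.
Qed.

Lemma cderive_cexp f t d : cderive f t d ->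
  cderive (fun x => cexp (f x)) t (cexp (f t) * d).
Proof.
move=> [f1 f2].
have de := is_derive1_comp (is_derive_expR (Re (f t))) f1.
split.
  under eq_fun do rewrite Re_cexp.
  apply: (is_derive_eq (is_deriveMr de (is_derive1_comp (is_derive_cos (Im (f t))) f2))).
  by rewrite /= ReM Re_cexp Im_cexp; ring.
under eq_fun do rewrite Im_cexp.
apply: (is_derive_eq (is_deriveMr de (is_derive1_comp (is_derive_sin (Im (f t))) f2))).
by rewrite /= ImM Re_cexp Im_cexp; ring.
Qed.

Section ccont_rules.
Context {T : topologicalType}.
Implicit Types (f g : T -> R[i]) (p : T).

Lemma ccont_cst (c : R[i]) p : ccont (fun=> c) p.
Proof. by split; exact: cvg_cst. Qed.

Lemma ccontD f g p : ccont f p -> ccont g p -> ccont (fun x => f x + g x) p.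
Proof.
move=> [f1 f2] [g1 g2]; split; rewrite /prop_for/continuous_at.
  by under eq_fun do rewrite ReD; rewrite ReD; exact: cvgD.
by under eq_fun do rewrite ImD; rewrite ImD; exact: cvgD.
Qed.

Lemma ccontN f p : ccont f p -> ccont (fun x => - f x) p.
Proof.
move=> [f1 f2]; split; rewrite /prop_for/continuous_at.
  by under eq_fun do rewrite ReN; rewrite ReN; exact: cvgN.
by under eq_fun do rewrite ImN; rewrite ImN; exact: cvgN.
Qed.

Lemma ccontM f g p : ccont f p -> ccont g p -> ccont (fun x => f x * g x) p.
Proof.
move=> [f1 f2] [g1 g2]; split; rewrite /prop_for/continuous_at.
  by under eq_fun do rewrite ReM; rewrite ReM; apply: cvgB; exact: cvgM.
by under eq_fun do rewrite ImM; rewrite ImM; apply: cvgD; exact: cvgM.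
Qed.

Lemma ccontV f p : f p != 0 -> ccont f p -> ccont (fun x => (f x)^-1) p.
Proof.
move=> fp [f1 f2].
have q0 : Re (f p) * Re (f p) + Im (f p) * Im (f p) != 0.
  by rewrite -!expr2 -sqr_normc expf_neq0// normc_eq0.
have cv : {for p, continuous (fun x => (Re (f x) * Re (f x) + Im (f x) * Im (f x))^-1)}.
  by apply: cvgV => //; apply: cvgD; exact: cvgM.
split; rewrite /prop_for/continuous_at.
  by under eq_fun do rewrite ReV !expr2; rewrite ReV !expr2; exact: cvgM.
by under eq_fun do rewrite ImV !expr2; rewrite ImV !expr2; apply: cvgN; exact: cvgM.
Qed.

Lemma ccont_cexp f p : ccont f p -> ccont (fun x => cexp (f x)) p.
Proof.
move=> [f1 f2].
have ce : {for p, continuous (fun x => expR (Re (f x)))}.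
  exact: (cvg_comp _ _ f1 (@continuous_expR R _)).
split; rewrite /prop_for/continuous_at.
  under eq_fun do rewrite Re_cexp; rewrite Re_cexp; apply: cvgM => //.
  exact: (cvg_comp _ _ f2 (@continuous_cos R _)).
under eq_fun do rewrite Im_cexp; rewrite Im_cexp; apply: cvgM => //.
exact: (cvg_comp _ _ f2 (@continuous_sin R _)).
Qed.

End ccont_rules.

Lemma cintegrable_itv_ccont (f : R -> R[i]) a b :
  (forall x, a <= x <= b -> ccont f x) -> cintegrable `[a, b] f.
Proof.
by move=> cf; split; apply: intg_itv_continuous => x /cf[].
Qed.

Lemma cintegral_FTC (F f : R -> R[i]) a b : a <= b ->
  (forall x, a <= x <= b -> cderive F x (f x)) ->
  (forall x, a <= x <= b -> ccont f x) ->
  cintegral `[a, b] f = F b - F a.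
Proof.
move=> ab dF cf; apply: complexP.
  rewrite Re_cintegral ReD ReN.
  by apply: (Rint_FTC (F := fun x => Re (F x))) => // x xab; [have [] := dF _ xab|have [] := cf _ xab].
rewrite Im_cintegral ImD ImN.
by apply: (Rint_FTC (F := fun x => Im (F x))) => // x xab; [have [] := dF _ xab|have [] := cf _ xab].
Qed.

End Complex_calculus.

(** * Contour deformation *)

Section Holomorphic.
Variable R : realType.
Local Notation mu := (@lebesgue_measure R).
Local Notation intg D f := (mu.-integrable D (EFin \o f)).
Implicit Types (U : set R[i]) (f g h : R[i] -> R[i]).

(* [f] is holomorphic on [U] with derivative [f'], in the only form needed for
   contour deformation: differentiability along curves meeting [U] (which need
   not be open), together with measurability and boundedness. *)
Definition holo U f f' :=
  [/\ forall (z : R -> R[i]) t d, cderive z t d -> U (z t) ->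
        cderive (fun x => f (z x)) t (f' (z t) * d),
      forall (z : R -> R[i]) t, ccont z t -> U (z t) ->
        ccont (fun x => f (z x)) t /\ ccont (fun x => f' (z x)) t,
      forall d (T : measurableType d) (z : T -> R[i]), cmeasurable setT z ->
        cmeasurable setT (fun x => f (z x)) /\ cmeasurable setT (fun x => f' (z x))
    & exists2 M : R, 0 <= M & forall z, U z -> normc (f z) <= M /\ normc (f' z) <= M].

Lemma holo_cst U c : holo U (fun=> c) (fun=> 0).
Proof.
split.
- by move=> z t d _ _; apply: cderive_eq (cderive_cst _ _) _; rewrite mul0r.
- by move=> *; split; exact: ccont_cst.
- by move=> *; split; exact: cmeasurable_cst.
- by exists (normc c); rewrite ?normc_ge0// => z _; rewrite Normc.normc0 normc_ge0.
Qed.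

Lemma holo_id U B : (forall z, U z -> normc z <= B) -> holo U (fun z => z) (fun=> 1).
Proof.
move=> UB; split.
- by move=> z t d dz _; apply: cderive_eq dz _; rewrite mul1r.
- by move=> z t cz _; split => //; exact: ccont_cst.
- by move=> d T z mz; split => //; exact: cmeasurable_cst.
- exists (Num.max B 1); first by rewrite le_max ler01 orbT.
  by move=> z /UB zB; rewrite !le_max zB Normc.normc1 lexx orbT.
Qed.

Lemma holoD U f f' g g' : holo U f f' -> holo U g g' ->
  holo U (fun z => f z + g z) (fun z => f' z + g' z).
Proof.
move=> [f1 f2 f3 [Mf Mf0 f4]] [g1 g2 g3 [Mg Mg0 g4]]; split.
- move=> z t d dz Uz; apply: cderive_eq (cderiveD (f1 _ _ _ dz Uz) (g1 _ _ _ dz Uz)) _.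
  by rewrite mulrDl.
- move=> z t cz Uz; have [fa fb] := f2 _ _ cz Uz; have [ga gb] := g2 _ _ cz Uz.
  by split; exact: ccontD.
- move=> d T z mz; have [fa fb] := f3 _ _ _ mz; have [ga gb] := g3 _ _ _ mz.
  by split; exact: cmeasurableD.
- exists (Mf + Mg); first exact: addr_ge0.
  move=> z Uz; have [fa fb] := f4 _ Uz; have [ga gb] := g4 _ Uz.
  by split; rewrite (le_trans (normcD _ _))// lerD.
Qed.

Lemma holoM U f f' g g' : holo U f f' -> holo U g g' ->
  holo U (fun z => f z * g z) (fun z => f' z * g z + f z * g' z).
Proof.
move=> [f1 f2 f3 [Mf Mf0 f4]] [g1 g2 g3 [Mg Mg0 g4]]; split.
- move=> z t d dz Uz; apply: cderive_eq (cderiveM (f1 _ _ _ dz Uz) (g1 _ _ _ dz Uz)) _.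
  by ring.
- move=> z t cz Uz; have [fa fb] := f2 _ _ cz Uz; have [ga gb] := g2 _ _ cz Uz.
  by split; [exact: ccontM|apply: ccontD; exact: ccontM].
- move=> d T z mz; have [fa fb] := f3 _ _ _ mz; have [ga gb] := g3 _ _ _ mz.
  by split; [exact: cmeasurableM|apply: cmeasurableD; exact: cmeasurableM].
- exists (Mf * Mg + Mf * Mg); first by rewrite addr_ge0// mulr_ge0.
  move=> z Uz; have [fa fb] := f4 _ Uz; have [ga gb] := g4 _ Uz.
  have h a b : normc a <= Mf -> normc b <= Mg -> normc (a * b) <= Mf * Mg.
    by move=> ? ?; rewrite normcM ler_pM ?normc_ge0.
  split; last by rewrite (le_trans (normcD _ _))// lerD// h.
  by rewrite (le_trans (h _ _ fa ga))// lerDl mulr_ge0.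
Qed.

(** The uniform lower bound e keeps 1/f and its derivative bounded on U, as the last clause of
    [holo] demands. *)
Lemma holoV U f f' e : 0 < e -> (forall z, U z -> e <= normc (f z)) ->
  holo U f f' -> holo U (fun z => (f z)^-1) (fun z => - f' z * (f z)^-1 ^+ 2).
Proof.
move=> e0 fe [f1 f2 f3 [M M0 f4]].
have fn0 z : U z -> f z != 0 by move=> /fe h; rewrite -normc_gt0 (lt_le_trans e0).
split.
- move=> z t d dz Uz; apply: cderive_eq (cderiveV (fn0 _ Uz) (f1 _ _ _ dz Uz)) _.
  by ring.
- move=> z t cz Uz; have [fa fb] := f2 _ _ cz Uz; split; first exact: ccontV (fn0 _ Uz) _.
  apply: ccontM; first exact: ccontN.
  by under eq_fun do rewrite expr2; apply: ccontM; exact: ccontV (fn0 _ Uz) _.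
- move=> d T z mz; have [fa fb] := f3 _ _ _ mz; split; first exact: cmeasurableV.
  apply: cmeasurableM; first exact: cmeasurableN.
  by under eq_fun do rewrite expr2; apply: cmeasurableM; exact: cmeasurableV.
- have h z : U z -> normc (f z)^-1 <= e^-1.
    by move=> Uz; rewrite normcV lef_pV2 ?posrE// ?fe// (lt_le_trans e0)// fe.
  exists (e^-1 + M * e^-1 ^+ 2).
    by rewrite addr_ge0 ?mulr_ge0 ?exprn_ge0// invr_ge0 ltW.
  move=> z Uz; have [fa fb] := f4 _ Uz; split.
    by rewrite (le_trans (h _ Uz))// lerDl mulr_ge0// exprn_ge0// invr_ge0 ltW.
  rewrite normcM normc_N expr2 normcM -expr2.
  rewrite (@le_trans _ _ (M * e^-1 ^+ 2))//; last by rewrite lerDr invr_ge0 ltW.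
  apply: ler_pM; rewrite ?normc_ge0 ?exprn_ge0 ?normc_ge0//.
  by apply: lerXn2r; rewrite ?nnegrE ?normc_ge0 ?invr_ge0 ?(ltW e0)// h.
Qed.

Lemma holo_cexp U B (l : R) : (forall z, U z -> normc z <= B) ->
  holo U (fun z => cexp (l%:C * z)) (fun z => l%:C * cexp (l%:C * z)).
Proof.
move=> UB; split.
- move=> z t d dz Uz; have := cderive_cexp (cderiveM (cderive_cst l%:C t) dz).
  by move/cderive_eq; apply; ring.
- move=> z t cz Uz; have h : ccont (fun x => cexp (l%:C * z x)) t.
    by apply: ccont_cexp; apply: ccontM => //; exact: ccont_cst.
  by split; [exact: h|apply: ccontM; [exact: ccont_cst|exact: h]].
- move=> d T z mz; have h : cmeasurable setT (fun x => cexp (l%:C * z x)).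
    by apply: cmeasurable_cexp; apply: cmeasurableM => //; exact: cmeasurable_cst.
  by split; [exact: h|apply: cmeasurableM; [exact: cmeasurable_cst|exact: h]].
- have h z : U z -> normc (cexp (l%:C * z)) <= expR (`|l| * B).
    move=> /UB zB; rewrite normc_cexp ler_expR ReM ReC ImC mul0r subr0.
    rewrite (le_trans (ler_norm _))// normrM ler_wpM2l//.
    exact: le_trans (normr_Re _) zB.
  exists ((1 + `|l|) * expR (`|l| * B)).
    by rewrite mulr_ge0 ?expR_ge0// addr_ge0.
  move=> z Uz; split.
    by rewrite (le_trans (h _ Uz))// ler_peMl ?expR_ge0// lerDl.
  rewrite normcM normcC (@le_trans _ _ (`|l| * expR (`|l| * B)))//.
    by rewrite ler_wpM2l// h.
  by rewrite ler_wpM2r ?expR_ge0// lerDr.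
Qed.

Lemma holo_prod U n (F : nat -> R[i] -> R[i]) :
  (forall k, exists f', holo U (F k) f') ->
  exists f', holo U (fun z => \prod_(k < n) F k z) f'.
Proof.
move=> hF; elim: n => [|n [f' IH]].
  exists (fun=> 0); under eq_fun do rewrite big_ord0; exact: holo_cst.
have [g' hg] := hF n; eexists; under eq_fun do rewrite big_ord_recr/=.
exact: holoM IH hg.
Qed.

Section contour_deformation.
Implicit Types t th : R.
Variables (U : set R[i]) (f f' : R[i] -> R[i]) (sigma : R -> R) (s0 N : R).
Hypothesis hf : holo U f f'.
Hypothesis dsigma : forall t, derivable sigma t 1.
Hypothesis cdsigma : continuous (derive1 sigma).
Hypothesis N0 : 0 <= N.
Let tau t := sigma t - s0.
Let zeta (th t : R) : R[i] := (s0 + th * tau t) +i* t.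
Hypothesis zetaU : forall th t, 0 <= th <= 1 -> - N <= t <= N -> U (zeta th t).

(* W is both d/dth (f (zeta) dzeta/dt) and d/dt (f (zeta) dzeta/dth); integrating
   it over the rectangle in the two orders deforms the contour. *)
Let W (th t : R) : R[i] :=
  f' (zeta th t) * (tau t)%:C * ((th * derive1 sigma t) +i* 1)
  + f (zeta th t) * (derive1 sigma t)%:C.

Let dtau t : is_derive t 1 tau (derive1 sigma t).
Proof.
have h : is_derive t 1 sigma (derive1 sigma t).
  by split => //; rewrite derive1E.
have := is_deriveD h (is_derive_cst (- s0) t 1).
by move/is_derive_eq; apply; rewrite addr0.
Qed.

Let csigma : continuous sigma.
Proof.
by move=> t; apply: differentiable_continuous; apply/derivable1_diffP.
Qed.

Let dzeta_th th t : cderive (fun x => zeta x t) th (tau t)%:C.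
Proof.
split; last exact: is_derive_cst.
have := is_deriveDr (is_derive_cst s0 th 1) (is_deriveMr (is_derive_id th 1) (is_derive_cst (tau t) th 1)).
by move/is_derive_eq; apply; rewrite add0r mulr0 add0r mulr1.
Qed.

Let dzeta_t th t : cderive (fun x => zeta th x) t ((th * derive1 sigma t) +i* 1).
Proof.
split; last exact: is_derive_id.
have := is_deriveDr (is_derive_cst s0 t 1) (is_deriveMr (is_derive_cst th t 1) (dtau t)).
by move/is_derive_eq; apply; rewrite mulr0 addr0 add0r.
Qed.

Let ctau t : {for t, continuous tau}. Proof. exact: is_derive_continuous (dtau t). Qed.

Lemma deformation_theta t : - N <= t <= N ->
  cintegral `[0, 1] (W ^~ t) =
  f (sigma t +i* t) * (derive1 sigma t +i* 1) - f (s0 +i* t) * 'i.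
Proof.
move=> tN; have [h1 h2 _ _] := hf.
rewrite (@cintegral_FTC R (fun th => f (zeta th t) * ((th * derive1 sigma t) +i* 1)) _ _ _ ler01).
- by rewrite /zeta !mul1r !mul0r addr0 /tau [s0 + _]addrC subrK.
- move=> th th01.
  have d2 : cderive (fun x : R => (x * derive1 sigma t) +i* 1) th (derive1 sigma t)%:C.
    split; last exact: is_derive_cst.
    have := is_deriveMr (is_derive_id th 1) (is_derive_cst (derive1 sigma t) th 1).
    by move/is_derive_eq; apply; rewrite mulr0 add0r mulr1.
  have := cderiveM (h1 _ _ _ (dzeta_th th t) (zetaU th01 tN)) d2.
  by move/cderive_eq; apply; rewrite /W.
- move=> th th01.
  have [ca cb] := h2 _ _ (cderive_ccont (dzeta_th th t)) (zetaU th01 tN).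
  apply: ccontD; last by apply: ccontM; [exact: ca|exact: ccont_cst].
  apply: ccontM; first by apply: ccontM; [exact: cb|exact: ccont_cst].
  split; last exact: cst_continuous.
  by apply: cvgM; [exact: cvg_id|exact: cvg_cst].
Qed.

Lemma deformation_t th : 0 <= th <= 1 ->
  cintegral `[- N, N] (W th) =
  f (zeta th N) * (tau N)%:C - f (zeta th (- N)) * (tau (- N))%:C.
Proof.
move=> th01; have [h1 h2 _ _] := hf.
have NN : - N <= N by rewrite (le_trans _ N0)// oppr_le0.
rewrite (@cintegral_FTC R (fun t => f (zeta th t) * (tau t)%:C) _ _ _ NN).
- by [].
- move=> t tN.
  have := cderiveM (h1 _ _ _ (dzeta_t th t) (zetaU th01 tN)) (cderive_real (dtau t)).
  by move/cderive_eq; apply; rewrite /W; ring.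
- move=> t tN.
  have [ca cb] := h2 _ _ (cderive_ccont (dzeta_t th t)) (zetaU th01 tN).
  have cs : ccont (fun x => (derive1 sigma x)%:C) t.
    by split; [exact: cdsigma|exact: cst_continuous].
  apply: ccontD; last by apply: ccontM; [exact: ca|exact: cs].
  apply: ccontM.
    by apply: ccontM; [exact: cb|split; [exact: ctau|exact: cst_continuous]].
  split; last exact: cst_continuous.
  by apply: cvgM; [exact: cvg_cst|exact: cdsigma].
Qed.

Let mzeta : cmeasurable setT (fun p : R * R => zeta p.1 p.2).
Proof.
have m2 : measurable_fun setT (fun p : R * R => sigma p.2).
  by apply: measurableT_comp => //; exact: continuous_measurable_fun.
apply: cmeasurable_Complex => //.
by apply: measurable_funD => //; apply: measurable_funM => //; apply: measurable_funB.
Qed.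

Let mW : cmeasurable setT (fun p : R * R => W p.1 p.2).
Proof.
have [_ _ h3 _] := hf; have [ma mb] := h3 _ _ _ mzeta.
have m2 : measurable_fun setT (fun p : R * R => sigma p.2).
  by apply: measurableT_comp => //; exact: continuous_measurable_fun.
have m3 : measurable_fun setT (fun p : R * R => derive1 sigma p.2).
  by apply: measurableT_comp => //; exact: continuous_measurable_fun.
apply: cmeasurableD.
  apply: cmeasurableM; last by apply: cmeasurable_Complex; [exact: measurable_funM|exact: measurable_cst].
  by apply: cmeasurableM => //; apply: cmeasurable_real; exact: measurable_funB.
by apply: cmeasurableM => //; exact: cmeasurable_real.
Qed.

(** Cauchy's theorem for the region between the line Re = s0 and the contour, cut at heights N and -
    N: the right-hand side collects the two horizontal edges. *)
Lemma contour_deformation :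
  cintegral `[- N, N] (fun t =>
    f (sigma t +i* t) * (derive1 sigma t +i* 1) - f (s0 +i* t) * 'i) =
  cintegral `[0, 1] (fun th =>
    f (zeta th N) * (tau N)%:C - f (zeta th (- N)) * (tau (- N))%:C).
Proof.
have [_ _ _ [M M0 hM]] := hf.
have [B1 B10 hB1] := @bounded_itv_continuous R tau (- N) N (fun t _ => @ctau t).
have [B2 B20 hB2] := @bounded_itv_continuous R (derive1 sigma) (- N) N (fun t _ => @cdsigma t).
have i01 a b (c : R) : intg `[a, b] (fun=> c).
  by apply: intg_itv_continuous => x _; exact: cst_continuous.
have b0 : 0 <= M * B1 * (B2 + 1) + M * B2 by rewrite addr_ge0// !mulr_ge0// addr_ge0.
have WB th t : `[0, 1]%classic th -> `[- N, N]%classic t ->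
    normc (W th t) <= (M * B1 * (B2 + 1) + M * B2) * 1.
  rewrite /= !in_itv/= => th01 tN.
  have [ha hb] := hM _ (zetaU th01 tN).
  have t1 := hB1 _ tN; have t2 := hB2 _ tN.
  have n1 : normc ((th * derive1 sigma t) +i* 1) <= B2 + 1.
    rewrite (le_trans (normc_le_ReIm _))//= normr1 lerD2r normrM.
    rewrite -[leRHS]mul1r ler_pM//.
    by case/andP: th01 => ? ?; rewrite ger0_norm.
  rewrite mulr1 (le_trans (normcD _ _))// lerD// !normcM normcC.
    by rewrite ler_pM ?mulr_ge0 ?normc_ge0// ler_pM ?normc_ge0.
  by rewrite ler_pM ?normc_ge0.
have [_ E] := @cfubini R `[0, 1] `[- N, N] W (fun=> M * B1 * (B2 + 1) + M * B2) (fun=> 1)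
  (measurable_itv _) (measurable_itv _) mW (i01 _ _ _) (i01 _ _ _) (fun x _ => b0) WB.
rewrite -(eq_cintegral (f := fun t => cintegral `[0, 1] (W ^~ t))); last first.
  by move=> t; rewrite /= in_itv/=; exact: deformation_theta.
by rewrite -E; apply: eq_cintegral => th; rewrite /= in_itv/=; exact: deformation_t.
Qed.

End contour_deformation.

End Holomorphic.

(** * Improper integrals along exhausting intervals *)

Section Improper_integrals.
Variable R : realType.
Local Notation mu := (@lebesgue_measure R).
Local Notation intg D f := (mu.-integrable D (EFin \o f)).
Implicit Types (D : set R) (a b : nat -> R).

(** One notion for the line, the half-lines and the images of substitutions: facts on compact
    intervals, such as the fundamental theorem of calculus, pass to D through it. *)
Definition exhaustion D a b :=
  [/\ D = \bigcup_n `[a n, b n]%classic, forall n, a n <= b n &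
      forall n m, (n <= m)%N -> a m <= a n /\ b n <= b m].

Lemma exhaustion_mem D a b n x : exhaustion D a b -> a n <= x <= b n -> D x.
Proof. by move=> [-> _ _] xab; exists n => //=; rewrite in_itv. Qed.

Lemma exhaustion_homo D a b : exhaustion D a b ->
  {homo (fun n => `[a n, b n]%classic : set R) : n m / (n <= m)%N >-> (n <= m)%O}.
Proof.
move=> [_ _ h] n m nm; apply/subsetPset => x /=; rewrite !in_itv/= => /andP[ax xb].
by have [h1 h2] := h _ _ nm; rewrite (le_trans h1)// (le_trans xb).
Qed.

Lemma exhaustion_measurable D a b : exhaustion D a b -> measurable D.
Proof. by move=> [-> _ _]; apply: bigcup_measurable => n _; exact: measurable_itv. Qed.

Lemma exhaustion_Rplus :
  exhaustion (Rplus R) (fun n => n.+1%:R^-1) (fun n => n.+1%:R).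
Proof.
split.
- apply/seteqP; split => x.
    rewrite /Rplus/= => x0.
    have [n _ /(_ n (leqnn n)) hn] := @nbhs_infty_gtr R (Num.max x x^-1).
    move: hn; rewrite /= gt_max => /andP[h1 h2].
    exists n => //=; rewrite in_itv/=.
    have n1 : (n%:R : R) <= n.+1%:R by rewrite ler_nat.
    rewrite -[x]invrK lef_pV2 ?posrE ?invr_gt0// (le_trans (ltW h2))//=.
    by rewrite invrK (le_trans (ltW h1)).
  move=> [n _] /=; rewrite in_itv/= => /andP[+ _].
  by apply: lt_le_trans; rewrite invr_gt0.
- move=> n; rewrite (@le_trans _ _ 1)// ?ler1n// invf_le1//.
  by rewrite ler1n.
- move=> n m nm; split; last by rewrite ler_nat.
  by rewrite lef_pV2 ?posrE// ler_nat.
Qed.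

Lemma exhaustion_setT : exhaustion setT (fun n => - n%:R) (fun n => n%:R).
Proof.
split.
- apply/seteqP; split => x // _.
  have [n _ /(_ n (leqnn n)) hn] := @nbhs_infty_gtr R `|x|.
  by exists n => //=; rewrite in_itv/= -ler_norml ltW.
- by move=> n; rewrite (@le_trans _ _ 0)// oppr_le0.
- by move=> n m nm; rewrite lerN2 !ler_nat.
Qed.

Lemma measurable_Rplus : measurable (Rplus R).
Proof. exact: exhaustion_measurable exhaustion_Rplus. Qed.

Lemma measurable_fun_Rplus (f : R -> R) :
  (forall x, 0 < x -> {for x, continuous f}) -> measurable_fun (Rplus R) f.
Proof.
move=> cf; apply: open_continuous_measurable_fun.
  have -> : Rplus R = `]0, +oo[%classic.
    by apply/seteqP; split => x /=; rewrite in_itv/= andbT.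
  exact: interval_open.
by move=> x /set_mem; exact: cf.
Qed.

(** Monotone convergence: the integral over D is the limit of the integrals over the intervals, all
    at most B. *)
Lemma intg_exhaust D a b (f : R -> R) B : exhaustion D a b -> measurable_fun D f ->
  (forall x, D x -> {for x, continuous f}) -> (forall x, D x -> 0 <= f x) ->
  (forall n, \int[mu]_(x in `[a n, b n]) f x <= B) -> intg D f.
Proof.
move=> ex mf cf f0 fB; have mD := exhaustion_measurable ex.
have exn := fun n x => @exhaustion_mem D a b n x ex.
have fi n : intg `[a n, b n] f.
  by apply: intg_itv_continuous => x /exn; exact: cf.
apply: intg_fin_lty => //.
apply: (@le_lt_trans _ _ B%:E); last exact: ltry.
have Inn := @ge0_nondecreasing_set_cvg_integral _ (measurableTypeR R) R
  (fun n => `[a n, b n]%classic) (fun x => (`|f x|)%:E) mu (exhaustion_homo ex)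
  (fun n => measurable_itv _).
have DE : \bigcup_n `[a n, b n]%classic = D by case: ex.
rewrite -DE; rewrite -(cvg_lim _ (Inn _ _))//.
- apply: lime_le.
    by apply/cvg_ex; eexists; apply: Inn => // n; apply/measurable_EFinP;
       apply: measurableT_comp => //; exact: intg_measurable.
  apply: nearW => n; have := fB n; rewrite -lee_fin; apply: le_trans; rewrite -Rint_EFin; [|exact: measurable_itv|exact: fi].
  rewrite le_eqVlt; apply/orP; left; apply/eqP; apply: eq_integral => x.
  by rewrite inE/= in_itv/= => /exn Dx; rewrite ger0_norm// f0.
- by move=> n; apply/measurable_EFinP; apply: measurableT_comp => //; exact: intg_measurable.
Qed.

Lemma cvg_exhaust D a b (f : R -> R) : exhaustion D a b -> intg D f ->
  (\int[mu]_(x in `[a n, b n]) f x) @[n --> \oo] --> \int[mu]_(x in D) f x.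
Proof.
move=> ex fi; have mD := exhaustion_measurable ex.
have exn := fun n x => @exhaustion_mem D a b n x ex.
have [||n x Dx|_] := @Rdominated_cvg R D (fun n x => f x * \1_(`[a n, b n]%classic) x) f
  (fun x => `|f x|) mD _ _ (intg_norm fi).
- by move=> n; exact: measurable_funM (intg_measurable fi) (measurable_indic (measurable_itv _)).
- move=> x Dx; apply: cvg_near_cst.
  have [DE _ h] := ex; move: (Dx); rewrite DE => -[n _ /=]; rewrite in_itv/= => /andP[h1 h2].
  near=> m; rewrite indicE mem_set ?mulr1//= in_itv/=.
  have nm : (n <= m)%N by near: m; exact: nbhs_infty_ge.
  have [h3 h4] := h n m nm.
  by rewrite (le_trans h3)// (le_trans h2).
- rewrite normrM indicE.
  by case: (_ \in _); rewrite ?normr1 ?mulr1// normr0 mulr0.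
have E n : \int[mu]_(x in D) (f x * \1_(`[a n, b n]%classic) x) = \int[mu]_(x in `[a n, b n]) f x.
  rewrite Rint_restrict [RHS]Rint_restrict; apply: eq_Rint => x _.
  rewrite !indicE; case: (boolP (x \in `[a n, b n]%classic)) => h; rewrite ?mulr0 ?mul0r// !mulr1.
  by rewrite mem_set ?mulr1//; apply: (exn n); move/set_mem : h; rewrite /= in_itv.
by under eq_fun do rewrite E.
Unshelve. all: by end_near. Qed.

Lemma cvg_cexhaust D a b (f : R -> R[i]) : exhaustion D a b -> cintegrable D f ->
  ccvg (fun n => cintegral `[a n, b n] f) (cintegral D f).
Proof. by move=> ex [f1 f2]; split; exact: cvg_exhaust. Qed.

Lemma cintegral_improper D a b (F f : R -> R[i]) L : exhaustion D a b ->
  (forall x, D x -> cderive F x (f x)) -> (forall x, D x -> ccont f x) ->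
  cintegrable D f -> ccvg (fun n => F (b n) - F (a n)) L -> cintegral D f = L.
Proof.
move=> ex dF cf fi FL; apply: (ccvg_unique (cvg_cexhaust ex fi)).
apply: ccvg_near FL; apply: nearW => n.
rewrite (cintegral_FTC (F := F))//; first by case: ex.
  by move=> x /(exhaustion_mem ex); exact: dF.
by move=> x /(exhaustion_mem ex); exact: cf.
Qed.

Lemma Rint_improper D a b (F f : R -> R) (L : R) : exhaustion D a b ->
  (forall x : R, D x -> is_derive x 1 F (f x)) -> (forall x, D x -> {for x, continuous f}) ->
  intg D f -> F (b n) - F (a n) @[n --> \oo] --> L -> \int[mu]_(x in D) f x = L.
Proof.
move=> ex dF cf fi FL; rewrite -(cvg_lim _ FL)//; apply/esym/cvg_lim => //.
apply: cvg_trans (cvg_exhaust ex fi); apply: near_eq_cvg; apply: nearW => n.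
have [_ ab _] := ex.
have dF' (x : R) (h : a n <= x <= b n) : is_derive x 1 F (f x) := dF _ (exhaustion_mem ex h).
have cf' x (h : a n <= x <= b n) : {for x, continuous f} := cf _ (exhaustion_mem ex h).
by rewrite (@Rint_FTC R F f _ _ (ab n) dF' cf').
Qed.

(** Each partial integral is F (b n) - F (a n), hence at most 2 B, and the integrand is
    nonnegative. *)
Lemma intg_improper D a b (F f : R -> R) (B : R) : exhaustion D a b -> measurable_fun D f ->
  (forall x : R, D x -> is_derive x 1 F (f x)) -> (forall x, D x -> {for x, continuous f}) ->
  (forall x, D x -> 0 <= f x) -> (forall x, D x -> `|F x| <= B) -> intg D f.
Proof.
move=> ex mf dF cf f0 FB; apply: (@intg_exhaust D a b f (B + B)) => // n.
have [_ ab _] := ex.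
have dF' (x : R) (h : a n <= x <= b n) : is_derive x 1 F (f x) := dF _ (exhaustion_mem ex h).
have cf' x (h : a n <= x <= b n) : {for x, continuous f} := cf _ (exhaustion_mem ex h).
rewrite (@Rint_FTC R F f _ _ (ab n) dF' cf').
have Fa : `|F (a n)| <= B by apply: FB; apply: (exhaustion_mem (n := n) ex); rewrite lexx ab.
have Fb : `|F (b n)| <= B by apply: FB; apply: (exhaustion_mem (n := n) ex); rewrite lexx ab.
by apply: (le_trans (ler_norm _)); apply: (le_trans (ler_normB _ _)); exact: lerD.
Qed.

End Improper_integrals.

(** * The Gamma function *)

Section Elementary_bounds.
Variable R : realType.
Implicit Types x y : R.

Lemma Re_1 : Re (1 : R[i]) = 1. Proof. by []. Qed.

Lemma Im_1 : Im (1 : R[i]) = 0. Proof. by []. Qed.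

Lemma ln_le_subr1 x : 0 < x -> ln x <= x - 1.
Proof. by move=> x0; have := expR_ge1Dx (ln x); rewrite lnK ?posrE// addrC lerBrDr. Qed.

Lemma normr_sin_le x : `|sin x| <= `|x|.
Proof.
wlog x0 : x / 0 <= x => [h|].
  have [/h//|/ltW x0] := leP 0 x.
  by rewrite -normrN -sinN -[leRHS]normrN; apply: h; rewrite oppr_ge0.
have [->|xn0] := eqVneq x 0; first by rewrite sin0 normr0.
have {}x0 : 0 < x by rewrite lt_neqAle eq_sym xn0.
have [|c _] := @MVT R sin cos 0 x x0 (fun y _ => is_derive_sin y).
  by apply: continuous_subspaceT; exact: continuous_sin.
by rewrite sin0 !subr0 => ->; rewrite normrM ler_piMl// cos_max.
Qed.

Lemma normr_cosB1_le x : `|cos x - 1| <= `|x|.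
Proof.
have h : 1 - cos x = sin (x / 2) ^+ 2 *+ 2.
  rewrite {1}(_ : x = (x / 2) *+ 2); last by rewrite -mulr_natr divfK.
  by rewrite cos_mulr2n cos2sin2; ring.
rewrite distrC h -mulr_natr normrM normrX expr2 normr_nat.
rewrite (@le_trans _ _ (1 * `|x / 2| * 2))//.
  by rewrite ler_wpM2r// ler_pM// ?sin_max ?normr_sin_le.
by rewrite mul1r normrM [`|2^-1|]ger0_norm// divfK.
Qed.

(* The function [x^p e^(-x)] is bounded: [p ln (x / p) <= x - p]. *)
Lemma expR_ln_bound (p : R) : 0 < p ->
  exists2 C : R, 0 < C & forall x, 0 < x -> expR (p * ln x) * expR (- x) <= C.
Proof.
move=> p0; exists (expR (p * ln p)); first exact: expR_gt0.
move=> x x0; rewrite -expRD ler_expR lerBlDr.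
have xp : 0 < x / p by rewrite divr_gt0.
have := ln_le_subr1 xp; rewrite ln_div ?posrE// lerBlDr => /(ler_wpM2l (ltW p0)).
rewrite mulrDr mulrBr mulr1 [p * (x / p)]mulrC divfK ?gt_eqF// => h.
by rewrite (le_trans h)// addrC lerD2l lerBlDr lerDl ltW.
Qed.

(** For 0 <= d <= 1 the power y^d lies between 1 and y. *)
Lemma expR_ln_near1 (d y : R) : 0 <= d <= 1 -> 0 < y -> `|expR (d * ln y) - 1| <= `|y - 1|.
Proof.
move=> /andP[d0 d1] y0.
have [y1|/ltW y1] := leP 1 y.
  have l0 : 0 <= ln y by rewrite ln_ge0.
  rewrite !ger0_norm ?subr_ge0 ?expR_ge1// ?mulr_ge0//; last by rewrite -expR0 ler_expR mulr_ge0.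
  by rewrite lerD2r -[leRHS](lnK y0) ler_expR ler_piMl.
have l0 : ln y <= 0 by rewrite ln_le0.
rewrite distrC [leRHS]distrC !ger0_norm ?subr_ge0//.
  rewrite lerD2l lerN2 -[leLHS](lnK y0) ler_expR -subr_ge0.
  have -> : d * ln y - ln y = (1 - d) * - ln y by ring.
  by rewrite mulr_ge0 ?subr_ge0 ?oppr_ge0.
by rewrite -expR0 ler_expR mulr_ge0_le0.
Qed.

(** A bound of y^w - 1 in terms of y - 1 with at most quadratic growth, so that the mean and the
    variance of a Gamma density will control it. *)
Lemma cexp_ln_near1 (w : R[i]) y : 0 <= Re w <= 1 -> 0 < y ->
  normc (cexp (w * (ln y)%:C) - 1) <= (8 + 4 * `|Im w|) * (`|y - 1| + (y - 1) ^+ 2).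
Proof.
move=> wd y0; set t := Im w; set d := Re w in wd *.
have Ew : Re (w * (ln y)%:C) = d * ln y /\ Im (w * (ln y)%:C) = t * ln y.
  by rewrite ReM ImM ReC ImC !mulr0 subr0 add0r.
have h1 := expR_ln_near1 wd y0.
(* Near 0 the logarithm is unbounded, but there |y^w - 1| <= 2 while (y - 1)^2 >= 1/4; this is where
   the constant 8 originates. *)
have [yh|yh] := ltP y (1 / 2).
  have n2 : normc (cexp (w * (ln y)%:C) - 1) <= 2.
    rewrite (le_trans (normcD _ _))// normc_N Normc.normc1 normc_cexp Ew.1.
    rewrite (_ : 2 = 1 + 1 :> R)// lerD2r -expR0 ler_expR mulr_ge0_le0//.
      by case/andP: wd.
    by rewrite ln_le0// (le_trans (ltW yh))// ler_pdivrMr// mul1r ler1n.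
  apply: (le_trans n2).
  have q : 1 / 4 <= (y - 1) ^+ 2 by nra.
  have p1 := normr_ge0 (y - 1); have p2 := normr_ge0 t.
  have : 8 * (1 / 4) <= (8 + 4 * `|t|) * (`|y - 1| + (y - 1) ^+ 2).
    by rewrite ler_pM//; [lra|rewrite (le_trans q)// lerDr].
  by apply: le_trans; lra.
(* Away from 0 the logarithm is Lipschitz at 1 with constant 2, from ln y <= y - 1 applied to y and
   to 1/y. *)
have ly : `|ln y| <= 2 * `|y - 1|.
  have u1 := ln_le_subr1 y0.
  have yV0 : 0 < y^-1 by rewrite invr_gt0.
  have u2 := ln_le_subr1 yV0; rewrite lnV ?posrE// in u2.
  have [y1|/ltW y1] := leP 1 y.
    rewrite !ger0_norm ?subr_ge0 ?ln_ge0//; apply: (le_trans u1).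
    by rewrite ler_peMl ?ler1n// subr_ge0.
  rewrite ler0_norm ?ln_le0// [`|y - 1|]ler0_norm ?subr_le0//.
  apply: (le_trans u2).
  have -> : y^-1 - 1 = (1 - y) * y^-1 by field; exact: lt0r_neq0.
  rewrite opprB mulrC ler_wpM2r ?subr_ge0//.
  by rewrite -[2]invrK lef_pV2 ?posrE ?invr_gt0// -[2^-1]mul1r.
have th : `|t * ln y| <= 2 * `|t| * `|y - 1|.
  by rewrite normrM (mulrC 2) -mulrA ler_wpM2l.
have e1 : expR (d * ln y) <= 1 + `|y - 1|.
  by move: h1; rewrite ler_norml => /andP[_]; rewrite lerBlDl.
rewrite (le_trans (normc_le_ReIm _))// ReD ImD ReN ImN Re_1 Im_1 subr0 Re_cexp Im_cexp Ew.1 Ew.2.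
have r1 : `|expR (d * ln y) * cos (t * ln y) - 1| <= `|y - 1| + 2 * `|t| * `|y - 1|.
  have -> : expR (d * ln y) * cos (t * ln y) - 1 =
    (expR (d * ln y) - 1) * cos (t * ln y) + (cos (t * ln y) - 1) by ring.
  rewrite (le_trans (ler_normD _ _))// lerD//.
    by rewrite normrM (le_trans _ h1)// ler_piMr// cos_max.
  exact: le_trans (normr_cosB1_le _) th.
have r2 : `|expR (d * ln y) * sin (t * ln y)| <= (1 + `|y - 1|) * (2 * `|t| * `|y - 1|).
  rewrite normrM ler_pM//; last exact: le_trans (normr_sin_le _) th.
  by rewrite ger0_norm ?expR_ge0.
apply: (le_trans (lerD r1 r2)).
have -> : (y - 1) ^+ 2 = `|y - 1| ^+ 2 by rewrite real_normK ?num_real.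
move: (`|y - 1|) (`|t|) (normr_ge0 (y - 1)) (normr_ge0 t) => p q p0 q0.
rewrite -subr_ge0.
have -> : (8 + 4 * q) * (p + p ^+ 2) - (p + 2 * q * p + (1 + p) * (2 * q * p)) =
  7 * p + 8 * p ^+ 2 + 2 * (q * p ^+ 2) by ring.
by rewrite !addr_ge0// !mulr_ge0// exprn_ge0.
Qed.

End Elementary_bounds.

(** * Euler's integral and its functional equation *)

Section Gamma_integral.
Variable R : realType.
Local Notation mu := (@lebesgue_measure R).
Local Notation intg D f := (mu.-integrable D (EFin \o f)).
Local Notation Rp := (Rplus R).
Implicit Types (a x : R) (z w : R[i]).

Definition gamma_weight a x := expR ((a - 1) * ln x) * expR (- x).

Definition euler_integrand z x : R[i] := cpow x (z - 1) * (expR (- x))%:C.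

Lemma cpowE x z : cpow x z = cexp (z * (ln x)%:C). Proof. by []. Qed.

Lemma normc_cpow x z : normc (cpow x z) = expR (Re z * ln x).
Proof. by rewrite cpowE normc_cexp ReM ReC ImC mulr0 subr0. Qed.

Lemma normc_euler_integrand z x : normc (euler_integrand z x) = gamma_weight (Re z) x.
Proof.
by rewrite /euler_integrand normcM normc_cpow normcC ger0_norm ?expR_ge0// ReD ReN Re_1.
Qed.

Lemma continuous_ln_gt0 x : 0 < x -> {for x, continuous (@ln R)}.
Proof. by move=> x0; exact: continuous_ln. Qed.

Lemma is_derive_ln_gt0 x : 0 < x -> is_derive x 1 (@ln R) x^-1.
Proof. by move=> x0; exact: is_derive1_ln. Qed.

Lemma is_derive_expRc (g : R -> R) (x d : R) : is_derive x 1 g d ->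
  is_derive x 1 (fun y => expR (g y)) (expR (g x) * d).
Proof. by move=> dg; exact: (@is_derive1_comp _ expR g x _ _ (is_derive_expR (g x)) dg). Qed.

Lemma is_deriveVc (g : R -> R) (x d : R) : g x != 0 -> is_derive x 1 g d ->
  is_derive x 1 (fun y => (g y)^-1) (- (g x ^- 2 * d)).
Proof.
move=> gx dg; apply: (is_derive_eq (@is_deriveV _ g x _ _ gx dg)).
by rewrite /GRing.scale/= mulNr.
Qed.

Lemma is_derive_expRl (l : R) x : 0 < x ->
  is_derive x 1 (fun y => expR (l * ln y)) (l * expR ((l - 1) * ln x)).
Proof.
move=> x0.
have h := is_deriveMr (is_derive_cst l x 1) (is_derive_ln_gt0 x0).
have := is_derive_expRc h; move/is_derive_eq; apply; rewrite /=.
rewrite mulr0 addr0 mulrBl mul1r expRD expRN lnK ?posrE//; ring.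
Qed.

Lemma continuous_expRl (l : R) x : 0 < x -> {for x, continuous (fun y => expR (l * ln y))}.
Proof. by move=> x0; exact: is_derive_continuous (is_derive_expRl l x0). Qed.

Lemma continuous_expRN x : {for x, continuous (fun y : R => expR (- y))}.
Proof.
exact: (is_derive_continuous (is_derive_expRc (is_deriveN (is_derive_id x 1)))).
Qed.

Lemma continuous_gamma_weight a x : 0 < x -> {for x, continuous (gamma_weight a)}.
Proof.
by move=> x0; apply: cvgM; [exact: continuous_expRl|exact: continuous_expRN].
Qed.

(* The weight is dominated by the derivative [x^(a-1) / (1 + x^a)^2] of the
   bounded function [- 1 / (a (1 + x^a))]. *)
Lemma intg_gamma_weight a : 0 < a -> intg Rp (gamma_weight a).
Proof.
move=> a0.
pose u x := expR (a * ln x).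
pose f x := expR ((a - 1) * ln x) * (1 + u x) ^- 2.
pose F x := - (a^-1 * (1 + u x)^-1).
have u0 x : 0 < 1 + u x by rewrite addr_gt0// expR_gt0.
have du x : 0 < x -> is_derive x 1 (fun y => 1 + u y) (a * expR ((a - 1) * ln x)).
  move=> x0; have := is_deriveDr (is_derive_cst (1 : R) x 1) (is_derive_expRl a x0).
  by move/is_derive_eq; apply; rewrite add0r.
have cf x : 0 < x -> {for x, continuous f}.
  move=> x0; apply: cvgM; first exact: continuous_expRl.
  have un : (1 + u x) * (1 + u x) != 0 by rewrite mulf_neq0// gt_eqF.
  under eq_fun do rewrite expr2; rewrite expr2; apply: (cvgV un).
  by apply: cvgM; exact: is_derive_continuous (du _ x0).
have fi : intg Rp f.
  apply: (@intg_improper R Rp _ _ F f a^-1 (exhaustion_Rplus R)) => //.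
  - exact: measurable_fun_Rplus.
  - move=> x x0; have h := @is_deriveVc (fun y => 1 + u y) x _ (lt0r_neq0 (u0 x)) (du _ x0).
    have := is_deriveN (is_deriveMr (is_derive_cst a^-1 x 1) h).
    move/is_derive_eq; apply; rewrite /f /= mulr0 addr0.
    by have un := lt0r_neq0 (u0 x); have an := lt0r_neq0 a0; field; rewrite un an.
  - by move=> x _; rewrite mulr_ge0 ?expR_ge0// invr_ge0 exprn_ge0// ltW.
  - move=> x _; rewrite /F normrN normrM !ger0_norm ?invr_ge0 ?(ltW (u0 x)) ?(ltW a0)//.
    by rewrite ler_piMr ?invr_ge0 ?(ltW a0)// invf_le1// lerDl expR_ge0.
(* The exponent 2a is that of u^2: a bound C of u^2 e^(-x) yields (1 + u)^2 e^(-x) <= 2 + 2 C. *)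
have a20 : 0 < a *+ 2 by rewrite mulrn_wgt0.
have [C C0 hC] := expR_ln_bound a20.
apply: (intg_le (@measurable_Rplus R) _ (intgZ (2 + 2 * C) (@measurable_Rplus R) fi)).
  by apply: measurable_fun_Rplus => x; exact: continuous_gamma_weight.
move=> x x0; rewrite ger0_norm; last by rewrite mulr_ge0 ?expR_ge0.
rewrite /gamma_weight /f mulrCA ler_wpM2l ?expR_ge0// ler_pdivlMr ?exprn_gt0//.
have h1 := hC _ x0.
have e1 : expR (- x) <= 1 by rewrite -expR0 ler_expR oppr_le0 ltW.
have u2 : u x ^+ 2 * expR (- x) <= C.
  by rewrite /u expr2 -expRD -mulrDl -mulr2n.
have q : (1 + u x) ^+ 2 <= 2 + 2 * u x ^+ 2 by have := sqr_ge0 (u x - 1); nra.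
have e0 := expR_ge0 (- x).
apply: (@le_trans _ _ (expR (- x) * (2 + 2 * u x ^+ 2))); first by rewrite ler_wpM2l.
nra.
Qed.

Lemma ccont_cpow z x : 0 < x -> ccont (fun y => cpow y z) x.
Proof.
move=> x0; apply: ccont_cexp; apply: ccontM; first exact: ccont_cst.
by split; [exact: continuous_ln_gt0|exact: cst_continuous].
Qed.

Lemma ccont_euler_integrand z x : 0 < x -> ccont (euler_integrand z) x.
Proof.
move=> x0; apply: ccontM; first exact: ccont_cpow.
by split; [exact: continuous_expRN|exact: cst_continuous].
Qed.

Lemma cmeasurable_Rplus (f : R -> R[i]) : (forall x, 0 < x -> ccont f x) -> cmeasurable Rp f.
Proof. by move=> cf; split; apply: measurable_fun_Rplus => x /cf[]. Qed.

Lemma cintegrable_euler z : 0 < Re z -> cintegrable Rp (euler_integrand z).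
Proof.
move=> z0; apply: (cintegrable_le (@measurable_Rplus R) _ (intg_gamma_weight z0)).
  by apply: cmeasurable_Rplus => x; exact: ccont_euler_integrand.
by move=> x _; rewrite normc_euler_integrand.
Qed.

Lemma cpowD x z w : cpow x (z + w) = cpow x z * cpow x w.
Proof. by rewrite !cpowE mulrDl cexpD. Qed.

Lemma cpow1 x : 0 < x -> cpow x 1 = x%:C.
Proof. by move=> x0; rewrite cpowE mul1r cexpC lnK ?posrE. Qed.

Lemma cpowN x z : cpow x (- z) = (cpow x z)^-1.
Proof. by rewrite !cpowE mulNr cexpN. Qed.

Lemma cderive_cpow z x : 0 < x -> cderive (fun y => cpow y z) x (z * cpow x (z - 1)).
Proof.
move=> x0.
have := cderive_cexp (cderiveM (cderive_cst z x) (cderive_real (is_derive_ln_gt0 x0))).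
move/cderive_eq; apply; rewrite mul0r add0r -cpowE cpowD cpowN cpow1// fmorphV.
by ring.
Qed.

(** Integration by parts: x^z e^(-x) is a primitive of the difference of the two integrands and
    vanishes at both ends of the half-line. *)
Lemma euler_functional z : 0 < Re z -> euler_integral (z + 1) = z * euler_integral z.
Proof.
move=> z0; have z1 : 0 < Re (z + 1) by rewrite ReD Re_1 addr_gt0.
have i1 := cintegrable_euler z0; have i2 := cintegrable_euler z1.
pose f x := z * euler_integrand z x - euler_integrand (z + 1) x.
pose F x : R[i] := cpow x z * (expR (- x))%:C.
have mR := @measurable_Rplus R.
have E : cintegral Rp f = z * euler_integral z - euler_integral (z + 1).
  by rewrite /f cintegralB//; [rewrite cintegralZl|exact: cintegrableZl].
suff : cintegral Rp f = 0 by rewrite E => /eqP; rewrite subr_eq0 => /eqP.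
have nF x : normc (F x) = gamma_weight (Re z + 1) x.
  by rewrite /F normcM normc_cpow normcC ger0_norm ?expR_ge0// /gamma_weight addrK.
have [C C0 hC] := expR_ln_bound z1.
apply: (cintegral_improper (F := F) (exhaustion_Rplus R)).
- move=> x x0; have de : is_derive x 1 (fun y : R => expR (- y)) (- expR (- x)).
    have := is_derive_expRc (is_deriveN (is_derive_id x 1)).
    by move/is_derive_eq; apply; rewrite mulrN1.
  have := cderiveM (cderive_cpow z x0) (cderive_real de).
  move/cderive_eq; apply; rewrite /f /euler_integrand addrK rmorphN.
  by ring.
- move=> x x0; apply: ccontD; last by apply: ccontN; exact: ccont_euler_integrand.
  by apply: ccontM; [exact: ccont_cst|exact: ccont_euler_integrand].
- apply: cintegrableD => //; first exact: cintegrableZl.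
  exact: cintegrableN.
- rewrite -[X in ccvg _ X]subr0; apply: ccvgD; last apply: ccvgN.
    apply: ccvg0P; under eq_fun do rewrite nF.
    (* The bound of x^(Re z + 1) e^(-x) has one power of x to spare, which gives the rate C / x at
       infinity. *)
    have hc : C * n.+1%:R^-1 @[n --> \oo] --> (0 : R).
      rewrite -[X in _ --> X](mulr0 C); apply: cvgM; first exact: cvg_cst.
      exact: cvg_harmonic.
    apply: (squeeze_cvgr _ (cvg_cst 0) hc); apply: nearW => n.
    rewrite mulr_ge0 ?expR_ge0//= ler_pdivlMr//.
    have := hC n.+1%:R (ltr0Sn _ _); rewrite ReD Re_1 mulrDl mul1r expRD lnK ?posrE//.
    by rewrite /gamma_weight addrK mulrAC.
  apply: ccvg0P; under eq_fun do rewrite nF.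
  have hc : (n.+1%:R^-1 : R) `^ (Re z) @[n --> \oo] --> (0 : R).
    apply: (cvg_at_rightP _ _ _).1 (powR_cvg0 z0) _ _.
    by split; [move=> n; rewrite invr_gt0|exact: cvg_harmonic].
  apply: (squeeze_cvgr _ (cvg_cst 0) hc).
  apply: nearW => n; rewrite mulr_ge0 ?expR_ge0//=.
  by rewrite /gamma_weight addrK /powR gt_eqF ?invr_gt0// ler_piMr ?expR_ge0//.
Qed.

Lemma conjcM z w : conjc (z * w) = conjc z * conjc w.
Proof. by apply: complexP; rewrite !(ReM, ImM, Re_conj, Im_conj); ring. Qed.

Lemma conjcD z w : conjc (z + w) = conjc z + conjc w.
Proof. by apply: complexP; rewrite !(ReD, ImD, Re_conj, Im_conj)//; ring. Qed.

Lemma conjcR a : conjc (a%:C) = a%:C.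
Proof. by apply: complexP; rewrite /= ?oppr0. Qed.

Lemma conj_cpow x z : conjc (cpow x z) = cpow x (conjc z).
Proof. by rewrite !cpowE conj_cexp conjcM conjcR. Qed.

Lemma conj_euler z : 0 < Re z -> conjc (euler_integral z) = euler_integral (conjc z).
Proof.
move=> z0; rewrite conj_cintegral//; [|exact: measurable_Rplus|exact: cintegrable_euler].
apply: eq_cintegral => x _.
rewrite conjcM conj_cpow conjcR conjcD.
by congr (cpow _ (_ + _) * _); apply: complexP; rewrite /= ?oppr0.
Qed.

Definition rgamma a := \int[mu]_(x in Rp) gamma_weight a x.

Lemma euler_rgamma a : 0 < a -> euler_integral a%:C = (rgamma a)%:C.
Proof.
move=> a0.
have E x : euler_integrand a%:C x = (gamma_weight a x)%:C.
  by rewrite /euler_integrand cpowE -(rmorph1 (real_complex R)) -rmorphB -rmorphM cexpC -rmorphM.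
rewrite -[LHS]/(cintegral Rp (euler_integrand a%:C)).
rewrite (eq_cintegral (g := fun x => (gamma_weight a x)%:C)); last by move=> x _; exact: E.
by apply: complexP => //; rewrite Im_cintegral /Rintegral integral0_eq.
Qed.

(** On [1, 2] one has 0 <= ln x <= 1, so the weight is at least e^(-|a - 1|) e^(-2) there. *)
Lemma rgamma_gt0 a : 0 < a -> 0 < rgamma a.
Proof.
move=> a0; rewrite /rgamma; set g := \int[mu]_(x in Rp) _.
have ex := exhaustion_Rplus R.
have w0 x : 0 <= gamma_weight a x by rewrite mulr_ge0 ?expR_ge0.
have i1 := intg_gamma_weight a0.
have h : \int[mu]_(x in `[1, 2]) (expR (- `|a - 1|) * expR (- 2)) <= g.
  apply: (@le_trans _ _ (\int[mu]_(x in `[1, 2]) gamma_weight a x)).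
    apply: ler_Rint => //.
    - by apply: intg_itv_continuous => x _; exact: cst_continuous.
    - by apply: (intgS (@measurable_Rplus R)) i1 => // x /=; rewrite in_itv/= => /andP[+ _]; exact: lt_le_trans.
    - move=> x /=; rewrite in_itv/= => /andP[x1 x2].
      rewrite ler_pM ?expR_ge0// ler_expR ?lerN2//.
      have l0 : 0 <= ln x by rewrite ln_ge0.
      have l1 : ln x <= 1 by rewrite (le_trans (ln_le_subr1 _))// ?(lt_le_trans _ x1)//; lra.
      have := ler_norm (- (a - 1)); rewrite normrN => h1.
      by have := normr_ge0 (a - 1); nra.
  rewrite Rint_restrict /g [leRHS]Rint_restrict; apply: ler_Rint => //.
  - apply: (intg_restrict _ (measurable_itv _)).1.
    by apply: (intgS (@measurable_Rplus R)) i1 => // x /=; rewrite in_itv/= => /andP[+ _]; exact: lt_le_trans.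
  - exact: (intg_restrict _ (@measurable_Rplus R)).1.
  - move=> x _; rewrite ler_wpM2l// !indicE.
    have [xi|] := boolP (x \in `[1, 2]%classic); last by rewrite ler0n.
    by rewrite mem_set//; move/set_mem : xi; rewrite /= in_itv/= => /andP[+ _]; exact: lt_le_trans.
apply: lt_le_trans h; rewrite Rintegral_cst//= mulr_gt0 ?mulr_gt0 ?expR_gt0//.
have l12 : (1 : R) < 2 by rewrite ltr1n.
by rewrite lebesgue_measure_itv/= lte_fin l12 /= subr_gt0.
Qed.

End Gamma_integral.

(** * Asymptotics of Gamma and the products of Gauss *)

Section Gamma_asymptotics.
Variable R : realType.
Local Notation mu := (@lebesgue_measure R).
Local Notation intg D f := (mu.-integrable D (EFin \o f)).
Local Notation Rp := (Rplus R).
Implicit Types (a x m : R) (z w : R[i]) (n k : nat).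

Lemma rgammaS a : 0 < a -> rgamma (a + 1) = a * rgamma a.
Proof.
move=> a0; have a1 : 0 < a + 1 by rewrite addr_gt0.
apply: (@complexI R); rewrite rmorphM/= -!euler_rgamma// -euler_functional//.
by rewrite rmorphD.
Qed.

Lemma gamma_weightS a x : 0 < x -> gamma_weight (a + 1) x = x * gamma_weight a x.
Proof.
move=> x0; rewrite /gamma_weight addrK mulrA; congr (_ * _).
by rewrite (_ : a * ln x = ln x + (a - 1) * ln x) ?expRD ?lnK ?posrE//; ring.
Qed.

(* Under the Gamma(m) density, x / m has mean 1 and variance 1 / m, so that
   (x / m)^w concentrates at 1: this gives Gamma (w + m) ~ m^w Gamma m. *)
Lemma gamma_variance m : 0 < m ->
  intg Rp (fun x => (x / m - 1) ^+ 2 * gamma_weight m x) /\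
  \int[mu]_(x in Rp) ((x / m - 1) ^+ 2 * gamma_weight m x) = rgamma m / m.
Proof.
move=> m0; have mR := @measurable_Rplus R.
have m1 : 0 < m + 1 by rewrite addr_gt0.
have m2 : 0 < m + 1 + 1 by rewrite addr_gt0.
have i0 := intg_gamma_weight m0; have i1 := intg_gamma_weight m1.
have i2 := intg_gamma_weight m2.
pose f x := m ^- 2 * gamma_weight (m + 1 + 1) x +
  (- (2 / m) * gamma_weight (m + 1) x + 1 * gamma_weight m x).
have fE x : 0 < x -> f x = (x / m - 1) ^+ 2 * gamma_weight m x.
  move=> x0; rewrite /f !gamma_weightS//; field; exact: lt0r_neq0.
have fi : intg Rp f.
  by apply: intgD => //; [exact: intgZ|apply: intgD => //; exact: intgZ].
split; first exact: eq_intg fi.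
rewrite -(eq_Rint (f := f))// /f RintegralD//; [|exact: intgZ|by apply: intgD => //; exact: intgZ].
rewrite RintegralD//; [|exact: intgZ|exact: intgZ].
rewrite !RintegralZl// -!/(rgamma _) rgammaS// rgammaS//.
by field; exact: lt0r_neq0.
Qed.

(** The estimate [cexp_ln_near1] at y = x / m is integrated against the Gamma(m) weight. Replacing
    |y - 1| by e + (y - 1)^2 / e leaves only the total mass and the variance. *)
Lemma euler_ratio_bound w m (e : R) : 0 <= Re w <= 1 -> 0 < m -> 0 < e ->
  normc (euler_integral (w + m%:C) * cpow m (- w) - (rgamma m)%:C) <=
  2 * (8 + 4 * `|Im w|) * (e + (1 + e^-1) / m) * rgamma m.
Proof.
move=> wd m0 e0; have mR := @measurable_Rplus R.
have w0 : 0 < Re (w + m%:C) by rewrite ReD ReC ltr_wpDl//; case/andP: wd.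
have i1 := cintegrable_euler w0; have i0 := @cintegrable_euler R m%:C m0.
pose D x := cpow m (- w) * euler_integrand (w + m%:C) x - euler_integrand m%:C x.
have DE x : 0 < x -> D x = (cexp (w * (ln (x / m))%:C) - 1) * euler_integrand m%:C x.
  move=> x0.
  have hc : cexp (w * (ln (x / m))%:C) = cpow x w * cpow m (- w).
    by rewrite ln_div ?posrE// rmorphB/= mulrBr cexpD cexpN cpowN.
  by rewrite /D /euler_integrand hc -addrA (cpowD x w); ring.
have iD : cintegrable Rp D.
  by apply: cintegrableD => //; [exact: cintegrableZl|exact: cintegrableN].
have -> : euler_integral (w + m%:C) * cpow m (- w) - (rgamma m)%:C = cintegral Rp D.
  by rewrite cintegralB ?cintegralZl//; [rewrite mulrC -euler_rgamma|exact: cintegrableZl].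
rewrite (le_trans (normc_cintegral mR iD))// -!mulrA ler_wpM2l//.
set C := 8 + 4 * `|Im w|.
have C0 : 0 <= C by rewrite addr_ge0// mulr_ge0.
have [iv vE] := gamma_variance m0; have ig := intg_gamma_weight m0.
pose h x := C * (e * gamma_weight m x + (1 + e^-1) * ((x / m - 1) ^+ 2 * gamma_weight m x)).
have ih : intg Rp h by apply: intgZ => //; apply: intgD => //; exact: intgZ.
apply: (@le_trans _ _ (\int[mu]_(x in Rp) h x)).
  apply: ler_Rint => //; first exact: intg_normc.
  move=> x x0; rewrite DE// normcM normc_euler_integrand ReC /h.
  have xm : 0 < x / m by rewrite divr_gt0.
  rewrite [e * _ + _](_ : _ = (e + (1 + e^-1) * (x / m - 1) ^+ 2) * gamma_weight m x); last by ring.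
  rewrite [leRHS]mulrA ler_wpM2r ?mulr_ge0 ?expR_ge0//.
  rewrite (le_trans (cexp_ln_near1 wd xm))// ler_wpM2l//.
  rewrite mulrDl mul1r [leRHS]addrCA [leRHS]addrC lerD2r.
  have -> : (x / m - 1) ^+ 2 = `|x / m - 1| ^+ 2 by rewrite real_normK ?num_real.
  move: (`|x / m - 1|) (normr_ge0 (x / m - 1)) => p p0.
  (* With p = |x / m - 1|, the claim p <= e + p^2 / e is multiplied by e and follows from the
     squares of e - p and e + p. *)
  rewrite -(ler_pM2l e0) mulrDr mulrA divff ?gt_eqF// mul1r -expr2.
  by have := sqr_ge0 (e - p); have := sqr_ge0 (e + p); nra.
rewrite RintegralZl//; last by apply: intgD => //; exact: intgZ.
rewrite RintegralD//; [|exact: intgZ|exact: intgZ].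
rewrite !RintegralZl// vE -!/(rgamma _) le_eqVlt; apply/orP; left; apply/eqP.
by rewrite -/C; ring.
Qed.

(** The quotient Gamma (z + n) / (n^z Gamma n), which is meaningful for every z once n > - Re z. *)
Definition euler_ratio z n : R[i] :=
  euler_integral (z + n%:R) * cpow n%:R (- z) * ((rgamma n%:R)^-1)%:C.

Lemma natC n : (n%:R : R[i]) = (n%:R : R)%:C.
Proof. by rewrite rmorph_nat. Qed.

Lemma euler_ratio_cvg01 w : 0 <= Re w <= 1 -> ccvg (euler_ratio w) 1.
Proof.
move=> wd.
suff h : ccvg (fun n => euler_ratio w n - 1) 0.
  have := ccvgD h (ccvg_cst 1); rewrite add0r; apply: ccvg_near.
  by apply: nearW => n; rewrite subrK.
apply: ccvg0P; apply/cvgrPdist_le => e e0.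
set C := 8 + 4 * `|Im w|.
have C0 : 0 < C by rewrite ltr_pwDl// mulr_ge0.
(* The bound becomes 2 C (d + d): one d is the free parameter, the other bounds the variance term
   for large n. *)
pose d := e / (4 * C).
have d0 : 0 < d by rewrite divr_gt0// mulr_gt0.
near=> n.
have n0 : 0 < (n%:R : R) by near: n; exact: nbhs_infty_gtr.
have nd : (1 + d^-1) / d <= n%:R by near: n; exact: nbhs_infty_ger.
have g0 := rgamma_gt0 n0.
rewrite distrC subr0 ger0_norm ?normc_ge0//.
have -> : euler_ratio w n - 1 = (euler_integral (w + (n%:R : R)%:C) * cpow n%:R (- w)
    - (rgamma n%:R)%:C) * ((rgamma n%:R)^-1)%:C.
  rewrite mulrBl /euler_ratio natC; congr (_ - _).
  by rewrite -rmorphM/= divff ?gt_eqF.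
rewrite normcM normcC gtr0_norm ?invr_gt0// ler_pdivrMr//.
rewrite (le_trans (euler_ratio_bound wd n0 d0))// ler_wpM2r ?(ltW g0)// -/C.
have h : (1 + d^-1) / n%:R <= d by rewrite ler_pdivrMr// mulrC -ler_pdivrMr.
have -> : e = 2 * C * (d + d) by rewrite /d; field; exact: lt0r_neq0.
by rewrite ler_wpM2l ?lerD2l// mulr_ge0// ltW.
Unshelve. all: by end_near. Qed.

Lemma ccvg_1Dinv z : ccvg (fun n => 1 + z * (n%:R^-1 : R)%:C) 1.
Proof.
rewrite -[X in ccvg _ X]addr0; apply: ccvgD; first exact: ccvg_cst.
rewrite -[X in ccvg _ X](mulr0 z); apply: ccvgM; first exact: ccvg_cst.
split => /=; last exact: cvg_cst.
apply/cvgrPdist_le => e e0; near=> n.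
have n0 : 0 < (n%:R : R) by near: n; exact: nbhs_infty_gtr.
have ne : e^-1 <= (n%:R : R) by near: n; exact: nbhs_infty_ger.
rewrite distrC subr0 gtr0_norm ?invr_gt0//.
by rewrite -[leRHS]invrK lef_pV2 ?posrE ?invr_gt0.
Unshelve. all: by end_near. Qed.

Lemma euler_ratioS z n : 0 < Re z + n%:R -> (0 < n)%N ->
  euler_ratio (z + 1) n = euler_ratio z n * (1 + z * (n%:R^-1 : R)%:C).
Proof.
move=> zn n0; rewrite /euler_ratio addrAC euler_functional ?ReD ?Re_nat//.
have nr : 0 < (n%:R : R) by rewrite ltr0n.
rewrite opprD cpowD [cpow _ (- 1)]cpowN cpow1// natC.
have h : (n%:R : R)%:C != 0 by rewrite -natC pnatr_eq0 -lt0n.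
rewrite [(n%:R^-1)%:C]fmorphV/=.
have F (a b c q : R[i]) : q != 0 -> (z + q) * a * (b / q) * c = a * b * c * (1 + z / q).
  by move=> q0; field.
exact: F.
Qed.

(** By the functional equation the ratios at z + 1 and z differ by the factor 1 + z / n, which tends
    to 1. Convergence thus spreads from the strip 0 <= Re z <= 1 one unit to each side at every
    induction step. *)
Lemma euler_ratio_cvg z : ccvg (euler_ratio z) 1.
Proof.
suff H k : forall z, - k%:R <= Re z <= k.+1%:R -> ccvg (euler_ratio z) 1.
  have [n _ /(_ n (leqnn n)) hn] := @nbhs_infty_gtr R `|Re z|.
  apply: (H n); have := ltW hn; rewrite ler_norml => /andP[-> /le_trans] /=; apply.
  by rewrite ler_nat.
elim: k => [{}z|k IH {}z /andP[z1 z2]].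
  by rewrite oppr0; exact: euler_ratio_cvg01.
have up u : ccvg (euler_ratio u) 1 -> ccvg (euler_ratio (u + 1)) 1.
  move=> hu; have := ccvgM hu (ccvg_1Dinv u); rewrite mulr1; apply: ccvg_near.
  near=> n; rewrite euler_ratioS//; last by near: n; exact: nbhs_infty_gt.
  by rewrite -ltrBlDl sub0r; near: n; exact: nbhs_infty_gtr.
have down u : ccvg (euler_ratio (u + 1)) 1 -> ccvg (euler_ratio u) 1.
  move=> hu; have := ccvgM hu (ccvgV (oner_neq0 _) (ccvg_1Dinv u)); rewrite invr1 mulr1.
  apply: ccvg_near; near=> n.
  have n0 : (0 < n)%N by near: n; exact: nbhs_infty_gt.
  have un : 0 < Re u + n%:R.
    by rewrite -ltrBlDl sub0r; near: n; exact: nbhs_infty_gtr.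
  rewrite euler_ratioS// mulfK//.
  have nr : 0 < (n%:R : R) by rewrite ltr0n.
  apply/eqP => /(congr1 (fun z => Re z)); rewrite ReD Re_1 ReM ReC ImC mulr0 subr0 /=.
  move=> h; have : (Re u + n%:R) / n%:R = 0.
    by rewrite mulrDl divff ?gt_eqF// addrC h.
  by apply/eqP; rewrite mulf_neq0 ?invr_eq0 ?gt_eqF.
have [h|h] := leP (Re z) k.+1%:R.
  have [h'|/ltW h'] := leP (- k%:R) (Re z); first by apply: IH; rewrite h h'.
  apply: down; apply: IH; rewrite ReD Re_1.
  move: z1 h'; rewrite -!natr1 => z1 h'; apply/andP; split; first lra.
  by have := ler0n R k; lra.
rewrite -[z](subrK 1); apply: up; apply: IH; rewrite ReD ReN Re_1.
move: z2 h; rewrite -!natr1 => z2 h; have := ler0n R k => k0.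
by apply/andP; split; lra.
Unshelve. all: by end_near. Qed.

Lemma euler_shift z n : 0 < Re z ->
  euler_integral (z + n%:R) = euler_integral z * \prod_(k < n) (z + k%:R).
Proof.
move=> z0; elim: n => [|n IH]; first by rewrite big_ord0 mulr1 addr0.
rewrite big_ord_recr/= -natr1 addrA euler_functional ?IH; first by ring.
by rewrite ReD Re_nat ltr_wpDr.
Qed.

(** By the functional equation a zero at z would make every [euler_ratio z n] vanish, while these
    tend to 1. *)
Lemma euler_neq0 z : 0 < Re z -> euler_integral z != 0.
Proof.
move=> z0; apply/eqP => ez.
have h : ccvg (euler_ratio z) 0.
  apply: ccvg_near (ccvg_cst 0); apply: nearW => n.
  by rewrite /euler_ratio euler_shift// ez !mul0r.
by have /eqP := ccvg_unique h (euler_ratio_cvg z); rewrite eq_sym oner_eq0.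
Qed.

Lemma Re_gt0_neq0 z : 0 < Re z -> z != 0.
Proof. by move=> z0; apply: contraTneq z0 => ->; rewrite ltxx. Qed.

(** Every further shift multiplies numerator and denominator by the same nonzero factor, so the
    continuation of Gamma does not depend on the number of shifts. *)
Lemma euler_prod_ratio z n k : 0 < Re z + n%:R ->
  euler_integral (z + (n + k)%:R) / \prod_(i < n + k) (z + i%:R) =
  euler_integral (z + n%:R) / \prod_(i < n) (z + i%:R).
Proof.
move=> zn; elim: k => [|k IH]; first by rewrite addn0.
have p : 0 < Re (z + (n + k)%:R).
  by rewrite ReD Re_nat natrD addrA ltr_wpDr.
rewrite addnS big_ord_recr/= -natr1 addrA euler_functional// invfM -IH.
by rewrite [_ * euler_integral _]mulrC [_^-1 * _]mulrC -mulrA [_ * (_ / _)]mulrA mulfV ?Re_gt0_neq0// mul1r.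
Qed.

Lemma gamma_shiftP z : 0 < Re z + (gamma_shift z)%:R.
Proof.
rewrite /gamma_shift; case: ifPn => [z0|_]; first by rewrite addr0.
by rewrite -ltrBlDl sub0r truncnS_gt.
Qed.

Lemma cgammaE z n : 0 < Re z + n%:R ->
  cgamma z = euler_integral (z + n%:R) / \prod_(k < n) (z + k%:R).
Proof.
move=> zn; rewrite /cgamma; set s := gamma_shift z.
have sP := gamma_shiftP z.
by rewrite -(euler_prod_ratio n sP) addnC euler_prod_ratio.
Qed.

Lemma cgamma_Re_gt0 z : 0 < Re z -> cgamma z = euler_integral z.
Proof. by move=> z0; rewrite (@cgammaE z 0) ?addr0// big_ord0 divr1. Qed.

Definition gauss_ratio z1 z2 n : R[i] :=
  cpow n%:R (z1 - z2) * \prod_(k < n) ((z2 + k%:R) / (z1 + k%:R)).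

(** For large n the quotient of Gammas divided by the quotient of the two Euler ratios is exactly
    the n-th product of Gauss, because the factors Gamma (z + n) and Gamma n cancel. *)
Lemma gauss_ratio_cvg z1 z2 : ccvg (gauss_ratio z1 z2) (cgamma z1 / cgamma z2).
Proof.
pose r n := euler_ratio z1 n / euler_ratio z2 n.
have rc : ccvg r 1.
  rewrite -[X in ccvg _ X]mulr1 -[X in _ * X]invr1.
  by apply: ccvgM; [|apply: ccvgV; rewrite ?oner_neq0//]; exact: euler_ratio_cvg.
have := ccvgM (ccvg_cst (cgamma z1 / cgamma z2)) (ccvgV (oner_neq0 _) rc).
rewrite invr1 mulr1; apply: ccvg_near.
near=> n.
have n0 : (0 < n)%N by near: n; exact: nbhs_infty_gt.
have nr : 0 < (n%:R : R) by rewrite ltr0n.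
have h1 : 0 < Re z1 + n%:R by rewrite -ltrBlDl sub0r; near: n; exact: nbhs_infty_gtr.
have h2 : 0 < Re z2 + n%:R by rewrite -ltrBlDl sub0r; near: n; exact: nbhs_infty_gtr.
have e1 : euler_integral (z1 + n%:R) != 0 by apply: euler_neq0; rewrite ReD Re_nat.
have e2 : euler_integral (z2 + n%:R) != 0 by apply: euler_neq0; rewrite ReD Re_nat.
have g0 : ((rgamma (n%:R : R))^-1)%:C != 0.
  by rewrite -normc_gt0 normcC normr_gt0 invr_eq0 gt_eqF// rgamma_gt0.
have c1 : cpow n%:R z1 != 0 by exact: cexp_neq0.
have c2 : cpow n%:R z2 != 0 by exact: cexp_neq0.
rewrite (cgammaE h1) (cgammaE h2) invf_div /r /euler_ratio /gauss_ratio.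
rewrite cpowD !cpowN big_split/= prodfV.
(* The two finite products enter as p1 and p2, which may vanish: poles of either Gamma are thereby
   covered, both sides being 0 there. *)
have F (a b p1 p2 k l g : R[i]) : a != 0 -> b != 0 -> k != 0 -> l != 0 -> g != 0 ->
    a * p1 * (p2 / b) / (a / k * g / (b / l * g)) = k / l * (p2 * p1).
  by move=> a0 b0 k0 l0 h0; field; rewrite a0 b0 k0 l0 h0.
exact: F.
Unshelve. all: by end_near. Qed.

End Gamma_asymptotics.

(** * Uniform bounds for the products of Gauss *)

Section Gauss_ratio_bounds.
Variable R : realType.
Implicit Types (a d t x A B K N : R) (n k : nat).

(** With D = x^2 + t^2 and D' its value at x + 1, the factor is 1 + (2dx + d^2) / D, at most the
    exponential of the second term. Here 2x + 1 = D' - D, and ln D' - ln D lies between (D' - D) /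
    D' and (D' - D) / D, so 2x / D may be replaced by a telescoping logarithm at the cost of
    multiples of 1/D and 1/D'. *)
Lemma gauss_factor_bound x t d : 0 < x ^+ 2 + t ^+ 2 -> 0 < (x + 1) ^+ 2 + t ^+ 2 ->
  ((x + d) ^+ 2 + t ^+ 2) / (x ^+ 2 + t ^+ 2) <=
  expR (d * (ln ((x + 1) ^+ 2 + t ^+ 2) - ln (x ^+ 2 + t ^+ 2)) +
    (3 * `|d| + d ^+ 2) * ((x ^+ 2 + t ^+ 2)^-1 + ((x + 1) ^+ 2 + t ^+ 2)^-1)).
Proof.
set D := x ^+ 2 + t ^+ 2; set D' := (x + 1) ^+ 2 + t ^+ 2 => D0 D'0.
have Dn : D != 0 by exact: lt0r_neq0.
have D'n : D' != 0 by exact: lt0r_neq0.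
have V0 : 0 < D^-1 by rewrite invr_gt0.
have V'0 : 0 < D'^-1 by rewrite invr_gt0.
have -> : ((x + d) ^+ 2 + t ^+ 2) / D = 1 + (2 * d * x + d ^+ 2) * D^-1.
  by apply: (mulIf Dn); rewrite divfK// [RHS]mulrDl divfK// mul1r /D; ring.
apply: (le_trans (expR_ge1Dx _)); rewrite ler_expR.
have E : D' - D = 2 * x + 1 by rewrite /D /D'; ring.
have up : ln D' - ln D <= (2 * x + 1) * D^-1.
  rewrite -ln_div ?posrE// (le_trans (ln_le_subr1 _)) ?divr_gt0//.
  by rewrite -E mulrBl divff.
have lo : (2 * x + 1) * D'^-1 <= ln D' - ln D.
  rewrite -lerN2 opprB -ln_div ?posrE// (le_trans (ln_le_subr1 _)) ?divr_gt0//.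
  by rewrite -E mulrBl divff// opprB.
have q1 : 0 <= d ^+ 2 * D'^-1 by rewrite mulr_ge0 ?sqr_ge0 ?ltW.
have [d0|d0] := leP 0 d.
  rewrite ger0_norm//.
  have h1 := ler_wpM2l d0 lo.
  apply: (@le_trans _ _ (d * ((2 * x + 1) * D'^-1) + (3 * d + d ^+ 2) * (D^-1 + D'^-1))); last by rewrite lerD2r.
  (* For d >= 0 the available lower bound of the logarithm has denominator D' instead of D; the
     difference 1/D - 1/D' = (2x + 1) / (D D') is absorbed through (2x + 1)^2 <= 2 (D + D'). *)
  have h2 : (2 * x + 1) ^+ 2 * (D^-1 * D'^-1) <= 2 * (D^-1 + D'^-1).
    have -> : D^-1 + D'^-1 = (D + D') * (D^-1 * D'^-1) by field; rewrite Dn D'n.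
    rewrite [leRHS]mulrA ler_pM2r ?mulr_gt0// /D /D'.
    by have := sqr_ge0 t; nra.
  have h3 : D^-1 - D'^-1 = (2 * x + 1) * (D^-1 * D'^-1).
    by rewrite -E; field; rewrite Dn D'n.
  have h4 : d * ((2 * x + 1) * (D^-1 - D'^-1)) <= d * (2 * (D^-1 + D'^-1)).
    by rewrite ler_wpM2l// h3 mulrA -expr2.
  have p1 : 0 <= d * D^-1 := mulr_ge0 d0 (ltW V0).
  have p2 : 0 <= d * D'^-1 := mulr_ge0 d0 (ltW V'0).
  rewrite -subr_ge0.
  have -> : d * ((2 * x + 1) * D'^-1) + (3 * d + d ^+ 2) * (D^-1 + D'^-1) - (2 * d * x + d ^+ 2) * D^-1
    = (d * (2 * (D^-1 + D'^-1)) - d * ((2 * x + 1) * (D^-1 - D'^-1))) +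
      (d * D^-1 *+ 2 + d * D'^-1 + d ^+ 2 * D'^-1) by ring.
  by rewrite addr_ge0 ?subr_ge0// !addr_ge0// mulrn_wge0.
rewrite ltr0_norm//.
have h1 : d * ((2 * x + 1) * D^-1) <= d * (ln D' - ln D) by rewrite ler_wnM2l// ltW.
have nd0 : 0 <= - d by rewrite oppr_ge0 ltW.
have p1 : 0 <= - d * D^-1 := mulr_ge0 nd0 (ltW V0).
have p2 : 0 <= - d * D'^-1 := mulr_ge0 nd0 (ltW V'0).
apply: (@le_trans _ _ (d * ((2 * x + 1) * D^-1) + (3 * - d + d ^+ 2) * (D^-1 + D'^-1))); last by rewrite lerD2r.
rewrite -subr_ge0.
have -> : d * ((2 * x + 1) * D^-1) + (3 * - d + d ^+ 2) * (D^-1 + D'^-1) - (2 * d * x + d ^+ 2) * D^-1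
    = - d * D^-1 *+ 2 + - d * D'^-1 *+ 3 + d ^+ 2 * D'^-1 by ring.
by rewrite !addr_ge0// mulrn_wge0.
Qed.

(** Comparison with a telescoping series: (n + 1)(n + 2) <= 2 (A + 2)^2 (1 + (a + n)^2). The point
    is a bound that depends neither on n nor on a in [-A, A]. *)
Lemma sum_inv_quadratic a A n : `|a| <= A ->
  \sum_(k < n) (1 + (a + k%:R) ^+ 2)^-1 <= 2 * (A + 2) ^+ 2.
Proof.
move=> aA; have A0 : 0 <= A by exact: le_trans aA.
set c := 2 * (A + 2) ^+ 2.
have c0 : 0 <= c by rewrite mulr_ge0 ?sqr_ge0.
(* The partial sums of 1 / ((n + 1)(n + 2)) are 1 - 1 / (n + 1), the form in which the bound goes
   through by induction. *)
suff h : \sum_(k < n) (1 + (a + k%:R) ^+ 2)^-1 <= c * (1 - (n%:R + 1)^-1).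
  have v0 : 0 <= (n%:R + 1 : R)^-1 by rewrite invr_ge0 addr_ge0.
  by apply: (le_trans h); rewrite -/c; nra.
elim: n => [|n IH]; first by rewrite big_ord0 add0r invr1 subrr mulr0.
rewrite big_ord_recr/=.
have n0 : (0 : R) <= n%:R by rewrite ler0n.
apply: (@le_trans _ _ (c * (1 - (n%:R + 1)^-1) + c * ((n%:R + 1) * (n%:R + 2))^-1)).
  rewrite lerD// -[leRHS]invrK invfM invrK.
  have q : 0 < 1 + (a + n%:R) ^+ 2 by rewrite ltr_pwDl// sqr_ge0.
  have c1 : 0 < c by rewrite mulr_gt0// exprn_gt0// ltr_wpDl.
  have p1 : (0 : R) < n%:R + 1 by lra.
  have p2 : (0 : R) < n%:R + 2 by lra.
  rewrite lef_pV2 ?posrE ?mulr_gt0 ?invr_gt0//.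
  rewrite mulrC ler_pdivrMr// /c.
  have /andP[a1 a2] : - A <= a <= A by rewrite -ler_norml.
  set u := a + n%:R; have -> : (n%:R : R) = u - a by rewrite /u addrC addKr.
  have h1 : u - a + 2 <= `|u| + (A + 2) by have := ler_norm u; lra.
  have h0 : 0 <= u - a by rewrite /u addrC addKr.
  have h2 : (u - a + 2) ^+ 2 <= (`|u| + (A + 2)) ^+ 2.
    have u0 := normr_ge0 u.
    by apply: lerXn2r => //; rewrite nnegrE; lra.
  have -> : u ^+ 2 = `|u| ^+ 2 by rewrite real_normK ?num_real.
  have u0 := normr_ge0 u.
  apply: (@le_trans _ _ ((u - a + 2) ^+ 2)); first by nra.
  apply: (le_trans h2).
  have A2 : 1 <= (A + 2) ^+ 2 by nra.
  have := sqr_ge0 (`|u| - (A + 2)) => s1.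
  have := sqr_ge0 `|u| => s2.
  nra.
rewrite -natr1 -mulrDr ler_wpM2l// le_eqVlt; apply/orP; left; apply/eqP.
by field; rewrite !gt_eqF//; lra.
Qed.

(** The factor 3 B + B^2 is the error coefficient of one factor, 2 (A + 3)^2 / K bounds the sum of
    the 1 / D_k, and the outer 2 accounts for the sums of 1 / D_k and 1 / D_(k+1); the shift in the
    latter turns A + 2 into A + 3. *)
Definition gauss_const A B K := expR (2 * (3 * B + B ^+ 2) * (2 * (A + 3) ^+ 2 / K)).

(** The logarithms of [gauss_factor_bound] telescope, and the errors sum to a constant independent
    of n and t: the separation hypothesis makes every D_k at least K (1 + (a + k)^2). *)
Lemma gauss_prod_bound A B K a d t n : `|a| <= A -> `|d| <= B -> 0 < K ->
  (forall k, K * (1 + (a + k%:R) ^+ 2) <= (a + k%:R) ^+ 2 + t ^+ 2) ->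
  \prod_(k < n) (((a + d + k%:R) ^+ 2 + t ^+ 2) / ((a + k%:R) ^+ 2 + t ^+ 2)) <=
  gauss_const A B K * expR (d * (ln ((a + n%:R) ^+ 2 + t ^+ 2) - ln (a ^+ 2 + t ^+ 2))).
Proof.
move=> aA dB K0 hK.
have A0 : 0 <= A by exact: le_trans aA.
have B0 : 0 <= B by exact: le_trans dB.
pose D k := (a + k%:R) ^+ 2 + t ^+ 2.
have D0 k : 0 < D k.
  by apply: lt_le_trans (hK k); rewrite mulr_gt0// ltr_pwDl// sqr_ge0.
pose c := 3 * `|d| + d ^+ 2.
have c0 : 0 <= c by rewrite addr_ge0 ?sqr_ge0// mulr_ge0.
have H : \prod_(k < n) (((a + d + k%:R) ^+ 2 + t ^+ 2) / D k) <=
    expR (d * (ln (D n) - ln (D 0%N)) + c * \sum_(k < n) ((D k)^-1 + (D k.+1)^-1)).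
  elim: n => [|n IH].
    by rewrite !big_ord0 subrr !mulr0 addr0 expR0.
  rewrite !big_ord_recr/=.
  have := @gauss_factor_bound (a + n%:R) t d (D0 n).
  rewrite -addrA natr1 -/(D n.+1) -/(D n) => /(_ (D0 n.+1)) h.
  rewrite [a + d + n%:R]addrAC; apply: (@le_trans _ _ _ _ _ (ler_pM _ _ IH h)).
  - by apply: prodr_ge0 => k _; rewrite divr_ge0 ?(ltW (D0 _))// addr_ge0 ?sqr_ge0.
  - by rewrite divr_ge0 ?(ltW (D0 _))// addr_ge0 ?sqr_ge0.
  - by rewrite -expRD ler_expR le_eqVlt; apply/orP; left; apply/eqP; rewrite /c; ring.
apply: (le_trans H); rewrite /D addr0 expRD mulrC ler_wpM2r ?expR_ge0//.
rewrite /gauss_const ler_expR -/c.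
have cB : c <= 3 * B + B ^+ 2.
  by rewrite lerD ?ler_wpM2l// -[leLHS]real_normK ?num_real// lerXn2r ?nnegrE.
have inv k : (D k)^-1 <= K^-1 * (1 + (a + k%:R) ^+ 2)^-1.
  by rewrite -invfM lef_pV2 ?posrE ?mulr_gt0// ltr_pwDl// sqr_ge0.
have S1 : \sum_(k < n) (D k)^-1 <= 2 * (A + 3) ^+ 2 / K.
  rewrite mulrC; apply: (@le_trans _ _ (K^-1 * \sum_(k < n) (1 + (a + k%:R) ^+ 2)^-1)).
    by rewrite mulr_sumr; apply: ler_sum => k _.
  rewrite ler_wpM2l ?invr_ge0 ?(ltW K0)// (le_trans (sum_inv_quadratic n aA))//.
  by rewrite ler_wpM2l// lerXn2r ?nnegrE ?addr_ge0// lerD2l ler_nat.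
have S2 : \sum_(k < n) (D k.+1)^-1 <= 2 * (A + 3) ^+ 2 / K.
  have a1 : `|a + 1| <= A + 1 by rewrite (le_trans (ler_normD _ _))// normr1 lerD2r.
  rewrite mulrC; apply: (@le_trans _ _ (K^-1 * \sum_(k < n) (1 + (a + 1 + k%:R) ^+ 2)^-1)).
    rewrite mulr_sumr; apply: ler_sum => k _; rewrite -addrA [1 + k%:R]addrC natr1; exact: inv.
  rewrite ler_wpM2l ?invr_ge0 ?(ltW K0)// (le_trans (sum_inv_quadratic n a1))//.
  by rewrite -addrA -natr1 [1 + _]addrC.
have S0 : 0 <= \sum_(k < n) ((D k)^-1 + (D k.+1)^-1).
  by apply: sumr_ge0 => k _; rewrite addr_ge0// invr_ge0 ltW.
apply: (@le_trans _ _ ((3 * B + B ^+ 2) * (\sum_(k < n) ((D k)^-1 + (D k.+1)^-1)))).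
  exact: ler_wpM2r.
rewrite [2 * _]mulrC -[leRHS]mulrA ler_wpM2l ?addr_ge0 ?mulr_ge0 ?sqr_ge0//.
by rewrite big_split/= mulr_natl mulr2n lerD.
Qed.

Variable gam b : R.

Definition Qnum (l : R[i]) n := gauss_ratio (b%:C - l) (gam%:C + b%:C + l) n.

Definition Qlim (l : R[i]) := cgamma (b%:C - l) / cgamma (gam%:C + b%:C + l).

Lemma Qnum_cvg l : ccvg (Qnum l) (Qlim l). Proof. exact: gauss_ratio_cvg. Qed.

(** A quantitative distance from l to the poles b, b + 1, ..., of exactly the strength that
    [gauss_prod_bound] sums. *)
Definition pole_sep K (l : R[i]) :=
  forall k, K * (1 + (b - Re l + k%:R) ^+ 2) <= (b - Re l + k%:R) ^+ 2 + Im l ^+ 2.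

(** The two arguments have opposite imaginary parts, and their real parts differ by d = gam + 2 Re
    l; the squared modulus is therefore the product of [gauss_prod_bound], times n^(-2d) from the
    power of n. *)
Lemma normc_Qnum A B K l n : `|b - Re l| <= A -> `|gam + 2 * Re l| <= B -> 0 < K ->
  pole_sep K l -> (0 < n)%N ->
  normc (Qnum l n) ^+ 2 <= gauss_const A B K *
   expR ((gam + 2 * Re l) * (ln ((b - Re l + n%:R) ^+ 2 + Im l ^+ 2) - 2 * ln n%:R
          - ln ((b - Re l) ^+ 2 + Im l ^+ 2))).
Proof.
move=> lA lB K0 sep n0; rewrite /Qnum /gauss_ratio normcM exprMn normc_cpow normc_prod.
rewrite -prodrXl.
have := gauss_prod_bound n lA lB K0 sep => h.
rewrite (eq_bigr (fun k : 'I_n => ((b - Re l + (gam + 2 * Re l) + k%:R) ^+ 2 + Im l ^+ 2) /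
   ((b - Re l + k%:R) ^+ 2 + Im l ^+ 2))); last first.
  move=> k _; rewrite normcM normcV exprMn exprVn !sqr_normc.
  rewrite !(ReD, ImD, ReN, ImN, ReC, ImC, Re_nat, Im_nat) !add0r !addr0 sqrrN.
  by congr ((_ ^+ 2 + _) / _); ring.
rewrite -expRM_natl.
apply: (le_trans (ler_wpM2l (expR_ge0 _) h)); rewrite mulrCA ler_wpM2l ?expR_ge0//.
rewrite -expRD ler_expR le_eqVlt; apply/orP; left; apply/eqP.
by rewrite !(ReD, ReN, ReC); ring.
Qed.

Lemma cvg_natV : (fun n => n%:R^-1 : R) @ \oo --> (0 : R).
Proof.
apply/cvgrPdist_le => e e0; near=> n.
have n0 : 0 < (n%:R : R) by near: n; exact: nbhs_infty_gtr.
have ne : e^-1 <= (n%:R : R) by near: n; exact: nbhs_infty_ger.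
rewrite distrC subr0 gtr0_norm ?invr_gt0//.
by rewrite -[leRHS]invrK lef_pV2 ?posrE ?invr_gt0.
Unshelve. all: by end_near. Qed.

Lemma ln_quadratic_cvg a t : ln ((a + n%:R) ^+ 2 + t ^+ 2) - 2 * ln n%:R @[n --> \oo] --> (0 : R).
Proof.
have h : (a * n%:R^-1 + 1) ^+ 2 + (t * n%:R^-1) ^+ 2 @[n --> \oo] --> (1 : R).
  have i0 := cvg_natV.
  rewrite [X in _ --> X](_ : 1 = (a * 0 + 1) ^+ 2 + (t * 0) ^+ 2); last by ring.
  have c1 (s : R) : s * n%:R^-1 @[n --> \oo] --> s * 0 by apply: cvgM => //; exact: cvg_cst.
  under eq_fun do rewrite !expr2; rewrite !expr2.
  by apply: cvgD; apply: cvgM => //; apply: cvgD => //; exact: cvg_cst.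
have := cvg_comp _ _ h (continuous_ln ltr01); rewrite ln1.
apply: cvg_trans; apply: near_eq_cvg; near=> n.
have n0 : 0 < (n%:R : R) by near: n; exact: nbhs_infty_gtr.
have an : `|a| < n%:R by near: n; exact: nbhs_infty_gtr.
have p : 0 < (a + n%:R) ^+ 2 + t ^+ 2.
  have q : 0 < a + n%:R by move: an; rewrite ltr_norml => /andP[? _]; lra.
  by rewrite ltr_pwDl ?sqr_ge0// exprn_gt0.
have -> : 2 * ln (n%:R : R) = ln (n%:R ^+ 2) by rewrite lnXn// mulr_natl.
rewrite -ln_div ?posrE ?exprn_gt0//=; congr ln.
by field; exact: lt0r_neq0.
Unshelve. all: by end_near. Qed.

(** As n grows the logarithm at n cancels against 2 ln n, leaving the decay |b - l|^(-2d) with d =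
    gam + 2 Re l. *)
Lemma normc_Qlim A B K l : `|b - Re l| <= A -> `|gam + 2 * Re l| <= B -> 0 < K ->
  pole_sep K l ->
  normc (Qlim l) ^+ 2 <= gauss_const A B K *
    expR (- ((gam + 2 * Re l) * ln ((b - Re l) ^+ 2 + Im l ^+ 2))).
Proof.
move=> lA lB K0 sep.
have h := ccvg_normc (Qnum_cvg l).
have h2 : normc (Qnum l n) ^+ 2 @[n --> \oo] --> normc (Qlim l) ^+ 2.
  by under eq_fun do rewrite expr2; rewrite expr2; exact: cvgM.
set d := gam + 2 * Re l in lB *.
have h3 : gauss_const A B K *
   expR (d * (ln ((b - Re l + n%:R) ^+ 2 + Im l ^+ 2) - 2 * ln n%:R
          - ln ((b - Re l) ^+ 2 + Im l ^+ 2))) @[n --> \oo] -->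
   gauss_const A B K * expR (d * (0 - ln ((b - Re l) ^+ 2 + Im l ^+ 2))).
  apply: cvgM; first exact: cvg_cst.
  have : d * (ln ((b - Re l + n%:R) ^+ 2 + Im l ^+ 2) - 2 * ln n%:R
          - ln ((b - Re l) ^+ 2 + Im l ^+ 2)) @[n --> \oo] --> d * (0 - ln ((b - Re l) ^+ 2 + Im l ^+ 2)).
    apply: cvgM; first exact: cvg_cst.
    by apply: cvgB; [exact: ln_quadratic_cvg|exact: cvg_cst].
  by move=> hh; exact: (cvg_comp _ _ hh (@continuous_expR R _)).
rewrite sub0r mulrN in h3.
apply: (ler_cvg_to h2 h3); near=> n; apply: normc_Qnum => //.
by near: n; exact: nbhs_infty_gt.
Unshelve. all: by end_near. Qed.

(* Away from the poles and for bounded [l], the Gauss approximants are bounded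
   uniformly in [n]. *)
Lemma Qnum_bounded A B K N : 0 < K ->
  exists C : R, exists n0 : nat, forall l n, `|b - Re l| <= A -> `|gam + 2 * Re l| <= B ->
    `|Im l| <= N -> pole_sep K l -> (n0 <= n)%N -> normc (Qnum l n) <= C.
Proof.
move=> K0.
pose L := ln ((A + 1) ^+ 2 + N ^+ 2) + ln 4.
pose L0 := `|ln K| + `|ln (A ^+ 2 + N ^+ 2)|.
exists (1 + gauss_const A B K * expR (B * (L + L0))).
(* From this index on a + n >= n / 2, hence (a + n)^2 / n^2 >= 1/4; this is the source of ln 4 in
   [L]. *)
have [n1 _ hn1] := @nbhs_infty_ger R (2 * A + 1).
exists n1 => l n lA lB lN sep nn1.
have A0 : 0 <= A by exact: le_trans lA.
have B0 : 0 <= B by exact: le_trans lB.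
have N0 : 0 <= N by exact: le_trans lN.
have nA : 2 * A + 1 <= n%:R by exact: hn1.
have n0 : (0 < n)%N by rewrite -(ltr0n R); lra.
have nr : 0 < (n%:R : R) by rewrite ltr0n.
have n1' : 1 <= (n%:R : R) by lra.
have h := normc_Qnum lA lB K0 sep n0.
set u := normc _ in h *; have u0 : 0 <= u by exact: normc_ge0.
(* A bound X of u^2 gives u <= 1 + X, whence the summand 1 in the constant. *)
suff : u ^+ 2 <= gauss_const A B K * expR (B * (L + L0)).
  by have := sqr_ge0 (u - 1); nra.
apply: (le_trans h); rewrite ler_wpM2l ?expR_ge0// ler_expR.
rewrite (le_trans (ler_norm _))// normrM ler_pM//.
set a := b - Re l in lA sep *; set t := Im l in lN sep *.
have /andP[a1 a2] : - A <= a <= A by rewrite -ler_norml.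
have t2 : t ^+ 2 <= N ^+ 2 by rewrite -[leLHS]real_normK ?num_real// lerXn2r ?nnegrE.
have t20 := sqr_ge0 t.
rewrite (le_trans (ler_normB _ _))// lerD//.
  have -> : 2 * ln (n%:R : R) = ln (n%:R ^+ 2) by rewrite lnXn// mulr_natl.
  have p : 0 < (a + n%:R) ^+ 2 + t ^+ 2 by rewrite ltr_pwDl// exprn_gt0//; lra.
  rewrite -ln_div ?posrE ?exprn_gt0//.
  have n20 : 0 < (n%:R : R) ^+ 2 by rewrite exprn_gt0.
  have l4 : 0 <= ln (4 : R) by rewrite ln_ge0// ler1n.
  have lAN : 0 <= ln ((A + 1) ^+ 2 + N ^+ 2).
    by rewrite ln_ge0//; have := sqr_ge0 N; nra.
  rewrite ler_norml; apply/andP; split.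
    have : ln (4^-1 : R) <= ln (((a + n%:R) ^+ 2 + t ^+ 2) / n%:R ^+ 2).
      rewrite ler_ln ?posrE ?invr_gt0// ?divr_gt0// ler_pdivlMr//.
      have q : n%:R / 2 <= a + n%:R by lra.
      have : (n%:R / 2) ^+ 2 <= (a + n%:R) ^+ 2 by rewrite lerXn2r ?nnegrE; lra.
      by rewrite expr_div_n => ?; lra.
    by rewrite lnV ?posrE// /L => ?; lra.
  have : ln (((a + n%:R) ^+ 2 + t ^+ 2) / n%:R ^+ 2) <= ln ((A + 1) ^+ 2 + N ^+ 2).
    rewrite ler_ln ?posrE ?divr_gt0//; last by rewrite ltr_pwDl ?sqr_ge0// exprn_gt0// ltr_wpDl.
    rewrite ler_pdivrMr// mulrDl lerD//.
      rewrite -exprMn lerXn2r ?nnegrE ?mulr_ge0//; nra.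
    by rewrite (le_trans t2)// ler_peMr ?sqr_ge0//; nra.
  by rewrite /L => ?; lra.
have pK := sep 0%N; rewrite addr0 in pK.
have Ka : K <= a ^+ 2 + t ^+ 2.
  by apply: le_trans pK; rewrite ler_peMr ?(ltW K0)// lerDl sqr_ge0.
have pa : 0 < a ^+ 2 + t ^+ 2 by exact: lt_le_trans Ka.
have aA2 : a ^+ 2 + t ^+ 2 <= A ^+ 2 + N ^+ 2.
  by rewrite lerD// -[leLHS]real_normK ?num_real// lerXn2r ?nnegrE.
rewrite ler_norml /L0; apply/andP; split.
  have : ln K <= ln (a ^+ 2 + t ^+ 2) by rewrite ler_ln ?posrE.
  by have := ler_norm (- ln K); rewrite normrN; have := normr_ge0 (ln (A ^+ 2 + N ^+ 2)); lra.
have : ln (a ^+ 2 + t ^+ 2) <= ln (A ^+ 2 + N ^+ 2) by rewrite ler_ln ?posrE// (lt_le_trans pa).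
by have := ler_norm (ln (A ^+ 2 + N ^+ 2)); have := normr_ge0 (ln K); lra.
Qed.

End Gauss_ratio_bounds.

(** * Moving a truncated contour for the Gamma quotients *)

Section Contour_shift.
Variable R : realType.
Local Notation mu := (@lebesgue_measure R).
Local Notation intg D f := (mu.-integrable D (EFin \o f)).
Implicit Types (t th K : R) (l : R[i]).

Lemma eq_holo (U : set R[i]) (f g f' : R[i] -> R[i]) : f =1 g -> holo U f f' -> holo U g f'.
Proof. by move=> /funext ->. Qed.

Lemma pole_sep_normc (b K : R) l (k : nat) : 0 <= K -> pole_sep b K l ->
  Num.sqrt K <= normc (b%:C - l + k%:R).
Proof.
move=> K0 /(_ k) h; apply: ler_sqr_ge0; first exact: normc_ge0.
rewrite sqr_sqrtr// sqr_normc !(ReD, ImD, ReN, ImN, ReC, ImC, Re_nat, Im_nat).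
rewrite add0r addr0 sqrrN (le_trans _ h)//.
by rewrite ler_peMr// lerDl sqr_ge0.
Qed.

Lemma holo_Qnum (U : set R[i]) (gam b B K : R) (n : nat) : 0 < K ->
  (forall l, U l -> normc l <= B /\ pole_sep b K l) ->
  exists f', holo U (fun l => Qnum gam b l n) f'.
Proof.
move=> K0 hU.
have UB l : U l -> normc l <= B by case/hU.
have hid := holo_id UB.
have hprod : forall k : nat, exists f', holo U (fun l =>
    (gam%:C + b%:C + l + k%:R) / (b%:C - l + k%:R)) f'.
  move=> k; eexists; apply: holoM.
    by apply: holoD; [apply: holoD; [exact: holo_cst|exact: hid]|exact: holo_cst].
  apply: (@holoV R U _ _ (Num.sqrt K)); first by rewrite sqrtr_gt0.
    by move=> l /hU[_ h]; apply: pole_sep_normc => //; exact: ltW.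
  apply: holoD; last exact: holo_cst.
  apply: holoD; first exact: holo_cst.
  have := holoM (holo_cst U (-1)) hid; apply: eq_holo.
  by move=> l; rewrite mulN1r.
have [f' hf'] := holo_prod n hprod.
have h1 := holoM (holo_cst U (cexp (- (gam%:C * (ln n%:R)%:C)))) (holo_cexp (- 2 * ln n%:R) UB).
eexists; have := holoM h1 hf'; apply: eq_holo => l.
rewrite /Qnum /gauss_ratio -cexpD cpowE; congr (cexp _ * _).
by rewrite !rmorphM/= rmorphN/= rmorph_nat; ring.
Qed.

Variables gam b1 b2 : R.

Definition Phi l := Qlim gam b1 l * Qlim gam b2 l.

Definition zeta (sigma : R -> R) (s0 th t : R) : R[i] := (s0 + th * (sigma t - s0)) +i* t.

Lemma zeta0 sigma s0 t : zeta sigma s0 0 t = s0 +i* t.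
Proof. by rewrite /zeta mul0r addr0. Qed.

Lemma zeta1 sigma s0 t : zeta sigma s0 1 t = sigma t +i* t.
Proof. by rewrite /zeta mul1r addrC subrK. Qed.

(** The poles are real, so only small |t| is delicate: there sigma t and s0 both stay at distance d
    to the left of b, and so do the points between them. For |t| >= r the height alone separates. *)
Lemma pole_sep_zeta (b s0 : R) (sigma : R -> R) : {for 0, continuous sigma} ->
  sigma 0 < b -> s0 < b ->
  exists2 K : R, 0 < K & forall th t, 0 <= th <= 1 -> pole_sep b K (zeta sigma s0 th t).
Proof.
move=> cs sb s0b.
pose d := Num.min (b - sigma 0) (b - s0) / 2.
have d20 : 0 < Num.min (b - sigma 0) (b - s0) by rewrite lt_min !subr_gt0 sb.
have d0 : 0 < d by rewrite divr_gt0.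
have [ds d1] : d *+ 2 <= b - sigma 0 /\ d *+ 2 <= b - s0.
  by rewrite /d -mulr_natr divfK// !ge_min !lexx orbT.
have [r r0 hr] : exists2 r : R, 0 < r & forall t, `|t| < r -> sigma t <= b - d.
  have /cvgrPdist_lt/(_ d d0) := cs.
  move=> /nbhs_ballP[r /= r0 h]; exists r => // t tr.
  have /= := h t; rewrite /ball/= sub0r normrN => /(_ tr).
  by rewrite ltr_norml => /andP[]; move: ds; rewrite mulr2n; lra.
(* The bounds 1 and r^2 serve at height |t| >= r, where K (1 + x^2) <= r^2 + x^2; the third serves
   for x >= d, where K (1 + x^2) <= x^2. *)
pose K := Num.min 1 (Num.min (r ^+ 2) (d ^+ 2 / (1 + d ^+ 2))).
have d2 : 0 < 1 + d ^+ 2 by rewrite ltr_pwDl// sqr_ge0.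
exists K; first by rewrite !lt_min ltr01 exprn_gt0//= divr_gt0// exprn_gt0.
have K1 : K <= 1 by rewrite ge_min lexx.
have Kr : K <= r ^+ 2 by rewrite !ge_min lexx !orbT.
have Kd : K * (1 + d ^+ 2) <= d ^+ 2 by rewrite -ler_pdivlMr// !ge_min lexx !orbT.
move=> th t /andP[th0 th1] k; rewrite [Re _]/= [Im _]/=.
set x := b - _ + _.
have x2 := sqr_ge0 x; have t2 := sqr_ge0 t.
have [tr|rt] := ltP `|t| r; last first.
  have : r ^+ 2 <= t ^+ 2 by rewrite -[leRHS]real_normK ?num_real// lerXn2r ?nnegrE// ltW.
  move: (t ^+ 2) (x ^+ 2) x2 t2 => T X X0 T0; nra.
have st := hr _ tr.
have xd : d <= x.
  have k0 : (0 : R) <= k%:R by rewrite ler0n.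
  have s1 : s0 <= b - d by move: d1; rewrite mulr2n; lra.
  rewrite /x; have : s0 + th * (sigma t - s0) <= b - d.
    have -> : s0 + th * (sigma t - s0) = (1 - th) * s0 + th * sigma t by ring.
    nra.
  lra.
have xd2 : d ^+ 2 <= x ^+ 2 by rewrite lerXn2r ?nnegrE ?(ltW d0)// (le_trans (ltW d0)).
move: (t ^+ 2) (x ^+ 2) (d ^+ 2) x2 t2 xd2 Kd => T X D X0 T0 XD KD; nra.
Qed.

Lemma cmeasurable_Qnum_Complex d (T : measurableType d) (z : T -> R[i]) (b : R) (n : nat) :
  cmeasurable setT z -> cmeasurable setT (fun x => Qnum gam b (z x) n).
Proof.
move=> mz; rewrite /Qnum /gauss_ratio; apply: cmeasurableM.
  under eq_fun do rewrite cpowE; apply: cmeasurable_cexp; apply: cmeasurableM; last exact: cmeasurable_cst.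
  apply: cmeasurableB; first by apply: cmeasurableB => //; exact: cmeasurable_cst.
  by apply: cmeasurableD => //; exact: cmeasurable_cst.
apply: (@cmeasurable_prod R _ T setT n (fun k x => (gam%:C + b%:C + z x + k%:R) / (b%:C - z x + k%:R))) => k.
apply: cmeasurableM.
  by apply: cmeasurableD; [apply: cmeasurableD => //; exact: cmeasurable_cst|exact: cmeasurable_cst].
apply: cmeasurableV; apply: cmeasurableD; last exact: cmeasurable_cst.
by apply: cmeasurableB => //; exact: cmeasurable_cst.
Qed.

Lemma cmeasurable_ccvg d (T : measurableType d) (D : set T) (f_ : nat -> T -> R[i]) (f : T -> R[i]) :
  (forall n, cmeasurable D (f_ n)) -> (forall x, D x -> ccvg (f_ ^~ x) (f x)) -> cmeasurable D f.
Proof.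
move=> mf cf; split.
  by apply: (measurable_fun_cvg (h := fun n x => Re (f_ n x))) => [n|x /cf[]//]; have [] := mf n.
by apply: (measurable_fun_cvg (h := fun n x => Im (f_ n x))) => [n|x /cf[]//]; have [] := mf n.
Qed.

Lemma cmeasurable_Qlim d (T : measurableType d) (z : T -> R[i]) (b : R) :
  cmeasurable setT z -> cmeasurable setT (fun x => Qlim gam b (z x)).
Proof.
move=> mz; apply: (@cmeasurable_ccvg _ T setT (fun n x => Qnum gam b (z x) n)).
  by move=> n; exact: cmeasurable_Qnum_Complex.
by move=> x _; exact: Qnum_cvg.
Qed.

Lemma cmeasurable_Phi d (T : measurableType d) (z : T -> R[i]) :
  cmeasurable setT z -> cmeasurable setT (fun x => Phi (z x)).
Proof. by move=> mz; apply: cmeasurableM; exact: cmeasurable_Qlim. Qed.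

Section finite_shift.
Variables (sigma : R -> R) (s0 N K w : R).
Hypothesis dsigma : forall t, derivable sigma t 1.
Hypothesis cdsigma : continuous (derive1 sigma).
Hypothesis N0 : 0 <= N.
Hypothesis K0 : 0 < K.
Hypothesis sep1 : forall th t, 0 <= th <= 1 -> pole_sep b1 K (zeta sigma s0 th t).
Hypothesis sep2 : forall th t, 0 <= th <= 1 -> pole_sep b2 K (zeta sigma s0 th t).

Let csigma : continuous sigma.
Proof. by move=> t; apply: differentiable_continuous; apply/derivable1_diffP. Qed.

Let f n l := Qnum gam b1 l n * Qnum gam b2 l n * cexp (w%:C * l).
Let g l := Phi l * cexp (w%:C * l).

Let fg l : ccvg (f ^~ l) (g l).
Proof. by apply: ccvgM; [apply: ccvgM; exact: Qnum_cvg|exact: ccvg_cst]. Qed.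

Let mzeta th : cmeasurable setT (fun t => zeta sigma s0 th t).
Proof.
split; last exact: measurable_id.
apply: measurable_funD => //; apply: measurable_funM => //; apply: measurable_funB => //.
exact: continuous_measurable_fun.
Qed.

Let mzeta_th t : cmeasurable setT (fun th => zeta sigma s0 th t).
Proof. by split => //=; apply: measurable_funD => //; exact: measurable_funM. Qed.

Let mf d (T : measurableType d) (z : T -> R[i]) n :
  cmeasurable setT z -> cmeasurable setT (fun x => f n (z x)).
Proof.
move=> mz; apply: cmeasurableM.
  by apply: cmeasurableM; exact: cmeasurable_Qnum_Complex.
by apply: cmeasurable_cexp; apply: cmeasurableM => //; exact: cmeasurable_cst.
Qed.

(** Deformation holds for each approximant of Gauss, made of exponentials and rational factors
    without poles on U. The uniform bound of [Qnum_bounded] on this bounded region lets both sides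
    pass to the limit by dominated convergence. *)
Lemma finite_contour_shift :
  cintegral `[- N, N] (fun t => g (sigma t +i* t) * (derive1 sigma t +i* 1) - g (s0 +i* t) * 'i) =
  cintegral `[0, 1] (fun th => g (zeta sigma s0 th N) * (sigma N - s0)%:C
     - g (zeta sigma s0 th (- N)) * (sigma (- N) - s0)%:C).
Proof.
have [M M0 hM] := @bounded_itv_continuous R sigma (- N) N (fun t _ => @csigma t).
have [M' M'0 hM'] := @bounded_itv_continuous R (derive1 sigma) (- N) N (fun t _ => @cdsigma t).
pose B0 := `|s0| + (M + `|s0|).
pose U : set R[i] := [set l | [/\ `|Re l| <= B0, `|Im l| <= N, pole_sep b1 K l & pole_sep b2 K l]].
have zU th t : 0 <= th <= 1 -> - N <= t <= N -> U (zeta sigma s0 th t).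
  move=> th01 tN; split; rewrite ?[Re _]/= ?[Im _]/=; [| |exact: sep1|exact: sep2].
    rewrite (le_trans (ler_normD _ _))// lerD2l normrM -[leRHS]mul1r ler_pM//.
      by case/andP: th01 => h1 h2; rewrite ger0_norm.
    by rewrite (le_trans (ler_normB _ _))// lerD2r hM.
  by rewrite ler_norml.
have UB l : U l -> normc l <= B0 + N.
  by move=> [h1 h2 _ _]; rewrite (le_trans (normc_le_ReIm _))// lerD.
have hf n : exists f', holo U (f n) f'.
  have [f1 h1] : exists f', holo U (fun l => Qnum gam b1 l n) f'.
    by apply: (@holo_Qnum U gam b1 (B0 + N) K n K0) => l Ul; split; [exact: UB|case: Ul].
  have [f2 h2] : exists f', holo U (fun l => Qnum gam b2 l n) f'.
    by apply: (@holo_Qnum U gam b2 (B0 + N) K n K0) => l Ul; split; [exact: UB|case: Ul].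
  by eexists; apply: holoM; [apply: holoM; [exact: h1|exact: h2]|exact: holo_cexp UB].
have [C1 [n1 hC1]] := @Qnum_bounded R gam b1 (`|b1| + B0) (`|gam| + 2 * B0) K N K0.
have [C2 [n2 hC2]] := @Qnum_bounded R gam b2 (`|b2| + B0) (`|gam| + 2 * B0) K N K0.
pose C := C1 * C2 * expR (`|w| * B0).
(* The uniform bounds hold from [n0] on only; the sequences are shifted by [n0] so that domination
   holds for every index. *)
pose n0 := maxn n1 n2.
have fC n l : U l -> (n0 <= n)%N -> normc (f n l) <= C.
  move=> [h1 h2 h3 h4]; rewrite geq_max => /andP[n1n n2n].
  have hB b : `|b - Re l| <= `|b| + B0 by rewrite (le_trans (ler_normB _ _))// lerD2l.
  have hG : `|gam + 2 * Re l| <= `|gam| + 2 * B0.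
    by rewrite (le_trans (ler_normD _ _))// lerD2l normrM ger0_norm// ler_wpM2l.
  rewrite /f 2!normcM normc_cexp !ler_pM ?mulr_ge0 ?normc_ge0 ?expR_ge0//.
  - exact: hC1 (hB _) hG h2 h3 n1n.
  - exact: hC2 (hB _) hG h2 h4 n2n.
  - rewrite ler_expR ReM ReC ImC mul0r subr0 (le_trans (ler_norm _))// normrM.
    by rewrite ler_wpM2l.
have C0 : 0 <= C.
  have U0 : U (zeta sigma s0 0 0) by apply: zU; rewrite ?lexx ?ler01 ?oppr_le0 ?N0.
  exact: le_trans (normc_ge0 _) (fC n0 _ U0 (leqnn _)).
have icst a b (c : R) : intg `[a, b] (fun=> c).
  by apply: intg_itv_continuous => x _; exact: cst_continuous.
have mds : cmeasurable setT (fun t => derive1 sigma t +i* 1).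
  by split => /=; [exact: continuous_measurable_fun|exact: measurable_cst].
have E n : cintegral `[- N, N] (fun t => f (n + n0)%N (zeta sigma s0 1 t) * (derive1 sigma t +i* 1)
      - f (n + n0)%N (zeta sigma s0 0 t) * 'i) =
    cintegral `[0, 1] (fun th => f (n + n0)%N (zeta sigma s0 th N) * (sigma N - s0)%:C
     - f (n + n0)%N (zeta sigma s0 th (- N)) * (sigma (- N) - s0)%:C).
  have [f' hf'] := hf (n + n0)%N.
  have := contour_deformation hf' dsigma cdsigma N0 zU.
  by move=> <-; apply: eq_cintegral => t _; rewrite zeta1 zeta0.
have shift (u : nat -> R[i]) v : ccvg u v -> ccvg (fun n => u (n + n0)%N) v.
  by move=> [u1 u2]; split; [rewrite (cvg_shiftn n0 (fun n => Re (u n)))|rewrite (cvg_shiftn n0 (fun n => Im (u n)))].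
have fgs l : ccvg (fun n => f (n + n0)%N l) (g l) := shift (f ^~ l) _ (fg l).
have fCn n l : U l -> normc (f (n + n0)%N l) <= C by move=> Ul; apply: fC => //; exact: leq_addl.
have ni : normc ('i : R[i]) = 1 by rewrite /= expr0n expr1n add0r sqrtr1.
pose u n t := f (n + n0)%N (zeta sigma s0 1 t) * (derive1 sigma t +i* 1)
      - f (n + n0)%N (zeta sigma s0 0 t) * 'i.
pose u' t := g (zeta sigma s0 1 t) * (derive1 sigma t +i* 1) - g (zeta sigma s0 0 t) * 'i.
pose v n th := f (n + n0)%N (zeta sigma s0 th N) * (sigma N - s0)%:C
     - f (n + n0)%N (zeta sigma s0 th (- N)) * (sigma (- N) - s0)%:C.
pose v' th := g (zeta sigma s0 th N) * (sigma N - s0)%:C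
     - g (zeta sigma s0 th (- N)) * (sigma (- N) - s0)%:C.
have mu_ n : cmeasurable setT (u n).
  by apply: cmeasurableB; apply: cmeasurableM; [exact: mf|exact: mds|exact: mf|exact: cmeasurable_cst].
have mv_ n : cmeasurable setT (v n).
  by apply: cmeasurableB; apply: cmeasurableM; [exact: mf|exact: cmeasurable_cst|exact: mf|exact: cmeasurable_cst].
have uu' t : ccvg (u ^~ t) (u' t).
  exact: (ccvgD (ccvgM (fgs _) (ccvg_cst _)) (ccvgN (ccvgM (fgs _) (ccvg_cst _)))).
have vv' th : ccvg (v ^~ th) (v' th).
  exact: (ccvgD (ccvgM (fgs _) (ccvg_cst _)) (ccvgN (ccvgM (fgs _) (ccvg_cst _)))).
have uB n t : `[- N, N]%classic t -> normc (u n t) <= C * (M' + 1) + C.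
  rewrite /= in_itv/= => tN.
  have u0 : U (zeta sigma s0 0 t) by apply: zU; rewrite ?lexx ?ler01.
  have u1 : U (zeta sigma s0 1 t) by apply: zU; rewrite ?lexx ?ler01.
  rewrite /u (le_trans (normcD _ _))// normc_N lerD//.
    rewrite (normcM (f _ _)) ler_pM ?normc_ge0 ?fCn//.
    by rewrite (le_trans (normc_le_ReIm _))//= normr1 lerD2r; exact: hM'.
  by rewrite (normcM (f _ _)) ni mulr1 fCn.
have NN : - N <= N by rewrite (le_trans _ N0)// oppr_le0.
have vB n th : `[0, 1]%classic th -> normc (v n th) <= C * `|sigma N - s0| + C * `|sigma (- N) - s0|.
  rewrite /= in_itv/= => th01.
  have u0 : U (zeta sigma s0 th N) by apply: zU; rewrite ?lexx ?NN.
  have u1 : U (zeta sigma s0 th (- N)) by apply: zU; rewrite ?lexx ?NN.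
  by rewrite /v (le_trans (normcD _ _))// normc_N lerD// (normcM (f _ _)) normcC ler_wpM2r// fCn.
have [_ c1] := @cdominated_cvg R `[- N, N] u u' (fun=> C * (M' + 1) + C) (measurable_itv _)
  (fun n => cmeasurableS measurableT (@subsetT _ _) (mu_ n)) (fun t _ => uu' t) (icst _ _ _) uB.
have [_ c2] := @cdominated_cvg R `[0, 1] v v' (fun=> C * `|sigma N - s0| + C * `|sigma (- N) - s0|)
  (measurable_itv _)
  (fun n => cmeasurableS measurableT (@subsetT _ _) (mv_ n)) (fun t _ => vv' t) (icst _ _ _) vB.
have c3 : ccvg (fun n => cintegral `[0, 1] (v n)) (cintegral `[- N, N] u').
  by apply: ccvg_near c1; apply: nearW => n; exact: E.
rewrite -[RHS](ccvg_unique c3 c2).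
by apply: eq_cintegral => t _; rewrite /u' zeta1 zeta0.
Qed.

End finite_shift.

End Contour_shift.

(** * Fourier transform *)

Section Half_lines.
Variable R : realType.
Local Notation mu := (@lebesgue_measure R).
Local Notation intg D f := (mu.-integrable D (EFin \o f)).
Implicit Types (f : R -> R) (e p t u : R).

Definition nonneg_line : set R := [set t | 0 <= t].
Definition neg_line : set R := [set t | t < 0].

Lemma exhaustion_nonneg : exhaustion nonneg_line (fun=> 0) (fun n => n%:R).
Proof.
split; [|by move=> n|by move=> n m nm; rewrite lexx ler_nat].
apply/seteqP; split => x.
  rewrite /nonneg_line/= => x0.
  have [n _ /(_ n (leqnn n)) hn] := @nbhs_infty_gtr R x.
  by exists n => //=; rewrite in_itv/= x0 ltW.
by move=> [n _] /=; rewrite in_itv/= => /andP[].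
Qed.

Lemma exhaustion_neg : exhaustion neg_line (fun n => - n.+1%:R) (fun n => - n.+1%:R^-1).
Proof.
have [Rp h1 h2] := exhaustion_Rplus R.
split.
- apply/seteqP; split => x.
    rewrite /neg_line/= => x0; have : Rplus R (- x) by rewrite /Rplus/= oppr_gt0.
    rewrite Rp => -[n _ /=]; rewrite in_itv/= => /andP[nx xn].
    by exists n => //=; rewrite in_itv/= lerNl xn lerNr nx.
  move=> [n _] /=; rewrite in_itv/= => /andP[_ xn].
  by apply: (le_lt_trans xn); rewrite oppr_lt0 invr_gt0.
- by move=> n; rewrite lerN2; exact: h1.
- by move=> n m /h2[h3 h4]; rewrite !lerN2.
Qed.

Lemma measurable_nonneg : measurable nonneg_line.
Proof. exact: exhaustion_measurable exhaustion_nonneg. Qed.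

Lemma measurable_neg : measurable neg_line.
Proof. exact: exhaustion_measurable exhaustion_neg. Qed.

Lemma nonneg_negU : [set: R] = nonneg_line `|` neg_line.
Proof.
by apply/seteqP; split => // x _; rewrite /nonneg_line /neg_line/=; case: (leP 0 x); [left|right].
Qed.

Lemma intg_halves f : measurable_fun setT f -> intg nonneg_line f -> intg neg_line f ->
  intg setT f /\
  \int[mu]_(t in setT) f t = \int[mu]_(t in nonneg_line) f t + \int[mu]_(t in neg_line) f t.
Proof.
move=> mf i1 i2.
have m1 := measurable_nonneg; have m2 := measurable_neg.
have i : intg setT f.
  have j1 := intg_norm ((intg_restrict _ m1).1 i1).
  have j2 := intg_norm ((intg_restrict _ m2).1 i2).
  apply: (intg_le _ mf (intgD _ j1 j2)) => // t _.
  rewrite !indicE; have [t0|t0] := leP 0 t.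
    by rewrite [t \in nonneg_line]mem_set// mulr1 lerDl.
  by rewrite [t \in neg_line]mem_set// mulr1 lerDr.
split => //; rewrite {1}nonneg_negU Rintegral_setU//.
- by rewrite -nonneg_negU.
- apply/disj_setPS => t [/=]; rewrite /nonneg_line /neg_line/= => h1 h2.
  by move: h2; rewrite ltNge h1.
Qed.

Lemma measurable_expR_abs (c : R) : measurable_fun setT (fun u : R => expR (c * `|u|)).
Proof.
by apply: measurableT_comp => //; apply: measurable_funM.
Qed.

Lemma is_derive_lin (c : R) t : is_derive t 1 (fun u : R => c * u) c.
Proof.
have := is_deriveMr (is_derive_cst c t 1) (is_derive_id t 1).
by move/is_derive_eq; apply; rewrite mulr1 mulr0 addr0.
Qed.

Lemma is_derive_expR_lin (c : R) t : is_derive t 1 (fun u : R => expR (c * u)) (expR (c * t) * c).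
Proof. exact: (is_derive_expRc (is_derive_lin c t)). Qed.

Lemma is_derive_cos_lin (c : R) t : is_derive t 1 (fun u : R => cos (u * c)) (- (sin (t * c) * c)).
Proof.
have h : is_derive t 1 (fun u : R => u * c) c.
  by under eq_fun do rewrite mulrC; exact: is_derive_lin.
have := @is_derive1_comp _ cos (fun u : R => u * c) t _ _ (is_derive_cos _) h.
by move/is_derive_eq; apply; rewrite mulNr.
Qed.

Lemma is_derive_sin_lin (c : R) t : is_derive t 1 (fun u : R => sin (u * c)) (cos (t * c) * c).
Proof.
have h : is_derive t 1 (fun u : R => u * c) c.
  by under eq_fun do rewrite mulrC; exact: is_derive_lin.
by have := @is_derive1_comp _ sin (fun u : R => u * c) t _ _ (is_derive_sin _) h.
Qed.

Lemma cvg_expR_Nnat (c : R) : 0 < c -> expR (- c * n%:R) @[n --> \oo] --> (0 : R).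
Proof.
move=> c0; have h := @cvg_natV R.
have h2 : c^-1 * n%:R^-1 @[n --> \oo] --> (0 : R).
  by rewrite -[X in _ --> X](mulr0 c^-1); apply: cvgM => //; exact: cvg_cst.
apply: (squeeze_cvgr _ (cvg_cst 0) h2); near=> n.
have n0 : 0 < (n%:R : R) by near: n; exact: nbhs_infty_gtr.
rewrite expR_ge0/= mulNr expRN -invfM lef_pV2 ?posrE ?expR_gt0 ?mulr_gt0//.
by have := expR_ge1Dx (c * n%:R); apply: le_trans; rewrite lerDr.
Unshelve. all: by end_near. Qed.

Lemma intg_expR_abs e : 0 < e -> intg setT (fun u => expR (- e * `|u|)).
Proof.
move=> e0; have en : e != 0 by exact: lt0r_neq0.
have mf := measurable_expR_abs (- e).
apply: (intg_halves mf _ _).1.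
  have : intg nonneg_line (fun u => expR (- e * u)).
    apply: (@intg_improper R _ _ _ (fun u => - e^-1 * expR (- e * u)) _ e^-1 exhaustion_nonneg).
    - by apply: measurable_funTS; apply: measurableT_comp => //; exact: measurable_funM.
    - move=> u _; have := is_deriveMr (is_derive_cst (- e^-1) u 1) (is_derive_expR_lin (- e) u).
      by move/is_derive_eq; apply; rewrite mulr0 addr0 /=; field.
    - by move=> u _; exact: is_derive_continuous (is_derive_expR_lin _ _).
    - by move=> u _; exact: expR_ge0.
    - move=> u; rewrite /nonneg_line/= => u0.
      rewrite normrM normrN !ger0_norm ?invr_ge0 ?expR_ge0 ?(ltW e0)// ler_piMr ?invr_ge0 ?(ltW e0)//.
      by rewrite -expR0 ler_expR mulNr oppr_le0 mulr_ge0 ?(ltW e0).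
  apply: eq_intg; first exact: measurable_nonneg.
  by move=> u; rewrite /nonneg_line/= => u0; rewrite ger0_norm.
have : intg neg_line (fun u => expR (e * u)).
  apply: (@intg_improper R _ _ _ (fun u => e^-1 * expR (e * u)) _ e^-1 exhaustion_neg).
  - by apply: measurable_funTS; apply: measurableT_comp => //; exact: measurable_funM.
  - move=> u _; have := is_deriveMr (is_derive_cst (e^-1) u 1) (is_derive_expR_lin e u).
    by move/is_derive_eq; apply; rewrite mulr0 addr0 /=; field.
  - by move=> u _; exact: is_derive_continuous (is_derive_expR_lin _ _).
  - by move=> u _; exact: expR_ge0.
  - move=> u; rewrite /neg_line/= => u0.
    rewrite normrM !ger0_norm ?invr_ge0 ?expR_ge0 ?(ltW e0)// ler_piMr ?invr_ge0 ?(ltW e0)//.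
    by rewrite -expR0 ler_expR mulr_ge0_le0 ?(ltW e0) ?(ltW u0).
apply: eq_intg; first exact: measurable_neg.
by move=> u; rewrite /neg_line/= => u0; rewrite ltr0_norm// mulrNN.
Qed.

(** On each half-line e^(cu) cos (ut) and e^(cu) sin (ut) have primitives in their own span; the
    coefficients solve a linear system of determinant e^2 + t^2. *)
Lemma poisson_integral e t : 0 < e ->
  \int[mu]_(u in setT) (expR (- e * `|u|) * cos (u * t)) = 2 * e / (e ^+ 2 + t ^+ 2) /\
  \int[mu]_(u in setT) (expR (- e * `|u|) * sin (u * t)) = 0.
Proof.
move=> e0; have en : e != 0 by exact: lt0r_neq0.
have q0 : 0 < e ^+ 2 + t ^+ 2 by rewrite ltr_pwDl ?sqr_ge0 ?exprn_gt0.
set q := _ + _ in q0 *; have qn : q != 0 by exact: lt0r_neq0.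
have mexp := measurable_expR_abs (- e).
have mcos : measurable_fun setT (fun u => cos (u * t)).
  by apply: measurableT_comp; [apply: continuous_measurable_fun; exact: continuous_cos|exact: measurable_funM].
have msin : measurable_fun setT (fun u => sin (u * t)).
  by apply: measurableT_comp; [apply: continuous_measurable_fun; exact: continuous_sin|exact: measurable_funM].
have i0 := intg_expR_abs e0.
have ic : intg setT (fun u => expR (- e * `|u|) * cos (u * t)).
  apply: (intg_le _ _ i0) => //; first exact: measurable_funM.
  by move=> u _; rewrite normrM ger0_norm ?expR_ge0// ler_piMr ?expR_ge0// cos_max.
have is_ : intg setT (fun u => expR (- e * `|u|) * sin (u * t)).
  apply: (intg_le _ _ i0) => //; first exact: measurable_funM.
  by move=> u _; rewrite normrM ger0_norm ?expR_ge0// ler_piMr ?expR_ge0// sin_max.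
have S D f : measurable D -> intg setT f -> intg D f by move=> mD; exact: intgS.
have m1 := measurable_nonneg; have m2 := measurable_neg.
(* a e^{cu} cos(ut) + b e^{cu} sin(ut) has derivative e^{cu} ((ac + bt) cos + (bc - at) sin) *)
have dF (c a b : R) u : is_derive u 1 (fun u => expR (c * u) * (a * cos (u * t) + b * sin (u * t)))
    (expR (c * u) * ((a * c + b * t) * cos (u * t) + (b * c - a * t) * sin (u * t))).
  have h1 := is_deriveMr (is_derive_cst a u 1) (is_derive_cos_lin t u).
  have h2 := is_deriveMr (is_derive_cst b u 1) (is_derive_sin_lin t u).
  have := is_deriveMr (is_derive_expR_lin c u) (is_deriveDr h1 h2).
  by move/is_derive_eq; apply; rewrite /=; ring.
have cF (c a b : R) u : {for u, continuous (fun u => expR (c * u) * (a * cos (u * t) + b * sin (u * t)))}.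
  exact: is_derive_continuous (dF c a b u).
have bd (a b u : R) : `|a * cos (u * t) + b * sin (u * t)| <= `|a| + `|b|.
  rewrite (le_trans (ler_normD _ _))// !normrM.
  by rewrite lerD// -[leRHS]mulr1 ler_wpM2l// ?cos_max ?sin_max.
have lim0 (a b : R) : expR (- e * n%:R) * (a * cos (n%:R * t) + b * sin (n%:R * t)) @[n --> \oo] --> (0 : R).
  have h : (`|a| + `|b|) * expR (- e * n%:R) @[n --> \oo] --> (0 : R).
    rewrite -[X in _ --> X](mulr0 (`|a| + `|b|)); apply: cvgM; [exact: cvg_cst|exact: cvg_expR_Nnat].
  apply/norm_cvg0P; apply: (squeeze_cvgr _ (cvg_cst 0) h); apply: nearW => n.
  by rewrite normr_ge0/= normrM [`|expR _|]ger0_norm ?expR_ge0// mulrC ler_wpM2r ?expR_ge0.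
(* The equations for A and B say that the combination with coefficients a, b is a primitive; it
   vanishes at infinity and equals a at 0, hence the value - a. *)
have pos (a b A B : R) f : (forall u, 0 <= u -> expR (- e * `|u|) * (A * cos (u * t) + B * sin (u * t)) = f u) ->
    intg nonneg_line f -> a * - e + b * t = A -> b * - e - a * t = B ->
    \int[mu]_(u in nonneg_line) f u = - a.
  move=> fE fi EA EB.
  pose g u := expR (- e * u) * (A * cos (u * t) + B * sin (u * t)).
  have gf u : nonneg_line u -> g u = f u.
    by rewrite /nonneg_line/= => u0; rewrite -fE// ger0_norm.
  rewrite -(eq_Rint gf).
  apply: (@Rint_improper R _ _ _ (fun u => expR (- e * u) * (a * cos (u * t) + b * sin (u * t))) g _ exhaustion_nonneg).
  - by move=> u _; have := dF (- e) a b u; rewrite EA EB.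
  - by move=> u _; exact: cF.
  - by apply: eq_intg fi => // u /gf.
  - have h : expR (- e * n%:R) * (a * cos (n%:R * t) + b * sin (n%:R * t)) - a @[n --> \oo] --> - a.
      by rewrite -[X in _ --> X]sub0r; apply: cvgB; [exact: lim0|exact: cvg_cst].
    apply: cvg_trans h; apply: near_eq_cvg; apply: nearW => n /=.
    by rewrite mulr0 expR0 mul0r cos0 sin0 mulr0 addr0 mulr1 mul1r.
have neg (a b A B : R) f : (forall u, u < 0 -> expR (- e * `|u|) * (A * cos (u * t) + B * sin (u * t)) = f u) ->
    intg neg_line f -> a * e + b * t = A -> b * e - a * t = B ->
    \int[mu]_(u in neg_line) f u = a.
  move=> fE fi EA EB.
  pose g u := expR (e * u) * (A * cos (u * t) + B * sin (u * t)).
  have gf u : neg_line u -> g u = f u.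
    by rewrite /neg_line/= => u0; rewrite -fE// ltr0_norm// mulrNN.
  pose F u := expR (e * u) * (a * cos (u * t) + b * sin (u * t)).
  rewrite -(eq_Rint gf).
  apply: (@Rint_improper R _ _ _ F g _ exhaustion_neg).
  - by move=> u _; have := dF e a b u; rewrite EA EB.
  - by move=> u _; exact: cF.
  - by apply: eq_intg fi => // u /gf.
  - rewrite -[X in _ --> X]subr0; apply: cvgB.
      have F0 : F 0 = a by rewrite /F mulr0 expR0 mul0r cos0 sin0 mulr0 addr0 mulr1 mul1r.
      have cv : - n.+1%:R^-1 @[n --> \oo] --> (0 : R).
        by rewrite -[X in _ --> X]oppr0; apply: cvgN; exact: cvg_harmonic.
      have cF0 : F x @[x --> (0 : R)] --> a by have := cF e a b 0; rewrite /prop_for /continuous_at -/(F 0) F0.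
      exact: (cvg_comp _ _ cv cF0).
    have := lim0 a (- b); rewrite -(cvg_shiftS (fun n => expR (- e * n%:R) * (a * cos (n%:R * t) + - b * sin (n%:R * t)))).
    apply: cvg_trans; apply: near_eq_cvg; apply: nearW => n.
    have NE (N : R) : expR (- e * N) * (a * cos (N * t) + - b * sin (N * t)) = F (- N).
      by rewrite /F mulNr mulrN [- N * t]mulNr cosN sinN mulNr mulrN.
    exact: NE.
split.
  have [_ ->] := intg_halves (measurable_funM mexp mcos) (S _ _ m1 ic) (S _ _ m2 ic).
  rewrite (pos (- e / q) (t / q) 1 0)//; [|by move=> u _; rewrite mul1r mul0r addr0|exact: S| |]; last 2 first.
  - by rewrite -[RHS](divff qn) /q; field; exact: qn.
  - by field; exact: qn.
  rewrite (neg (e / q) (t / q) 1 0)//; [|by move=> u _; rewrite mul1r mul0r addr0|exact: S| |]; last 2 first.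
  - by rewrite -[RHS](divff qn) /q; field; exact: qn.
  - by field; exact: qn.
  by field; exact: qn.
have [_ ->] := intg_halves (measurable_funM mexp msin) (S _ _ m1 is_) (S _ _ m2 is_).
rewrite (pos (- t / q) (- e / q) 0 1)//; [|by move=> u _; rewrite mul1r mul0r add0r|exact: S| |]; last 2 first.
- by field; exact: qn.
- by rewrite -[RHS](divff qn) /q; field; exact: qn.
rewrite (neg (- t / q) (e / q) 0 1)//; [|by move=> u _; rewrite mul1r mul0r add0r|exact: S| |]; last 2 first.
- by field; exact: qn.
- by rewrite -[RHS](divff qn) /q; field; exact: qn.
by field; exact: qn.
Qed.

(** From (1 + |t|)^2 <= 2 (1 + t^2) the function is at most 2^p (1 + |t|)^(-2p), which on each
    half-line has an elementary primitive, bounded because 2p > 1. *)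
Lemma intg_japanese p : 2^-1 < p -> intg setT (fun t => expR (- p * ln (1 + t ^+ 2))).
Proof.
move=> p2; pose q := 2 * p - 1; have q0 : 0 < q by rewrite /q; lra.
have qn : q != 0 by exact: lt0r_neq0.
have mh : measurable_fun setT (fun t : R => expR (- (2 * p) * ln (1 + `|t|))).
  apply: measurableT_comp => //; apply: measurable_funM => //.
  by apply: measurableT_comp => //; apply: measurable_funD => //; exact: measurableT_comp.
have dln (s t : R) : 0 < 1 + s * t -> is_derive t 1 (fun u : R => expR (- q * ln (1 + s * u)))
    (- q * s * expR (- (2 * p) * ln (1 + s * t))).
  move=> h; have d1 : is_derive t 1 (fun u : R => 1 + s * u) s.
    by have := is_deriveDr (is_derive_cst (1 : R) t 1) (is_derive_lin s t); move/is_derive_eq; apply; rewrite add0r.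
  have d2 := @is_derive1_comp _ (@ln R) (fun u : R => 1 + s * u) t _ _ (is_derive_ln_gt0 h) d1.
  have d3 := is_deriveMr (is_derive_cst (- q) t 1) d2.
  have := is_derive_expRc d3; move/is_derive_eq; apply; rewrite /= mulr0 addr0.
  have -> : - (2 * p) * ln (1 + s * t) = - q * ln (1 + s * t) - ln (1 + s * t) by rewrite /q; ring.
  by rewrite expRD expRN lnK ?posrE//; ring.
have cont (s t : R) : 0 < 1 + s * t -> {for t, continuous (fun u => expR (- (2 * p) * ln (1 + s * u)))}.
  move=> h; have d1 : is_derive t 1 (fun u : R => 1 + s * u) s.
    by have := is_deriveDr (is_derive_cst (1 : R) t 1) (is_derive_lin s t); move/is_derive_eq; apply; rewrite add0r.
  have d2 := @is_derive1_comp _ (@ln R) (fun u : R => 1 + s * u) t _ _ (is_derive_ln_gt0 h) d1.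
  have d3 := is_deriveMr (is_derive_cst (- (2 * p)) t 1) d2.
  exact: (is_derive_continuous (is_derive_expRc d3)).
have bd (s t : R) : 0 <= s * t -> `|q^-1 * expR (- q * ln (1 + s * t))| <= q^-1.
  move=> h; rewrite normrM !ger0_norm ?invr_ge0 ?expR_ge0 ?(ltW q0)// ler_piMr ?invr_ge0 ?(ltW q0)//.
  have l0 : 0 <= ln (1 + s * t) by apply: ln_ge0; rewrite lerDl.
  by rewrite -[leRHS]expR0 ler_expR mulNr oppr_le0 mulr_ge0 ?(ltW q0).
(* The sign s = 1 or -1 treats both half-lines at once, with s t = |t| on each. *)
have side (s : R) D a b : exhaustion D a b -> s * s = 1 -> (forall t, D t -> 0 <= s * t) ->
    intg D (fun t : R => expR (- (2 * p) * ln (1 + s * t))).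
  move=> ex ss st; have h t : D t -> 0 < 1 + s * t by move=> /st h; rewrite ltr_pwDl.
  apply: (@intg_improper R D a b (fun u => - (s * q^-1) * expR (- q * ln (1 + s * u)))
    (fun t => expR (- (2 * p) * ln (1 + s * t))) (`|s| * q^-1) ex).
  - apply: measurable_funTS; apply: measurableT_comp => //; apply: measurable_funM => //.
    by apply: measurableT_comp => //; apply: measurable_funD => //; exact: measurable_funM.
  - move=> t Dt; have := is_deriveMr (is_derive_cst (- (s * q^-1)) t 1) (dln s t (h t Dt)).
    move/is_derive_eq; apply; rewrite /= mulr0 addr0.
    rewrite -[RHS]mul1r mulrA; congr (_ * _).
    by rewrite -ss; field; exact: qn.
  - by move=> t Dt; apply: cont; exact: h.
  - by move=> t _; exact: expR_ge0.
  - move=> t Dt; rewrite mulNr normrN -mulrA normrM ler_wpM2l//; apply: bd; exact: st.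
have ih : intg setT (fun t : R => expR (- (2 * p) * ln (1 + `|t|))).
  apply: (intg_halves mh _ _).1.
    have s1 (t : R) : nonneg_line t -> 0 <= 1 * t by rewrite mul1r.
    have := side 1 _ _ _ exhaustion_nonneg (mulr1 1) s1.
    apply: eq_intg; first exact: measurable_nonneg.
    by move=> t; rewrite /nonneg_line/= => t0; rewrite mul1r ger0_norm.
  have s1 (t : R) : neg_line t -> 0 <= -1 * t by rewrite /neg_line/= => /ltW; rewrite mulN1r oppr_ge0.
  have ss : -1 * -1 = 1 :> R by rewrite mulrNN mulr1.
  have := side (-1) _ _ _ exhaustion_neg ss s1.
  apply: eq_intg; first exact: measurable_neg.
  by move=> t; rewrite /neg_line/= => t0; rewrite mulN1r ltr0_norm.
apply: (intg_le _ _ (intgZ (expR (p * ln 2)) _ ih)) => //.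
  apply: measurableT_comp => //; apply: measurable_funM => //.
  by apply: measurableT_comp => //; apply: measurable_funD => //; exact: measurable_funX.
move=> t _; rewrite ger0_norm ?expR_ge0// -expRD ler_expR.
have t0 := normr_ge0 t.
have p1 : 0 < 1 + `|t| by rewrite ltr_pwDl.
have p3 : 0 < 1 + t ^+ 2 by rewrite ltr_pwDl// sqr_ge0.
have h : 2 * ln (1 + `|t|) <= ln 2 + ln (1 + t ^+ 2).
  rewrite -lnM ?posrE// mulr_natl -lnXn// ler_ln ?posrE ?exprn_gt0 ?mulr_gt0//.
  have -> : t ^+ 2 = `|t| ^+ 2 by rewrite real_normK ?num_real.
  by have := sqr_ge0 (`|t| - 1); nra.
by have : 0 < p; [lra|nra].
Qed.

End Half_lines.

(** * Change of variables on an open set *)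

Section Substitution.
Variable R : realType.
Local Notation mu := (@lebesgue_measure R).
Local Notation intg D f := (mu.-integrable D (EFin \o f)).
Variables (F F' : R -> R) (D : set R).
Hypotheses (dF : forall t : R, is_derive t 1 F (F' t)) (cF' : continuous F').
Hypothesis F'_gt0 : forall t, 0 < F' t.
Hypothesis exD : exhaustion D (fun n => F (- n%:R)) (fun n => F n%:R).
Hypothesis oD : open D.

Let cF : continuous F.
Proof. by move=> t; exact: is_derive_continuous (dF t). Qed.

Let F'E : F^`()%classic = F'.
Proof. by apply/funext => t; rewrite derive1E; exact: derive_val. Qed.

Lemma subst_increasing s t : s < t -> F s < F t.
Proof.
move=> st; have [|c _ E] := @MVT R F F' s t st (fun x _ => dF x); last first.
  by rewrite -subr_gt0 E mulr_gt0// subr_gt0.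
by apply: within_continuous_itv => x _; exact: cF.
Qed.

Lemma subst_image t : D (F t).
Proof.
have [DE _ _] := exD; rewrite DE.
have [n _ /(_ n (leqnn n)) hn] := @nbhs_infty_gtr R `|t|.
have /ler_normlP[h1 h2] := ltW hn.
exists n => //=; rewrite in_itv/=; apply/andP; split.
  by rewrite ltW_homo//; [exact: subst_increasing|rewrite lerNl].
by rewrite ltW_homo//; exact: subst_increasing.
Qed.

Lemma Rint_subst_itv (G : R -> R) a b : a <= b ->
  (forall x, F a <= x <= F b -> {for x, continuous G}) ->
  \int[mu]_(x in `[F a, F b]) G x = \int[mu]_(t in `[a, b]) (G (F t) * F' t).
Proof.
move=> ab cG; rewrite /Rintegral.
rewrite (@integration_by_substitution_increasing _ F G a b)//.
- by congr fine; apply: eq_integral => t _; rewrite F'E.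
- by move=> x y _ _; exact: subst_increasing.
- by rewrite F'E => x _; exact: cF'.
- by rewrite F'E; apply: (cvgP (F' a)); apply: cvg_at_right_filter; exact: cF'.
- by rewrite F'E; apply: (cvgP (F' b)); apply: cvg_at_left_filter; exact: cF'.
- split.
  + by move=> x _; exact: ex_derive.
  + by apply: cvg_at_right_filter; exact: cF.
  + by apply: cvg_at_left_filter; exact: cF.
- by apply: within_continuous_itv => x /cG.
Qed.

Lemma subst_continuous (G : R -> R) : (forall x, D x -> {for x, continuous G}) ->
  continuous (fun t => G (F t) * F' t).
Proof.
move=> cG t; apply: cvgM; last exact: cF'.
by apply: continuous_comp; [exact: cF|apply: cG; exact: subst_image].
Qed.

(** In either direction the integrals of |G| over exhausting intervals agree with those of its
    pullback, and are bounded by the total integral assumed finite; monotone convergence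
    concludes. *)
Lemma intg_subst (G : R -> R) : (forall x, D x -> {for x, continuous G}) ->
  intg D G <-> intg setT (fun t => G (F t) * F' t).
Proof.
move=> cG.
have cN x : D x -> {for x, continuous (fun x => `|G x|)}.
  by move=> Dx; apply: continuous_comp; [exact: cG|exact: norm_continuous].
have mG : measurable_fun D G.
  by apply: open_continuous_measurable_fun => // x /set_mem; exact: cG.
have mN : measurable_fun D (fun x => `|G x|) by exact: measurableT_comp.
have sc := subst_continuous cG; have scN := subst_continuous cN.
have exT := exhaustion_setT R.
have mD := exhaustion_measurable exD.
have n0 n : - n%:R <= n%:R :> R by case: exT.
have E n : \int[mu]_(x in `[F (- n%:R), F n%:R]) `|G x| = \int[mu]_(t in `[- n%:R, n%:R]) (`|G (F t)| * F' t).
  apply: Rint_subst_itv => // x h; apply: cN; exact: (@exhaustion_mem _ _ _ _ n x exD).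
split => h.
  have i : intg setT (fun t => `|G (F t)| * F' t).
    apply: (@intg_exhaust R setT _ _ _ (\int[mu]_(x in D) `|G x|) exT).
    - exact: continuous_measurable_fun.
    - by move=> x _; exact: scN.
    - by move=> x _; rewrite mulr_ge0// ltW.
    - move=> n; rewrite -E Rint_restrict [leRHS]Rint_restrict; apply: ler_Rint => //.
      + apply/(intg_restrict _ (measurable_itv _)); apply: intgS (intg_norm h) => //.
        by move=> x /=; rewrite in_itv/= => /(exhaustion_mem exD).
      + by apply/(intg_restrict _ mD); exact: intg_norm.
      + move=> x _; rewrite ler_wpM2l// !indicE ler_nat.
        case: (boolP (x \in `[F (- n%:R), F n%:R]%classic)) => // /set_mem/=.
        by rewrite in_itv/= => /(exhaustion_mem exD) Dx; rewrite mem_set.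
  apply: intg_le i _ => //; first exact: continuous_measurable_fun.
  by move=> t _; rewrite normrM [`|F' t|]ger0_norm// ltW.
have h' : intg setT (fun t => `|G (F t)| * F' t).
  by apply: eq_intg (intg_norm h) => // t _; rewrite normrM [`|F' t|]ger0_norm// ltW.
have i : intg D (fun x => `|G x|).
  apply: (@intg_exhaust R D _ _ _ (\int[mu]_(t in setT) (`|G (F t)| * F' t)) exD) => //.
  move=> n; rewrite E Rint_restrict; apply: ler_Rint => //.
  + apply/(intg_restrict _ (measurable_itv _)); exact: intgS h'.
  + move=> x _; rewrite indicE; case: (_ \in _); rewrite ?mulr1// mulr0 mulr_ge0//.
    exact: ltW.
by apply: intg_le i _.
Qed.

Lemma Rint_subst (G : R -> R) : (forall x, D x -> {for x, continuous G}) -> intg D G ->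
  \int[mu]_(x in D) G x = \int[mu]_(t in setT) (G (F t) * F' t).
Proof.
move=> cG iG; have iG' := (intg_subst cG).1 iG.
have exT := exhaustion_setT R.
have c1 := cvg_exhaust exD iG; have c2 := cvg_exhaust exT iG'.
rewrite -(cvg_lim _ c1)// -(cvg_lim _ c2)//; congr (lim (_ @ \oo)); apply/funext => n.
apply: Rint_subst_itv; first by case: exT.
by move=> x /(@exhaustion_mem _ _ _ _ n x exD); exact: cG.
Qed.

End Substitution.

(** * Plancherel's identity *)

Section Plancherel.
Variable R : realType.
Local Notation mu := (@lebesgue_measure R).
Local Notation intg D f := (mu.-integrable D (EFin \o f)).
Implicit Types (psi : R -> R[i]).

Definition cis (x : R) : R[i] := cos x +i* sin x.

Lemma normc_cis x : normc (cis x) = 1.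
Proof. by rewrite /cis /= cos2Dsin2 sqrtr1. Qed.

Lemma cisD x y : cis (x + y) = cis x * cis y.
Proof. by apply: complexP; rewrite ?ReM ?ImM /= ?cosD ?sinD//; ring. Qed.

Lemma conj_cis x : conjc (cis x) = cis (- x).
Proof. by rewrite /cis /= cosN sinN. Qed.

Lemma cexp_cis (a b : R) : cexp (a +i* b) = (expR a)%:C * cis b.
Proof. by []. Qed.

Lemma cmeasurable_cis d (T : measurableType d) (D : set T) (f : T -> R) :
  measurable_fun D f -> cmeasurable D (fun x => cis (f x)).
Proof.
move=> mf; split => /=.
  by apply: measurableT_comp mf; apply: continuous_measurable_fun; exact: continuous_cos.
by apply: measurableT_comp mf; apply: continuous_measurable_fun; exact: continuous_sin.
Qed.

(** The kernel is e^(iut) without normalisation, which puts 2 pi into Plancherel's identity and 1 /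
    (2 pi) into the transform. *)
Definition fourier psi (u : R) : R[i] := cintegral setT (fun t => psi t * cis (u * t)).

Lemma cintegrable_cis psi (f : R -> R) : measurable_fun setT f -> cintegrable setT psi ->
  cintegrable setT (fun t => psi t * cis (f t)).
Proof.
move=> mf ip; apply: cintegrable_le (intg_normc _ ip) _ => //.
  apply: cmeasurableM; [exact: cintegrable_cmeasurable|exact: cmeasurable_cis].
by move=> x _; rewrite normcM normc_cis mulr1.
Qed.

Lemma normc_fourier psi u : cintegrable setT psi ->
  normc (fourier psi u) <= 2 * \int[mu]_(t in setT) normc (psi t).
Proof.
move=> ip; have mm : measurable_fun setT (fun t : R => u * t) by exact: measurable_funM.
apply: (le_trans (normc_cintegral _ (cintegrable_cis mm ip))) => //.
rewrite (@eq_Rint _ _ _ (fun t => normc (psi t)))// => t _.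
by rewrite normcM normc_cis mulr1.
Qed.

Lemma ccont_fourier psi u : cintegrable setT psi -> ccont (fourier psi) u.
Proof.
move=> ip.
have cv (v : nat -> R) : v n @[n --> \oo] --> u -> ccvg (fun n => fourier psi (v n)) (fourier psi u).
  move=> vu.
  apply: (@cdominated_cvg R setT (fun n t => psi t * cis (v n * t))
      (fun t => psi t * cis (u * t)) (fun t => normc (psi t)) measurableT _ _ (intg_normc measurableT ip) _).2.
  - move=> n; apply: cmeasurableM; [exact: cintegrable_cmeasurable|].
    by apply: cmeasurable_cis; exact: measurable_funM.
  - move=> t _; apply: ccvgM; first exact: ccvg_cst.
    have h : v n * t @[n --> \oo] --> u * t by apply: cvgM => //; exact: cvg_cst.
    split; [exact: (cvg_comp _ _ h (@continuous_cos R _))|exact: (cvg_comp _ _ h (@continuous_sin R _))].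
  - by move=> n t _; rewrite normcM normc_cis mulr1.
split; apply/(@cvg_nbhsP R R^o) => v /cv[]//.
Qed.

Lemma conjc_mul_normc (z : R[i]) : conjc z * z = (normc z ^+ 2)%:C.
Proof. by apply: complexP; rewrite sqr_normc ?ReM ?ImM Re_conj Im_conj /=; ring. Qed.

Lemma cmeasurable_conj d (T : measurableType d) (D : set T) (f : T -> R[i]) :
  cmeasurable D f -> cmeasurable D (fun x => conjc (f x)).
Proof.
move=> [h1 h2]; split; first by under eq_fun do rewrite Re_conj.
by under eq_fun do rewrite Im_conj; exact: measurableT_comp.
Qed.

Lemma cmeasurable_ccont psi : (forall t, ccont psi t) -> cmeasurable setT psi.
Proof. by move=> h; split; apply: continuous_measurable_fun => t; have [] := h t. Qed.

Lemma cmeasurable_fst psi : cmeasurable setT psi ->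
  cmeasurable setT (fun p : R * R => psi p.1).
Proof. by move=> [h1 h2]; split; [exact: (measurableT_comp h1)|exact: (measurableT_comp h2)]. Qed.

Lemma cmeasurable_snd psi : cmeasurable setT psi ->
  cmeasurable setT (fun p : R * R => psi p.2).
Proof. by move=> [h1 h2]; split; [exact: (measurableT_comp h1)|exact: (measurableT_comp h2)]. Qed.

Lemma fourier_adjoint psi h : cintegrable setT psi -> cintegrable setT h ->
  cintegral setT (fun u => h u * fourier psi u) = cintegral setT (fun t => psi t * fourier h t).
Proof.
move=> ip ih; have mT := @measurableT _ R.
have mp := cintegrable_cmeasurable ip; have mh := cintegrable_cmeasurable ih.
have mm (c : R) : measurable_fun setT (fun t : R => c * t) by exact: measurable_funM.
have bd (u t : R) : setT u -> setT t ->
    normc (h u * (psi t * cis (u * t))) <= normc (h u) * normc (psi t).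
  by move=> _ _; rewrite 2!normcM normc_cis mulr1.
have [_] := @cfubini R setT setT (fun u t => h u * (psi t * cis (u * t)))
  (fun u => normc (h u)) (fun t => normc (psi t)) mT mT
  (cmeasurableM (cmeasurable_fst mh) (cmeasurableM (cmeasurable_snd mp)
     (cmeasurable_cis (measurable_funM measurable_fst measurable_snd))))
  (intg_normc mT ih) (intg_normc mT ip) (fun u _ => normc_ge0 _) bd.
rewrite (@eq_cintegral _ _ _ (fun u => h u * fourier psi u)); last first.
  by move=> u _; rewrite cintegralZl//; exact: cintegrable_cis.
move=> ->; apply: eq_cintegral => t _.
rewrite -cintegralZl//; last exact: cintegrable_cis.
by apply: eq_cintegral => u _; rewrite [t * u]mulrC; exact: mulrCA.
Qed.

Lemma cintegral_real (D : set R) (f : R -> R) :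
  cintegral D (fun t => (f t)%:C) = (\int[mu]_(t in D) f t)%:C.
Proof.
apply: complexP => //; rewrite Im_cintegral /= /Rintegral.
by rewrite integral0_eq.
Qed.

Definition poisson (e w : R) : R := 2 * e / (e ^+ 2 + w ^+ 2).

Lemma fourier_expR_abs e t : 0 < e ->
  fourier (fun u => (expR (- e * `|u|))%:C) t = (poisson e t)%:C.
Proof.
move=> e0; have [h1 h2] := poisson_integral t e0.
apply: complexP; rewrite ?Re_cintegral ?Im_cintegral /=; last first.
  by rewrite -[RHS]h2; apply: eq_Rint => u _; rewrite /= mul0r addr0 [t * u]mulrC.
by rewrite /poisson -[RHS]h1; apply: eq_Rint => u _; rewrite /= mul0r subr0 [t * u]mulrC.
Qed.

Lemma cintegrable_expR_abs (e : R) (h : R -> R[i]) (M : R) : 0 < e -> cmeasurable setT h ->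
  (forall u, normc (h u) <= M) -> cintegrable setT (fun u => (expR (- e * `|u|))%:C * h u).
Proof.
move=> e0 mh hM; apply: (cintegrable_le _ _ (intgZ M _ (intg_expR_abs e0))) => //.
  by apply: cmeasurableM => //; apply: cmeasurable_real; exact: measurable_expR_abs.
by move=> u _; rewrite normcM normcC ger0_norm ?expR_ge0// mulrC ler_wpM2r ?expR_ge0.
Qed.

(* The factor e^(-e|u|), whose Fourier transform is the Poisson kernel, makes
   Fubini's theorem applicable. *)
Lemma regularized_plancherel psi e : 0 < e -> cintegrable setT psi ->
  (\int[mu]_(u in setT) (expR (- e * `|u|) * normc (fourier psi u) ^+ 2))%:C =
  cintegral setT (fun s => psi s *
    conjc (cintegral setT (fun t => psi t * (poisson e (t - s))%:C))).
Proof.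
move=> e0 ip; have mT := @measurableT _ R.
have mm (c : R) : measurable_fun setT (fun t : R => c * t) by exact: measurable_funM.
have mF : cmeasurable setT (fourier psi) by apply: cmeasurable_ccont => t; exact: ccont_fourier.
pose h u := (expR (- e * `|u|))%:C * fourier psi u.
have ih : cintegrable setT h by apply: cintegrable_expR_abs => // u; exact: normc_fourier.
have ihc : cintegrable setT (fun u => conjc (h u)).
  apply: cintegrable_le (intg_normc mT ih) _ => //.
    exact: cmeasurable_conj (cintegrable_cmeasurable ih).
  by move=> u _; rewrite normc_conj.
rewrite -cintegral_real.
rewrite (@eq_cintegral _ _ _ (fun u => conjc (h u) * fourier psi u)); last first.
  by move=> u _; rewrite /h conjcM conjcR -mulrA conjc_mul_normc -rmorphM.
rewrite (fourier_adjoint ip ihc); apply: eq_cintegral => s _; congr (_ * _).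
have -> : fourier (fun u => conjc (h u)) s = conjc (cintegral setT (fun u => h u * cis (- s * u))).
  rewrite conj_cintegral//; last exact: cintegrable_cis.
  by apply: eq_cintegral => u _; rewrite (conjcM (h u)) conj_cis mulNr opprK.
congr conjc.
rewrite (@eq_cintegral _ _ _ (fun u => ((expR (- e * `|u|))%:C * cis (- s * u)) * fourier psi u)); last first.
  by move=> u _; rewrite /h mulrAC.
have ic : cintegrable setT (fun u => (expR (- e * `|u|))%:C * cis (- s * u)).
  apply: (cintegrable_expR_abs (M := 1) e0); first exact: cmeasurable_cis (mm _).
  by move=> u; rewrite normc_cis.
rewrite (fourier_adjoint ip ic).
apply: eq_cintegral => t _; congr (_ * _); rewrite -fourier_expR_abs//.
by apply: eq_cintegral => u _; rewrite -mulrA -cisD; congr (_ * cis _); ring.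
Qed.

Lemma intg_poisson1 : intg setT (poisson 1) /\ \int[mu]_(v in setT) poisson 1 v = 2 * pi.
Proof.
have p1 v : poisson 1 v = 2 * (1 + v ^+ 2)^-1 by rewrite /poisson expr1n mulr1.
have d0 (v : R) : 1 + v ^+ 2 != 0 by rewrite lt0r_neq0// ltr_pwDl// sqr_ge0.
have dp (v : R) : is_derive v 1 (fun v : R => 2 * atan v) (poisson 1 v).
  have h : is_derive v 1 (@atan R) ((1 + v ^+ 2)^-1).
    by split; [exact: derivable_atan|rewrite -derive1E derive1_atan].
  have := is_deriveMr (is_derive_cst (2 : R) v 1) h.
  by move/is_derive_eq; apply; rewrite mulr0 addr0 p1.
have cp (v : R) : {for v, continuous (poisson 1)}.
  have -> : poisson 1 = (fun v => 2 * (1 + v ^+ 2)^-1) by apply/funext.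
  apply: cvgM; first exact: cvg_cst.
  apply: cvgV => //; apply: cvgD; first exact: cvg_cst.
  exact: exprn_continuous.
have i : intg setT (poisson 1).
  apply: (@intg_improper R setT _ _ (fun v => 2 * atan v) (poisson 1) pi (exhaustion_setT R)).
  - exact: continuous_measurable_fun.
  - by move=> v _; exact: cp.
  - by move=> v _; rewrite p1 mulr_ge0// invr_ge0 addr_ge0// sqr_ge0.
  - move=> v _; rewrite normrM ger0_norm// -ler_pdivlMl// mulrC ler_norml.
    by rewrite ltW ?atan_gtNpi2 //= ltW ?atan_ltpi2.
split => //.
have exT := exhaustion_setT R.
apply: (@Rint_improper R setT _ _ (fun v => 2 * atan v) (poisson 1) (2 * pi) exT) => //.
have h : (2 * 2) * atan (n%:R : R) @[n --> \oo] --> (2 * 2) * (pi / 2 : R).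
  apply: cvgM; first exact: cvg_cst.
  exact: (cvg_comp _ _ (@cvgr_idn R) (@cvgy_atan R)).
have -> : 2 * pi = (2 * 2) * (pi / 2) :> R by field.
apply: cvg_trans h; apply: near_eq_cvg; apply: nearW => n.
by rewrite atanN; ring.
Qed.

Lemma continuous_poisson e : 0 < e -> continuous (poisson e).
Proof.
move=> e0 w; apply: cvgM; first exact: cvg_cst.
have q0 : e ^+ 2 + w ^+ 2 != 0 by rewrite lt0r_neq0// ltr_pwDl ?sqr_ge0 ?exprn_gt0.
apply: cvgV => //; apply: cvgD; first exact: cvg_cst.
exact: exprn_continuous.
Qed.

Lemma poisson_ge0 e w : 0 <= e -> 0 <= poisson e w.
Proof. by move=> e0; rewrite divr_ge0 ?mulr_ge0// addr_ge0 ?sqr_ge0. Qed.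

Lemma exhaustion_affine (s e : R) : 0 < e ->
  exhaustion setT (fun n => s + e * - n%:R) (fun n => s + e * n%:R).
Proof.
move=> e0; split.
- apply/seteqP; split => x // _.
  have [n _ /(_ n (leqnn n)) hn] := @nbhs_infty_gtr R (`|x - s| / e).
  exists n => //=; rewrite in_itv/=.
  have : `|x - s| <= e * n%:R by rewrite -ler_pdivrMl// mulrC ltW.
  rewrite ler_norml => /andP[h1 h2]; rewrite mulrN.
  by apply/andP; split; lra.
- by move=> n; rewrite lerD2l ler_pM2l// (@le_trans _ _ 0)// oppr_le0.
- by move=> n m nm; rewrite !lerD2l !ler_pM2l// lerN2 ler_nat.
Qed.

(** The substitution t = s + e v replaces the kernel of width e by the fixed one of width 1, so that
    e remains only in the argument of g and dominated convergence applies as e tends to 0. *)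
Lemma Rint_poisson_shift (g : R -> R) (M e s : R) : 0 < e -> continuous g ->
  (forall t, `|g t| <= M) ->
  \int[mu]_(t in setT) (g t * poisson e (t - s)) =
  \int[mu]_(v in setT) (g (s + e * v) * poisson 1 v).
Proof.
move=> e0 cg gM; have en : e != 0 by exact: lt0r_neq0.
pose F (v : R) := s + e * v.
have dF (v : R) : is_derive v 1 F ((fun=> e) v).
  have := is_deriveDr (is_derive_cst s v 1) (is_derive_lin e v).
  by move/is_derive_eq; apply; rewrite add0r.
have cG (t : R) : [set: R] t -> {for t, continuous (fun t => g t * poisson e (t - s))}.
  move=> _; apply: cvgM; first exact: cg.
  apply: (@continuous_comp _ _ _ (fun t : R => t - s) (poisson e)).
    by apply: cvgB; [exact: cvg_id|exact: cvg_cst].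
  exact: continuous_poisson.
have pE v : poisson e (F v - s) * e = poisson 1 v.
  rewrite /F addrAC subrr add0r /poisson exprMn expr1n; field.
  by apply/andP; split; rewrite lt0r_neq0// ltr_pwDl ?sqr_ge0 ?exprn_gt0.
have E v : g (F v) * poisson e (F v - s) * e = g (s + e * v) * poisson 1 v.
  by rewrite -mulrA pE.
have [i1 _] := intg_poisson1.
have cF1 : continuous (fun v : R => g (s + e * v) * poisson 1 v).
  move=> v; apply: cvgM; last exact: continuous_poisson.
  by apply: (@continuous_comp _ _ _ F g); [exact: is_derive_continuous (dF v)|exact: cg].
have iG : mu.-integrable setT (EFin \o (fun t => g t * poisson e (t - s))).
  apply/(intg_subst dF (fun _ => cvg_cst _) (fun _ => e0) (exhaustion_affine s e0) openT cG).
  apply: eq_intg (fun v _ => esym (E v)) _ => //.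
  apply: intg_le (intgZ M _ i1) _ => //; first exact: continuous_measurable_fun.
  move=> v _; rewrite normrM [`|poisson _ _|]ger0_norm ?poisson_ge0//.
  by rewrite ler_wpM2r ?poisson_ge0.
rewrite (Rint_subst dF (fun _ => cvg_cst _) (fun _ => e0) (exhaustion_affine s e0) openT cG iG).
by apply: eq_Rint => v _; exact: E.
Qed.

Lemma ccvg_conj (u : nat -> R[i]) a : ccvg u a -> ccvg (fun n => conjc (u n)) (conjc a).
Proof.
move=> [h1 h2]; split; first by under eq_fun do rewrite Re_conj; rewrite Re_conj.
by under eq_fun do rewrite Im_conj; rewrite Im_conj; exact: cvgN.
Qed.

Lemma continuous_sqr_normc (f : R -> R[i]) t : ccont f t ->
  {for t, continuous (fun u => normc (f u) ^+ 2)}.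
Proof.
move=> [c1 c2].
have -> : (fun u => normc (f u) ^+ 2) = (fun u => Re (f u) * Re (f u) + Im (f u) * Im (f u)).
  by apply/funext => v; rewrite sqr_normc !expr2.
by apply: cvgD; apply: cvgM.
Qed.

(** As e tends to 0 in [regularized_plancherel], the Poisson kernel, of mass 2 pi, concentrates at
    the diagonal, so the right-hand side tends to 2 pi |psi|^2. Integrability of the squared
    transform is deduced first, and the left-hand side then converges by domination. *)
Theorem plancherel psi (M : R) : (forall t, ccont psi t) -> (forall t, normc (psi t) <= M) ->
  cintegrable setT psi ->
  intg setT (fun u => normc (fourier psi u) ^+ 2) /\
  \int[mu]_(u in setT) normc (fourier psi u) ^+ 2 =
    2 * pi * \int[mu]_(t in setT) normc (psi t) ^+ 2.
Proof.
move=> cpsi psiM ip; have mT := @measurableT _ R.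
have mpsi := cintegrable_cmeasurable ip.
have [ip1 Ep1] := intg_poisson1.
have M0 : 0 <= M by apply: le_trans (psiM 0); exact: normc_ge0.
pose eps n : R := n.+1%:R^-1.
have e0 n : 0 < eps n by rewrite invr_gt0.
have epsV : eps n @[n --> \oo] --> (0 : R) by exact: cvg_harmonic.
(* Poisson averages of [psi], tending pointwise to 2 pi psi; they are bounded because [psi] is. *)
pose A n s := cintegral setT (fun t => psi t * (poisson (eps n) (t - s))%:C).
have AE n s : A n s = cintegral setT (fun v => psi (s + eps n * v) * (poisson 1 v)%:C).
  apply: complexP; rewrite ?Re_cintegral ?Im_cintegral.
    transitivity (\int[mu]_(t in setT) (Re (psi t) * poisson (eps n) (t - s))).
      by apply: eq_Rint => t _; rewrite ReM /= mulr0 subr0.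
    rewrite (@Rint_poisson_shift (fun t => Re (psi t)) M)//.
    - by apply: eq_Rint => t _; rewrite ReM /= mulr0 subr0.
    - by move=> t; have [] := cpsi t.
    - by move=> t; exact: le_trans (normr_Re _) (psiM t).
  transitivity (\int[mu]_(t in setT) (Im (psi t) * poisson (eps n) (t - s))).
    by apply: eq_Rint => t _; rewrite ImM /= mulr0 add0r.
  rewrite (@Rint_poisson_shift (fun t => Im (psi t)) M)//.
  - by apply: eq_Rint => t _; rewrite ImM /= mulr0 add0r.
  - by move=> t; have [] := cpsi t.
  - by move=> t; exact: le_trans (normr_Im _) (psiM t).
have mp1 : measurable_fun setT (poisson 1) by apply: continuous_measurable_fun; exact: continuous_poisson.
have mA0 n s : cmeasurable setT (fun v => psi (s + eps n * v) * (poisson 1 v)%:C).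
  apply: cmeasurableM; last exact: cmeasurable_real.
  have ml : measurable_fun setT (fun v : R => s + eps n * v).
    by apply: measurable_funD => //; exact: measurable_funM.
  by have [h1 h2] := mpsi; split; [exact: (measurableT_comp h1 ml)|exact: (measurableT_comp h2 ml)].
have bA0 n s v : normc (psi (s + eps n * v) * (poisson 1 v)%:C) <= M * poisson 1 v.
  rewrite normcM normcC [`|poisson _ _|]ger0_norm ?poisson_ge0//.
  by rewrite ler_wpM2r ?poisson_ge0.
have iA0 n s : cintegrable setT (fun v => psi (s + eps n * v) * (poisson 1 v)%:C).
  exact: cintegrable_le mT (mA0 n s) (intgZ M mT ip1) (fun v _ => bA0 n s v).
have bA n s : normc (A n s) <= 2 * (M * (2 * pi)).
  rewrite AE; apply: (le_trans (normc_cintegral mT (iA0 n s))).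
  rewrite ler_wpM2l// -Ep1 -RintegralZl//; apply: ler_Rint => //.
  - exact: intg_normc.
  - exact: intgZ.
have cA s : ccvg (A ^~ s) (psi s * (2 * pi)%:C).
  have -> : psi s * (2 * pi)%:C = cintegral setT (fun v => psi s * (poisson 1 v)%:C).
    rewrite cintegralZl// ?cintegral_real ?Ep1//.
    by split => //=; exact: (integrable0 mu).
  have cc v : [set: R] v -> ccvg (fun n => psi (s + eps n * v) * (poisson 1 v)%:C) (psi s * (poisson 1 v)%:C).
    move=> _; apply: (ccvgM _ (ccvg_cst _)).
    have h : s + eps n * v @[n --> \oo] --> s.
      rewrite -[X in _ --> X]addr0 -[X in _ + X](mul0r v); apply: cvgD; first exact: cvg_cst.
      by apply: cvgM => //; exact: cvg_cst.
    have [c1 c2] := cpsi s.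
    by split; [exact: (cvg_comp _ _ h c1)|exact: (cvg_comp _ _ h c2)].
  have [_] := @cdominated_cvg R setT (fun n v => psi (s + eps n * v) * (poisson 1 v)%:C)
    (fun v => psi s * (poisson 1 v)%:C) (fun v => M * poisson 1 v) mT (fun n => mA0 n s)
    cc (intgZ M mT ip1) (fun n v _ => bA0 n s v).
  by apply: ccvg_near; apply: nearW => n; rewrite AE.
pose I n := \int[mu]_(u in setT) (expR (- eps n * `|u|) * normc (fourier psi u) ^+ 2).
have IE n : (I n)%:C = cintegral setT (fun s => psi s * conjc (A n s)).
  exact: regularized_plancherel (e0 n) ip.
pose J := 2 * pi * \int[mu]_(t in setT) normc (psi t) ^+ 2.
have i2 : intg setT (fun t => normc (psi t) ^+ 2).
  apply: (intg_le _ _ (intgZ M _ (intg_normc mT ip))) => //.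
    by apply: measurable_funX; exact: cmeasurable_normc.
  by move=> t _; rewrite ger0_norm ?sqr_ge0// expr2 ler_wpM2r ?normc_ge0.
have mA n : cmeasurable setT (A n).
  apply: cmeasurable_ccont => s.
  have cv (w : nat -> R) : w k @[k --> \oo] --> s -> ccvg (fun k => A n (w k)) (A n s).
    move=> ws; rewrite AE.
    have cc v : [set: R] v -> ccvg (fun k => psi (w k + eps n * v) * (poisson 1 v)%:C) (psi (s + eps n * v) * (poisson 1 v)%:C).
      move=> _; apply: (ccvgM _ (ccvg_cst _)).
      have h : w k + eps n * v @[k --> \oo] --> s + eps n * v by apply: cvgD => //; exact: cvg_cst.
      have [c1 c2] := cpsi (s + eps n * v).
      by split; [exact: (cvg_comp _ _ h c1)|exact: (cvg_comp _ _ h c2)].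
    have [_] := @cdominated_cvg R setT (fun k v => psi (w k + eps n * v) * (poisson 1 v)%:C)
      _ (fun v => M * poisson 1 v) mT (fun k => mA0 n (w k))
      cc (intgZ M mT ip1) (fun k v _ => bA0 n (w k) v).
    by apply: ccvg_near; apply: nearW => k; rewrite AE.
  split; apply/(@cvg_nbhsP R R^o) => w /cv[]//.
have IJ : I n @[n --> \oo] --> J.
  have mAc n : cmeasurable setT (fun s => psi s * conjc (A n s)).
    by apply: cmeasurableM => //; exact: cmeasurable_conj.
  have cc s : [set: R] s -> ccvg (fun n => psi s * conjc (A n s)) (psi s * conjc (psi s * (2 * pi)%:C)).
    by move=> _; apply: (ccvgM (ccvg_cst _)); exact: ccvg_conj.
  have bc n s : [set: R] s -> normc (psi s * conjc (A n s)) <= 2 * (M * (2 * pi)) * normc (psi s).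
    by move=> _; rewrite normcM normc_conj mulrC ler_wpM2r ?normc_ge0.
  have [_ [+ _]] := @cdominated_cvg R setT (fun n s => psi s * conjc (A n s)) _ _ mT mAc cc
    (intgZ _ mT (intg_normc mT ip)) bc.
  have -> : Re (cintegral setT (fun s => psi s * conjc (psi s * (2 * pi)%:C))) = J.
    rewrite Re_cintegral /J -RintegralZl//; apply: eq_Rint => s _.
    by rewrite conjcM conjcR mulrA [psi s * _]mulrC conjc_mul_normc -rmorphM /= mulrC.
  by apply: cvg_trans; apply: near_eq_cvg; apply: nearW => n; rewrite -IE.
have cF u : {for u, continuous (fun u => normc (fourier psi u) ^+ 2)}.
  exact: continuous_sqr_normc (ccont_fourier u ip).
have mF : measurable_fun setT (fun u => normc (fourier psi u) ^+ 2) by exact: continuous_measurable_fun.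
have iI n : intg setT (fun u => expR (- eps n * `|u|) * normc (fourier psi u) ^+ 2).
  apply: (intg_le _ _ (intgZ ((2 * \int[mu]_(t in setT) normc (psi t)) ^+ 2) _ (intg_expR_abs (e0 n)))) => //.
    by apply: measurable_funM => //; exact: measurable_expR_abs.
  move=> u _; have f0 := normc_ge0 (fourier psi u).
  rewrite normrM [`|expR _|]ger0_norm ?expR_ge0// mulrC; apply: ler_wpM2r; first exact: expR_ge0.
  rewrite normrX (ger0_norm f0) ler_pXn2r ?nnegrE//; first exact: normc_fourier.
  exact: le_trans f0 (normc_fourier u ip).
have cE c : expR (- eps n * c) @[n --> \oo] --> (1 : R).
  have h : - eps n * c @[n --> \oo] --> (0 : R).
    by rewrite -[X in _ --> X](mul0r c) -[X in X * _]oppr0; apply: cvgM; [exact: cvgN|exact: cvg_cst].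
  by have := cvg_comp _ _ h (@continuous_expR R 0); rewrite expR0.
(* On [-N, N] the weight is at least e^(-eps N), so e^(-eps N) times the integral is at most I n;
   letting n grow bounds every such integral by J. *)
have iF : intg setT (fun u => normc (fourier psi u) ^+ 2).
  apply: (@intg_exhaust R setT _ _ _ J (exhaustion_setT R)) => //.
    by move=> u _; exact: sqr_ge0.
  move=> N; set IN := Rintegral _ _ _.
  have h : expR (- eps n * N%:R) * IN @[n --> \oo] --> IN.
    by rewrite -[X in _ --> X]mul1r; apply: cvgM; [exact: cE|exact: cvg_cst].
  apply: (ler_cvg_to h IJ); apply: nearW => n.
  have iN := @intg_itv_continuous R _ (- N%:R) N%:R (fun x _ => cF x).
  rewrite /IN -RintegralZl// Rint_restrict; apply: ler_Rint => //.
    by apply/(intg_restrict _ (measurable_itv _)); apply: intgZ.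
  move=> u _; rewrite indicE; case: (boolP (u \in _)) => [/set_mem/=|_]; last first.
    by rewrite mulr0 mulr_ge0 ?expR_ge0 ?sqr_ge0.
  rewrite in_itv/= -ler_norml mulr1 => uN; rewrite ler_wpM2r ?sqr_ge0// ler_expR !mulNr lerN2.
  by rewrite ler_wpM2l// ltW.
split => //; apply: (cvg_unique _ _ IJ) => //.
have bF n u : [set: R] u -> `|expR (- eps n * `|u|) * normc (fourier psi u) ^+ 2| <= normc (fourier psi u) ^+ 2.
  move=> _; have f0 : 0 <= normc (fourier psi u) ^+ 2 by exact: sqr_ge0.
  rewrite normrM (ger0_norm f0) [`|expR _|]ger0_norm ?expR_ge0//; apply: ler_piMl => //.
  by rewrite -[leRHS]expR0 ler_expR mulNr oppr_le0 mulr_ge0// ltW.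
have cc u : [set: R] u -> expR (- eps n * `|u|) * normc (fourier psi u) ^+ 2 @[n --> \oo] --> normc (fourier psi u) ^+ 2.
  by move=> _; rewrite -[X in _ --> X]mul1r; apply: cvgM; [exact: cE|exact: cvg_cst].
exact: (Rdominated_cvg mT (fun n => intg_measurable (iI n)) cc iF bF).2.
Qed.

End Plancherel.

(** * The transform of a test function *)

Section Critical_line.
Variable R : realType.
Variables gam b1 b2 : R.
Local Notation mu := (@lebesgue_measure R).
Local Notation intg D f := (mu.-integrable D (EFin \o f)).

Definition crit (t : R) : R[i] := Phi gam b1 b2 ((- (gam / 2)) +i* t).

Lemma Qlim_crit b t : 0 < b + gam / 2 ->
  Qlim gam b ((- (gam / 2)) +i* t) =
  euler_integral ((b + gam / 2) +i* (- t)) / euler_integral ((b + gam / 2) +i* t).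
Proof.
move=> b0; rewrite /Qlim.
have -> : b%:C - (- (gam / 2) +i* t) = (b + gam / 2) +i* (- t).
  by apply: complexP; rewrite /=; field.
have -> : gam%:C + b%:C + (- (gam / 2) +i* t) = (b + gam / 2) +i* t.
  by apply: complexP; rewrite /=; field.
by rewrite !cgamma_Re_gt0.
Qed.

Lemma ccont_euler_vertical (a t : R) : 0 < a -> ccont (fun t => euler_integral (a +i* t)) t.
Proof.
move=> a0; have mRp := @measurable_Rplus R.
have cv (v : nat -> R) : v n @[n --> \oo] --> t ->
    ccvg (fun n => euler_integral (a +i* v n)) (euler_integral (a +i* t)).
  move=> vt.
  have cc x : Rplus R x -> ccvg (fun n => euler_integrand (a +i* v n) x) (euler_integrand (a +i* t) x).
    move=> x0; apply: (ccvgM _ (ccvg_cst _)).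
    have E (s : R) : cpow x ((a +i* s) - 1) = (expR ((a - 1) * ln x))%:C * cis (s * ln x).
      rewrite cpowE -cexp_cis; congr cexp; apply: complexP; rewrite ?ReM ?ImM /=; ring.
    have h : v n * ln x @[n --> \oo] --> t * ln x by apply: cvgM => //; exact: cvg_cst.
    apply: (ccvg_near (u := fun n => (expR ((a - 1) * ln x))%:C * cis (v n * ln x))).
      by apply: nearW => n; rewrite E.
    rewrite E; apply: (ccvgM (ccvg_cst _)).
    by split; [exact: (cvg_comp _ _ h (@continuous_cos R _))|exact: (cvg_comp _ _ h (@continuous_sin R _))].
  have mm n : cmeasurable (Rplus R) (fun x => euler_integrand (a +i* v n) x).
    by apply: cmeasurable_Rplus => x; exact: ccont_euler_integrand.
  have bb n x : Rplus R x -> normc (euler_integrand (a +i* v n) x) <= gamma_weight a x.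
    by move=> _; rewrite normc_euler_integrand.
  exact: (@cdominated_cvg R (Rplus R) _ _ _ mRp mm cc (intg_gamma_weight a0) bb).2.
split; apply/(@cvg_nbhsP R R^o) => v /cv[]//.
Qed.

Lemma ccont_euler_verticalN (a t : R) : 0 < a -> ccont (fun t => euler_integral (a +i* (- t))) t.
Proof.
move=> a0; have [c1 c2] := ccont_euler_vertical (- t) a0.
have h : {for t, continuous (fun t : R => - t)} by exact: opp_continuous.
by split; [exact: (continuous_comp h c1)|exact: (continuous_comp h c2)].
Qed.

Hypotheses (b1_gt : 0 < b1 + gam / 2) (b2_gt : 0 < b2 + gam / 2).

Lemma conjcV (z : R[i]) : conjc z^-1 = (conjc z)^-1.
Proof. by apply: complexP; rewrite ?(Re_conj, Im_conj) ?ReV ?ImV ?Re_conj ?Im_conj sqrrN// mulNr. Qed.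

Lemma conj_Qlim_crit b t : 0 < b + gam / 2 ->
  conjc (Qlim gam b ((- (gam / 2)) +i* t)) = Qlim gam b ((- (gam / 2)) +i* (- t)).
Proof.
by move=> b0; rewrite !Qlim_crit// conjcM conjcV !conj_euler// !opprK.
Qed.

Lemma normc_Qlim_crit b t : 0 < b + gam / 2 -> normc (Qlim gam b ((- (gam / 2)) +i* t)) = 1.
Proof.
move=> b0; rewrite Qlim_crit// normcM normcV.
have -> : euler_integral ((b + gam / 2) +i* - t) = conjc (euler_integral ((b + gam / 2) +i* t)).
  by rewrite conj_euler.
by rewrite normc_conj divff// normc_eq0 euler_neq0.
Qed.

Lemma conj_crit t : conjc (crit t) = crit (- t).
Proof. by rewrite [LHS]conjcM (conj_Qlim_crit t b1_gt) (conj_Qlim_crit t b2_gt). Qed.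

Lemma normc_crit t : normc (crit t) = 1.
Proof. by rewrite [LHS]normcM (normc_Qlim_crit t b1_gt) (normc_Qlim_crit t b2_gt) mulr1. Qed.

Lemma ccont_Qlim_crit b t : 0 < b + gam / 2 -> ccont (fun t => Qlim gam b ((- (gam / 2)) +i* t)) t.
Proof.
move=> b0; have -> : (fun t => Qlim gam b ((- (gam / 2)) +i* t)) =
    (fun t => euler_integral ((b + gam / 2) +i* (- t)) / euler_integral ((b + gam / 2) +i* t)).
  by apply/funext => s; exact: Qlim_crit.
apply: ccontM; first exact: ccont_euler_verticalN.
by apply: ccontV; [exact: euler_neq0|exact: ccont_euler_vertical].
Qed.

Lemma ccont_crit t : ccont crit t.
Proof. by apply: ccontM; exact: ccont_Qlim_crit. Qed.

End Critical_line.

(** * Decay of the Gamma quotients between the contour and the critical line *)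

Section Contour_bound.
Variable R : realType.
Variables (gam : R) (sigma : R -> R) (T gam' : R).
Local Notation mu := (@lebesgue_measure R).
Local Notation intg D f := (mu.-integrable D (EFin \o f)).
Hypothesis csigma : continuous sigma.
Hypothesis sigma_far : forall t, T < `|t| -> sigma t = gam'.
Let p := gam + 2 * gam'.
Hypothesis p0 : 0 < p.
Let s0 := - (gam / 2).

Lemma sigma_bounded : exists2 M : R, 0 <= M & forall t, `|sigma t| <= M.
Proof.
have [M M0 hM] := @bounded_itv_continuous R sigma (- T) T (fun t _ => @csigma t).
exists (M + `|gam'|); first by rewrite addr_ge0.
move=> t; have [tT|tT] := leP `|t| T.
  by rewrite (le_trans (hM _ _)) ?lerDl// -ler_norml.
by rewrite sigma_far// lerDr.
Qed.

(** Because s0 = - gam / 2, the exponent gam + 2 Re l equals th (gam + 2 sigma t): it grows linearly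
    from 0 on the critical line to p on the far part of the contour. The bounded part |t| <= T only
    affects the constant. *)
Lemma normc_Qlim_zeta (b K : R) : 0 < K ->
  (forall th t, 0 <= th <= 1 -> pole_sep b K (zeta sigma s0 th t)) ->
  exists C : R, forall th t, 0 <= th <= 1 ->
    normc (Qlim gam b (zeta sigma s0 th t)) ^+ 2 <= expR (C - th * p * ln (1 + t ^+ 2)).
Proof.
move=> K0 sep; have [M M0 hM] := sigma_bounded.
pose A := `|b| + (`|s0| + (M + `|s0|)); pose B := 2 * M + `|gam|.
have A0 : 0 <= A by rewrite !addr_ge0.
have B0 : 0 <= B by rewrite addr_ge0// mulr_ge0.
(* With q = |b - l|^2, separation gives q >= K, and q >= t^2 is clear; together (1 + K) q >= K (1 +
   t^2), so ln q is at least ln (1 + t^2) up to ln k0. *)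
pose k0 := K / (1 + K); have k00 : 0 < k0 by rewrite divr_gt0// addr_gt0.
pose L := `|ln K| + ln (A ^+ 2 + T ^+ 2 + 1).
have q0 : 0 < A ^+ 2 + T ^+ 2 + 1 by rewrite ltr_wpDl// addr_ge0 ?sqr_ge0.
have lq0 : 0 <= ln (A ^+ 2 + T ^+ 2 + 1) by rewrite ln_ge0// lerDr addr_ge0 ?sqr_ge0.
have l1T : 0 <= ln (1 + T ^+ 2) by rewrite ln_ge0// lerDl sqr_ge0.
(* The first term is the loss ln k0 for |t| > T; the other two bound, for |t| <= T, the logarithm of
   the modulus and the decay that is claimed there. *)
pose C0 := p * `|ln k0| + B * L + p * ln (1 + T ^+ 2).
pose G := gauss_const A B K; have G0 : 0 < G by exact: expR_gt0.
exists (ln G + C0) => th t th01; have /andP[th0 th1] := th01.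
set l := zeta _ _ _ _.
have lA : `|b - Re l| <= A.
  rewrite (le_trans (ler_normB _ _))// lerD2l /= (le_trans (ler_normD _ _))// lerD2l.
  rewrite normrM (ger0_norm th0) -[leRHS]mul1r ler_pM// (le_trans (ler_normB _ _))// lerD2r.
  exact: hM.
have mE : gam + 2 * Re l = th * (gam + 2 * sigma t) by rewrite /= /s0; field.
have dB : `|gam + 2 * sigma t| <= B.
  by rewrite (le_trans (ler_normD _ _))// addrC lerD2r normrM ger0_norm// ler_wpM2l ?hM.
have lB : `|gam + 2 * Re l| <= B.
  by rewrite mE normrM (ger0_norm th0) -[leRHS]mul1r ler_pM.
apply: (le_trans (normc_Qlim lA lB K0 (sep th t th01))).
rewrite -/G -{1}[G]lnK ?posrE// -expRD ler_expR -addrA lerD2l mE.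
have := sep th t th01 0%N; rewrite addr0 -/l; set x := b - Re l; rewrite [Im l]/=.
set q := x ^+ 2 + t ^+ 2 => hq.
have x2 := sqr_ge0 x; have t2 := sqr_ge0 t.
have Kq : K <= q by rewrite (le_trans _ hq)// ler_peMr ?(ltW K0)// lerDl.
have q00 : 0 < q by exact: lt_le_trans Kq.
have tpos : 0 < 1 + t ^+ 2 by rewrite ltr_pwDl.
have lt0 : 0 <= ln (1 + t ^+ 2) by rewrite ln_ge0// lerDl.
have [tT|tT] := leP `|t| T; last first.
  rewrite sigma_far// -/p.
  have kq : k0 * (1 + t ^+ 2) <= q.
    rewrite /k0 mulrAC ler_pdivrMr ?addr_gt0//; move: hq; rewrite /q.
    by have := sqr_ge0 t; nra.
  have h : ln k0 + ln (1 + t ^+ 2) <= ln q.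
    by rewrite -lnM ?posrE// ler_ln ?posrE// mulr_gt0.
  have h2 : - `|ln k0| <= ln k0 by have := ler_norm (- ln k0); rewrite normrN lerNl.
  have h3 : - `|ln k0| + ln (1 + t ^+ 2) <= ln q by lra.
  have h4 : 0 <= B * L + p * ln (1 + T ^+ 2).
    have L0 : 0 <= L by apply: addr_ge0.
    by apply: addr_ge0; apply: mulr_ge0 => //; exact: ltW.
  have h5 : th * p * (- `|ln k0| + ln (1 + t ^+ 2)) <= th * p * ln q.
    by rewrite ler_wpM2l// mulr_ge0// ltW.
  have h6 : th * (p * `|ln k0|) <= p * `|ln k0|.
    by rewrite ler_piMl// mulr_ge0// ltW.
  rewrite /C0; lra.
have T2 : t ^+ 2 <= T ^+ 2 by rewrite -[leLHS]real_normK ?num_real// lerXn2r ?nnegrE// (le_trans _ tT).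
have x2A : x ^+ 2 <= A ^+ 2 by rewrite -[leLHS]real_normK ?num_real// lerXn2r ?nnegrE.
have lqL : `|ln q| <= L.
  rewrite ler_norml; apply/andP; split.
    have h1 : ln K <= ln q by rewrite ler_ln ?posrE.
    have h2 : - `|ln K| <= ln K by have := ler_norm (- ln K); rewrite normrN lerNl.
    rewrite /L; lra.
  have h1 : ln q <= ln (A ^+ 2 + T ^+ 2 + 1) by rewrite ler_ln ?posrE// /q; lra.
  have := normr_ge0 (ln K); rewrite /L; lra.
have h1 : - (th * (gam + 2 * sigma t) * ln q) <= B * L.
  rewrite (le_trans (ler_norm _))// normrN normrM ler_pM// normrM (ger0_norm th0).
  by rewrite -[leRHS]mul1r ler_pM.
have h2 : th * p * ln (1 + t ^+ 2) <= p * ln (1 + T ^+ 2).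
  rewrite -mulrA -[leRHS]mul1r ler_pM// ?mulr_ge0 ?(ltW p0)// ler_wpM2l ?(ltW p0)//.
  by rewrite ler_ln ?posrE// ?lerD2l// ltr_pwDl// sqr_ge0.
have h3 : 0 <= p * `|ln k0| by rewrite mulr_ge0// ltW.
rewrite /C0; lra.
Qed.

Lemma normc_Phi_zeta (b1 b2 : R) : sigma 0 < b1 -> s0 < b1 -> sigma 0 < b2 -> s0 < b2 ->
  exists2 C : R, 0 <= C & forall th t, 0 <= th <= 1 ->
    normc (Phi gam b1 b2 (zeta sigma s0 th t)) <= C * expR (- (th * p * ln (1 + t ^+ 2))).
Proof.
move=> h1 h2 h3 h4.
have [K1 K10 s1] := pole_sep_zeta (@csigma 0) h1 h2.
have [K2 K20 s2] := pole_sep_zeta (@csigma 0) h3 h4.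
have [C1 hC1] := normc_Qlim_zeta K10 s1; have [C2 hC2] := normc_Qlim_zeta K20 s2.
exists (expR ((C1 + C2) / 2)); first exact: expR_ge0.
move=> th t th01; apply: ler_sqr_ge0; first by rewrite mulr_ge0 ?expR_ge0.
rewrite /Phi normcM exprMn (le_trans (ler_pM _ _ (hC1 th t th01) (hC2 th t th01))) ?sqr_ge0//.
rewrite -!expRD -expRM_natl ler_expR le_eqVlt; apply/orP; left; apply/eqP.
by field.
Qed.

End Contour_bound.

(** * Laplace transforms of compactly supported functions *)

Section Laplace.
Variable R : realType.
Local Notation mu := (@lebesgue_measure R).
Local Notation intg D f := (mu.-integrable D (EFin \o f)).
Implicit Types (D : set R) (a c z : R -> R[i]) (l : R -> R) (u V B : R).

Lemma cintegral_support D a : (forall x, ~ D x -> a x = 0) -> cintegral setT a = cintegral D a.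
Proof.
move=> aD.
have E x : a x = a x * (\1_D x)%:C.
  rewrite indicE; have [h|h] := boolP (x \in D); first by rewrite mulr1.
  by rewrite aD ?mul0r// => /mem_set; exact/negP.
apply: complexP; rewrite ?Re_cintegral ?Im_cintegral [RHS]Rint_restrict; apply: eq_Rint => x _.
  by rewrite [in LHS]E ReM /= mulr0 subr0.
by rewrite [in LHS]E ImM /= mulr0 add0r.
Qed.

Lemma cintegrable_support a V : (forall v, ccont a v) -> (forall v, V < `|v| -> a v = 0) ->
  cintegrable setT a.
Proof.
move=> ca aV; have mV := measurable_itv `[- V, V].
have [i1 i2] : cintegrable `[- V, V] a by apply: cintegrable_itv_ccont => v _; exact: ca.
have E v : a v * (\1_(`[- V, V]%classic : set R) v)%:C = a v.
  rewrite indicE; have [h|h] := boolP (v \in _); first by rewrite mulr1.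
  rewrite aV ?mul0r// ltNge; apply: contra h => h; apply/mem_set.
  by rewrite /= in_itv/= -ler_norml.
split.
  have := (intg_restrict _ mV).1 i1; apply: eq_intg => // v _.
  by rewrite -[in RHS]E ReM /= mulr0 subr0.
have := (intg_restrict _ mV).1 i2; apply: eq_intg => // v _.
by rewrite -[in RHS]E ImM /= mulr0 add0r.
Qed.

(** Fubini: on the support of a the quantity l y is bounded, and Re (z t) is bounded, so the
    exponential is at most e^((|u| + V) B). It is used with l y = ln y / gam for the kernel, and
    with l the identity in logarithmic coordinates. *)
Lemma laplace_swap D1 D a l c z u V B : measurable D1 -> measurable D ->
  cmeasurable setT a -> measurable_fun setT l -> cmeasurable setT c -> cmeasurable setT z ->
  cintegrable D1 a -> cintegrable D c ->
  (forall y, D1 y -> a y != 0 -> `|l y| <= V) -> (forall t, D t -> `|Re (z t)| <= B) ->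
  [/\ cintegrable D1 (fun y => a y * cintegral D (fun t => c t * cexp ((u + l y)%:C * z t))),
      cintegrable D (fun t => c t * cexp (u%:C * z t) *
        cintegral D1 (fun y => a y * cexp ((l y)%:C * z t))) &
      cintegral D1 (fun y => a y * cintegral D (fun t => c t * cexp ((u + l y)%:C * z t))) =
      cintegral D (fun t => c t * cexp (u%:C * z t) *
        cintegral D1 (fun y => a y * cexp ((l y)%:C * z t)))].
Proof.
move=> mD1 mD ma ml mc mz ia ic aV zB.
have n0 : normc (0 : R[i]) = 0 by apply/eqP; rewrite normc_eq0.
pose W y t := a y * (c t * cexp ((u + l y)%:C * z t)).
have mW : cmeasurable setT (fun q : R * R => W q.1 q.2).
  apply: cmeasurableM; first exact: cmeasurable_fst.
  apply: cmeasurableM; first exact: cmeasurable_snd.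
  apply: cmeasurable_cexp; apply: cmeasurableM; last exact: cmeasurable_snd.
  apply: cmeasurable_real; apply: measurable_funD => //.
  exact: (measurableT_comp ml measurable_fst).
have mW' : cmeasurable setT (fun q : R * R => W q.2 q.1).
  apply: cmeasurableM; first exact: cmeasurable_snd.
  apply: cmeasurableM; first exact: cmeasurable_fst.
  apply: cmeasurable_cexp; apply: cmeasurableM; last exact: cmeasurable_fst.
  apply: cmeasurable_real; apply: measurable_funD => //.
  exact: (measurableT_comp ml measurable_snd).
pose g1 y := expR ((`|u| + V) * B) * normc (a y).
have ig1 : intg D1 g1 by apply: intgZ => //; exact: intg_normc.
have ig2 : intg D (fun t => normc (c t)) by exact: intg_normc.
have g10 y : D1 y -> 0 <= g1 y by move=> _; rewrite mulr_ge0 ?expR_ge0 ?normc_ge0.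
have ee y t : D1 y -> a y != 0 -> D t -> normc (cexp ((u + l y)%:C * z t)) <= expR ((`|u| + V) * B).
  move=> Dy ay Dt; rewrite normc_cexp ler_expR ReM ReC ImC mul0r subr0 (le_trans (ler_norm _))//.
  rewrite normrM ler_pM ?zB// (le_trans (ler_normD _ _))// lerD2l; exact: aV.
have bW y t : D1 y -> D t -> normc (W y t) <= g1 y * normc (c t).
  move=> Dy Dt; rewrite /W /g1 2!normcM.
  have [->|ay] := eqVneq (a y) 0; first by rewrite n0 mulr0 !mul0r.
  rewrite mulrA mulrAC; apply: ler_wpM2r; first exact: normc_ge0.
  by rewrite mulrC ler_wpM2r ?normc_ge0 ?ee.
have bW' t y : D t -> D1 y -> normc (W y t) <= normc (c t) * g1 y.
  by move=> Dt Dy; rewrite mulrC; exact: bW.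
have iy y : D1 y -> a y != 0 -> cintegrable D (fun t => c t * cexp ((u + l y)%:C * z t)).
  move=> Dy ay; apply: (cintegrable_le mD _ (intgZ (expR ((`|u| + V) * B)) mD ig2)).
    apply: (cmeasurableS measurableT (@subsetT _ _)); apply: (cmeasurableM mc).
    by apply: cmeasurable_cexp; apply: (cmeasurableM _ mz); exact: cmeasurable_cst.
  by move=> t Dt; rewrite normcM mulrC ler_wpM2r ?normc_ge0 ?ee.
have it t : D t -> cintegrable D1 (fun y => a y * cexp ((l y)%:C * z t)).
  move=> Dt; apply: (cintegrable_le mD1 _ (intgZ (expR (V * B)) mD1 (intg_normc mD1 ia))).
    apply: (cmeasurableS measurableT (@subsetT _ _)); apply: (cmeasurableM ma).
    by apply: cmeasurable_cexp; apply: cmeasurableM; [exact: cmeasurable_real|exact: cmeasurable_cst].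
  move=> y Dy; rewrite normcM mulrC.
  have [->|ay] := eqVneq (a y) 0; first by rewrite n0 !mulr0.
  rewrite ler_wpM2r ?normc_ge0// normc_cexp ler_expR ReM ReC ImC mul0r subr0 (le_trans (ler_norm _))//.
  by rewrite normrM ler_pM ?zB// aV.
have Ey y : D1 y -> cintegral D (W y) = a y * cintegral D (fun t => c t * cexp ((u + l y)%:C * z t)).
  move=> Dy; have [a0|ay] := eqVneq (a y) 0; last exact: (cintegralZl (a y) mD (iy y Dy ay)).
  rewrite /W a0 mul0r; under eq_cintegral do rewrite mul0r.
  by apply: complexP; rewrite ?Re_cintegral ?Im_cintegral /Rintegral /= integral0_eq.
have Et t : D t -> cintegral D1 (W ^~ t) = c t * cexp (u%:C * z t) *
        cintegral D1 (fun y => a y * cexp ((l y)%:C * z t)).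
  move=> Dt; rewrite -(cintegralZl _ mD1 (it t Dt)); apply: eq_cintegral => y _; rewrite /W rmorphD/= mulrDl cexpD.
  by rewrite (mulrA (c t)) mulrCA.
have [i1 E1] := @cfubini R D1 D W _ _ mD1 mD mW ig1 ig2 g10 bW.
have [i2 _] := @cfubini R D D1 (fun t y => W y t) _ _ mD mD1 mW' ig2 ig1 (fun t _ => normc_ge0 _) bW'.
split.
- exact: eq_cintegrable mD1 Ey i1.
- exact: eq_cintegrable mD Et i2.
- by rewrite -(eq_cintegral Ey) E1; exact: eq_cintegral.
Qed.

Definition laplace a (w : R[i]) : R[i] := cintegral setT (fun v => a v * cexp (v%:C * w)).

Variables (a a1 a2 : R -> R[i]) (V : R).
Hypotheses (da : forall v, cderive a v (a1 v)) (da1 : forall v, cderive a1 v (a2 v)).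
Hypotheses (ca2 : forall v, ccont a2 v) (aV : forall v, V < `|v| -> a v = 0).
Hypothesis V0 : 0 <= V.

Let ca v : ccont a v. Proof. exact: cderive_ccont (da v). Qed.

Lemma derive_support v : V < `|v| -> a1 v = 0.
Proof.
move=> vV.
have nz : \forall x \near v, a x = 0.
  near=> x; apply: aV; near: x.
  by apply: (cvgr_gt `|v|) => //; exact: norm_continuous.
have d0 (g : R -> R) (d : R) : is_derive v 1 g d -> (\forall x \near v, g x = 0) -> d = 0.
  by move=> [_ <-] g0; rewrite (@near_eq_derive _ _ _ g (cst 0) _ _ g0) derive_cst.
have [d1 d2] := da v.
by apply: complexP; [apply: d0 d1 _|apply: d0 d2 _]; apply: filterS nz => x ->.
Unshelve. all: by end_near. Qed.

Lemma ccont_cexp_real (w : R[i]) v : ccont (fun v : R => cexp (v%:C * w)) v.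
Proof.
apply: ccont_cexp; apply: ccontM; last exact: ccont_cst.
by split; [exact: cvg_id|exact: cst_continuous].
Qed.

Lemma laplace_itv (w : R[i]) (W : R) : V < W ->
  laplace a w = cintegral `[- W, W] (fun v => a v * cexp (v%:C * w)).
Proof.
move=> VW; apply: cintegral_support => v h; rewrite aV ?mul0r// ltNge; apply/negP => vV.
by apply: h; rewrite /= in_itv/= -ler_norml (le_trans vV)// ltW.
Qed.

Lemma normc_itv_bound (b : R -> R[i]) (w : R[i]) (W B M : R) : 0 <= W -> 0 <= M ->
  (forall v, - W <= v <= W -> ccont b v) -> (forall v, - W <= v <= W -> normc (b v) <= M) ->
  `|Re w| <= B ->
  normc (cintegral `[- W, W] (fun v => b v * cexp (v%:C * w))) <= 2 * (M * expR (W * B) * (W + W)).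
Proof.
move=> W0 M0 cb bM wB.
have ic : cintegrable `[- W, W] (fun v => b v * cexp (v%:C * w)).
  apply: cintegrable_itv_ccont => v vW; apply: ccontM; [exact: cb|exact: ccont_cexp_real].
apply: (le_trans (normc_cintegral (measurable_itv _) ic)); rewrite ler_wpM2l//.
have ik : intg `[- W, W] (fun=> M * expR (W * B)).
  by apply: intg_itv_continuous => x _; exact: cst_continuous.
apply: le_trans (_ : \int[mu]_(x in `[- W, W]) (M * expR (W * B)) <= _).
  apply: ler_Rint => //; first exact: intg_normc.
  move=> v /=; rewrite in_itv/= => vW; rewrite normcM normc_cexp; apply: ler_pM; rewrite ?normc_ge0 ?expR_ge0 ?bM//.
  rewrite ler_expR ReM ReC ImC mul0r subr0 (le_trans (ler_norm _))// normrM ler_pM//.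
  by rewrite ler_norml.
have WW : - W <= W by rewrite (le_trans _ W0)// oppr_le0.
rewrite Rintegral_cst//= lebesgue_measure_itv/= lte_fin; case: ifPn => //= _.
  by rewrite opprK.
by rewrite mulr0 !mulr_ge0 ?expR_ge0 ?addr_ge0.
Qed.

(** Two integrations by parts turn w^2 times the transform of a into the transform of its second
    derivative, which is bounded on vertical strips; and |w|^2 >= (Im w)^2. *)
Lemma laplace_decay (B : R) :
  exists2 C : R, 0 <= C & forall w, `|Re w| <= B -> normc (laplace a w) * (1 + Im w ^+ 2) <= C.
Proof.
(* An endpoint strictly beyond the support, so that [a] and [a1] both vanish at - W and W. *)
pose W := V + 1; have VW : V < W by rewrite ltrDl.
have W0 : 0 <= W by rewrite addr_ge0.
have WW : - W <= W by rewrite (le_trans _ W0)// oppr_le0.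
have bnd (b : R -> R[i]) : (forall v, ccont b v) ->
    exists2 M : R, 0 <= M & forall v, - W <= v <= W -> normc (b v) <= M.
  move=> cb; have [M1 M10 h1] := @bounded_itv_continuous R (fun v => Re (b v)) (- W) W (fun v _ => (cb v).1).
  have [M2 M20 h2] := @bounded_itv_continuous R (fun v => Im (b v)) (- W) W (fun v _ => (cb v).2).
  exists (M1 + M2); first by rewrite addr_ge0.
  by move=> v vW; rewrite (le_trans (normc_le_ReIm _))// lerD ?h1 ?h2.
have [Ma Ma0 hMa] := bnd a ca; have [M2 M20 hM2] := bnd a2 ca2.
exists (2 * (Ma * expR (W * B) * (W + W)) + 2 * (M2 * expR (W * B) * (W + W))).
  by rewrite addr_ge0// !mulr_ge0 ?expR_ge0 ?addr_ge0.
move=> w wB; rewrite mulrDr mulr1; apply: lerD.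
  rewrite (laplace_itv w VW); apply: normc_itv_bound => // v _; exact: ca.
have E : cintegral `[- W, W] (fun v => a2 v * cexp (v%:C * w)) = w ^+ 2 * laplace a w.
  rewrite (laplace_itv w VW).
  have ia : cintegrable `[- W, W] (fun v => a v * cexp (v%:C * w)).
    by apply: cintegrable_itv_ccont => v _; apply: ccontM; [exact: ca|exact: ccont_cexp_real].
  have ia2 : cintegrable `[- W, W] (fun v => a2 v * cexp (v%:C * w)).
    by apply: cintegrable_itv_ccont => v _; apply: ccontM; [exact: ca2|exact: ccont_cexp_real].
  rewrite -cintegralZl//; apply/eqP; rewrite -subr_eq0 -cintegralB//; last exact: cintegrableZl.
  apply/eqP.
  rewrite (@eq_cintegral _ _ _ (fun v => (a2 v - w ^+ 2 * a v) * cexp (v%:C * w))); last first.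
    by move=> v _; rewrite mulrBl mulrA.
  (* Both integrations by parts at once: (a' - w a) e^(vw) has derivative (a'' - w^2 a) e^(vw). *)
  rewrite (@cintegral_FTC R (fun v => (a1 v - w * a v) * cexp (v%:C * w)))//.
  - rewrite !derive_support ?normrN ?ger0_norm// !aV ?normrN ?ger0_norm//.
    by rewrite !mulr0 !subr0 !mul0r subr0.
  - move=> v _.
    have d1 := cderiveD (da1 v) (cderiveN (cderiveM (cderive_cst w v) (da v))).
    have d2 := cderive_cexp (cderiveM (cderive_real (is_derive_id v (1 : R))) (cderive_cst w v)).
    have := cderiveM d1 d2; move/cderive_eq; apply.
    by rewrite rmorph1; ring.
  - move=> v _; apply: ccontM; last exact: ccont_cexp_real.
    apply: ccontD; first exact: ca2.
    by apply: ccontN; apply: ccontM; [exact: ccont_cst|exact: ca].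
apply: le_trans (_ : normc (w ^+ 2 * laplace a w) <= _).
  have -> : normc (w ^+ 2 * laplace a w) = normc (laplace a w) * normc w ^+ 2.
    by rewrite normcM (expr2 w) (normcM w) -expr2 mulrC.
  by rewrite ler_wpM2l ?normc_ge0// sqr_normc lerDr sqr_ge0.
by rewrite -E; apply: normc_itv_bound => // v _; exact: ca2.
Qed.

End Laplace.

(** * Moving the infinite contour to the critical line *)

Section Laplace_contour.
Variable R : realType.
Local Notation mu := (@lebesgue_measure R).
Local Notation intg D f := (mu.-integrable D (EFin \o f)).
Implicit Types (D E : set R) (c z : R -> R[i]).

Lemma cintegrable_cexp D c z (w B : R) : measurable D -> cmeasurable setT c -> cmeasurable setT z ->
  cintegrable D c -> (forall t, D t -> `|Re (z t)| <= B) ->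
  cintegrable D (fun t => c t * cexp (w%:C * z t)).
Proof.
move=> mD mc mz ic zB.
apply: (cintegrable_le mD _ (intgZ (expR (`|w| * B)) mD (intg_normc mD ic))).
  apply: (cmeasurableS measurableT (@subsetT _ _)); apply: (cmeasurableM mc).
  by apply: cmeasurable_cexp; apply: (cmeasurableM _ mz); exact: cmeasurable_cst.
move=> t Dt; rewrite normcM mulrC ler_wpM2r ?normc_ge0// normc_cexp ler_expR ReM ReC ImC mul0r subr0.
by rewrite (le_trans (ler_norm _))// normrM ler_wpM2l// zB.
Qed.

Variables (a a1 a2 : R -> R[i]) (V : R).
Hypotheses (da : forall v, cderive a v (a1 v)) (da1 : forall v, cderive a1 v (a2 v)).
Hypotheses (ca2 : forall v, ccont a2 v) (aV : forall v, V < `|v| -> a v = 0).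
Hypothesis V0 : 0 <= V.

Let ca v : ccont a v. Proof. exact: cderive_ccont (da v). Qed.
Let ia : cintegrable setT a. Proof. exact: cintegrable_support aV. Qed.
Let ma : cmeasurable setT a. Proof. exact: cintegrable_cmeasurable ia. Qed.
Let aV' v : [set: R] v -> a v != 0 -> `|v| <= V.
Proof. by move=> _; apply: contraNT; rewrite -ltNge => /aV ->. Qed.

Lemma laplace_swap_line D c z u B : measurable D -> cmeasurable setT c -> cmeasurable setT z ->
  cintegrable D c -> (forall t, D t -> `|Re (z t)| <= B) ->
  [/\ cintegrable setT (fun v => a v * cintegral D (fun t => c t * cexp ((u + v)%:C * z t))),
      cintegrable D (fun t => c t * cexp (u%:C * z t) * laplace a (z t)) &
      cintegral setT (fun v => a v * cintegral D (fun t => c t * cexp ((u + v)%:C * z t))) =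
      cintegral D (fun t => c t * cexp (u%:C * z t) * laplace a (z t))].
Proof.
move=> mD mc mz ic zB.
exact: (laplace_swap u measurableT mD ma (@measurable_id _ R setT) mc mz ia ic aV' zB).
Qed.

(* Integrating an identity between exponentials e^(wz) against [a] replaces them by
   the rapidly decreasing [laplace a z]. *)
Lemma laplace_transport D E c1 z1 c2 z2 d1 y1 d2 y2 u B : measurable D -> measurable E ->
  cmeasurable setT c1 -> cmeasurable setT z1 -> cmeasurable setT c2 -> cmeasurable setT z2 ->
  cmeasurable setT d1 -> cmeasurable setT y1 -> cmeasurable setT d2 -> cmeasurable setT y2 ->
  cintegrable D c1 -> cintegrable D c2 -> cintegrable E d1 -> cintegrable E d2 ->
  (forall t, D t -> `|Re (z1 t)| <= B) -> (forall t, D t -> `|Re (z2 t)| <= B) ->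
  (forall t, E t -> `|Re (y1 t)| <= B) -> (forall t, E t -> `|Re (y2 t)| <= B) ->
  (forall w : R, cintegral D (fun t => c1 t * cexp (w%:C * z1 t) - c2 t * cexp (w%:C * z2 t)) =
    cintegral E (fun t => d1 t * cexp (w%:C * y1 t) - d2 t * cexp (w%:C * y2 t))) ->
  cintegral D (fun t => c1 t * cexp (u%:C * z1 t) * laplace a (z1 t)) -
  cintegral D (fun t => c2 t * cexp (u%:C * z2 t) * laplace a (z2 t)) =
  cintegral E (fun t => d1 t * cexp (u%:C * y1 t) * laplace a (y1 t)) -
  cintegral E (fun t => d2 t * cexp (u%:C * y2 t) * laplace a (y2 t)).
Proof.
move=> mD mE mc1 mz1 mc2 mz2 md1 my1 md2 my2 ic1 ic2 id1 id2 zB1 zB2 yB1 yB2.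
have h1 w := cintegrable_cexp w mD mc1 mz1 ic1 zB1.
have h2 w := cintegrable_cexp w mD mc2 mz2 ic2 zB2.
have h3 w := cintegrable_cexp w mE md1 my1 id1 yB1.
have h4 w := cintegrable_cexp w mE md2 my2 id2 yB2.
have [i1 _ <-] := laplace_swap_line u mD mc1 mz1 ic1 zB1.
have [i2 _ <-] := laplace_swap_line u mD mc2 mz2 ic2 zB2.
have [i3 _ <-] := laplace_swap_line u mE md1 my1 id1 yB1.
have [i4 _ <-] := laplace_swap_line u mE md2 my2 id2 yB2.
have mT := @measurableT _ R.
move=> H; apply: (etrans (esym (cintegralB mT i1 i2))); apply: (etrans _ (cintegralB mT i3 i4)).
apply: eq_cintegral => v _; apply: (etrans (esym (mulrBr _ _ _))); apply: (etrans _ (mulrBr _ _ _)).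
congr (_ * _); apply: (etrans (esym (cintegralB mD (h1 _) (h2 _)))).
by apply: (etrans _ (cintegralB mE (h3 _) (h4 _))); exact: H.
Qed.

Variables (gam b1 b2 : R) (sigma : R -> R) (T gam' : R).
Hypothesis dsigma : forall t, derivable sigma t 1.
Hypothesis cdsigma : continuous (derive1 sigma).
Hypothesis sigma_far : forall t, T < `|t| -> sigma t = gam'.
Let p := gam + 2 * gam'.
Hypothesis p2 : 2^-1 < p.
Let s0 := - (gam / 2).
Hypotheses (sb1 : sigma 0 < b1) (sb2 : sigma 0 < b2) (s0b1 : s0 < b1) (s0b2 : s0 < b2).

Let csigma : continuous sigma.
Proof. by move=> t; apply: differentiable_continuous; apply/derivable1_diffP. Qed.

Let p0 : 0 < p. Proof. by apply: lt_trans p2; rewrite invr_gt0. Qed.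

Lemma derive1_sigma_bounded : exists2 M : R, 0 <= M & forall t, `|derive1 sigma t| <= M.
Proof.
have [M M0 hM] := @bounded_itv_continuous R (derive1 sigma) (- T) T (fun t _ => @cdsigma t).
exists M => // t; have [tT|tT] := leP `|t| T; first by apply: hM; rewrite -ler_norml.
rewrite derive1E (@near_eq_derive _ _ _ sigma (cst gam') t 1) ?derive_cst ?normr0//.
near=> x; apply: sigma_far; near: x.
by apply: (cvgr_gt `|t|) => //; exact: norm_continuous.
Unshelve. all: by end_near. Qed.

Definition contour_density t : R[i] := Phi gam b1 b2 (sigma t +i* t) * (derive1 sigma t +i* 1).

Lemma cmeasurable_contour : cmeasurable setT (fun t => sigma t +i* t).
Proof. by split => /=; [exact: continuous_measurable_fun|exact: measurable_id]. Qed.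

Lemma cmeasurable_contour_density : cmeasurable setT contour_density.
Proof.
apply: cmeasurableM; first by apply: cmeasurable_Phi; exact: cmeasurable_contour.
by split => /=; [exact: continuous_measurable_fun|exact: measurable_cst].
Qed.

Lemma cintegrable_contour_density : cintegrable setT contour_density.
Proof.
have mT := @measurableT _ R.
have [C C0 hC] := normc_Phi_zeta csigma sigma_far p0 sb1 s0b1 sb2 s0b2.
have [M M0 hM] := derive1_sigma_bounded.
apply: (cintegrable_le mT cmeasurable_contour_density (intgZ (C * (M + 1)) mT (intg_japanese p2))).
move=> t _; rewrite normcM mulrAC; apply: ler_pM; rewrite ?normc_ge0//.
  by have := hC 1 t; rewrite zeta1 mul1r ler01 lexx mulNr; apply.
by rewrite (le_trans (normc_le_ReIm _))//= normr1 lerD2r.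
Qed.

(** The finite shift, valid for each exponential e^(wz), is integrated against a on [-n, n]. The
    rapid decay of [laplace a] makes the horizontal edges O(1 / (1 + n^2)) and the integral on the
    critical line converge, where the Gamma quotient is merely bounded. *)
Lemma laplace_contour_shift u :
  cintegral setT (fun t => contour_density t * cexp (u%:C * (sigma t +i* t)) * laplace a (sigma t +i* t)) =
  cintegral setT (fun t => Phi gam b1 b2 (s0 +i* t) * 'i * cexp (u%:C * (s0 +i* t)) * laplace a (s0 +i* t)).
Proof.
have mT := @measurableT _ R.
have [C C0 hC] := normc_Phi_zeta csigma sigma_far p0 sb1 s0b1 sb2 s0b2.
have [K1 K10 sep1] := pole_sep_zeta (@csigma 0) sb1 s0b1.
have [K2 K20 sep2] := pole_sep_zeta (@csigma 0) sb2 s0b2.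
have [M M0 hM] := sigma_bounded csigma sigma_far.
pose B := `|s0| + (M + `|s0|).
have zB th t : 0 <= th <= 1 -> `|Re (zeta sigma s0 th t)| <= B.
  move=> /andP[th0 th1]; rewrite /= (le_trans (ler_normD _ _))// lerD2l normrM (ger0_norm th0).
  by rewrite -[leRHS]mul1r ler_pM// (le_trans (ler_normB _ _))// lerD2r.
have zB1 t : `|Re (sigma t +i* t)| <= B by rewrite -(zeta1 sigma s0); apply: zB; rewrite ler01 lexx.
have zB0 t : `|Re (s0 +i* t)| <= B by rewrite -(zeta0 sigma s0); apply: zB; rewrite ler01 lexx.
have [CL CL0 hL] := laplace_decay da da1 ca2 aV V0 B.
have hPhi th t : 0 <= th <= 1 -> normc (Phi gam b1 b2 (zeta sigma s0 th t)) <= C.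
  move=> th01; have /andP[th0 _] := th01; rewrite (le_trans (hC th t th01))// ler_piMr//.
  rewrite -[leRHS]expR0 ler_expR oppr_le0 !mulr_ge0 ?(ltW p0)// ln_ge0// lerDl sqr_ge0.
  by [].
have ni : normc ('i : R[i]) = 1 by rewrite /= expr0n expr1n add0r sqrtr1.
have lap_le th t : 0 <= th <= 1 -> normc (laplace a (zeta sigma s0 th t)) <= CL * (1 + t ^+ 2)^-1.
  move=> th01; rewrite ler_pdivlMr; last by rewrite ltr_pwDl// sqr_ge0.
  exact: hL (zB th t th01).
have cexp_le th t : 0 <= th <= 1 -> normc (cexp (u%:C * zeta sigma s0 th t)) <= expR (`|u| * B).
  move=> th01; rewrite normc_cexp ler_expR ReM ReC ImC mul0r subr0 (le_trans (ler_norm _))//.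
  by rewrite normrM ler_wpM2l// zB.
have mz0 : cmeasurable setT (fun t : R => s0 +i* t) by split => /=; [exact: measurable_cst|exact: measurable_id].
have mz1 := cmeasurable_contour.
pose c2 t := Phi gam b1 b2 (s0 +i* t) * 'i.
have mc2 : cmeasurable setT c2 by apply: cmeasurableM; [exact: cmeasurable_Phi|exact: cmeasurable_cst].
have mc1 := cmeasurable_contour_density; have ic1 := cintegrable_contour_density.
pose P t := contour_density t * cexp (u%:C * (sigma t +i* t)) * laplace a (sigma t +i* t).
pose Q t := c2 t * cexp (u%:C * (s0 +i* t)) * laplace a (s0 +i* t).
have [_ iP _] := laplace_swap_line u mT mc1 mz1 ic1 (fun t _ => zB1 t).
have iQ : cintegrable setT Q.
  (* On a vertical line the Laplace transform is the Fourier transform of a e^(s0 v), hence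
     continuous. *)
  have mL : cmeasurable setT (fun t => laplace a (s0 +i* t)).
    pose h v := a v * (expR (s0 * v))%:C.
    have ch v : ccont h v.
      apply: ccontM => //; split => /=; last exact: cst_continuous.
      exact: is_derive_continuous (is_derive_expR_lin s0 v).
    have ih : cintegrable setT h.
      by apply: (cintegrable_support (V := V)) => // v vV; rewrite /h aV// mul0r.
    have -> : (fun t => laplace a (s0 +i* t)) = fourier h.
      apply/funext => t; apply: eq_cintegral => v _; rewrite /h -mulrA -cexp_cis; congr (_ * cexp _).
      by apply: complexP; rewrite ?ReM ?ImM /=; ring.
    by apply: cmeasurable_ccont => t; exact: ccont_fourier.
  have mQ : cmeasurable setT Q.
    apply: (cmeasurableM _ mL); apply: (cmeasurableM mc2); apply: cmeasurable_cexp.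
    by apply: (cmeasurableM _ mz0); exact: cmeasurable_cst.
  have ij : 2^-1 < 1 :> R by lra.
  apply: (cintegrable_le mT mQ (intgZ (C * expR (`|u| * B) * CL) mT (intg_japanese ij))).
  move=> t _; have t0 : 0 < 1 + t ^+ 2 by rewrite ltr_pwDl// sqr_ge0.
  rewrite mulN1r expRN lnK ?posrE// -mulrA.
  have z01 : 0 <= (0 : R) <= 1 by rewrite lexx ler01.
  have := hPhi 0 t z01; have := lap_le 0 t z01; have := cexp_le 0 t z01; rewrite zeta0 => h1 h2 h3.
  rewrite /Q 2!normcM; apply: ler_pM => //; rewrite ?mulr_ge0 ?normc_ge0//.
  by apply: ler_pM => //; rewrite ?normc_ge0// /c2 normcM ni mulr1.
have exT := exhaustion_setT R.
have lim1 := ccvgD (cvg_cexhaust exT iP) (ccvgN (cvg_cexhaust exT iQ)).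
suff lim0 : ccvg (fun n => cintegral `[- n%:R, n%:R] P - cintegral `[- n%:R, n%:R] Q) 0.
  by apply/eqP; rewrite -subr_eq0; apply/eqP; exact: ccvg_unique lim1 lim0.
pose d N th := Phi gam b1 b2 (zeta sigma s0 th N) * (sigma N - s0)%:C.
(* The horizontal edge at height N, integrated in the homotopy parameter. *)
pose S N := cintegral `[0, 1] (fun th => d N th * cexp (u%:C * zeta sigma s0 th N) * laplace a (zeta sigma s0 th N)).
have mz N : cmeasurable setT (fun th => zeta sigma s0 th N).
  by split => /=; [apply: measurable_funD => //; exact: measurable_funM|exact: measurable_cst].
have md N : cmeasurable setT (d N) by apply: cmeasurableM; [exact: cmeasurable_Phi|exact: cmeasurable_cst].
have m01 := measurable_itv `[0 : R, 1].
have icst x y (k : R) : intg `[x, y] (fun=> k).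
  by apply: intg_itv_continuous => t _; exact: cst_continuous.
have dB N th : `[0, 1]%classic th -> normc (d N th) <= C * (M + `|s0|).
  rewrite /= in_itv/= => th01; rewrite /d (normcM (Phi _ _ _ _)) normcC; apply: ler_pM; rewrite ?normc_ge0 ?hPhi//.
  by rewrite (le_trans (ler_normB _ _))// lerD2r.
have id_ N : cintegrable `[0, 1] (d N).
  exact: cintegrable_le m01 (cmeasurableS measurableT (@subsetT _ _) (md N)) (icst _ _ _) (dB N).
have yB N th : `[0, 1]%classic th -> `|Re (zeta sigma s0 th N)| <= B.
  by rewrite /= in_itv/=; exact: zB.
have SN N : normc (S N) <= 2 * (C * (M + `|s0|) * expR (`|u| * B) * CL) * (1 + N ^+ 2)^-1.
  have [_ iS _] := laplace_swap_line u m01 (md N) (mz N) (id_ N) (yB N).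
  rewrite /S (le_trans (normc_cintegral m01 iS))// -mulrA ler_wpM2l//.
  apply: (@le_trans _ _ (\int[mu]_(th in `[0, 1]) (C * (M + `|s0|) * expR (`|u| * B) * CL * (1 + N ^+ 2)^-1))).
    apply: ler_Rint => //; first exact: intg_normc.
    move=> th th01; rewrite 2!normcM -[leRHS]mulrA; apply: ler_pM; rewrite ?mulr_ge0 ?normc_ge0//.
      by apply: ler_pM; rewrite ?normc_ge0 ?dB// cexp_le//; move: th01; rewrite /= in_itv.
    by apply: lap_le; move: th01; rewrite /= in_itv.
  rewrite Rintegral_cst//= lebesgue_measure_itv/= lte_fin ltr01 /= oppr0 addr0 mulr1.
  by [].
have EN n : cintegral `[- n%:R, n%:R] P - cintegral `[- n%:R, n%:R] Q = S n%:R - S (- n%:R).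
  have mN := measurable_itv `[- n%:R : R, n%:R].
  have ic1N : cintegrable `[- n%:R, n%:R] contour_density by exact: cintegrableS ic1.
  have ic2N : cintegrable `[- n%:R, n%:R] c2.
    apply: cintegrable_le mN (cmeasurableS measurableT (@subsetT _ _) mc2) (icst _ _ C) _ => t _.
    by rewrite /c2 normcM ni mulr1 -(zeta0 sigma s0); apply: hPhi; rewrite ler01 lexx.
  apply: (laplace_transport u mN m01 mc1 mz1 mc2 mz0 (md _) (mz _) (md _) (mz _) ic1N ic2N
    (id_ _) (id_ _) (fun t _ => zB1 t) (fun t _ => zB0 t) (yB _) (yB _)) => w.
  (* The finite shift asks for one separation constant serving both families of poles. *)
  pose K := Num.min K1 K2.
  have K0 : 0 < K by rewrite lt_min K10.
  have sepK b K' th t : K <= K' -> pole_sep b K' (zeta sigma s0 th t) -> pole_sep b K (zeta sigma s0 th t).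
    move=> KK h k; apply: le_trans (h k); rewrite ler_wpM2r// addr_ge0// sqr_ge0.
    by [].
  have N0 : 0 <= n%:R :> R by rewrite ler0n.
  have KK1 : K <= K1 by rewrite ge_min lexx.
  have KK2 : K <= K2 by rewrite ge_min lexx orbT.
  have := @finite_contour_shift R gam b1 b2 sigma s0 n%:R K w dsigma cdsigma N0 K0
    (fun th t h => sepK _ _ _ _ KK1 (sep1 th t h)) (fun th t h => sepK _ _ _ _ KK2 (sep2 th t h)).
  rewrite /contour_density /c2 /d => H; transitivity (cintegral `[0, 1] (fun th : R =>
    Phi gam b1 b2 (zeta sigma s0 th n%:R) * cexp (w%:C * zeta sigma s0 th n%:R) * (sigma n%:R - s0)%:C -
    Phi gam b1 b2 (zeta sigma s0 th (- n%:R)) * cexp (w%:C * zeta sigma s0 th (- n%:R)) * (sigma (- n%:R) - s0)%:C)).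
    by rewrite -H; apply: eq_cintegral => t _; congr (_ - _); exact: mulrAC.
  by apply: eq_cintegral => t _; congr (_ - _); exact: mulrAC.
rewrite (funext EN); clear EN.
have Slim (w : nat -> R) : (forall n, w n ^+ 2 = n%:R ^+ 2) -> ccvg (fun n => S (w n)) 0.
  move=> w2; apply: ccvg0P.
  have h : 2 * (C * (M + `|s0|) * expR (`|u| * B) * CL) * n%:R^-1 @[n --> \oo] --> (0 : R).
    set k := 2 * _; rewrite -[X in _ --> X](mulr0 k); apply: cvgM; [exact: cvg_cst|exact: cvg_natV].
  apply: (squeeze_cvgr _ (cvg_cst 0) h); near=> n.
  have n0 : 0 < (n%:R : R) by near: n; exact: nbhs_infty_gtr.
  rewrite normc_ge0/= (le_trans (SN _))// w2 ler_wpM2l ?mulr_ge0 ?addr_ge0 ?expR_ge0//.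
  rewrite lef_pV2 ?posrE ?ltr_pwDl ?sqr_ge0//.
  by have := sqr_ge0 (n%:R - 1 : R); nra.
rewrite -[X in ccvg _ X]subr0; apply: ccvgD; first exact: Slim.
by apply: ccvgN; apply: Slim => n; rewrite sqrrN.
Unshelve. all: by end_near. Qed.

End Laplace_contour.

(** * The substitution x = e^(gam v) *)

Section Exponential_substitution.
Variable R : realType.
Local Notation mu := (@lebesgue_measure R).
Local Notation intg D f := (mu.-integrable D (EFin \o f)).
Variable gam : R.
Hypothesis gam0 : 0 < gam.

Let F (v : R) := expR (gam * v).
Let F' (v : R) := expR (gam * v) * gam.

Let dF (v : R) : is_derive v 1 F (F' v). Proof. exact: is_derive_expR_lin. Qed.
Let cF' : continuous F'.
Proof.
by move=> v; apply: cvgM; [exact: is_derive_continuous (dF v)|exact: cvg_cst].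
Qed.
Let F'0 v : 0 < F' v. Proof. by rewrite mulr_gt0 ?expR_gt0. Qed.

Lemma exhaustion_expR : exhaustion (Rplus R) (fun n => F (- n%:R)) (fun n => F n%:R).
Proof.
split.
- apply/seteqP; split => x; last first.
    move=> [n _] /=; rewrite in_itv/= => /andP[+ _]; apply: lt_le_trans; exact: expR_gt0.
  rewrite /Rplus/= => x0.
  have [n _ /(_ n (leqnn n)) hn] := @nbhs_infty_gtr R (`|ln x| / gam).
  have : `|ln x| <= gam * n%:R by rewrite -ler_pdivrMl// mulrC ltW.
  rewrite ler_norml => /andP[h1 h2].
  exists n => //=; rewrite in_itv/= /F mulrN -[in X in X && _](lnK x0) -[in X in _ && X](lnK x0).
  by rewrite !ler_expR h1 h2.
- by move=> n; rewrite ler_expR ler_pM2l// (@le_trans _ _ 0)// oppr_le0.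
- by move=> n m nm; rewrite !ler_expR !ler_pM2l// lerN2 ler_nat.
Qed.

Lemma open_Rplus : open (Rplus R).
Proof.
have -> : Rplus R = `]0, +oo[%classic.
  by apply/seteqP; split => x /=; rewrite in_itv/= andbT.
exact: interval_open.
Qed.

Lemma intg_expR_subst (G : R -> R) : (forall x, 0 < x -> {for x, continuous G}) ->
  intg (Rplus R) G <-> intg setT (fun v => G (expR (gam * v)) * (expR (gam * v) * gam)).
Proof. by move=> cG; exact: (intg_subst dF cF' F'0 exhaustion_expR open_Rplus cG). Qed.

Lemma Rint_expR_subst (G : R -> R) : (forall x, 0 < x -> {for x, continuous G}) ->
  intg (Rplus R) G ->
  \int[mu]_(x in Rplus R) G x = \int[mu]_(v in setT) (G (expR (gam * v)) * (expR (gam * v) * gam)).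
Proof. by move=> cG iG; exact: (Rint_subst dF cF' F'0 exhaustion_expR open_Rplus cG iG). Qed.

Lemma cintegral_expR_subst (k : R -> R[i]) : (forall x, 0 < x -> ccont k x) ->
  cintegrable (Rplus R) k ->
  cintegral (Rplus R) k = cintegral setT (fun v => k (expR (gam * v)) * (expR (gam * v) * gam)%:C).
Proof.
move=> ck [i1 i2]; apply: complexP; rewrite ?Re_cintegral ?Im_cintegral.
  rewrite (Rint_expR_subst (fun x x0 => (ck x x0).1) i1); apply: eq_Rint => v _.
  by rewrite ReM ReC ImC mulr0 subr0.
rewrite (Rint_expR_subst (fun x x0 => (ck x x0).2) i2); apply: eq_Rint => v _.
by rewrite ImM ReC ImC mulr0 add0r.
Qed.

End Exponential_substitution.

(** * Test functions in logarithmic coordinates *)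

Section Test_functions.
Variable R : realType.
Implicit Types f : R -> R[i].

Lemma cderive_comp f (g : R -> R) (v : R) d e : cderive f (g v) d -> is_derive v 1 g e ->
  cderive (fun v => f (g v)) v (d * e%:C).
Proof.
move=> [f1 f2] dg; split.
  apply: (is_derive_eq (@is_derive1_comp _ (fun x => Re (f x)) g v _ _ f1 dg)).
  by rewrite ReM ReC ImC mulr0 subr0.
apply: (is_derive_eq (@is_derive1_comp _ (fun x => Im (f x)) g v _ _ f2 dg)).
by rewrite ImM ReC ImC mulr0 add0r.
Qed.

Definition cderive1n n f x : R[i] :=
  derive1n n (fun y => Re (f y)) x +i* derive1n n (fun y => Im (f y)) x.

Lemma test_cderive n f x : test_function f -> cderive (cderive1n n f) x (cderive1n n.+1 f x).
Proof.
move=> [f1 f2 _]; split => /=.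
  by have := f1 n x => h; apply: DeriveDef => //; rewrite -derive1E.
by have := f2 n x => h; apply: DeriveDef => //; rewrite -derive1E.
Qed.

Lemma cderive1n0 f : cderive1n 0 f = f.
Proof. by apply/funext => x; rewrite /cderive1n/=; case: (f x). Qed.

Lemma test_ccont f x : test_function f -> ccont f x.
Proof. by move=> /(test_cderive 0 x); rewrite cderive1n0; exact: cderive_ccont. Qed.

Lemma test_cmeasurable f : test_function f -> cmeasurable setT f.
Proof. by move=> tf; apply: cmeasurable_ccont => t; exact: test_ccont. Qed.

Lemma test_cintegrable f : test_function f -> cintegrable setT f.
Proof.
move=> tf; have [_ _ [a [b [a0 fab]]]] := tf.
apply: (cintegrable_support (V := b)) => [v|v bv]; first exact: test_ccont.
apply/eqP; apply: contraTT bv => /fab /andP[av vb]; rewrite -leNgt ger0_norm//.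
by rewrite ltW// (lt_le_trans a0).
Qed.

Variable gam : R.
Hypothesis gam0 : 0 < gam.

Lemma test_log_support f : test_function f ->
  exists2 V : R, 0 <= V & forall v, V < `|v| -> f (expR (gam * v)) = 0.
Proof.
move=> [_ _ [a [b [a0 fab]]]]; exists ((`|ln a| + `|ln b|) / gam).
  by rewrite divr_ge0 ?addr_ge0// ltW.
move=> v; rewrite ltr_pdivrMr// => h; apply/eqP; apply: contraTT h => /fab /andP[av vb].
have b0 : 0 < b by rewrite (lt_le_trans _ vb)// expR_gt0.
rewrite -leNgt; have -> : `|v| * gam = `|gam * v| by rewrite normrM (gtr0_norm gam0) mulrC.
have h1 : ln a <= gam * v by rewrite -[leRHS]expRK ler_ln ?posrE ?expR_gt0.
have h2 : gam * v <= ln b by rewrite -[leLHS]expRK ler_ln ?posrE ?expR_gt0.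
have h3 := ler_norm (ln b); have h4 := ler_norm (- ln a); rewrite normrN in h4.
have h5 := normr_ge0 (ln b); have h6 := normr_ge0 (ln a).
by rewrite ler_norml; apply/andP; split; lra.
Qed.

(** The density f(y) dy in the coordinate y = e^(gam v), up to the factor gam. *)
Definition log_weighted f (v : R) : R[i] := f (expR (gam * v)) * (expR (gam * v))%:C.

(** Supplies the two derivatives that the double integration by parts of [laplace_decay]
    consumes. *)
Lemma log_weighted_C2 f : test_function f -> exists a1 a2 : R -> R[i],
  [/\ forall v, cderive (log_weighted f) v (a1 v), forall v, cderive a1 v (a2 v) &
      forall v, ccont a2 v].
Proof.
move=> tf.
have dE v := is_derive_expR_lin gam v.
have dg v := cderive_real (dE v).
have df n v : cderive (fun v => cderive1n n f (expR (gam * v))) v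
   (cderive1n n.+1 f (expR (gam * v)) * (expR (gam * v) * gam)%:C).
  exact: (@cderive_comp (cderive1n n f) (fun v => expR (gam * v)) v _ _ (test_cderive _ _ tf) (dE v)).
pose g v : R[i] := (expR (gam * v))%:C.
pose f_ n v := cderive1n n f (expR (gam * v)).
have gM v : (expR (gam * v) * gam)%:C = g v * gam%:C by rewrite rmorphM.
exists (fun v => gam%:C * (f_ 1%N v * (g v * g v) + f_ 0%N v * g v)).
exists (fun v => gam%:C * (gam%:C * (f_ 2%N v * (g v * (g v * g v)) + (f_ 1%N v * (g v * g v)) *+ 3 + f_ 0%N v * g v))).
split => v.
- have -> : log_weighted f = (fun v => f_ 0%N v * g v).
    by apply/funext => w; rewrite /f_ cderive1n0.
  have := cderiveM (df 0%N v) (dg v); move/cderive_eq; apply.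
  by rewrite !gM -/(f_ 0%N v) -/(f_ 1%N v) -/(g v); ring.
- have d2 := cderiveM (df 1%N v) (cderiveM (dg v) (dg v)).
  have := cderiveM (cderive_cst gam%:C v) (cderiveD d2 (cderiveM (df 0%N v) (dg v))).
  move/cderive_eq; apply.
  by rewrite !gM -/(f_ 0%N v) -/(f_ 1%N v) -/(f_ 2%N v) -/(g v); ring.
- have cf n := cderive_ccont (df n v); have cg := cderive_ccont (dg v).
  apply: ccontM; first exact: ccont_cst.
  apply: ccontM; first exact: ccont_cst.
  have c3 (h : R -> R[i]) : ccont h v -> ccont (fun v => h v *+ 3) v.
    move=> ch; have -> : (fun v => h v *+ 3) = (fun v => 3%:R * h v) by apply/funext => w; rewrite mulr_natl.
    by apply: ccontM => //; exact: ccont_cst.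
  apply: ccontD; last exact: ccontM (cf 0%N) cg.
  apply: ccontD; first exact: ccontM (cf 2%N) (ccontM cg (ccontM cg cg)).
  by apply: c3; exact: ccontM (cf 1%N) (ccontM cg cg).
Qed.

End Test_functions.

(** * The Meijer transform of a test function as a Fourier multiplier *)

Section Transform_on_test_functions.
Variable R : realType.
Local Notation mu := (@lebesgue_measure R).
Local Notation intg D f := (mu.-integrable D (EFin \o f)).
Implicit Types f k : R -> R[i].
Variables (gam b1 b2 : R) (sigma : R -> R) (T gam' : R).
Hypothesis gam0 : 0 < gam.
Hypothesis dsigma : forall t, derivable sigma t 1.
Hypothesis cdsigma : continuous (derive1 sigma).
Hypothesis sigma_far : forall t, T < `|t| -> sigma t = gam'.
Hypothesis p2 : 2^-1 < gam + 2 * gam'.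
Hypotheses (sb1 : sigma 0 < b1) (sb2 : sigma 0 < b2).
Hypotheses (b1_gt : 0 < b1 + gam / 2) (b2_gt : 0 < b2 + gam / 2).

Let csigma : continuous sigma.
Proof. by move=> t; apply: differentiable_continuous; apply/derivable1_diffP. Qed.

Let s0b1 : - (gam / 2) < b1. Proof. by rewrite -subr_gt0 opprK. Qed.
Let s0b2 : - (gam / 2) < b2. Proof. by rewrite -subr_gt0 opprK. Qed.

Let mRp := @measurable_Rplus R.

(** The argument (xy)^(1/gam) has logarithm ln x / gam + ln y / gam, so its power lambda splits into
    a factor in x and one in y: the integral over y becomes a Laplace transform. *)
Lemma meijerG2004_contour_density (x y : R) : 0 < x -> 0 < y ->
  meijerG2004 sigma b1%:C b2%:C (1 - gam - b1)%:C (1 - gam - b2)%:C ((x * y) `^ (gam^-1)) =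
  (0 +i* (2%:R * pi))^-1 * cintegral setT (fun t => contour_density gam b1 b2 sigma t *
     cexp ((ln x / gam + ln y / gam)%:C * (sigma t +i* t))).
Proof.
move=> x0 y0; rewrite /meijerG2004; congr (_ * _); apply: eq_cintegral => t _.
rewrite /meijerG2004_integrand /contour_density /Phi /Qlim cpowE.
have -> : ln ((x * y) `^ gam^-1) = ln x / gam + ln y / gam.
  by rewrite ln_powR lnM ?posrE// mulrDr mulrC [_ * ln y]mulrC.
have E b : 1 - (1 - gam - b)%:C = gam%:C + b%:C by rewrite !rmorphB/= rmorph1; ring.
rewrite !E [(sigma t +i* t) * _]mulrC invfM.
by move: (cgamma _) (cgamma _) (cgamma _)^-1 (cgamma _)^-1 (cexp _) => A B C D X; ring.
Qed.

(* The pullback of f as a half-density under x = e^(gam v), hence an L2 isometry up to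
   the factor gam. *)
Definition log_half f (v : R) : R[i] := f (expR (gam * v)) * (expR (gam / 2 * v))%:C.

Lemma laplace_test f (w : R[i]) : test_function f ->
  cintegral (Rplus R) (fun y => f y * cexp ((ln y / gam)%:C * w)) =
  gam%:C * laplace (log_weighted gam f) w.
Proof.
move=> tf; have [V V0 fV] := test_log_support gam0 tf.
have [a1 [a2 [da _ _]]] := log_weighted_C2 gam tf.
have gn : gam != 0 by exact: lt0r_neq0.
have ck y : 0 < y -> ccont (fun y => f y * cexp ((ln y / gam)%:C * w)) y.
  move=> y0; apply: ccontM; first exact: test_ccont.
  apply: ccont_cexp; apply: ccontM; last exact: ccont_cst.
  split => /=; last exact: cst_continuous.
  by apply: cvgM; [exact: continuous_ln_gt0|exact: cvg_cst].
have E v : f (expR (gam * v)) * cexp ((ln (expR (gam * v)) / gam)%:C * w) * (expR (gam * v) * gam)%:C =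
    gam%:C * (log_weighted gam f v * cexp (v%:C * w)).
  rewrite expRK (_ : gam * v / gam = v); last by field.
  by rewrite /log_weighted rmorphM/=; ring.
have ia : cintegrable setT (fun v => log_weighted gam f v * cexp (v%:C * w)).
  apply: (cintegrable_support (V := V)) => [v|v vV]; last by rewrite /log_weighted fV// !mul0r.
  by apply: ccontM; [exact: cderive_ccont (da v)|exact: ccont_cexp_real].
have ik : cintegrable (Rplus R) (fun y => f y * cexp ((ln y / gam)%:C * w)).
  have [i1 i2] : cintegrable setT (fun v => f (expR (gam * v)) * cexp ((ln (expR (gam * v)) / gam)%:C * w) * (expR (gam * v) * gam)%:C).
    apply: eq_cintegrable (cintegrableZl gam%:C _ ia) => // v _; exact: esym (E v).
  split.
    apply/(intg_expR_subst gam0 (fun y y0 => (ck y y0).1)); apply: eq_intg i1 => // v _.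
    by rewrite ReM ReC ImC mulr0 subr0.
  apply/(intg_expR_subst gam0 (fun y y0 => (ck y y0).2)); apply: eq_intg i2 => // v _.
  by rewrite ImM ReC ImC mulr0 add0r.
rewrite (cintegral_expR_subst gam0 ck ik) -cintegralZl//.
by apply: eq_cintegral => v _; exact: E.
Qed.

(** At Re w = - gam / 2 the weight e^(gam v) of the density becomes e^(gam v / 2), that of the
    half-density. *)
Lemma laplace_crit f t : test_function f ->
  laplace (log_weighted gam f) (- (gam / 2) +i* t) = fourier (log_half f) t.
Proof.
move=> tf; apply: eq_cintegral => v _; rewrite /log_weighted /log_half -!mulrA; congr (_ * _).
have -> : v%:C * (- (gam / 2) +i* t) = (- (gam / 2) * v) +i* (t * v).
  by apply: complexP; rewrite ?ReM ?ImM /=; ring.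
rewrite cexp_cis mulrA; congr (_ * _); rewrite -rmorphM -expRD; congr (expR _)%:C.
by field.
Qed.

Definition multiplier f t := crit gam b1 b2 t * fourier (log_half f) t.

Lemma ccont_log_half f v : test_function f -> ccont (log_half f) v.
Proof.
move=> tf; have h c : is_derive v 1 (fun u : R => expR (c * u)) _ := is_derive_expR_lin c v.
apply: ccontM; first exact: cderive_ccont (@cderive_comp R f (fun u => expR (gam * u)) v _ _ (eq_ind _ (fun g => cderive g _ _) (test_cderive 0 _ tf) _ (cderive1n0 f)) (h gam)).
exact: cderive_ccont (cderive_real (h _)).
Qed.

Lemma log_half_support f : test_function f ->
  exists2 V : R, 0 <= V & forall v, V < `|v| -> log_half f v = 0.
Proof.
move=> tf; have [V V0 fV] := test_log_support gam0 tf.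
by exists V => // v /fV h; rewrite /log_half h mul0r.
Qed.

Lemma cintegrable_log_half f : test_function f -> cintegrable setT (log_half f).
Proof.
move=> tf; have [V V0 fV] := log_half_support tf.
by apply: (cintegrable_support (V := V)) fV => v; exact: ccont_log_half.
Qed.

Lemma ccont_multiplier f t : test_function f -> ccont (multiplier f) t.
Proof.
move=> tf; apply: ccontM; first exact: ccont_crit.
exact: ccont_fourier (cintegrable_log_half tf).
Qed.

Lemma normc_multiplier f t : normc (multiplier f t) = normc (fourier (log_half f) t).
Proof. by rewrite /multiplier normcM normc_crit// mul1r. Qed.

Lemma cintegrable_fourier_log_half f : test_function f -> cintegrable setT (fourier (log_half f)).
Proof.
move=> tf; have [V V0 fV] := test_log_support gam0 tf; have mT := @measurableT _ R.
have [a1 [a2 [da da1 ca2]]] := log_weighted_C2 gam tf.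
have aV v : V < `|v| -> log_weighted gam f v = 0 by move=> /fV h; rewrite /log_weighted h mul0r.
have [C C0 hC] := laplace_decay da da1 ca2 aV V0 `|gam / 2|.
have j : 2^-1 < 1 :> R by lra.
have mF : cmeasurable setT (fourier (log_half f)).
  by apply: cmeasurable_ccont => t; exact: ccont_fourier (cintegrable_log_half tf).
apply: (cintegrable_le mT mF (intgZ C mT (intg_japanese j))) => t _.
have t0 : 0 < 1 + t ^+ 2 by rewrite ltr_pwDl// sqr_ge0.
rewrite mulN1r expRN lnK ?posrE// ler_pdivlMr// -laplace_crit//.
by apply: hC; rewrite /= normrN.
Qed.

Lemma cintegrable_multiplier f : test_function f -> cintegrable setT (multiplier f).
Proof.
move=> tf; have mT := @measurableT _ R.
have mM : cmeasurable setT (multiplier f).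
  by apply: cmeasurable_ccont => t; exact: ccont_multiplier.
apply: (cintegrable_le mT mM (intg_normc mT (cintegrable_fourier_log_half tf))) => t _.
by rewrite normc_multiplier.
Qed.

(** The y-integral is carried inside the contour integral, the contour is moved, and [laplace_crit]
    identifies the result. The prefactor 1/gam cancels the gam of dy, and the i of d lambda cancels
    that of 2 pi i. *)
Lemma meijer_transform_test f x : test_function f -> 0 < x ->
  meijer_transform sigma b1 b2 gam f x =
  (expR (- (gam / 2) * (ln x / gam)) / (2 * pi))%:C * fourier (multiplier f) (ln x / gam).
Proof.
move=> tf x0; set u := ln x / gam.
have mT := @measurableT _ R.
have gn : gam != 0 by exact: lt0r_neq0.
have [V V0 fV] := test_log_support gam0 tf.
have [a1 [a2 [da da1 ca2]]] := log_weighted_C2 gam tf.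
have aV v : V < `|v| -> log_weighted gam f v = 0 by move=> /fV h; rewrite /log_weighted h mul0r.
have mc1 := cmeasurable_contour_density gam b1 b2 dsigma cdsigma.
have ic1 := cintegrable_contour_density dsigma cdsigma sigma_far p2 sb1 sb2 s0b1 s0b2.
have mz1 := cmeasurable_contour dsigma.
have [M M0 hM] := sigma_bounded csigma sigma_far.
have ml : measurable_fun setT (fun y : R => ln y / gam) by apply: measurable_funM => //; exact: measurable_ln.
have iF : cintegrable (Rplus R) f by apply: cintegrableS (test_cintegrable tf) => //; exact: mRp.
have lV y : Rplus R y -> f y != 0 -> `|ln y / gam| <= V.
  move=> y0; apply: contraNT; rewrite -ltNge => /fV.
  rewrite (_ : gam * (ln y / gam) = ln y); last by field.
  by rewrite lnK ?posrE// => ->.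
have [iE _ E1] := laplace_swap u mRp mT (test_cmeasurable tf) ml mc1 mz1 iF ic1 lV (fun t _ => hM t).
have [_ iL _] := laplace_swap_line da aV u mT mc1 mz1 ic1 (fun t _ => hM t).
have shift := laplace_contour_shift da da1 ca2 aV V0 dsigma cdsigma sigma_far p2 sb1 sb2 s0b1 s0b2 u.
have iM := cintegrable_cis (measurable_funM (measurable_cst u) (@measurable_id _ R setT)) (cintegrable_multiplier tf).
(* The form reached after the exchange of integrals, still on the original contour. *)
have e1 : meijer_transform sigma b1 b2 gam f x = (gam^-1)%:C * ((0 +i* (2%:R * pi))^-1 *
  (gam%:C * cintegral setT (fun t => contour_density gam b1 b2 sigma t * cexp (u%:C * (sigma t +i* t)) *
   laplace (log_weighted gam f) (sigma t +i* t)))).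
  rewrite /meijer_transform; congr (_ * _); rewrite -(cintegralZl gam%:C mT iL).
  apply: (etrans (eq_cintegral (g := fun y => (0 +i* (2%:R * pi))^-1 * (f y *
    cintegral setT (fun t => contour_density gam b1 b2 sigma t * cexp ((u + ln y / gam)%:C * (sigma t +i* t))))) _)).
    move=> y y0; rewrite (meijerG2004_contour_density x0 y0) -mulrA; congr (_ * _); exact: mulrC.
  rewrite (cintegralZl _ mRp iE); congr (_ * _); rewrite E1.
  apply: eq_cintegral => t _; rewrite (laplace_test (sigma t +i* t) tf); exact: mulrCA.
rewrite e1 shift.
have -> : cintegral setT (fun t => Phi gam b1 b2 (- (gam / 2) +i* t) * 'i * cexp (u%:C * (- (gam / 2) +i* t)) *
    laplace (log_weighted gam f) (- (gam / 2) +i* t)) =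
    ('i * (expR (- (gam / 2) * u))%:C) * fourier (multiplier f) u.
  rewrite -(cintegralZl _ mT iM); apply: eq_cintegral => t _.
  rewrite (laplace_crit t tf) /multiplier /crit.
  have -> : u%:C * (- (gam / 2) +i* t) = (- (gam / 2) * u) +i* (u * t).
    by apply: complexP; rewrite ?ReM ?ImM /=; ring.
  by rewrite cexp_cis; ring.
clear E1 e1 shift iE iL iM.
rewrite !mulrA; congr (_ * _).
have -> : (gam^-1)%:C * (0 +i* (2%:R * pi))^-1 * gam%:C = (0 +i* (2%:R * pi))^-1.
  by rewrite mulrAC -rmorphM mulVf// rmorph1 mul1r.
have -> : (0 +i* (2%:R * (pi : R)))^-1 * 'i = ((2 * pi)^-1)%:C.
  have -> : 0 +i* (2%:R * (pi : R)) = (2 * pi)%:C * 'i by apply: complexP; rewrite /=; ring.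
  have i0 : ('i : R[i]) != 0 by rewrite -normc_gt0 /= expr0n expr1n add0r sqrtr1.
  by rewrite invfM (divfK i0) fmorphV.
by rewrite -rmorphM mulrC.
Qed.

End Transform_on_test_functions.

(** * Reflection of the line *)

Section Reflection.
Variable R : realType.
Local Notation mu := (@lebesgue_measure R).
Local Notation intg D f := (mu.-integrable D (EFin \o f)).

Lemma Rint_reflect (g : R -> R) : continuous g -> intg setT g -> intg setT (fun t => g (- t)) ->
  \int[mu]_(t in setT) g (- t) = \int[mu]_(t in setT) g t.
Proof.
move=> cg i1 i2; have exT := exhaustion_setT R.
have h1 := cvg_exhaust exT i1; have h2 := cvg_exhaust exT i2.
rewrite -(cvg_lim _ h1)// -(cvg_lim _ h2)//; congr (lim (_ @ \oo)); apply/funext => n.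
have nn : - n%:R <= n%:R :> R by case: exT.
rewrite /Rintegral; congr fine.
have := @integration_by_substitution_oppr R g (- n%:R) n%:R nn.
rewrite opprK => -> //.
by apply: continuous_subspaceT.
Qed.

Lemma cintegral_reflect (g : R -> R[i]) : (forall t, ccont g t) -> cintegrable setT g ->
  cintegrable setT (fun t => g (- t)) ->
  cintegral setT (fun t => g (- t)) = cintegral setT g.
Proof.
move=> cg [i1 i2] [j1 j2]; apply: complexP; rewrite ?Re_cintegral ?Im_cintegral.
  by apply: (@Rint_reflect (fun t => Re (g t))) => // t; have [] := cg t.
by apply: (@Rint_reflect (fun t => Im (g t))) => // t; have [] := cg t.
Qed.

Lemma cintegrable_expR_subst (gam : R) (k : R -> R[i]) : 0 < gam -> (forall x, 0 < x -> ccont k x) ->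
  cintegrable setT (fun v => k (expR (gam * v)) * (expR (gam * v) * gam)%:C) ->
  cintegrable (Rplus R) k.
Proof.
move=> gam0 ck [i1 i2]; split.
  apply/(intg_expR_subst gam0 (fun y y0 => (ck y y0).1)); apply: eq_intg i1 => // v _.
  by rewrite ReM ReC ImC mulr0 subr0.
apply/(intg_expR_subst gam0 (fun y y0 => (ck y y0).2)); apply: eq_intg i2 => // v _.
by rewrite ImM ReC ImC mulr0 add0r.
Qed.

End Reflection.

(** * Isometry, symmetry and reality on test functions *)

Section Transform_properties.
Variable R : realType.
Local Notation mu := (@lebesgue_measure R).
Local Notation intg D f := (mu.-integrable D (EFin \o f)).
Implicit Types f k : R -> R[i].
Variables (gam b1 b2 : R).
Hypothesis gam0 : 0 < gam.
Hypotheses (b1_gt : 0 < b1 + gam / 2) (b2_gt : 0 < b2 + gam / 2).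

Let mRp := @measurable_Rplus R.
Let gn : gam != 0. Proof. exact: lt0r_neq0. Qed.
Let pn : (2 * pi : R) != 0. Proof. by apply: lt0r_neq0; rewrite mulr_gt0// pi_gt0. Qed.

(** The exponential is x^(-1/2): it undoes the half-density factor in the variable x. This formula
    agrees with the Meijer transform for x > 0 and no longer involves the contour. *)
Definition critical_transform f (x : R) : R[i] :=
  (expR (- (gam / 2) * (ln x / gam)) / (2 * pi))%:C * fourier (multiplier gam b1 b2 f) (ln x / gam).

Local Notation Tr := critical_transform.

Lemma ccont_critical_transform f x : test_function f -> 0 < x -> ccont (Tr f) x.
Proof.
move=> tf x0.
have cl : {for x, continuous (fun x : R => ln x / gam)}.
  by apply: cvgM; [exact: continuous_ln_gt0|exact: cvg_cst].
have [c1 c2] := ccont_fourier (ln x / gam) (cintegrable_multiplier gam0 b1_gt b2_gt tf).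
apply: ccontM.
  split => /=; last exact: cst_continuous.
  apply: cvgM; last exact: cvg_cst.
  apply: (@continuous_comp _ _ _ (fun x : R => - (gam / 2) * (ln x / gam)) (@expR R)).
    by apply: cvgM => //; exact: cvg_cst.
  exact: continuous_expR.
split; [exact: (continuous_comp cl c1)|exact: (continuous_comp cl c2)].
Qed.

Lemma log_half_linear (c : R[i]) f k v :
  log_half gam (fun x => c * f x + k x) v = c * log_half gam f v + log_half gam k v.
Proof. by rewrite /log_half; ring. Qed.

Lemma fourier_linear (c : R[i]) (f k : R -> R[i]) u : cintegrable setT f -> cintegrable setT k ->
  fourier (fun t => c * f t + k t) u = c * fourier f u + fourier k u.
Proof.
move=> i1 i2; have mT := @measurableT _ R.
have mu_ : measurable_fun setT (fun t : R => u * t) by exact: measurable_funM.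
have j1 := cintegrable_cis mu_ i1; have j2 := cintegrable_cis mu_ i2.
rewrite -(cintegralZl c mT j1) -(cintegralD mT (cintegrableZl c mT j1) j2).
by apply: eq_cintegral => t _; ring.
Qed.

Lemma critical_transform_linear (c : R[i]) f k x : test_function f -> test_function k ->
  Tr (fun x => c * f x + k x) x = c * Tr f x + Tr k x.
Proof.
move=> tf tk.
have i1 := cintegrable_log_half gam0 tf; have i2 := cintegrable_log_half gam0 tk.
have e1 t : multiplier gam b1 b2 (fun x => c * f x + k x) t = c * multiplier gam b1 b2 f t + multiplier gam b1 b2 k t.
  rewrite /multiplier (_ : log_half gam _ = (fun v => c * log_half gam f v + log_half gam k v)).
    by rewrite (fourier_linear c t i1 i2); ring.
  by apply/funext => v; exact: log_half_linear.
rewrite /critical_transform (funext e1).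
rewrite (fourier_linear c _ (cintegrable_multiplier gam0 b1_gt b2_gt tf) (cintegrable_multiplier gam0 b1_gt b2_gt tk)).
by rewrite [LHS]mulrDr; congr (_ + _); exact: mulrCA.
Qed.

Lemma bounded_fourier (f : R -> R[i]) : cintegrable setT f -> exists M : R, forall u, normc (fourier f u) <= M.
Proof. by move=> i; eexists => u; exact: normc_fourier i. Qed.

Lemma bounded_ccont_support (f : R -> R[i]) V : (forall v, ccont f v) -> (forall v, V < `|v| -> f v = 0) ->
  exists M : R, forall v, normc (f v) <= M.
Proof.
move=> cf fV.
have [M1 M10 h1] := @bounded_itv_continuous R (fun v => Re (f v)) (- V) V (fun v _ => (cf v).1).
have [M2 M20 h2] := @bounded_itv_continuous R (fun v => Im (f v)) (- V) V (fun v _ => (cf v).2).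
exists (M1 + M2) => v; have [vV|vV] := leP `|v| V; last first.
  by rewrite fV// (_ : normc 0 = 0) ?addr_ge0//; apply/eqP; rewrite normc_eq0.
by rewrite (le_trans (normc_le_ReIm _))// lerD ?h1 ?h2 // -ler_norml.
Qed.

(** Plancherel is used twice, for the multiplied transform and for the half-density, with |m| = 1 in
    between. The two factors 2 pi cancel the square of 1 / (2 pi). *)
Lemma critical_transform_isometry f : test_function f ->
  [/\ intg (Rplus R) (fun x => normc (Tr f x) ^+ 2), intg (Rplus R) (fun x => normc (f x) ^+ 2) &
    \int[mu]_(x in Rplus R) normc (Tr f x) ^+ 2 = \int[mu]_(x in Rplus R) normc (f x) ^+ 2].
Proof.
move=> tf; have mT := @measurableT _ R.
have iM := cintegrable_multiplier gam0 b1_gt b2_gt tf; have iH := cintegrable_log_half gam0 tf.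
have iF := cintegrable_fourier_log_half gam0 tf.
have [V V0 fV] := log_half_support gam0 tf.
have [C hC] := bounded_ccont_support (fun v => ccont_log_half gam v tf) fV.
have [C' hC'] := bounded_fourier iH.
have nm t : normc (multiplier gam b1 b2 f t) = normc (fourier (log_half gam f) t).
  exact: normc_multiplier.
have cm t : ccont (multiplier gam b1 b2 f) t by exact: ccont_multiplier.
have bm t : normc (multiplier gam b1 b2 f t) <= C' by rewrite nm.
have [P1 P2] := plancherel cm bm iM.
have [P3 P4] := plancherel (fun v => ccont_log_half gam v tf) hC iH.
have c1 x : 0 < x -> {for x, continuous (fun x => normc (Tr f x) ^+ 2)}.
  by move=> x0; apply: continuous_sqr_normc; exact: ccont_critical_transform.
have c2 x : 0 < x -> {for x, continuous (fun x => normc (f x) ^+ 2)}.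
  by move=> x0; apply: continuous_sqr_normc; exact: test_ccont.
have E1 v : normc (Tr f (expR (gam * v))) ^+ 2 * (expR (gam * v) * gam) =
    gam / (2 * pi) ^+ 2 * normc (fourier (multiplier gam b1 b2 f) v) ^+ 2.
  rewrite /critical_transform expRK (_ : gam * v / gam = v); last by field.
  rewrite normcM normcC exprMn real_normK ?num_real// exprMn exprVn.
  have e2 : expR (- (gam / 2) * v) ^+ 2 * expR (gam * v) = 1.
    rewrite expr2 -!expRD -[RHS]expR0; congr expR; by field.
  by rewrite -[RHS]mul1r -[X in _ = X * _]e2; ring.
have E2 v : normc (f (expR (gam * v))) ^+ 2 * (expR (gam * v) * gam) = gam * normc (log_half gam f v) ^+ 2.
  rewrite /log_half normcM normcC exprMn real_normK ?num_real//.
  have -> : expR (gam / 2 * v) ^+ 2 = expR (gam * v) by rewrite expr2 -expRD; congr expR; field.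
  by ring.
have i1 : intg (Rplus R) (fun x => normc (Tr f x) ^+ 2).
  by apply/(intg_expR_subst gam0 c1); apply: eq_intg (fun v _ => esym (E1 v)) _ => //; exact: intgZ.
have iH2 : intg setT (fun v => normc (log_half gam f v) ^+ 2).
  apply: (intg_le _ _ (intgZ C _ (intg_normc mT iH))) => //.
    by apply: measurable_funX; exact: cmeasurable_normc (cintegrable_cmeasurable iH).
  by move=> t _; rewrite ger0_norm ?sqr_ge0// expr2 ler_wpM2r ?normc_ge0.
have i2 : intg (Rplus R) (fun x => normc (f x) ^+ 2).
  by apply/(intg_expR_subst gam0 c2); apply: eq_intg (fun v _ => esym (E2 v)) _ => //; exact: intgZ.
split => //; rewrite (Rint_expR_subst gam0 c1 i1) (Rint_expR_subst gam0 c2 i2).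
rewrite (eq_Rint (fun v _ => E1 v)) (eq_Rint (fun v _ => E2 v)) !RintegralZl// P2.
rewrite (eq_Rint (fun v _ => congr1 (fun x => x ^+ 2) (nm v))) P4.
by move: pn; set P := 2 * pi => Pn; field; exact: Pn.
Qed.

(** The pairing carries no conjugation, because the Fourier transform is symmetric for the bilinear
    product; the right-hand side is visibly symmetric in f and k. *)
Lemma critical_transform_adjoint f k : test_function f -> test_function k ->
  cintegrable (Rplus R) (fun x => Tr f x * k x) /\
  cintegral (Rplus R) (fun x => Tr f x * k x) =
  (gam / (2 * pi))%:C * cintegral setT (fun t => crit gam b1 b2 t *
     (fourier (log_half gam f) t * fourier (log_half gam k) t)).
Proof.
move=> tf tk; have mT := @measurableT _ R.
have iM := cintegrable_multiplier gam0 b1_gt b2_gt tf; have iH := cintegrable_log_half gam0 tk.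
have [V V0 kV] := log_half_support gam0 tk.
have ck x : 0 < x -> ccont (fun x => Tr f x * k x) x.
  by move=> x0; apply: ccontM; [exact: ccont_critical_transform|exact: test_ccont].
have E v : Tr f (expR (gam * v)) * k (expR (gam * v)) * (expR (gam * v) * gam)%:C =
    (gam / (2 * pi))%:C * (log_half gam k v * fourier (multiplier gam b1 b2 f) v).
  rewrite /critical_transform expRK (_ : gam * v / gam = v); last by field.
  rewrite /log_half.
  have -> : expR (gam / 2 * v) = expR (- (gam / 2) * v) * expR (gam * v).
    by rewrite -expRD; congr expR; field.
  by rewrite !rmorphM/=; ring.
have i : cintegrable setT (fun v => log_half gam k v * fourier (multiplier gam b1 b2 f) v).
  apply: (cintegrable_support (V := V)) => [v|v vV]; last by rewrite kV// mul0r.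
  by apply: ccontM; [exact: ccont_log_half|exact: ccont_fourier].
have iE := cintegrableZl (gam / (2 * pi))%:C mT i.
have ik : cintegrable (Rplus R) (fun x => Tr f x * k x).
  by apply: (cintegrable_expR_subst gam0 ck); apply: eq_cintegrable (fun v _ => esym (E v)) iE.
split => //.
rewrite (cintegral_expR_subst gam0 ck ik) (eq_cintegral (fun v _ => E v)) (cintegralZl _ mT i).
congr (_ * _); rewrite (fourier_adjoint iM iH); apply: eq_cintegral => t _.
by rewrite /multiplier mulrA.
Qed.

Lemma test_conj f : test_function f -> test_function (fun x => conjc (f x)).
Proof.
move=> [f1 f2 [a [b [a0 fab]]]]; split.
- by move=> n x; have := f1 n x; rewrite (_ : (fun y => Re (conjc (f y))) = (fun y => Re (f y)))//; apply/funext => y; exact: Re_conj.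
- move=> n x; have h : (fun y => Im (conjc (f y))) = (fun y => - Im (f y)) by apply/funext => y; exact: Im_conj.
  rewrite h.
  have -> : derive1n n (fun y => - Im (f y)) = (fun y => - derive1n n (fun y => Im (f y)) y).
    elim: n {x} => [//|n IH]; rewrite [LHS]/= IH; apply/funext => y.
    by rewrite derive1E deriveN; [rewrite -derive1E|exact: f2].
  exact: derivableN (f2 n x).
- exists a, b; split => // x; rewrite conjc_eq0; exact: fab.
Qed.

Lemma conj_fourier (f : R -> R[i]) u : cintegrable setT f ->
  conjc (fourier f u) = fourier (fun t => conjc (f t)) (- u).
Proof.
move=> i; rewrite conj_cintegral//; last by apply: cintegrable_cis => //; exact: measurable_funM.
by apply: eq_cintegral => t _; rewrite (conjcM (f t)) conj_cis mulNr.
Qed.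

(** Conjugation reverses the frequency in each Fourier transform, and conj (m t) = m (- t) matches
    this reversal; the substitution t to - t then restores the formula. In effect the kernel is
    real. *)
Lemma critical_transform_conj f x : test_function f ->
  conjc (Tr f x) = Tr (fun x => conjc (f x)) x.
Proof.
move=> tf; have tc := test_conj tf; have mT := @measurableT _ R.
have iM := cintegrable_multiplier gam0 b1_gt b2_gt tf; have iMc := cintegrable_multiplier gam0 b1_gt b2_gt tc.
rewrite /critical_transform (conjcM (_)%:C) conjcR; congr (_ * _).
set u := ln x / gam; rewrite (conj_fourier _ iM).
(* Conjugating f reflects its Fourier transform, so conjugating the multiplied transform amounts to
   reflecting the one of the conjugate function. *)
have E t : conjc (multiplier gam b1 b2 f t) = multiplier gam b1 b2 (fun x => conjc (f x)) (- t).
  rewrite /multiplier (conjcM (crit _ _ _ _)) conj_crit// (conj_fourier _ (cintegrable_log_half gam0 tf)).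
  have -> : log_half gam (fun x => conjc (f x)) = (fun v => conjc (log_half gam f v)); last by [].
  by apply/funext => v; rewrite /log_half (conjcM (f _)) conjcR.
have mm (w : R) : measurable_fun setT (fun t : R => w * t) by exact: measurable_funM.
have E2 t : conjc (multiplier gam b1 b2 f t) * cis (- u * t) =
   (fun s => multiplier gam b1 b2 (fun x => conjc (f x)) s * cis (u * s)) (- t).
  by rewrite E mulrN mulNr.
rewrite /fourier (eq_cintegral (fun t _ => E2 t)); apply: (@cintegral_reflect R (fun s => _ s * cis (u * s))).
- move=> t; apply: ccontM; first exact: ccont_multiplier.
  have h : {for t, continuous (fun t : R => u * t)} by exact: is_derive_continuous (is_derive_lin u t).
  split; [exact: (continuous_comp h (@continuous_cos R _))|exact: (continuous_comp h (@continuous_sin R _))].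
- exact: cintegrable_cis.
- apply: (eq_cintegrable mT (fun t _ => E2 t)); apply: cintegrable_cis => //.
  apply: (cintegrable_le mT _ (intg_normc mT iM)).
    exact: cmeasurable_conj (cintegrable_cmeasurable iM).
  by move=> t _; rewrite normc_conj.
Qed.

End Transform_properties.

(** * Square-integrable functions *)

Section L2_space.
Variable R : realType.
Local Notation mu := (@lebesgue_measure R).
Local Notation intg D f := (mu.-integrable D (EFin \o f)).
Local Notation Rp := (Rplus R).
Implicit Types (f g k : R -> R[i]) (c : R[i]).

Let mRp := @measurable_Rplus R.

(** The real part of the Hermitian product. Norms and symmetry need only this real form; the
    imaginary part is recovered by rotating g. *)
Definition ipL2 f g := \int[mu]_(x in Rp) (Re (f x) * Re (g x) + Im (f x) * Im (g x)).

Definition nsqL2 f := \int[mu]_(x in Rp) normc (f x) ^+ 2.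

Lemma inL2P f : inL2 f <-> cmeasurable Rp f /\ intg Rp (fun x => normc (f x) ^+ 2).
Proof.
split=> [[m1 m2 h]|[[m1 m2] h]].
  have mf : cmeasurable Rp f by [].
  split => //; apply: intg_fin_lty => //.
    by apply: measurable_funX; exact: cmeasurable_normc.
  by under eq_integral do rewrite ger0_norm ?sqr_ge0//.
split => //; rewrite (Rint_EFin mRp h); exact: ltry.
Qed.

Lemma inL2_cmeasurable f : inL2 f -> cmeasurable Rp f.
Proof. by move=> /inL2P[]. Qed.

Lemma inL2_intg f : inL2 f -> intg Rp (fun x => normc (f x) ^+ 2).
Proof. by move=> /inL2P[]. Qed.

Lemma ipL2_nsq f : ipL2 f f = nsqL2 f.
Proof. by apply: eq_Rint => x _; rewrite sqr_normc !expr2. Qed.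

Lemma ip_le (z w : R[i]) : `|Re z * Re w + Im z * Im w| <= normc z ^+ 2 + normc w ^+ 2.
Proof.
rewrite !sqr_normc ler_norml.
have h1 := sqr_ge0 (Re z - Re w); have h2 := sqr_ge0 (Re z + Re w).
have h3 := sqr_ge0 (Im z - Im w); have h4 := sqr_ge0 (Im z + Im w).
have := sqr_ge0 (Re z); have := sqr_ge0 (Re w); have := sqr_ge0 (Im z); have := sqr_ge0 (Im w).
by move=> *; apply/andP; split; nra.
Qed.

Lemma inL2_intg_ip f g : inL2 f -> inL2 g ->
  intg Rp (fun x => Re (f x) * Re (g x) + Im (f x) * Im (g x)).
Proof.
move=> /inL2P[[f1 f2] fi] /inL2P[[g1 g2] gi].
apply: (intg_le mRp _ (intgD mRp fi gi)).
  by apply: measurable_funD; apply: measurable_funM.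
by move=> x _; exact: ip_le.
Qed.

Lemma inL2_lin c f g : inL2 f -> inL2 g -> inL2 (fun x => c * f x + g x).
Proof.
move=> /inL2P[mf fi] /inL2P[mg gi]; apply/inL2P.
have m : cmeasurable Rp (fun x => c * f x + g x).
  by apply: cmeasurableD => //; apply: cmeasurableM => //; exact: cmeasurable_cst.
split => //; apply: (intg_le mRp _ (intgD mRp (intgZ (2 * normc c ^+ 2) mRp fi) (intgZ 2 mRp gi))).
  by apply: measurable_funX; exact: cmeasurable_normc.
move=> x _; rewrite ger0_norm ?sqr_ge0//.
have h := normcD (c * f x) (g x); rewrite normcM in h.
have n0 := normc_ge0 (c * f x + g x).
apply: (@le_trans _ _ ((normc c * normc (f x) + normc (g x)) ^+ 2)).
  by rewrite ler_pXn2r ?nnegrE ?addr_ge0 ?mulr_ge0 ?normc_ge0.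
have := sqr_ge0 (normc c * normc (f x) - normc (g x)).
by move: (normc c) (normc (f x)) (normc (g x)) => C F G; nra.
Qed.

Lemma inL2_cst0 : inL2 (fun=> 0 : R[i]).
Proof.
apply/inL2P; split; first exact: cmeasurable_cst.
have -> : (fun _ : R => normc (0 : R[i]) ^+ 2) = (fun=> 0).
  by apply/funext => x; apply/eqP; rewrite sqrf_eq0 normc_eq0.
exact: integrable0.
Qed.

Lemma inL2Z c f : inL2 f -> inL2 (fun x => c * f x).
Proof.
move=> h; have := inL2_lin c h inL2_cst0.
by rewrite (_ : (fun x => c * f x + 0) = (fun x => c * f x))//; apply/funext => x; rewrite addr0.
Qed.

Lemma inL2D f g : inL2 f -> inL2 g -> inL2 (fun x => f x + g x).
Proof.
move=> h1 h2; have := inL2_lin 1 h1 h2.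
by rewrite (_ : (fun x => 1 * f x + g x) = (fun x => f x + g x))//; apply/funext => x; rewrite mul1r.
Qed.

Lemma inL2B f g : inL2 f -> inL2 g -> inL2 (fun x => f x - g x).
Proof.
move=> h1 h2; have := inL2_lin (-1) h2 h1.
by rewrite (_ : (fun x => -1 * g x + f x) = (fun x => f x - g x))//; apply/funext => x; rewrite mulN1r addrC.
Qed.

Lemma nsqL2_ge0 f : 0 <= nsqL2 f.
Proof. by apply: Rintegral_ge0 => x _; exact: sqr_ge0. Qed.

Lemma nsqL2Z c f : inL2 f -> nsqL2 (fun x => c * f x) = normc c ^+ 2 * nsqL2 f.
Proof.
move=> /inL2_intg fi; rewrite /nsqL2 -RintegralZl//; apply: eq_Rint => x _.
by rewrite normcM exprMn.
Qed.

Lemma ipL2C f g : ipL2 f g = ipL2 g f.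
Proof. by apply: eq_Rint => x _; rewrite mulrC [Im (f x) * _]mulrC. Qed.

Lemma ipL2Dl f g k : inL2 f -> inL2 g -> inL2 k ->
  ipL2 (fun x => f x + g x) k = ipL2 f k + ipL2 g k.
Proof.
move=> hf hg hk; rewrite /ipL2 -RintegralD//; try exact: inL2_intg_ip.
by apply: eq_Rint => x _; rewrite ReD ImD; ring.
Qed.

Lemma ipL2Bl f g k : inL2 f -> inL2 g -> inL2 k ->
  ipL2 (fun x => f x - g x) k = ipL2 f k - ipL2 g k.
Proof.
move=> hf hg hk; rewrite /ipL2 -RintegralB//; try exact: inL2_intg_ip.
by apply: eq_Rint => x _; rewrite ReD ImD ReN ImN; ring.
Qed.

Lemma ipL2Br f g k : inL2 f -> inL2 g -> inL2 k ->
  ipL2 k (fun x => f x - g x) = ipL2 k f - ipL2 k g.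
Proof. by move=> hf hg hk; rewrite ipL2C ipL2Bl// ![ipL2 k _]ipL2C. Qed.

Lemma nsqL2D f g : inL2 f -> inL2 g ->
  nsqL2 (fun x => f x + g x) = nsqL2 f + nsqL2 g + 2 * ipL2 f g.
Proof.
move=> hf hg; have hs := inL2D hf hg.
rewrite -!ipL2_nsq ipL2Dl// ![ipL2 _ (fun x => f x + g x)]ipL2C !ipL2Dl//.
by rewrite [ipL2 g f]ipL2C; ring.
Qed.

Lemma nsqL2B f g : inL2 f -> inL2 g ->
  nsqL2 (fun x => f x - g x) = nsqL2 f + nsqL2 g - 2 * ipL2 f g.
Proof.
move=> hf hg; have hs := inL2B hf hg.
rewrite -!ipL2_nsq ipL2Bl// ![ipL2 _ (fun x => f x - g x)]ipL2C !ipL2Bl//.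
by rewrite [ipL2 g f]ipL2C; ring.
Qed.

Lemma nsqL2_distC f g : nsqL2 (fun x => f x - g x) = nsqL2 (fun x => g x - f x).
Proof. by apply: eq_Rint => x _; rewrite -[f x - g x]opprB normc_N. Qed.

Lemma nsqL2D_le f g : inL2 f -> inL2 g ->
  nsqL2 (fun x => f x + g x) <= 2 * nsqL2 f + 2 * nsqL2 g.
Proof.
move=> hf hg; have := nsqL2_ge0 (fun x => f x - g x).
by rewrite nsqL2B// => h; rewrite nsqL2D//; lra.
Qed.

Lemma nsqL2_triangle f g k : inL2 f -> inL2 g -> inL2 k ->
  nsqL2 (fun x => f x - k x) <= 2 * nsqL2 (fun x => f x - g x) + 2 * nsqL2 (fun x => g x - k x).
Proof.
move=> hf hg hk; apply: le_trans (nsqL2D_le (inL2B hf hg) (inL2B hg hk)).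
by rewrite le_eqVlt; apply/orP; left; apply/eqP; apply: eq_Rint => x _; rewrite addrA subrK.
Qed.

(** The squared norm of t f - g is a nonnegative quadratic in the real number t. *)
Lemma cauchy_schwarz f g : inL2 f -> inL2 g ->
  `|ipL2 f g| <= Num.sqrt (nsqL2 f) * Num.sqrt (nsqL2 g).
Proof.
move=> hf hg; rewrite -sqrtrM ?nsqL2_ge0// -sqrtr_sqr; apply: ler_wsqrtr.
have q t : 0 <= nsqL2 f * t ^+ 2 - 2 * ipL2 f g * t + nsqL2 g.
  have hc : inL2 (fun x => t%:C * f x) by exact: inL2Z.
  have := nsqL2_ge0 (fun x => t%:C * f x - g x); rewrite nsqL2B// nsqL2Z// normcC real_normK ?num_real//.
  have -> : ipL2 (fun x => t%:C * f x) g = t * ipL2 f g.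
    rewrite /ipL2 -RintegralZl//; last exact: inL2_intg_ip.
    by apply: eq_Rint => x _; rewrite ReM ImM ReC ImC !mul0r subr0 addr0 mulrDr !mulrA.
  lra.
have a0 := nsqL2_ge0 f; have b0 := nsqL2_ge0 g.
move: (nsqL2 f) (nsqL2 g) (ipL2 f g) q a0 b0 => A B I q A0 B0.
have [Az|An] := eqVneq A 0.
  (* If the leading coefficient is 0 and I is not, this t gives the quadratic the value -1, a
     contradiction. *)
  have := q ((B + 1) / (2 * I)); rewrite Az !mul0r add0r.
  have [->|In] := eqVneq I 0; first by rewrite expr0n.
  rewrite (_ : 2 * I * ((B + 1) / (2 * I)) = B + 1); last by field.
  lra.
have Ap : 0 < A by rewrite lt_neqAle eq_sym An.
(* The minimum of the quadratic. *)
have := q (I / A).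
have -> : A * (I / A) ^+ 2 - 2 * I * (I / A) + B = (A * B - I ^+ 2) / A by field.
by rewrite pmulr_lge0 ?invr_gt0// subr_ge0.
Qed.

Lemma eqL2_refl f : eqL2 f f.
Proof. exact: ae_eq_refl. Qed.

Lemma eqL2_sym f g : eqL2 f g -> eqL2 g f.
Proof. exact: ae_eq_sym. Qed.

Lemma eqL2_trans f g k : eqL2 f g -> eqL2 g k -> eqL2 f k.
Proof. exact: ae_eq_trans. Qed.

Lemma eqL2_pointwise f g : (forall x, 0 < x -> f x = g x) -> eqL2 f g.
Proof. by move=> h; apply: aeW => x x0; exact: h. Qed.

Lemma eqL2_Rint (F G : R -> R) : measurable_fun Rp F -> measurable_fun Rp G ->
  ae_eq mu Rp F G ->
  \int[mu]_(x in Rp) F x = \int[mu]_(x in Rp) G x.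
Proof.
move=> mF mG h; rewrite /Rintegral; congr fine.
apply: (@ae_eq_integral _ _ _ mu Rp (EFin \o G) (EFin \o F) mRp); [exact/measurable_EFinP|exact/measurable_EFinP|].
by apply: filterS h => x h x0 /=; rewrite h.
Qed.

Lemma eqL2_nsq f g : inL2 f -> inL2 g -> eqL2 f g -> nsqL2 f = nsqL2 g.
Proof.
move=> /inL2_cmeasurable mf /inL2_cmeasurable mg fg; apply: eqL2_Rint.
- by apply: measurable_funX; exact: cmeasurable_normc.
- by apply: measurable_funX; exact: cmeasurable_normc.
- by apply: filterS fg => x h x0; rewrite h.
Qed.

Lemma eqL2_nsq0 f g : inL2 f -> inL2 g -> nsqL2 (fun x => f x - g x) = 0 -> eqL2 f g.
Proof.
move=> hf hg; have /inL2P[md di] := inL2B hf hg => n0.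
have m2 : measurable_fun Rp (fun x => normc (f x - g x) ^+ 2).
  by apply: measurable_funX; exact: cmeasurable_normc.
have : (\int[mu]_(x in Rp) (normc (f x - g x) ^+ 2)%:E = 0)%E by rewrite Rint_EFin// -/(nsqL2 _) n0.
have := @ae_eq_integral_abs _ _ _ mu Rp mRp (fun x => (normc (f x - g x) ^+ 2)%:E).
move=> /(_ _)[|h _]; first exact/measurable_EFinP.
under eq_integral => x _ do rewrite -(ger0_norm (sqr_ge0 (normc (f x - g x)))).
move=> /h; apply: filterS => x h0 x0; move: (h0 x0) => /= /eqP.
by rewrite eqe sqrf_eq0 normc_eq0 subr_eq0 => /eqP.
Qed.

Lemma eqL2_nsqB f f' g : inL2 f -> inL2 f' -> inL2 g -> eqL2 f f' ->
  nsqL2 (fun x => g x - f x) = nsqL2 (fun x => g x - f' x).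
Proof.
move=> hf hf' hg e; apply: eqL2_nsq; [exact: inL2B|exact: inL2B|].
by apply: filterS e => x h x0; rewrite h.
Qed.

Definition cvgL2 (u : nat -> R -> R[i]) f := nsqL2 (fun x => u n x - f x) @[n --> \oo] --> (0 : R).

Lemma cvgL2_ip (u v : nat -> R -> R[i]) f g : (forall n, inL2 (u n)) -> (forall n, inL2 (v n)) ->
  inL2 f -> inL2 g -> cvgL2 u f -> cvgL2 v g -> ipL2 (u n) (v n) @[n --> \oo] --> ipL2 f g.
Proof.
move=> hu hv hf hg cu cv.
have sq (w : nat -> R) : w n @[n --> \oo] --> (0 : R) -> Num.sqrt (w n) @[n --> \oo] --> (0 : R).
  by move=> h; have := cvg_comp _ _ h (@sqrt_continuous R 0); rewrite sqrtr0.
have su := sq _ cu; have sv := sq _ cv.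
pose a := Num.sqrt (nsqL2 f); pose b := Num.sqrt (nsqL2 g).
have h : Num.sqrt (nsqL2 (fun x => u n x - f x)) * b + a * Num.sqrt (nsqL2 (fun x => v n x - g x)) +
   Num.sqrt (nsqL2 (fun x => u n x - f x)) * Num.sqrt (nsqL2 (fun x => v n x - g x)) @[n --> \oo] --> 0 * b + a * 0 + 0 * 0.
  apply: cvgD; last exact: cvgM.
  by apply: cvgD; apply: cvgM => //; exact: cvg_cst.
rewrite mul0r !mulr0 !addr0 in h.
suff : ipL2 (u n) (v n) - ipL2 f g @[n --> \oo] --> (0 : R).
  move=> h0; rewrite -[X in _ --> X]add0r.
  have h1 : (ipL2 (u n) (v n) - ipL2 f g) + ipL2 f g @[n --> \oo] --> 0 + ipL2 f g.
    by apply: cvgD => //; exact: cvg_cst.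
  apply: cvg_trans h1; apply: near_eq_cvg; apply: nearW => n /=.
  by rewrite subrK.
apply/norm_cvg0P; apply: (squeeze_cvgr _ (cvg_cst 0) h); apply: nearW => n; rewrite normr_ge0/=.
have du := inL2B (hu n) hf; have dv := inL2B (hv n) hg.
have -> : ipL2 (u n) (v n) - ipL2 f g = ipL2 (fun x => u n x - f x) g + ipL2 f (fun x => v n x - g x) +
   ipL2 (fun x => u n x - f x) (fun x => v n x - g x).
  rewrite [ipL2 (fun x => u n x - f x) (fun x => v n x - g x)]ipL2Br// !ipL2Bl// ipL2Br//; ring.
rewrite (le_trans (ler_normD _ _))// lerD//; last exact: cauchy_schwarz.
by rewrite (le_trans (ler_normD _ _))// lerD//; exact: cauchy_schwarz.
Qed.

Lemma cvgL2_nsq (u : nat -> R -> R[i]) f : (forall n, inL2 (u n)) -> inL2 f -> cvgL2 u f ->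
  nsqL2 (u n) @[n --> \oo] --> nsqL2 f.
Proof.
move=> hu hf cu; rewrite -ipL2_nsq; have := cvgL2_ip hu hu hf hf cu cu.
by apply: cvg_trans; apply: near_eq_cvg; apply: nearW => n; rewrite ipL2_nsq.
Qed.

Lemma cvgL2_lin c (u v : nat -> R -> R[i]) f g : (forall n, inL2 (u n)) -> (forall n, inL2 (v n)) ->
  inL2 f -> inL2 g -> cvgL2 u f -> cvgL2 v g ->
  cvgL2 (fun n x => c * u n x + v n x) (fun x => c * f x + g x).
Proof.
move=> hu hv hf hg cu cv.
have h : 2 * (normc c ^+ 2 * nsqL2 (fun x => u n x - f x)) + 2 * nsqL2 (fun x => v n x - g x) @[n --> \oo] -->
   2 * (normc c ^+ 2 * 0) + 2 * (0 : R).
  apply: cvgD; apply: cvgM => //; try exact: cvg_cst.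
  by apply: cvgM => //; exact: cvg_cst.
rewrite !mulr0 addr0 in h.
apply: (squeeze_cvgr _ (cvg_cst 0) h); apply: nearW => n; rewrite nsqL2_ge0/=.
have du := inL2B (hu n) hf; have dv := inL2B (hv n) hg.
rewrite -nsqL2Z//; apply: le_trans (nsqL2D_le (inL2Z c du) dv).
rewrite le_eqVlt; apply/orP; left; apply/eqP; apply: eq_Rint => x _; congr (normc _ ^+ 2); ring.
Qed.

End L2_space.

(** * Completeness of L^2 *)

Section L2_complete.
Variable R : realType.
Local Notation mu := (@lebesgue_measure R).
Local Notation intg D f := (mu.-integrable D (EFin \o f)).
Local Notation Rp := (Rplus R).

Let mRp := @measurable_Rplus R.

Lemma cvg_bounded_variation (w : nat -> R) (M : R) :
  (forall n, \sum_(k < n) `|w k.+1 - w k| <= M) -> cvgn w.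
Proof.
move=> hM; pose r k := w k.+1 - w k.
have h : cvgn [normed series r].
  apply: nondecreasing_is_cvgn.
    by apply: nondecreasing_series => k _ _; exact: normr_ge0.
  by exists M => _ [n _ <-]; change (\sum_(0 <= k < n) `|r k| <= M); rewrite big_mkord; exact: hM.
have hs : cvgn (series r) := normed_cvg h.
have -> : w = (fun n => w 0%N + series r n).
  apply/funext => n; rewrite /series/= telescope_sumr// addrC subrK//.
by apply: is_cvgD => //; exact: is_cvg_cst.
Qed.

Lemma limn_einf_le (w : nat -> \bar R) (c : \bar R) : (forall n, (w n <= c)%E) -> (limn_einf w <= c)%E.
Proof.
move=> wc; rewrite limn_einf_lim; apply: lime_le; first exact: is_cvg_einfs.
apply: nearW => n; apply: le_trans (wc n); apply: ereal_inf_lbound.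
by exists n => /=.
Qed.

Lemma sum_half_le n : \sum_(k < n) (2^-1 : R) ^+ k <= 2.
Proof.
suff -> : \sum_(k < n) (2^-1 : R) ^+ k = 2 - 2 * 2^-1 ^+ n.
  by rewrite lerBlDr lerDl mulr_ge0 ?exprn_ge0.
elim: n => [|n IH]; first by rewrite big_ord0 expr0; ring.
by rewrite big_ord_recr/= IH exprS; field.
Qed.

(** The argument of Riesz and Fischer for a geometrically fast sequence: a weighted sum of squared
    increments has finite integral, so almost everywhere the increments are summable and the
    sequence converges; Fatou's lemma bounds the distance to the limit. *)
Lemma L2_complete (u : nat -> R -> R[i]) : (forall n, inL2 (u n)) ->
  (forall n m, (n <= m)%N -> nsqL2 (fun x => u n x - u m x) <= (4^-1) ^+ n) ->
  exists2 f, inL2 f & cvgL2 u f.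
Proof.
move=> hu fast.
pose d k x := normc (u k.+1 x - u k x).
(* The k-th increment has squared norm at most 4^-k; the weight 2^k still leaves the summable bound
   2^-k, and is enough to control the increments themselves. *)
pose q k x := 2 ^+ k * d k x ^+ 2.
have q0 k x : 0 <= q k x by rewrite mulr_ge0 ?sqr_ge0// exprn_ge0.
have hd k : inL2 (fun x => u k.+1 x - u k x) by exact: inL2B.
have iq k : intg Rp (q k) by apply: intgZ => //; exact: inL2_intg (hd k).
have mq k : measurable_fun Rp (q k) by exact: intg_measurable (iq k).
have hq k : \int[mu]_(x in Rp) q k x <= 2^-1 ^+ k.
  rewrite RintegralZl//; last exact: inL2_intg (hd k).
  have := fast k k.+1 (leqnSn k); rewrite nsqL2_distC -/(nsqL2 _) => h.
  apply: le_trans (ler_wpM2l _ h) _; first by rewrite exprn_ge0.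
  by rewrite -exprMn (_ : 2 * 4^-1 = 2^-1 :> R)//; field.
pose F x := (\sum_(k <oo) (q k x)%:E)%E.
have mF : measurable_fun Rp F.
  by apply: ge0_emeasurable_sum => [k x _ _|k _]; [rewrite lee_fin|exact/measurable_EFinP].
have F0 x : (0 <= F x)%E by apply: nneseries_ge0 => k _ _; rewrite lee_fin.
have iF : mu.-integrable Rp F.
  apply/integrableP; split => //.
  under eq_integral do rewrite gee0_abs//.
  rewrite integral_nneseries//; [|by move=> k; apply/measurable_EFinP; exact: mq|by move=> k x _; rewrite lee_fin].
  apply: (@le_lt_trans _ _ 2%:E); last exact: ltry.
  apply: lime_le.
    by apply: is_cvg_nneseries => k _ _; apply: integral_ge0 => x _; rewrite lee_fin.
  apply: nearW => n; rewrite big_mkord.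
  rewrite (eq_bigr (fun k : 'I_n => (\int[mu]_(x in Rp) q k x)%:E)); last by move=> k _; rewrite Rint_EFin.
  rewrite sumEFin lee_fin; apply: le_trans (sum_half_le n); apply: ler_sum => k _; exact: hq.
pose A : set R := Rp `&` [set x | F x \is a fin_num].
have mA : measurable A by exact: emeasurable_fin_num.
(* Cutting off outside the set of convergence makes the pointwise limit exist everywhere, at the
   cost of a null set. *)
pose v n x := u n x * (\1_A x)%:C.
have vA n x : A x -> v n x = u n x by move=> Ax; rewrite /v indicE mem_set// mulr1.
have vN n x : ~ A x -> v n x = 0.
  by move=> Ax; rewrite /v indicE memNset// mulr0.
have dA x : A x -> exists M, forall n, \sum_(k < n) d k x <= M.
  move=> [x0 /= Fx]; exists (2 + fine (F x)) => n.
  have h1 : \sum_(k < n) q k x <= fine (F x).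
    rewrite -lee_fin fineK// -sumEFin -(big_mkord xpredT (fun k => (q k x)%:E)).
    by apply: nneseries_lim_ge => k _ _; rewrite lee_fin.
  apply: le_trans (lerD (sum_half_le n) h1); rewrite -big_split/=; apply: ler_sum => k _.
  have d0 : 0 <= d k x by exact: normc_ge0.
  have p0 : 0 < (2 ^+ k : R) by rewrite exprn_gt0.
  rewrite /q exprVn; set p := 2 ^+ k in p0 *.
  (* Either the increment is at most 2^-k, or 2^k times it exceeds 1 and it is at most [q k x]. *)
  have [h|h] := leP (d k x) p^-1; first by rewrite (le_trans h)// lerDl mulr_ge0 ?sqr_ge0// ltW.
  apply: ler_wpDl; first by rewrite invr_ge0 ltW.
  by rewrite expr2 mulrA ler_peMl// -(mulfV (lt0r_neq0 p0)) ler_pM2l// ltW.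
have cv x : ccvg (v ^~ x) (lim (Re (v n x) @[n --> \oo]) +i* lim (Im (v n x) @[n --> \oo])).
  have [Ax|Ax] := pselect (A x); last first.
    have E : (v ^~ x) = (fun=> 0) by apply/funext => n; exact: vN.
    have l0 : lim ((0 : R) @[n --> \oo]) = 0 by exact: lim_cst.
    by rewrite (funext (fun n => congr1 (@complex.Re R) (vN n x Ax))) (funext (fun n => congr1 (@complex.Im R) (vN n x Ax))) !l0 E; exact: ccvg_cst.
  have [M hM] := dA x Ax.
  split; [rewrite [Re (_ +i* _)]/=; apply: (@cvg_bounded_variation _ M)|rewrite [Im (_ +i* _)]/=; apply: (@cvg_bounded_variation _ M)] => n;
    apply: le_trans (hM n); apply: ler_sum => k _; rewrite !vA// /d.
    by rewrite -ReN -ReD normr_Re.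
  by rewrite -ImN -ImD normr_Im.
set f := fun x => lim (Re (v n x) @[n --> \oo]) +i* lim (Im (v n x) @[n --> \oo]) in cv.
have mv n : cmeasurable Rp (v n).
  apply: cmeasurableM; first exact: inL2_cmeasurable.
  by apply: cmeasurable_real; apply: measurable_funTS; exact: measurable_indic.
have mf : cmeasurable Rp f by apply: (@cmeasurable_ccvg R _ _ Rp v f mv) => x _; exact: cv.
have uv n : eqL2 (u n) (v n).
  have [Z [mZ Z0 hZ]] := @integrable_ae _ _ _ mu Rp mRp F iF.
  exists Z; split => // x hx; apply: hZ => hh; apply: hx => x0.
  by rewrite vA//; split => //; exact: hh.
have bound n : (\int[mu]_(x in Rp) (normc (v n x - f x) ^+ 2)%:E <= ((4^-1) ^+ n)%:E)%E.
  have mvv m : measurable_fun Rp (fun x => (normc (v n x - v (m + n)%N x) ^+ 2)%:E).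
    by apply/measurable_EFinP; apply: measurable_funX; apply: cmeasurable_normc; exact: cmeasurableB.
  (* Fatou in the second index, the first being fixed: the bound 4^-n between terms passes to the
     limit function. *)
  have := @fatou _ _ _ mu Rp mRp (fun m x => (normc (v n x - v (m + n)%N x) ^+ 2)%:E) mvv
     (fun m x _ => ltac:(by rewrite lee_fin sqr_ge0)).
  have E x : limn_einf (fun m => (normc (v n x - v (m + n)%N x) ^+ 2)%:E) = (normc (v n x - f x) ^+ 2)%:E.
    have cs : ccvg (fun m => v (m + n)%N x) (f x).
      have [c1 c2] := cv x; split.
        by rewrite (cvg_shiftn n (fun m => Re (v m x))).
      by rewrite (cvg_shiftn n (fun m => Im (v m x))).
    have c1 := ccvg_normc (ccvgD (ccvg_cst (v n x)) (ccvgN cs)).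
    have c2 : normc (v n x - v (m + n)%N x) ^+ 2 @[m --> \oo] --> normc (v n x - f x) ^+ 2.
      exact: (cvg_comp _ _ c1 (@exprn_continuous R 2 _)).
    have c3 : (normc (v n x - v (m + n)%N x) ^+ 2)%:E @[m --> \oo] --> (normc (v n x - f x) ^+ 2)%:E.
      by apply: cvg_EFin c2; exact: nearW.
    by rewrite (cvg_limn_einf_sup c3).1.
  under eq_integral do rewrite E.
  move=> /le_trans; apply; apply: limn_einf_le => m.
  have hnm := inL2B (hu n) (hu (m + n)%N).
  apply: (@le_trans _ _ (nsqL2 (fun x => u n x - u (m + n)%N x))%:E); last first.
    by rewrite lee_fin; apply: fast; exact: leq_addl.
  rewrite /nsqL2 -Rint_EFin//; last exact: inL2_intg hnm.
  apply: ge0_le_integral => //.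
  - by move=> x _; rewrite lee_fin sqr_ge0.
  - exact: mvv.
  - by apply/measurable_EFinP; exact: intg_measurable (inL2_intg hnm).
  - move=> x _; rewrite lee_fin; have [Ax|Ax] := pselect (A x); first by rewrite !vA.
    by rewrite !vN// subr0 (_ : normc 0 ^+ 2 = 0) ?sqr_ge0//; apply/eqP; rewrite sqrf_eq0 normc_eq0.
have hvf n : inL2 (fun x => v n x - f x).
  have [m1 m2] := cmeasurableB (mv n) mf.
  by split => //; apply: le_lt_trans (bound n) _; exact: ltry.
have hv n : inL2 (v n).
  apply/inL2P; split => //; apply: (intg_le mRp _ (inL2_intg (hu n))).
    by apply: measurable_funX; exact: cmeasurable_normc.
  move=> x _; rewrite ger0_norm ?sqr_ge0//; have [Ax|Ax] := pselect (A x); first by rewrite vA.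
  by rewrite vN// (_ : normc 0 ^+ 2 = 0) ?sqr_ge0//; apply/eqP; rewrite sqrf_eq0 normc_eq0.
have hf : inL2 f.
  have := inL2B (hv 0%N) (hvf 0%N).
  by rewrite (_ : (fun x => v 0%N x - (v 0%N x - f x)) = f)//; apply/funext => x; rewrite opprB addrC subrK.
exists f => //.
have h4 : (4^-1 : R) ^+ n @[n --> \oo] --> (0 : R).
  by apply: cvg_expr; rewrite ger0_norm; lra.
apply: (squeeze_cvgr _ (cvg_cst 0) h4); apply: nearW => n; rewrite nsqL2_ge0/=.
have -> : nsqL2 (fun x => u n x - f x) = nsqL2 (fun x => v n x - f x).
  rewrite nsqL2_distC [RHS]nsqL2_distC; exact: eqL2_nsqB.
by rewrite -lee_fin /nsqL2 -Rint_EFin//; exact: inL2_intg.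
Qed.

End L2_complete.

(** * Smooth bump functions *)

Section Bumps.
Variable R : realType.
Implicit Types (x c d : R) (f g : R -> R).

(* The functions P_i(x) = x^-i e^(-1/x) on x > 0, extended by 0, satisfy P_i' = P_(i+2) - i P_(i+1);
   hence the algebra spanned by their translates is stable under differentiation. *)
Definition flat (i : nat) x : R := if 0 < x then x^-1 ^+ i * expR (- x^-1) else 0.

(** At y = 1/x the bound of y^(i+2) e^(-y) leaves a factor x^2, which forces the derivative at 0 to
    vanish. *)
Lemma flat_le (i : nat) : exists2 C : R, 0 <= C & forall x, `|flat i x| <= C * x ^+ 2.
Proof.
have p0 : 0 < (i.+2%:R : R) by rewrite ltr0n.
have [C C0 hC] := expR_ln_bound p0; exists C; first exact: ltW.
move=> x; rewrite /flat; case: ifPn => x0; last by rewrite normr0 mulr_ge0 ?sqr_ge0// ltW.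
have y0 : 0 < x^-1 by rewrite invr_gt0.
rewrite ger0_norm ?mulr_ge0 ?expR_ge0 ?exprn_ge0// ?(ltW y0)//.
have -> : x^-1 ^+ i * expR (- x^-1) = (x^-1 ^+ i.+2 * expR (- x^-1)) * x ^+ 2.
  rewrite mulrAC -addn2 exprD -[_ * x ^+ 2]mulrA -exprMn mulVf ?expr1n ?mulr1//.
  exact: lt0r_neq0.
apply: ler_wpM2r; first exact: sqr_ge0.
have := hC _ y0; rewrite mulr_natl -lnXn// lnK// posrE exprn_gt0//.
Qed.

Lemma is_derive_flat (i : nat) x : is_derive x 1 (flat i) (flat i.+2 x - i%:R * flat i.+1 x).
Proof.
have [x0|x0|->] := ltgtP x 0.
- have -> : flat i.+2 x - i%:R * flat i.+1 x = 0.
    by rewrite /flat ltNge (ltW x0)/= mulr0 subr0.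
  have nz : \forall y \near x, cst 0 y = flat i y.
    near=> y; have y0 : y < 0 by near: y; exact: lt_nbhsl.
    by rewrite /flat ltNge (ltW y0).
  by apply: near_eq_is_derive nz _; exact: is_derive_cst.
- have nz : \forall y \near x, (y^-1 ^+ i * expR (- y^-1)) = flat i y.
    near=> y; have y0 : 0 < y by near: y; exact: lt_nbhsr.
    by rewrite /flat y0.
  apply: near_eq_is_derive nz _.
  have xn : x != 0 by exact: lt0r_neq0.
  have dV : is_derive x 1 (fun y : R => y^-1) (- x ^- 2).
    have := @is_deriveVc R (fun y : R => y) x _ xn (is_derive_id x 1).
    by move/is_derive_eq; apply; rewrite mulr1.
  have dX : is_derive x 1 (fun y : R => y^-1 ^+ i) (i%:R * x^-1 ^+ i.-1 * (- x ^- 2)).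
    have -> : (fun y : R => y^-1 ^+ i) = (fun y : R => y^-1) ^+ i by apply/funext => y; rewrite exprfctE.
    exact: (is_derive_eq (@is_deriveX _ _ (fun y : R => y^-1) i x 1 _ dV)).
  have dE := @is_derive_expRc R (fun y : R => - y^-1) x _ (is_deriveN dV).
  have := is_deriveMr dX dE; move/is_derive_eq; apply.
  have -> : x ^- 2 = x^-1 ^+ 2 by rewrite exprVn.
  rewrite /flat x0 opprK; case: i {dX} => [|i]; first by rewrite /=; ring.
  by rewrite /= !exprS; ring.
- have -> : flat i.+2 0 - i%:R * flat i.+1 0 = 0 by rewrite /flat ltxx mulr0 subr0.
  have [C C0 hC] := flat_le i.
  have h : h^-1 *: (flat i (h *: 1 + 0) - flat i 0) @[h --> 0^'] --> (0 : R).
    have C1 : C * `|h| @[h --> (0 : R)^'] --> (0 : R).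
      rewrite -[X in _ --> X](mulr0 C); apply: cvgM; first exact: cvg_cst.
      have n0 : `|y| @[y --> (0 : R)] --> `|0 : R| by exact: norm_continuous.
      by rewrite normr0 in n0; exact: cvg_within_filter n0.
    apply/norm_cvg0P; apply: (squeeze_cvgr _ (cvg_cst 0) C1); near=> h.
    rewrite normr_ge0/= addr0 /GRing.scale/= mulr1 {2}/flat ltxx subr0 normrM.
    have hn : h != 0 by near: h; exact: nbhs_dnbhs_neq.
    rewrite normfV ler_pdivrMl ?normr_gt0// (le_trans (hC h))//.
    by rewrite [leRHS]mulrCA -(expr2 `|h|) real_normK ?num_real.
  split; first by apply/cvg_ex; exists 0.
  exact: cvg_lim h.
Unshelve. all: by end_near. Qed.

Lemma flat_ge0 i x : 0 <= flat i x.
Proof.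
rewrite /flat; case: ifPn => // x0; rewrite mulr_ge0 ?expR_ge0// exprn_ge0// invr_ge0 ltW//.
Qed.

Lemma flat0_le1 x : flat 0 x <= 1.
Proof.
rewrite /flat; case: ifPn => // x0; rewrite expr0 mul1r -[leRHS]expR0 ler_expR oppr_le0 invr_ge0 ltW//.
Qed.

Inductive bump_algebra (k c d : R) : (R -> R) -> Prop :=
| bump_prod i j : bump_algebra k c d (fun x => flat i (k * (x - c)) * flat j (k * (d - x)))
| bump_add f g : bump_algebra k c d f -> bump_algebra k c d g -> bump_algebra k c d (fun x => f x + g x)
| bump_scale (a : R) f : bump_algebra k c d f -> bump_algebra k c d (fun x => a * f x).

Lemma bump_algebra_derive k c d f : bump_algebra k c d f ->
  exists2 g, bump_algebra k c d g & forall x, is_derive x 1 f (g x).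
Proof.
elim=> {f} [i j|f g _ [f' hf' df] _ [g' hg' dg]|a f _ [f' hf' df]].
- pose B m n := fun x => flat m (k * (x - c)) * flat n (k * (d - x)).
  exists (fun x => k * (B i.+2 j x + (- i%:R) * B i.+1 j x) + (- k) * (B i j.+2 x + (- j%:R) * B i j.+1 x)).
    by apply: bump_add; apply: bump_scale; apply: bump_add; [exact: bump_prod|apply: bump_scale; exact: bump_prod|exact: bump_prod|apply: bump_scale; exact: bump_prod].
  move=> x.
  have d1 : is_derive x 1 (fun x => k * (x - c)) k.
    have := is_deriveMr (is_derive_cst k x 1) (is_deriveDr (is_derive_id x 1) (is_derive_cst (- c) x 1)).
    by move/is_derive_eq; apply; rewrite addr0 mulr1 mulr0 addr0.
  have d2 : is_derive x 1 (fun x => k * (d - x)) (- k).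
    have := is_deriveMr (is_derive_cst k x 1) (is_deriveDr (is_derive_cst d x 1) (is_deriveN (is_derive_id x 1))).
    by move/is_derive_eq; apply; rewrite add0r mulrN1 mulr0 addr0.
  have e1 := @is_derive1_comp _ (flat i) (fun x => k * (x - c)) x _ _ (is_derive_flat _ _) d1.
  have e2 := @is_derive1_comp _ (flat j) (fun x => k * (d - x)) x _ _ (is_derive_flat _ _) d2.
  have := is_deriveMr e1 e2; move/is_derive_eq; apply; rewrite /B /comp; ring.
- exists (fun x => f' x + g' x); first exact: bump_add.
  by move=> x; exact: is_deriveDr.
- exists (fun x => a * f' x); first exact: bump_scale.
  move=> x; have := is_deriveMr (is_derive_cst a x 1) (df x).
  by move/is_derive_eq; apply; rewrite mulr0 addr0.
Qed.

Lemma bump_algebra_smooth k c d f n : bump_algebra k c d f -> bump_algebra k c d (derive1n n f).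
Proof.
move=> hf; elim: n => [//|n IH]; have [g hg dg] := bump_algebra_derive IH.
rewrite (_ : derive1n n.+1 f = g)//; apply/funext => x /=.
by rewrite derive1E; exact: derive_val.
Qed.

Definition smooth_bump k c d x : R := flat 0 (k * (x - c)) * flat 0 (k * (d - x)).

Lemma derive1n_cst0 n : derive1n n (fun=> 0 : R) = (fun=> 0).
Proof. by elim: n => [//|n IH]; rewrite /= IH; apply/funext => x; rewrite derive1E derive_cst. Qed.

Lemma test_bump k c d : 0 < k -> 0 < c -> test_function (fun x => (smooth_bump k c d x)%:C).
Proof.
move=> k0 c0; split.
- move=> n x /=.
  have [g _ dg] := bump_algebra_derive (bump_algebra_smooth n (bump_prod k c d 0 0)).
  by have [] := dg x.
- by move=> n x /=; rewrite derive1n_cst0; exact: derivable_cst.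
- exists c, d; split => // x; rewrite /smooth_bump /flat.
  case: ifPn => [h1|_]; last by rewrite mul0r eqxx.
  case: ifPn => [h2 _|_]; last by rewrite mulr0 eqxx.
  by move: h1 h2; rewrite !pmulr_rgt0// !subr_gt0 => /ltW -> /ltW ->.
Qed.

(** For y > 0 the factor e^(-1/((n + 1) y)) tends to 1, while it is 0 for y <= 0: steepening the
    bumps produces the indicator of the open interval. *)
Lemma cvg_bump c d x : smooth_bump n.+1%:R c d x @[n --> \oo] --> (\1_(`]c, d[%classic : set R) x : R).
Proof.
have fl y : flat 0 (n.+1%:R * y) @[n --> \oo] --> (if 0 < y then 1 else 0 : R).
  case: ifPn => y0; last first.
    have -> : (fun n : nat => flat 0 (n.+1%:R * y)) = (fun=> 0).
      by apply/funext => n; rewrite /flat pmulr_rgt0// (negbTE y0).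
    exact: cvg_cst.
  have -> : (fun n : nat => flat 0 (n.+1%:R * y)) = (fun n => expR (- (n.+1%:R^-1 * y^-1))).
    by apply/funext => n; rewrite /flat pmulr_rgt0// y0 expr0 mul1r invfM.
  have h : - (n.+1%:R^-1 * y^-1) @[n --> \oo] --> - (0 * y^-1 : R).
    by apply: cvgN; apply: cvgM; [exact: cvg_harmonic|exact: cvg_cst].
  by have := cvg_comp _ _ h (@continuous_expR R _); rewrite mul0r oppr0 expR0.
have -> : (\1_(`]c, d[%classic : set R) x : R) = (if 0 < x - c then 1 else 0) * (if 0 < d - x then 1 else 0).
  rewrite indicE !subr_gt0; have [h|h] := boolP (x \in _).
    by move/set_mem : h; rewrite /= in_itv/= => /andP[-> ->]; rewrite mulr1.
  have : ~~ ((c < x) && (x < d)) by apply: contra h => h; apply/mem_set; rewrite /= in_itv.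
  by case: (c < x); case: (x < d) => //= _; rewrite ?mul0r ?mulr0.
by apply: cvgM; exact: fl.
Qed.

End Bumps.

(** * Approximation by test functions *)

Section Density.
Variable R : realType.
Local Notation mu := (@lebesgue_measure R).
Local Notation intg D f := (mu.-integrable D (EFin \o f)).
Local Notation Rp := (Rplus R).
Implicit Types (f g k : R -> R[i]) (c : R[i]) (A : set R).

Let mRp := @measurable_Rplus R.

Lemma test_lin c f k : test_function f -> test_function k -> test_function (fun x => c * f x + k x).
Proof.
move=> tf tk; have [f1 f2 [a [b [a0 fab]]]] := tf; have [k1 k2 [a' [b' [a'0 kab]]]] := tk.
have lin (p q r : R -> R) (c1 c2 : R) :
    (forall n x, derivable (derive1n n p) x 1) -> (forall n x, derivable (derive1n n q) x 1) ->
    (forall n x, derivable (derive1n n r) x 1) ->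
    forall n x, derivable (derive1n n (fun y => c1 * p y + c2 * q y + r y)) x 1.
  move=> h1 h2 h3 n.
  have L (P Q S : R -> R) (dP dQ dS x : R) : is_derive x 1 P dP -> is_derive x 1 Q dQ ->
      is_derive x 1 S dS -> is_derive x 1 (fun y => c1 * P y + c2 * Q y + S y) (c1 * dP + c2 * dQ + dS).
    move=> hP hQ hS.
    have := is_deriveDr (is_deriveDr (is_deriveMr (is_derive_cst c1 x 1) hP) (is_deriveMr (is_derive_cst c2 x 1) hQ)) hS.
    by move/is_derive_eq; apply; rewrite !mulr0 !addr0.
  have dd (g : R -> R) (hg : forall n x, derivable (derive1n n g) x 1) m (x : R) :
      is_derive x 1 (derive1n m g) (derive1n m.+1 g x).
    by apply: DeriveDef; [exact: hg|rewrite /= derive1E].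
  have D m (x : R) : is_derive x 1 (fun y => c1 * derive1n m p y + c2 * derive1n m q y + derive1n m r y)
      (c1 * derive1n m.+1 p x + c2 * derive1n m.+1 q x + derive1n m.+1 r x).
    by apply: L; exact: dd.
  have -> : derive1n n (fun y => c1 * p y + c2 * q y + r y) =
      (fun y => c1 * derive1n n p y + c2 * derive1n n q y + derive1n n r y).
    elim: n => [//|m IH]; rewrite [LHS]/= IH; apply/funext => y.
    by rewrite derive1E; have [_ ->] := D m y.
  by move=> x; have [] := D n x.
split.
- move=> n x; rewrite (_ : (fun y => _) = (fun y => Re c * Re (f y) + (- Im c) * Im (f y) + Re (k y))).
    exact: (lin _ _ _ (Re c) (- Im c) f1 f2 k1).
  by apply/funext => y; rewrite ReD ReM mulNr.
- move=> n x; rewrite (_ : (fun y => _) = (fun y => Re c * Im (f y) + Im c * Re (f y) + Im (k y))).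
    exact: (lin _ _ _ (Re c) (Im c) f2 f1 k2).
  by apply/funext => y; rewrite ImD ImM.
- exists (Num.min a a'), (Num.max b b'); split; first by rewrite lt_min a0.
  move=> x h; have [f0|fn] := eqVneq (f x) 0; have [k0|kn] := eqVneq (k x) 0.
  + by move: h; rewrite f0 k0 mulr0 addr0 eqxx.
  + by have /andP[h1 h2] := kab _ kn; rewrite ge_min le_max h1 h2 !orbT.
  + by have /andP[h1 h2] := fab _ fn; rewrite ge_min le_max h1 h2.
  + by have /andP[h1 h2] := fab _ fn; rewrite ge_min le_max h1 h2.
Qed.

Lemma test_inL2 f : test_function f -> inL2 f.
Proof.
move=> tf; have mT := @measurableT _ R; have [_ _ [a [b [a0 fab]]]] := tf.
have cf t : ccont f t by exact: test_ccont.
have fV v : b < `|v| -> f v = 0.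
  move=> bv; apply/eqP; apply: contraTT bv => /fab /andP[av vb]; rewrite -leNgt ger0_norm//.
  by rewrite ltW// (lt_le_trans a0).
have [C hC] := bounded_ccont_support cf fV.
apply/inL2P; split; first by apply: cmeasurableS (test_cmeasurable tf) => //; exact: measurableT.
have i := cintegrableS mT mRp (@subsetT _ _) (test_cintegrable tf).
apply: (intg_le mRp _ (intgZ C mRp (intg_normc mRp i))).
  by apply: measurable_funX; exact: cmeasurable_normc (cintegrable_cmeasurable i).
by move=> x _; rewrite ger0_norm ?sqr_ge0// expr2 ler_wpM2r ?normc_ge0.
Qed.

(** A property of the single function f: it belongs to the closure of the test functions. *)
Definition denseL2 f := forall e : R, 0 < e -> exists2 k, test_function k & nsqL2 (fun x => f x - k x) <= e.

Lemma denseL2_closed f : inL2 f ->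
  (forall e : R, 0 < e -> exists2 g, inL2 g /\ denseL2 g & nsqL2 (fun x => f x - g x) <= e) -> denseL2 f.
Proof.
move=> hf h e e0; have e4 : 0 < e / 4 by rewrite divr_gt0.
have [g [hg dg] fg] := h _ e4; have [k tk gk] := dg _ e4.
exists k => //; apply: (le_trans (nsqL2_triangle hf hg (test_inL2 tk))); lra.
Qed.

Lemma denseL2_cvg f (u : nat -> R -> R[i]) : inL2 f -> (forall n, inL2 (u n)) -> (forall n, denseL2 (u n)) ->
  cvgL2 u f -> denseL2 f.
Proof.
move=> hf hu du cu; apply: denseL2_closed => // e e0.
have [n _ /(_ n (leqnn n)) /= h] := cvgr_lt (0 : R) cu e e0.
by exists (u n) => //; rewrite nsqL2_distC ltW.
Qed.

Lemma denseL2_lin c f g : inL2 f -> inL2 g -> denseL2 f -> denseL2 g -> denseL2 (fun x => c * f x + g x).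
Proof.
(* The summand 1 keeps the divisor positive when c = 0; the two tolerances then add up to e. *)
move=> hf hg df dg e e0; pose C := 1 + normc c ^+ 2.
have C0 : 0 < C by rewrite ltr_pwDl// sqr_ge0.
have e1 : 0 < e / (4 * C) by rewrite divr_gt0// mulr_gt0.
have e2 : 0 < e / 4 by rewrite divr_gt0.
have [k tk hk] := df _ e1; have [l tl hl] := dg _ e2.
exists (fun x => c * k x + l x); first exact: test_lin.
have h1 := inL2B hf (test_inL2 tk); have h2 := inL2B hg (test_inL2 tl).
apply: (@le_trans _ _ (nsqL2 (fun x => c * (f x - k x) + (g x - l x)))).
  by rewrite le_eqVlt; apply/orP; left; apply/eqP; apply: eq_Rint => x _; congr (normc _ ^+ 2); ring.
apply: (le_trans (nsqL2D_le (inL2Z c h1) h2)); rewrite nsqL2Z//.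
have n0 := nsqL2_ge0 (fun x => f x - k x).
have : normc c ^+ 2 * nsqL2 (fun x => f x - k x) <= C * (e / (4 * C)).
  by apply: ler_pM => //; [exact: sqr_ge0|rewrite lerDr].
have -> : C * (e / (4 * C)) = e / 4 by field; exact: lt0r_neq0.
lra.
Qed.

Lemma denseL2_0 : denseL2 (fun=> 0).
Proof.
move=> e e0; exists (fun=> 0); last first.
  by rewrite /nsqL2 (eq_Rint (g := fun=> 0)) ?Rintegral_cst ?mul0r ?ltW//; move=> x _; apply/eqP; rewrite sqrf_eq0 normc_eq0 subr0.
split; [| |by exists 1, 1; split => // x; rewrite eqxx].
- by move=> n x /=; rewrite derive1n_cst0; exact: derivable_cst.
- by move=> n x /=; rewrite derive1n_cst0; exact: derivable_cst.
Qed.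

(** The squared distance is at most 4 G, by |a - b|^2 <= 2 |a|^2 + 2 |b|^2, so dominated convergence
    applies to it. *)
Lemma cvgL2_dominated (u : nat -> R -> R[i]) f (G : R -> R) : (forall n, cmeasurable Rp (u n)) ->
  (forall x, Rp x -> ccvg (u ^~ x) (f x)) -> intg Rp G ->
  (forall n x, Rp x -> normc (u n x) ^+ 2 <= G x) ->
  [/\ forall n, inL2 (u n), inL2 f & cvgL2 u f].
Proof.
move=> mu_ cu iG bG.
have mf : cmeasurable Rp f by exact: cmeasurable_ccvg mu_ cu.
have msq (v : R -> R[i]) : cmeasurable Rp v -> measurable_fun Rp (fun x => normc (v x) ^+ 2).
  by move=> mv; apply: measurable_funX; exact: cmeasurable_normc.
have hu n : inL2 (u n).
  apply/inL2P; split => //; apply: (intg_le mRp (msq _ (mu_ n)) iG) => x x0.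
  by rewrite ger0_norm ?sqr_ge0// bG.
have fG x : Rp x -> normc (f x) ^+ 2 <= G x.
  move=> x0; have c1 := ccvg_normc (cu x x0).
  have c2 : normc (u n x) ^+ 2 @[n --> \oo] --> normc (f x) ^+ 2.
    exact: (cvg_comp _ _ c1 (@exprn_continuous R 2 _)).
  by apply: (cvgr_to_le c2); apply: nearW => n; exact: bG.
have hf : inL2 f.
  apply/inL2P; split => //; apply: (intg_le mRp (msq _ mf) iG) => x x0.
  by rewrite ger0_norm ?sqr_ge0// fG.
split => //.
have cc x : Rp x -> normc (u n x - f x) ^+ 2 @[n --> \oo] --> (0 : R).
  move=> x0; have c1 := ccvg_normc (ccvgD (cu x x0) (ccvgN (ccvg_cst (f x)))).
  have := cvg_comp _ _ c1 (@exprn_continuous R 2 _).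
  have n0 : normc (f x - f x) = 0 by apply/eqP; rewrite normc_eq0 subrr.
  by rewrite n0 expr0n.
have bb n x : Rp x -> `|normc (u n x - f x) ^+ 2| <= 4 * G x.
  move=> x0; rewrite ger0_norm ?sqr_ge0//.
  have h := normcD (u n x) (- f x); rewrite normc_N in h.
  have h1 := bG n x x0; have h2 := fG x x0.
  have := normc_ge0 (u n x - f x); have := normc_ge0 (u n x); have := normc_ge0 (f x).
  move: (normc (u n x)) (normc (f x)) (normc (u n x - f x)) (G x) h h1 h2 => a b s g h h1 h2 b0 a0 s0.
  have := sqr_ge0 (a - b); nra.
have [_] := Rdominated_cvg mRp (fun n => msq _ (cmeasurableB (mu_ n) mf)) cc (intgZ 4 mRp iG) bb.
by rewrite /cvgL2 /nsqL2 (_ : \int[mu]_(x in Rp) (0 : R) = 0)// Rintegral_cst// mul0r.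
Qed.

Definition indc A (x : R) : R[i] := (\1_A x)%:C.

Lemma normc_indc A x : normc (indc A x) ^+ 2 = \1_A x.
Proof.
rewrite /indc normcC indicE; case: (_ \in _); rewrite ?normr1 ?expr1n// normr0 expr0n//.
Qed.

Lemma cmeasurable_indc A : measurable A -> cmeasurable Rp (indc A).
Proof. by move=> mA; apply: cmeasurable_real; apply: measurable_funTS; exact: measurable_indic. Qed.

Lemma intg_ind (a b : R) A : measurable A -> A `<=` `[a, b]%classic -> intg Rp (\1_A : R -> R).
Proof.
move=> mA AB.
have i : intg setT (fun x => 1 * \1_(`[a, b]%classic : set R) x : R).
  by apply/(intg_restrict (fun=> 1) (measurable_itv _)); apply: intg_itv_continuous => x _; exact: cst_continuous.
apply: (intg_le mRp _ (intgS measurableT mRp (@subsetT _ _) i)).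
  by apply: measurable_funTS; exact: measurable_indic.
move=> x _; rewrite mul1r ger0_norm ?indicE// ler_nat.
by case: (boolP (x \in A)) => // /set_mem /AB xB; rewrite mem_set.
Qed.

Lemma denseL2_itv (c d : R) : 0 < c -> denseL2 (indc `]c, d[%classic).
Proof.
move=> c0; pose u n x : R[i] := (smooth_bump n.+1%:R c d x)%:C.
have tu n : test_function (u n) by exact: test_bump.
have b1 n x : normc (u n x) ^+ 2 <= \1_(`]c, d[%classic : set R) x.
  rewrite normcC indicE real_normK ?num_real//.
  have [h|h] := boolP (x \in _).
    rewrite -[leRHS](expr1n _ 2) ler_pXn2r ?nnegrE//; last by rewrite mulr_ge0 ?flat_ge0.
    by rewrite /smooth_bump -[leRHS]mulr1 ler_pM ?flat_ge0 ?flat0_le1.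
  have : ~~ ((c < x) && (x < d)) by apply: contra h => h; apply/mem_set; rewrite /= in_itv.
  rewrite /smooth_bump /flat !pmulr_rgt0// !subr_gt0.
  by case: (c < x); case: (x < d) => //= _; rewrite ?mul0r ?mulr0 expr0n.
have iG : intg Rp (\1_(`]c, d[%classic : set R) : R -> R).
  by apply: (@intg_ind c d) => // x /=; rewrite !in_itv/= => /andP[/ltW -> /ltW ->].
have cc x : Rp x -> ccvg (u ^~ x) (indc `]c, d[%classic x).
  by move=> _; split => /=; [exact: cvg_bump|exact: cvg_cst].
have [h1 h2 h3] := cvgL2_dominated (fun n => (inL2_cmeasurable (test_inL2 (tu n)))) cc iG (fun n x _ => b1 n x).
apply: (denseL2_cvg h2 h1 _ h3) => n e e0; exists (u n) => //.
rewrite /nsqL2 (eq_Rint (g := fun=> 0)) ?Rintegral_cst ?mul0r ?ltW// => x _.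
by apply/eqP; rewrite sqrf_eq0 normc_eq0 subrr.
Qed.

End Density.

(** * Density: from intervals to all square-integrable functions *)

Section Density_general.
Variable R : realType.
Local Notation mu := (@lebesgue_measure R).
Local Notation intg D f := (mu.-integrable D (EFin \o f)).
Local Notation Rp := (Rplus R).
Implicit Types (f g k : R -> R[i]) (A : set R).

Let mRp := @measurable_Rplus R.

(** Away from 0 and bounded: indicators inside a window are square-integrable, and bumps inside it
    are test functions. *)
Definition window (n : nat) : set R := `]n.+1%:R^-1, n.+1%:R[%classic.

Lemma measurable_window n : measurable (window n). Proof. exact: measurable_itv. Qed.

Lemma window_sub n A : A `&` window n `<=` `[n.+1%:R^-1, n.+1%:R]%classic.
Proof. by move=> x [_]; rewrite /window/= !in_itv/= => /andP[/ltW -> /ltW ->]. Qed.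

Lemma inL2_indc n A : measurable A -> inL2 (indc (A `&` window n)).
Proof.
move=> mA; have mAw := measurableI _ _ mA (measurable_window n).
apply/inL2P; split; first exact: cmeasurable_indc.
by under eq_fun do rewrite normc_indc; exact: intg_ind mAw (@window_sub n A).
Qed.

(** The sets whose trace on the window has an approximable indicator form a Dynkin system, and it
    contains the open half-lines, which are stable under intersection and generate the Borel
    sets. *)
Lemma denseL2_indc n A : measurable A -> denseL2 (indc (A `&` window n)).
Proof.
have c0 : 0 < (n.+1%:R : R)^-1 by rewrite invr_gt0.
have dT : denseL2 (indc ([set: R] `&` window n)) by rewrite setTI; exact: denseL2_itv.
move=> mA; have : <<s @RGenOInfty.G R >> A.
  have E : @measurable _ (measurableTypeR R) = <<s @RGenOInfty.G R >> := RGenOInfty.measurableE R.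
  by rewrite -E.
apply: (dynkin_induction (P := fun A => denseL2 (indc (A `&` window n)))) => //.
- exact: RGenOInfty.measurableE.
- move=> _ _ [x ->] [y ->]; exists (Num.max x y); apply/seteqP; split => z /=.
    by rewrite !in_itv/= !andbT gt_max => -[-> ->].
  by rewrite !in_itv/= !andbT gt_max => /andP[].
- move=> _ [x ->]; have -> : `]x, +oo[%classic `&` window n = `]Num.max x n.+1%:R^-1, n.+1%:R[%classic.
    apply/seteqP; split => z; rewrite /window/= !in_itv/= andbT gt_max.
      by move=> [-> /andP[-> ->]].
    by move=> /andP[/andP[-> ->] ->].
  by apply: denseL2_itv; rewrite lt_max c0 orbT.
- move=> S mS dS.
  have -> : indc (~` S `&` window n) = (fun x => -1 * indc (S `&` window n) x + indc ([set: R] `&` window n) x).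
    apply/funext => x; rewrite /indc !indicE !in_setI in_setC in_setT.
    by case: (x \in S); case: (x \in window n) => /=; apply: complexP; rewrite ?ReD ?ImD ?ReM ?ImM /=; ring.
  by apply: denseL2_lin => //; exact: inL2_indc.
- move=> F mF tF dF; have mU : measurable (\bigcup_k F k) by exact: bigcupT_measurable.
  (* Finite disjoint unions follow by linearity, and the countable union by dominated
     convergence. *)
  pose u m x := indc ((\bigcup_(k < m) F k) `&` window n) x.
  have mUm m : measurable (\bigcup_(k < m) F k) by exact: bigcup_measurable.
  have du m : denseL2 (u m).
    elim: m => [|m IH].
      have -> : u 0%N = (fun=> 0).
        by apply/funext => x; rewrite /u bigcup0 // set0I /indc indicE in_set0.
      exact: denseL2_0.
    have -> : u m.+1 = (fun x => 1 * indc (F m `&` window n) x + u m x).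
      apply/funext => x; rewrite /u /indc !indicE !in_setI mul1r -rmorphD/=; congr (_%:C).
      case: (x \in window n); last by rewrite !andbF addr0.
      rewrite !andbT -natrD; congr (_%:R).
      have [xm|xm] := boolP (x \in F m).
        rewrite mem_set; last by exists m => //=; exact: set_mem.
        rewrite memNset// => -[k /= km Fk].
        have /trivIsetP := tF => /(_ k m I I); rewrite neq_ltn km => /(_ isT) h.
        have FF : (F k `&` F m) x by split => //; exact: set_mem.
        by move: FF; rewrite h.
      have [xu|xu] := boolP (x \in \bigcup_(k < m) F k).
        by rewrite mem_set//; move/set_mem : xu => [k /= km Fk]; exists k => //=; exact: ltnW.
      rewrite memNset// => -[k /=]; rewrite ltnS leq_eqVlt => /predU1P[->|km] Fk.
        by move/negP : xm; apply; exact: mem_set.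
      by move/negP : xu; apply; apply: mem_set; exists k.
    by apply: denseL2_lin => //; [exact: inL2_indc|exact: inL2_indc].
  have iG : intg Rp (\1_((\bigcup_k F k) `&` window n) : R -> R).
    exact: intg_ind (measurableI _ _ mU (measurable_window n)) (@window_sub n _).
  have cc x : Rp x -> ccvg (u ^~ x) (indc ((\bigcup_k F k) `&` window n) x).
    move=> _; apply: (ccvg_near (u := fun=> indc ((\bigcup_k F k) `&` window n) x)); last exact: ccvg_cst.
    have [[k _ Fk]|nF] := pselect ((\bigcup_k F k) x); last first.
      apply: nearW => m; rewrite /u /indc !indicE !memNset//; first by move=> [[k _ Fk] _]; apply: nF; exists k.
      by move=> [].
    near=> m; rewrite /u /indc !indicE !in_setI; congr (nat_of_bool (_ && _))%:R%:C.
    rewrite !mem_set//; last by exists k.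
    by exists k => //=; near: m; exact: nbhs_infty_gt.
  have bb m x : Rp x -> normc (u m x) ^+ 2 <= \1_((\bigcup_k F k) `&` window n) x.
    move=> _; rewrite /u normc_indc !indicE ler_nat !in_setI.
    case: (x \in window n); rewrite ?andbF// !andbT.
    case: (boolP (x \in \bigcup_(k < m) F k)) => // /set_mem[k _ Fk].
    by rewrite mem_set//; exists k.
  have [h1 h2 h3] := cvgL2_dominated (fun m => inL2_cmeasurable (inL2_indc n (mUm m))) cc iG bb.
  exact: denseL2_cvg h2 h1 du h3.
Unshelve. all: by end_near. Qed.

(** The sum counts the integers between 1 and y, hence is the floor of y; only its distance to y is
    recorded. *)
Lemma count_floor m (y : R) : 0 <= y <= m%:R ->
  y - 1 <= \sum_(k < m) (((k.+1%:R <= y)%R : nat)%:R : R) <= y.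
Proof.
elim: m y => [|m IH] y /andP[y0 ym].
  by rewrite big_ord0 y0 lerBlDr add0r (le_trans ym).
rewrite big_ord_recr/=; have [ym1|ym1] := leP m.+1%:R y.
  have -> : y = m.+1%:R by apply/eqP; rewrite eq_le ym ym1.
  rewrite (eq_bigr (fun=> 1)); last by move=> k _; rewrite ler_nat ltnS ltnW.
  by rewrite sumr_const card_ord natr1 lexx lerBlDr lerDl ler01.
have [ym2|ym2] := leP y m%:R; first by rewrite addr0; apply: IH; rewrite y0.
rewrite (eq_bigr (fun=> 1)); last by move=> k _; rewrite (le_trans _ (ltW ym2))// ler_nat.
by rewrite sumr_const card_ord addr0 (ltW ym2) andbT lerBlDr natr1 ltW.
Qed.

Lemma denseL2_sum (I : Type) (s : seq I) (F : I -> R -> R[i]) :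
  (forall i, inL2 (F i)) -> (forall i, denseL2 (F i)) ->
  inL2 (fun x => \sum_(i <- s) F i x) /\ denseL2 (fun x => \sum_(i <- s) F i x).
Proof.
move=> hF dF; elim: s => [|i s [IH1 IH2]].
  under eq_fun do rewrite big_nil; split; [exact: inL2_cst0|exact: denseL2_0].
under eq_fun do rewrite big_cons.
have -> : (fun x => F i x + \sum_(j <- s) F j x) = (fun x => 1 * F i x + \sum_(j <- s) F j x).
  by apply/funext => x; rewrite mul1r.
by split; [exact: inL2_lin|exact: denseL2_lin].
Qed.

(** The mean of the indicators of the superlevel sets g >= k/m, for 1 <= k <= m, approximates g from
    below within 1/m, by [count_floor]. *)
Lemma denseL2_unit_bounded n (g : R -> R) : measurable_fun Rp g -> (forall x, 0 <= g x <= 1) ->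
  inL2 (fun x => (g x)%:C * indc (window n) x) /\ denseL2 (fun x => (g x)%:C * indc (window n) x).
Proof.
move=> mg g01.
have mgw : cmeasurable Rp (fun x => (g x)%:C * indc (window n) x).
  by apply: cmeasurableM; [exact: cmeasurable_real|exact: cmeasurable_indc (measurable_window n)].
have iw : intg Rp (\1_(window n) : R -> R).
  by apply: intg_ind (measurable_window n) _; rewrite -[X in X `<=` _]setTI; exact: window_sub.
pose A m (k : 'I_m) := Rp `&` [set x | k.+1%:R <= m%:R * g x].
have mA m (k : 'I_m) : measurable (A m k).
  have h : measurable_fun Rp (fun x => m%:R * g x) by exact: measurable_funM.
  have := h mRp `[k.+1%:R, +oo[%classic (measurable_itv _).
  by rewrite (_ : _ @^-1` _ = [set x | k.+1%:R <= m%:R * g x])//; apply/seteqP; split => x /=; rewrite in_itv/= andbT.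
pose u m x : R[i] := (m.+1%:R^-1)%:C * \sum_(k < m.+1) indc (A m.+1 k `&` window n) x.
have hu m : inL2 (u m) /\ denseL2 (u m).
  have [h1 h2] := @denseL2_sum _ (index_enum 'I_m.+1) (fun k : 'I_m.+1 => indc (A m.+1 k `&` window n))
    (fun k : 'I_m.+1 => inL2_indc n (mA _ _)) (fun k : 'I_m.+1 => @denseL2_indc n _ (mA _ _)).
  split; first exact: inL2Z.
  have := denseL2_lin (m.+1%:R^-1)%:C h1 (inL2_cst0 R) h2 (@denseL2_0 R).
  by rewrite (_ : (fun x => _ + 0) = u m)//; apply/funext => x; rewrite addr0.
have uE m x : Rp x -> exists2 r : R, u m x = r%:C * indc (window n) x & g x - m.+1%:R^-1 <= r <= g x.
  move=> x0; have /andP[g0 g1] := g01 x; have m0 : 0 < (m.+1%:R : R) by [].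
  exists (m.+1%:R^-1 * \sum_(k < m.+1) ((k.+1%:R <= m.+1%:R * g x)%R : nat)%:R).
    rewrite /u rmorphM -mulrA; congr (_ * _); rewrite rmorph_sum mulr_suml; apply: eq_bigr => k _.
    rewrite /indc -rmorphM !indicE; congr (_%:C).
    have -> : (x \in A m.+1 k `&` window n) = (k.+1%:R <= m.+1%:R * g x) && (x \in window n).
      rewrite in_setI; congr andb; apply/idP/idP => [/set_mem[] //|h].
      by apply/mem_set; split.
    by rewrite -natrM mulnb.
  have : 0 <= m.+1%:R * g x <= m.+1%:R by rewrite mulr_ge0//= ler_piMr.
  move=> /count_floor /andP[h1 h2]; apply/andP; split.
    by rewrite ler_pdivlMl// mulrBr mulfV ?lt0r_neq0.
  by rewrite ler_pdivrMl.
have cc x : Rp x -> ccvg (u ^~ x) ((g x)%:C * indc (window n) x).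
  move=> x0.
  pose r m : R := sval (cid2 (uE m x x0)).
  have rE m : u m x = (r m)%:C * indc (window n) x by rewrite /r; case: cid2.
  have rb m : g x - m.+1%:R^-1 <= r m <= g x by rewrite /r; case: cid2.
  rewrite (funext rE); apply: (ccvgM _ (ccvg_cst _)); split => /=; last exact: cvg_cst.
  have h : g x - m.+1%:R^-1 @[m --> \oo] --> g x.
    by rewrite -[X in _ --> X]subr0; apply: cvgB; [exact: cvg_cst|exact: cvg_harmonic].
  by apply: (squeeze_cvgr _ h (cvg_cst _)); apply: nearW.
have bb m x : Rp x -> normc (u m x) ^+ 2 <= 4 * \1_(window n) x.
  move=> x0; have [r -> /andP[r1 r2]] := uE m x x0; have /andP[g0 g1] := g01 x.
  rewrite normcM exprMn normc_indc ler_wpM2r ?indicE// normcC real_normK ?num_real//.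
  have m1 : (m.+1%:R : R)^-1 <= 1 by rewrite invf_le1// ler1n.
  move: r1 m1 r2 g0 g1; move: (m.+1%:R^-1) (g x) => e y r1 m1 r2 y0 y1.
  have h1 : -1 <= r by lra.
  have h2 : r <= 1 by lra.
  nra.
have [h1 h2 h3] := cvgL2_dominated (fun m => inL2_cmeasurable (hu m).1) cc (intgZ 4 mRp iw) bb.
by split => //; apply: denseL2_cvg h2 h1 (fun m => (hu m).2) h3.
Unshelve. all: by end_near. Qed.

Lemma denseL2_bounded n (g : R -> R) (M : R) : 0 < M -> measurable_fun Rp g -> (forall x, `|g x| <= M) ->
  inL2 (fun x => (g x)%:C * indc (window n) x) /\ denseL2 (fun x => (g x)%:C * indc (window n) x).
Proof.
move=> M0 mg gM; pose h x := (g x + M) / (2 * M).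
have M2 : 0 < 2 * M by rewrite mulr_gt0.
have mh : measurable_fun Rp h by apply: measurable_funM => //; exact: measurable_funD.
have h01 x : 0 <= h x <= 1.
  have /ler_normlP[h1 h2] := gM x; rewrite divr_ge0 ?(ltW M2)//=; last by lra.
  by rewrite ler_pdivrMr// mul1r; lra.
have [a1 a2] := @denseL2_unit_bounded n h mh h01.
have c01 (x : R) : 0 <= (1 : R) <= 1 by rewrite ler01 lexx.
have [b1 b2] := @denseL2_unit_bounded n (fun=> 1) (measurable_cst _) c01.
have -> : (fun x => (g x)%:C * indc (window n) x) =
    (fun x => (2 * M)%:C * ((h x)%:C * indc (window n) x) + ((- M)%:C * (1%:C * indc (window n) x) + 0)).
  apply/funext => x; have gE : g x = 2 * M * h x - M by rewrite /h mulrC divfK ?addrK ?lt0r_neq0.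
  by rewrite [in LHS]gE rmorphB rmorphM rmorphN rmorph1; ring.
have d1 := inL2_lin (- M)%:C b1 (inL2_cst0 R).
have d2 := denseL2_lin (- M)%:C b1 (inL2_cst0 R) b2 (@denseL2_0 R).
by split; [exact: inL2_lin|exact: denseL2_lin].
Qed.

Lemma cvg_window (x : R) : 0 < x -> \forall n \near \oo, window n x.
Proof.
move=> x0; near=> n; rewrite /window/= in_itv/=; apply/andP; split.
  rewrite -[ltRHS]invrK ltf_pV2 ?posrE ?invr_gt0//.
  have h : x^-1 < n%:R by near: n; exact: nbhs_infty_gtr.
  by rewrite (lt_trans h)// ltr_nat.
have h : x < n%:R by near: n; exact: nbhs_infty_gtr.
by rewrite (lt_trans h)// ltr_nat.
Unshelve. all: by end_near. Qed.

Lemma denseL2_real (g : R -> R) : measurable_fun Rp g -> intg Rp (fun x => g x ^+ 2) ->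
  inL2 (fun x => (g x)%:C) /\ denseL2 (fun x => (g x)%:C).
Proof.
(* Truncation in value, combined below with restriction to a window, reduces to bounded functions;
   g^2 dominates throughout. *)
move=> mg ig; pose t n x := Num.max (- n.+1%:R) (Num.min n.+1%:R (g x)).
have mt n : measurable_fun Rp (t n) by apply: measurable_maxr => //; exact: measurable_minr.
have tn n x : `|t n x| <= n.+1%:R.
  have n0 : 0 <= (n.+1%:R : R) by [].
  by rewrite ler_norml /t le_max lexx/= ge_max ge_min lexx/= (le_trans _ n0)// oppr_le0.
have n1 n : 0 < (n.+1%:R : R) by [].
have tg n x : `|t n x| <= `|g x|.
  have n0 : 0 <= (n.+1%:R : R) by [].
  rewrite /t ler_norml ge_max ge_min ler_norm orbT andbT le_max le_min.
  have h1 : - `|g x| <= g x by have := ler_norm (- g x); rewrite normrN lerNl.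
  have h2 := normr_ge0 (g x).
  apply/andP; split; first by rewrite h1 andbT; apply/orP; right; lra.
  lra.
pose u n x := (t n x)%:C * indc (window n) x.
have hu n : inL2 (u n) /\ denseL2 (u n) by exact: (@denseL2_bounded n (t n) n.+1%:R (n1 n) (mt n) (tn n)).
have cc x : Rp x -> ccvg (u ^~ x) (g x)%:C.
  move=> x0; apply: (ccvg_near (u := fun=> (g x)%:C)); last exact: ccvg_cst.
  near=> n; rewrite /u /indc indicE mem_set; last by near: n; exact: cvg_window.
  rewrite mulr1 /t; have h : `|g x| < n%:R by near: n; exact: nbhs_infty_gtr.
  have h2 : `|g x| <= n.+1%:R by rewrite (le_trans (ltW h))// ler_nat.
  by move: h2; rewrite ler_norml => /andP[h3 h4]; rewrite min_r// max_r.
have bb n x : Rp x -> normc (u n x) ^+ 2 <= g x ^+ 2.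
  move=> _; rewrite /u normcM exprMn normc_indc normcC.
  apply: (@le_trans _ _ (`|t n x| ^+ 2)).
    by rewrite ler_piMr ?sqr_ge0// indicE; case: (_ \in _).
  by rewrite -[leRHS]real_normK ?num_real// ler_pXn2r ?nnegrE.
have [h1 h2 h3] := cvgL2_dominated (fun n => inL2_cmeasurable (hu n).1) cc ig bb.
by split => //; exact: denseL2_cvg h2 h1 (fun n => (hu n).2) h3.
Unshelve. all: by end_near. Qed.

Theorem denseL2_inL2 f : inL2 f -> denseL2 f.
Proof.
move=> /inL2P[[m1 m2] fi].
have i1 : intg Rp (fun x => Re (f x) ^+ 2).
  apply: (intg_le mRp _ fi); first exact: measurable_funX.
  by move=> x _; rewrite ger0_norm ?sqr_ge0// sqr_normc lerDl sqr_ge0.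
have i2 : intg Rp (fun x => Im (f x) ^+ 2).
  apply: (intg_le mRp _ fi); first exact: measurable_funX.
  by move=> x _; rewrite ger0_norm ?sqr_ge0// sqr_normc lerDr sqr_ge0.
have [h1 d1] := denseL2_real m1 i1; have [h2 d2] := denseL2_real m2 i2.
have -> : f = (fun x => 'i * (Im (f x))%:C + (Re (f x))%:C).
  by apply/funext => x; apply: complexP; rewrite ?ReD ?ImD ?ReM ?ImM /=; ring.
exact: denseL2_lin.
Qed.

End Density_general.

(** * Extension to square-integrable functions *)

Section Inner_product.
Variable R : realType.
Local Notation Rp := (Rplus R).
Implicit Types (f g : R -> R[i]).

(** The imaginary part arises from Im z = Re (- i z), because the product is conjugate-linear in its
    second argument. *)
Lemma innerL2E f g : innerL2 f g = ipL2 f g +i* ipL2 f (fun x => 'i * g x).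
Proof.
apply: complexP; rewrite ?Re_cintegral ?Im_cintegral /=; apply: eq_Rint => x _.
  by rewrite ReM Re_conj Im_conj; ring.
by rewrite ImM ReM Re_conj Im_conj /=; rewrite ImM /=; ring.
Qed.

Lemma normL2E f : normL2 f = Num.sqrt (nsqL2 f).
Proof. by []. Qed.

End Inner_product.

(** * Extension of a symmetric isometry given on test functions *)

Section Involutive_extension.
Variable R : realType.
Local Notation Rp := (Rplus R).
Implicit Types (f g k l h : R -> R[i]) (c : R[i]) (u : nat -> R -> R[i]).
Variable T : (R -> R[i]) -> R -> R[i].
Hypothesis T_inL2 : forall f, test_function f -> inL2 (T f).
Hypothesis T_lin : forall c f k (x : R), test_function f -> test_function k -> 0 < x ->
  T (fun y => c * f y + k y) x = c * T f x + T k x.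
Hypothesis T_iso : forall f, test_function f -> nsqL2 (T f) = nsqL2 f.
Hypothesis T_sym : forall f k, test_function f -> test_function k -> ipL2 (T f) k = ipL2 f (T k).

(** The closure of the graph of T in L^2 x L^2. It is a relation because g is determined only up to
    a null set; a representative is chosen at the end. *)
Definition in_closure f g := inL2 g /\ exists u,
  [/\ forall n, test_function (u n), cvgL2 u f & cvgL2 (fun n => T (u n)) g].

Lemma nsqL2_subE f g : nsqL2 (fun x => f x - g x) = nsqL2 (fun x => -1 * g x + f x).
Proof. by apply: eq_Rint => x _; rewrite mulN1r addrC. Qed.

Lemma nsqL2_sub f : nsqL2 (fun x => f x - f x) = 0.
Proof.
rewrite /nsqL2 (eq_Rint (g := fun=> 0)) => [|x _]; last by apply/eqP; rewrite sqrf_eq0 normc_eq0 subrr.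
by rewrite Rintegral_cst ?mul0r//; exact: measurable_Rplus.
Qed.

Lemma cvgL2_cst f : cvgL2 (fun=> f) f.
Proof. by rewrite /cvgL2 nsqL2_sub; exact: cvg_cst. Qed.

Lemma in_closure_test f : test_function f -> in_closure f (T f).
Proof. by move=> tf; split; [exact: T_inL2|exists (fun=> f); split => //; exact: cvgL2_cst]. Qed.

(** The rate is fitted to [L2_complete]: with errors 4^-n / 4 the squared distance of two terms n <=
    m is at most 2 (4^-n / 4) + 2 (4^-m / 4) <= 4^-n. *)
Lemma test_seq f : inL2 f -> exists2 u, (forall n, test_function (u n)) &
  forall n, nsqL2 (fun x => f x - u n x) <= 4^-1 ^+ n / 4.
Proof.
move=> /denseL2_inL2 df.
have e0 n : 0 < (4^-1 ^+ n / 4 : R) by rewrite divr_gt0// exprn_gt0.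
exists (fun n => sval (cid2 (df _ (e0 n)))) => n; by case: cid2.
Qed.

Lemma cvgL2_geometric u f : (forall n, nsqL2 (fun x => f x - u n x) <= 4^-1 ^+ n / 4) -> cvgL2 u f.
Proof.
move=> h; have c : (4^-1 ^+ n / 4 : R) @[n --> \oo] --> (0 : R).
  rewrite -[X in _ --> X](mul0r (4^-1)); apply: cvgM; last exact: cvg_cst.
  by apply: cvg_expr; rewrite ger0_norm// invf_lt1// ltr1n.
apply: (squeeze_cvgr _ (cvg_cst 0) c); apply: nearW => n.
by rewrite nsqL2_ge0/= nsqL2_distC.
Qed.

Lemma nsqL2_T_sub f k : test_function f -> test_function k ->
  nsqL2 (fun x => T f x - T k x) = nsqL2 (fun x => f x - k x).
Proof.
move=> tf tk; rewrite nsqL2_subE [RHS]nsqL2_subE -[RHS]T_iso; last exact: test_lin.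
by apply: eq_Rint => x x0; rewrite T_lin.
Qed.

Lemma in_closure_total f : inL2 f -> exists g, in_closure f g.
Proof.
move=> hf; have [u tu hu] := test_seq hf.
have hTu n : inL2 (T (u n)) by exact: T_inL2.
have [n m nm|g hg cg] := L2_complete hTu; last first.
  by exists g; split => //; exists u; split => //; exact: cvgL2_geometric.
rewrite nsqL2_T_sub//; apply: (le_trans (nsqL2_triangle (test_inL2 (tu n)) hf (test_inL2 (tu m)))).
rewrite nsqL2_distC.
have h1 := hu n; have h2 := hu m.
have h3 : (4^-1 ^+ m : R) <= 4^-1 ^+ n by rewrite ler_wiXn2l// invf_le1// ler1n.
move: h1 h2 h3; move: (4^-1 ^+ n) (4^-1 ^+ m) => a b; lra.
Qed.

Lemma in_closure_lin c f g k l : inL2 f -> inL2 k -> in_closure f g -> in_closure k l ->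
  in_closure (fun x => c * f x + k x) (fun x => c * g x + l x).
Proof.
move=> hf hk [hg [u [tu cu cTu]]] [hl [v [tv cv cTv]]]; split; first exact: inL2_lin.
exists (fun n x => c * u n x + v n x); split => [n||]; first exact: test_lin.
  by apply: cvgL2_lin => // n; exact: test_inL2.
have := cvgL2_lin c (fun n => T_inL2 (tu n)) (fun n => T_inL2 (tv n)) hg hl cTu cTv.
apply: cvg_trans; apply: near_eq_cvg; apply: nearW => n; apply: eq_Rint => x x0.
by rewrite T_lin.
Qed.

Lemma in_closure_nsq f g : inL2 f -> in_closure f g -> nsqL2 g = nsqL2 f.
Proof.
move=> hf [hg [u [tu cu cTu]]].
have h1 := cvgL2_nsq (fun n => test_inL2 (tu n)) hf cu.
have h2 := cvgL2_nsq (fun n => T_inL2 (tu n)) hg cTu.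
apply: (cvg_unique (@norm_hausdorff _ R) h2); apply: cvg_trans h1; apply: near_eq_cvg; apply: nearW => n.
by rewrite T_iso.
Qed.

(** By linearity the difference of the images is an image of the difference of the arguments, so by
    isometry both have norm 0. *)
Lemma in_closure_eqL2 f f' g g' : inL2 f -> inL2 f' -> eqL2 f f' ->
  in_closure f g -> in_closure f' g' -> eqL2 g g'.
Proof.
move=> hf hf' e fg fg'; apply: eqL2_nsq0; [exact: fg.1|exact: fg'.1|].
rewrite nsqL2_subE (in_closure_nsq _ (in_closure_lin (-1) hf' hf fg' fg)); last exact: inL2_lin.
by rewrite -nsqL2_subE -(eqL2_nsqB hf hf' hf e) nsqL2_sub.
Qed.

Lemma in_closure_sym f g k l : inL2 f -> inL2 k -> in_closure f g -> in_closure k l ->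
  ipL2 g k = ipL2 f l.
Proof.
move=> hf hk [hg [u [tu cu cTu]]] [hl [v [tv cv cTv]]].
have iu n := test_inL2 (tu n); have iv n := test_inL2 (tv n).
have iTu n := T_inL2 (tu n); have iTv n := T_inL2 (tv n).
have h1 := cvgL2_ip iTu iv hg hk cTu cv; have h2 := cvgL2_ip iu iTv hf hl cu cTv.
apply: (cvg_unique (@norm_hausdorff _ R) h1); apply: cvg_trans h2; apply: near_eq_cvg; apply: nearW => n.
by rewrite T_sym.
Qed.

(** Polarisation: the isometry is applied to the difference f - k. *)
Lemma in_closure_ip f g k l : inL2 f -> inL2 k -> in_closure f g -> in_closure k l ->
  ipL2 g l = ipL2 f k.
Proof.
move=> hf hk fg kl; have := in_closure_nsq (inL2_lin (-1) hk hf) (in_closure_lin (-1) hk hf kl fg).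
rewrite -!nsqL2_subE (nsqL2B fg.1 kl.1) (nsqL2B hf hk).
by rewrite (in_closure_nsq hf fg) (in_closure_nsq hk kl); lra.
Qed.

(* <h, f> = <g, g> by symmetry, so that |h - f|^2 = |h|^2 + |f|^2 - 2 |g|^2 = 0. *)
Lemma in_closure_involutive f g h : inL2 f -> in_closure f g -> in_closure g h -> eqL2 h f.
Proof.
move=> hf fg gh; apply: eqL2_nsq0 => //; first exact: gh.1.
rewrite nsqL2B//; last exact: gh.1.
rewrite (in_closure_sym fg.1 hf gh fg) ipL2_nsq (in_closure_nsq fg.1 gh) (in_closure_nsq hf fg); ring.
Qed.

(** A choice of image for each representative; outside L^2 the value is the default 0. *)
Definition L2_extension f : R -> R[i] :=
  if pselect (inL2 f) is left hf then sval (cid (in_closure_total hf)) else fun=> 0.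

Lemma L2_extensionP f : inL2 f -> in_closure f (L2_extension f).
Proof. by move=> hf; rewrite /L2_extension; case: pselect => // h; case: cid. Qed.

Lemma L2_extension_linear : linearL2 L2_extension.
Proof.
split.
- by move=> f /L2_extensionP[].
- by move=> f g hf hg e; apply: (in_closure_eqL2 hf hg e); exact: L2_extensionP.
- move=> c f g hf hg; have hl := inL2_lin c hf hg.
  apply: (in_closure_eqL2 hl hl (eqL2_refl _) (L2_extensionP hl)).
  by apply: in_closure_lin => //; exact: L2_extensionP.
Qed.

Lemma L2_extension_continuous : continuous_extensionL2 T L2_extension.
Proof.
split; first exact: L2_extension_linear.
  by exists 1 => f hf; rewrite !normL2E mul1r (in_closure_nsq hf (L2_extensionP hf)).
move=> f tf; have hf := test_inL2 tf.
exact: (in_closure_eqL2 hf hf (eqL2_refl f) (L2_extensionP hf) (in_closure_test tf)).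
Qed.

(** If test functions tend to f, boundedness makes their images under S, which are those under T,
    tend to S f. Hence the pair of f and S f lies in the closure of the graph, where images are
    unique. *)
Lemma L2_extension_unique S : continuous_extensionL2 T S ->
  forall f, inL2 f -> eqL2 (S f) (L2_extension f).
Proof.
move=> [[S1 S2 S3] [M SM] ST] f hf.
apply: (in_closure_eqL2 hf hf (eqL2_refl f) _ (L2_extensionP hf)); split; first exact: S1.
have [u tu hu] := test_seq hf; have cu := cvgL2_geometric hu; exists u; split => //.
have c : M ^+ 2 * nsqL2 (fun x => u n x - f x) @[n --> \oo] --> M ^+ 2 * 0.
  by apply: cvgM => //; exact: cvg_cst.
rewrite mulr0 in c.
apply: (squeeze_cvgr _ (cvg_cst 0) c); apply: nearW => n; rewrite nsqL2_ge0/=.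
have hun := test_inL2 (tu n); have hd := inL2_lin (-1) hun hf.
have e : nsqL2 (fun x => T (u n) x - S f x) = nsqL2 (S (fun x => -1 * u n x + f x)).
  rewrite nsqL2_distC nsqL2_subE; apply/esym/eqL2_nsq; [exact: S1|exact: inL2_lin (T_inL2 _) (S1 _ _)|].
  apply: (eqL2_trans (S3 _ _ _ hun hf)).
  by apply: filterS (ST _ (tu n)) => x h x0; rewrite h.
rewrite e nsqL2_distC nsqL2_subE.
have /= h := SM _ hd; rewrite !normL2E in h.
have n1 := nsqL2_ge0 (S (fun x => -1 * u n x + f x)); have n2 := nsqL2_ge0 (fun x => -1 * u n x + f x).
(* Squaring needs a nonnegative right-hand side; M comes without a sign, so this is deduced from the
   bound [h] itself. *)
rewrite -[leLHS]sqr_sqrtr// -[X in _ * X]sqr_sqrtr// -exprMn.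
by rewrite ler_pXn2r ?nnegrE ?sqrtr_ge0// (le_trans (sqrtr_ge0 _) h).
Qed.

Lemma L2_extension_involutive f : inL2 f -> eqL2 (L2_extension (L2_extension f)) f.
Proof.
move=> hf; have fg := L2_extensionP hf.
exact: (in_closure_involutive hf fg (L2_extensionP fg.1)).
Qed.

Lemma L2_extension_unitary : unitaryL2 L2_extension.
Proof.
split; first exact: L2_extension_linear.
- move=> f g hf hg; have fS := L2_extensionP hf; have gS := L2_extensionP hg.
  rewrite !innerL2E (in_closure_ip hf hg fS gS).
  (* Multiplication by i is written in the form c k + k handled by [in_closure_lin], so that the
     imaginary part of the inner product reduces to the real one. *)
  have iE k : (fun x => 'i * k x) = (fun x => ('i - 1) * k x + k x).
    by apply/funext => x; ring.
  have := in_closure_lin ('i - 1) hg hg gS gS; have := inL2Z 'i hg; rewrite -!iE => hi iS.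
  by rewrite (in_closure_ip hf hi fS iS).
- move=> g hg; exists (L2_extension g); first exact: (L2_extensionP hg).1.
  exact: L2_extension_involutive.
Qed.

End Involutive_extension.

(** * The hypotheses of the extension for the critical transform *)

Section Critical_transform_L2.
Variable R : realType.
Local Notation Rp := (Rplus R).
Implicit Types (f k : R -> R[i]).
Variables (gam b1 b2 : R).
Hypothesis gam0 : 0 < gam.
Hypotheses (b1_gt : 0 < b1 + gam / 2) (b2_gt : 0 < b2 + gam / 2).
Local Notation Tr := (critical_transform gam b1 b2).

Lemma critical_transform_inL2 f : test_function f -> inL2 (Tr f).
Proof.
move=> tf; have [i _ _] := critical_transform_isometry gam0 b1_gt b2_gt tf.
have c x (x0 : 0 < x) := ccont_critical_transform gam0 b1_gt b2_gt tf x0.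
apply/inL2P; split => //; split; apply: open_continuous_measurable_fun; rewrite ?Rplus_itv//.
- by move=> x /set_mem x0; have [] := c x x0.
- by move=> x /set_mem x0; have [] := c x x0.
Qed.

Lemma critical_transform_nsq f : test_function f -> nsqL2 (Tr f) = nsqL2 f.
Proof. by move=> tf; have [] := critical_transform_isometry gam0 b1_gt b2_gt tf. Qed.

(** The bilinear symmetry is applied to f and the conjugate of k; as the transform commutes with
    conjugation, the real parts give symmetry for the inner product. *)
Lemma critical_transform_sym f k : test_function f -> test_function k ->
  ipL2 (Tr f) k = ipL2 f (Tr k).
Proof.
move=> tf tk; have tc := test_conj tk.
have [_ e1] := critical_transform_adjoint gam0 b1_gt b2_gt tf tc.
have [_ e2] := critical_transform_adjoint gam0 b1_gt b2_gt tc tf.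
have E : cintegral Rp (fun x => Tr f x * conjc (k x)) = cintegral Rp (fun x => Tr (fun x => conjc (k x)) x * f x).
  rewrite e1 e2; apply: congr1.
  move: (fourier (log_half gam (fun x => conjc (k x)))) (fourier (log_half gam f)) => B A.
  by apply: eq_cintegral => t _; rewrite (mulrC (A t)).
have := congr1 (@Re R) E; rewrite !Re_cintegral => E'.
transitivity (Rintegral lebesgue_measure Rp (fun x => Re (Tr f x * conjc (k x)))).
  by apply: eq_Rint => x _; rewrite ReM Re_conj Im_conj; ring.
rewrite E'; apply: eq_Rint => x _.
by rewrite -(critical_transform_conj gam0 b1_gt b2_gt x tk) ReM Re_conj Im_conj; ring.
Qed.

End Critical_transform_L2.

Theorem corollary1p9p3 (R : realType) (b1 b2 gamma : R)
    (hb1 : half_integer b1) (hb2 : half_integer b2)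
    (hgamma : half_integer gamma)
    (b1_ge0 : 0 <= b1) (gamma_ge1 : 1 <= gamma)
    (b2_ge : (1 - gamma) / 2%:R <= b2) (b2_le : b2 <= 1 / 2%:R + b1)
    (sigma : R -> R)
    (hsigma : meijerG2004_contour b1%:C b2%:C
                (1 - gamma - b1)%:C (1 - gamma - b2)%:C sigma) :
  exists S : (R -> R[i]) -> (R -> R[i]),
    [/\ continuous_extensionL2 (meijer_transform sigma b1 b2 gamma) S,
        forall S' : (R -> R[i]) -> (R -> R[i]),
          continuous_extensionL2 (meijer_transform sigma b1 b2 gamma) S' ->
          forall f, inL2 f -> eqL2 (S' f) (S f),
        unitaryL2 S
      & forall f, inL2 f -> eqL2 (S (S f)) f].
Proof.
have [dsigma cdsigma [gam' [T [gam'_gt sigma_far]]] /(_ 0%N) + /(_ 0%N)] := hsigma.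
(* Both b1 and b2 are real, so their poles lie at height 0, and passing to the left of the leftmost
   ones, k = 0, is the information kept. *)
rewrite !addr0 /= => sb1 sb2.
(* The four parameters sum to 2 - 2 gamma; this is the condition on gamma' rewritten. *)
have p2 : 2^-1 < gamma + 2 * gam' by move: gam'_gt => /=; lra.
have gam0 : 0 < gamma by lra.
have b1_gt : 0 < b1 + gamma / 2 by lra.
(* The lower bound on b2 says precisely that b2 + gamma / 2 >= 1/2. *)
have b2_gt : 0 < b2 + gamma / 2 by lra.
have TE f : test_function f ->
    eqL2 (meijer_transform sigma b1 b2 gamma f) (critical_transform gamma b1 b2 f).
  move=> tf; apply: eqL2_pointwise => x x0.
  exact: (meijer_transform_test gam0 dsigma cdsigma sigma_far p2 sb1 sb2 b1_gt b2_gt tf x0).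
have T_inL2 := critical_transform_inL2 gam0 b1_gt b2_gt.
have T_lin c f k (x : R) (tf : test_function f) (tk : test_function k) (_ : 0 < x) :=
  critical_transform_linear gam0 b1_gt b2_gt c x tf tk.
have T_iso := critical_transform_nsq gam0 b1_gt b2_gt.
have T_sym := critical_transform_sym gam0 b1_gt b2_gt.
(* Extensions see the transform only through almost everywhere equality on test functions, so the
   contour integral may be replaced by the critical form. *)
have extE S : continuous_extensionL2 (meijer_transform sigma b1 b2 gamma) S <->
    continuous_extensionL2 (critical_transform gamma b1 b2) S.
  split=> -[S1 S2 S3]; split => // f tf; apply: (eqL2_trans (S3 f tf)); first exact: TE.
  exact/eqL2_sym/TE.
exists (L2_extension T_inL2 T_lin T_iso); split.
- by apply/extE; exact: L2_extension_continuous.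
- by move=> S' /extE; exact: L2_extension_unique.
- exact: L2_extension_unitary.
- exact: L2_extension_involutive.
Qed.
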